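(* Let $\mathcal E$ be a class of Banach spaces stable by finite representability and containing an infinite dimensional space. Let $G$ be a compactly presented locally compact group, and let $H$ be a quotient of $G$ by a discrete normal subgroup such that $H$ has strong property (T) with respect to $\mathcal E$. Then for every $C>0$ there are $s>0$ and a compactly presented intermediate quotient $G\to H'\to H$ such that $\mathcal C_{\mathcal F(\mathcal E,s\ell+C)}(H')$ has a Kazhdan projection, which is self-adjoint if $\mathcal E$ is stable by duality.
   Context: Standing assumptions: $G$ is compactly generated, locally compact, separable and infinite; $S\subset G$ is a compact symmetric generating set containing the identity. On any quotient of $G$, $\ell$ denotes the word length with respect to the image of $S$: $\ell(g)=\min\{n:g\in S^n\}$. A group with compact generating set $S$ is compactly presented if, as an abstract group, it has a presentation with generating set $S$ and relators of bounded length. If $H=G/N$, an intermediate quotient $G\to H'\to H$ is $H'=G/N'$ with $N'\subset N$ normal in $G$. A Banach space $X$ is finitely representable in $\mathcal E$ if every finite dimensional subspace of $X$ is, for every $\varepsilon>0$, at (multiplicative) Banach–Mazur distance less than $1+\varepsilon$ from a subspace of a space in $\mathcal E$; $\mathcal E$ is stable by finite representability if it contains every such $X$. For a compactly generated locally compact group $\Gamma$ (here $H$ or $H'$): a representation $(\pi,E)$ is a strongly continuous homomorphism from $\Gamma$ to the bounded invertible operators of a Banach space $E$; $\pi(f)=\int f(g)\pi(g)\,dg$ (left Haar measure) for $f\in C_c(\Gamma)$. For a function $m$ on $\Gamma$, $\mathcal F(\mathcal E,m)$ is the collection of representations $(\pi,E)$ of $\Gamma$ with $E$ isometric to a space in $\mathcal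 E$ and $\|\pi(g)\|\le e^{m(g)}$ for all $g\in\Gamma$. $\mathcal C_{\mathcal F}(\Gamma)$ is the (Hausdorff) completion of $C_c(\Gamma)$ for $\|f\|_{\mathcal F}=\sup_{(\pi,E)\in\mathcal F}\|\pi(f)\|_{B(E)}$. A Kazhdan projection in it is an idempotent $p$ in the closure of $\{f\in C_c(\Gamma):\int f=1\}$ such that $\pi(p)$ is a projection onto $E^\pi=\{x:\pi(g)x=x\ \forall g\}$ for every $(\pi,E)\in\mathcal F$. For $f\in C_c(\Gamma)$, $\widetilde f\in C_c(\Gamma)$ is defined by requiring $\widetilde f\,dg$ to be the image of the measure $f\,dg$ under $g\mapsto g^{-1}$; when $f\mapsto\widetilde f$ extends to a bounded map of $\mathcal C_{\mathcal F}(\Gamma)$, an element $a$ is self-adjoint if $\widetilde a=a$. $\Gamma$ has strong property (T) with respect to $\mathcal E$ if there is $s>0$ such that for all $C>0$, $\mathcal C_{\mathcal F(\mathcal E,s\ell+C)}(\Gamma)$ has a Kazhdan projection. *)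

(* Defs.v *)
From HB Require Import structures.
From mathcomp Require Import all_boot all_order all_algebra.
From mathcomp Require Import all_classical all_reals all_analysis.
From mathcomp Require Import complex.

Set Implicit Arguments.
Unset Strict Implicit.
Unset Printing Implicit Defensive.

Import Order.TTheory GRing.Theory Num.Theory.
Import numFieldNormedType.Exports.

Local Open Scope classical_set_scope.
Local Open Scope ring_scope.

(* Banach spaces are real or complex: every notion is parametrized by the kind
   of scalars. *)
Inductive scalar_kind := real_scalars | complex_scalars.

Definition scal (R : realType) (k : scalar_kind) : numFieldType :=
  match k with
  | real_scalars => (R : numFieldType)
  | complex_scalars => (R[i] : numFieldType)
  end.

Definition sc_re (R : realType) (k : scalar_kind) : scal R k -> R :=
  match k return scal R k -> R with
  | real_scalars => fun z => z
  | complex_scalars => fun z => complex.Re z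
  end.

(* The norm of a [normedModType K] is [K]-valued in the library (with values in
   the nonnegative reals of [K]); [nrm] is the same norm, seen in [R]. *)
Definition nrm (R : realType) (k : scalar_kind) (E : normedModType (scal R k))
  (x : E) : R := sc_re `|x|.

HB.mixin Record isTopologicalGroup G of Topological G & Group G := {
  mulg_continuous : continuous (fun x : G * G => (x.1 * x.2)%g) ;
  invg_continuous : continuous (fun x : G => x^-1%g)
}.

#[short(type="topGroupType")]
HB.structure Definition TopologicalGroup :=
  {G of Topological G & Group G & isTopologicalGroup G}.

(* [g_sigma_algebraType] asks for a pointed type: point groups at 1. *)
Definition pointed_group (G : topGroupType) : Type := G.
HB.instance Definition _ (G : topGroupType) := Choice.on (pointed_group G).
HB.instance Definition _ (G : topGroupType) :=
  isPointed.Build (pointed_group G) (1%g : G).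

Notation borelType G :=
  (g_sigma_algebraType (@open G : set (set (pointed_group G)))).

Section Groups.
Implicit Types G H : topGroupType.

Definition separable_space G := exists D : set G, countable D /\ dense D.

Definition normal_subgroup G (N : set G) :=
  [/\ N 1%g, (forall x y, N x -> N y -> N (x * y)%g),
      (forall x, N x -> N x^-1%g) &
      (forall x g, N x -> N (g * x * g^-1)%g)].

Definition discrete_subset G (N : set G) := N `<=` isolated N.

(* [q : G -> H] exhibits [H] as the topological group G/N. *)
Definition is_quotient G H (N : set G) (q : G -> H) :=
  [/\ {morph q : x y / (x * y)%g}, continuous q,
      (forall U : set G, open U -> open (q @` U)),
      (forall h, exists g, q g = h) &
      (forall g, q g = 1%g <-> N g)].

Fixpoint spow G (T : set G) (n : nat) : set G :=
  if n is n'.+1 then [set z | exists x y, [/\ spow T n' x, T y & z = (x * y)%g]]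
  else [set 1%g].

Definition word_length G (T : set G) (g : G) : nat :=
  xget 0%N [set n | spow T n g /\ forall m, spow T m g -> (n <= m)%N].

(* Elements of the free group on T are represented by words in the letters
   (t, false) = t and (t, true) = t^-1, for t in T. *)
Definition word G := seq (G * bool).

Definition word_on G (T : set G) (w : word G) := forall l, l \in w -> T l.1.

Definition word_eval G (w : word G) : G :=
  foldr (fun l g => ((if l.2 then l.1^-1 else l.1) * g)%g) 1%g w.

(* Equality of words in the group < T | Rel >. *)
Inductive presented_eq G (T : set G) (Rel : set (word G)) :
    word G -> word G -> Prop :=
| presented_refl w : presented_eq T Rel w w
| presented_sym w w' : presented_eq T Rel w w' -> presented_eq T Rel w' w
| presented_trans w w' w'' : presented_eq T Rel w w' ->
    presented_eq T Rel w' w'' -> presented_eq T Rel w w''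
| presented_cancel u v t b : T t ->
    presented_eq T Rel (u ++ [:: (t, b); (t, ~~ b)] ++ v) (u ++ v)
| presented_relator u v r : Rel r ->
    presented_eq T Rel (u ++ r ++ v) (u ++ v).

Definition compactly_presented G (T : set G) :=
  [/\ compact T,
      (forall g, exists2 w, word_on T w & word_eval w = g) &
      exists (L : nat) (Rel : set (word G)),
        (forall r, Rel r ->
           [/\ word_on T r, (size r <= L)%N & word_eval r = 1%g]) /\
        (forall w, word_on T w -> word_eval w = 1%g ->
           presented_eq T Rel w [::])].

(* Regularity is part of the definition (it is automatic when G is second
   countable): a left Haar measure is a left invariant nonzero Radon measure. *)
Record left_haar (R : realType) G
    (mu : {measure set (borelType G) -> \bar R}) : Prop := {
  haar_compact : forall A : set G, compact A -> (mu A < +oo)%E ;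
  haar_outer : forall A : set (borelType G), measurable A ->
    mu A = ereal_inf [set mu U | U in [set U : set G | open U /\ A `<=` U]] ;
  haar_inner : forall U : set G, open U ->
    mu U = ereal_sup [set mu A | A in [set A : set G | compact A /\ A `<=` U]] ;
  haar_invariant : forall (g : G) (A : set (borelType G)), measurable A ->
    mu [set (g * x : G)%g | x in (A : set G)] = mu A ;
  haar_neq0 : mu setT != 0%E
}.

End Groups.

Section BanachSpaces.
Context (R : realType) (k : scalar_kind).
Local Notation K := (scal R k).
Local Notation banach := (completeNormedModType K).
Implicit Types (E F X Y : banach) (EE : banach -> Prop).

Definition is_subspace E (W : set E) :=
  W 0 /\ forall (a : K) x y, W x -> W y -> W (a *: x + y).

Definition finite_dim E (V : set E) :=
  exists (n : nat) (v : 'I_n -> E),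
    V = [set x | exists c : 'I_n -> K, x = \sum_(i < n) c i *: v i].

(* Infimum of |T| |T^-1| over the linear isomorphisms T from V onto W; [a] and
   [b] range over the upper bounds of |T| and |T^-1|. *)
Definition banach_mazur E F (V : set E) (W : set F) : \bar R :=
  ereal_inf [set r | exists (T : E -> F) (a b : R),
    [/\ (forall (c : K) x y, V x -> V y -> T (c *: x + y) = c *: T x + T y),
        set_bij V W T,
        0 <= a /\ (forall x, V x -> nrm (T x) <= a * nrm x),
        0 <= b /\ (forall x, V x -> nrm x <= b * nrm (T x)) &
        r = (a * b)%:E]].

Definition finitely_representable EE X :=
  forall V : set X, finite_dim V -> forall eps : R, 0 < eps ->
    exists Y (W : set Y), [/\ EE Y, is_subspace W &
      (banach_mazur V W < (1 + eps)%:E)%E].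

Definition stable_by_finite_representability EE :=
  forall X, finitely_representable EE X -> EE X.

Definition isometric E F :=
  exists T : {linear E -> F}, bijective T /\ forall x, `|T x| = `|x|.

(* [X] is, up to isometry, the dual Banach space of [E]. *)
Definition is_dual E X :=
  exists B : X -> {linear E -> K^o},
    [/\ (forall xi, continuous (B xi)),
        (forall (a : K) xi eta x, B (a *: xi + eta) x = a * B xi x + B eta x),
        (forall phi : {linear E -> K^o}, continuous phi ->
           exists xi, forall x, B xi x = phi x) &
        (forall xi, nrm xi =
           sup [set nrm (B xi x) | x in [set x : E | nrm x <= 1]])].

Definition stable_by_duality EE :=
  forall E X, EE E -> is_dual E X -> EE X.

End BanachSpaces.

Section Representations.
Context (R : realType) (k : scalar_kind) (G : topGroupType).
Local Notation K := (scal R k).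
Local Notation banach := (completeNormedModType K).

Record is_representation (E : banach) (pi : G -> {linear E -> E}) : Prop := {
  rep1 : forall x, pi 1%g x = x ;
  repM : forall g h x, pi (g * h)%g x = pi g (pi h x) ;
  rep_bounded : forall g, continuous (pi g) ;
  rep_strongly_continuous : forall x, continuous (fun g => pi g x)
}.

Definition rep_family := forall E : banach, (G -> {linear E -> E}) -> Prop.

Definition family_of (EE : banach -> Prop) (m : G -> R) : rep_family :=
  fun E pi =>
    [/\ is_representation pi, (exists2 E0, EE E0 & isometric E E0) &
        (forall g x, nrm (pi g x) <= expR (m g) * nrm x)].

Definition is_Cc (f : G -> K) :=
  continuous (f : G -> K^o) /\ compact (closure [set g | f g != 0]).

Context (mu : {measure set (borelType G) -> \bar R}).

Definition scal_integral (A : set (borelType G)) : (G -> K) -> K :=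
  match k return (G -> scal R k) -> scal R k with
  | real_scalars => fun f => \int[mu]_(x in A) (f x : R)
  | complex_scalars => fun f =>
      ((\int[mu]_(x in A) complex.Re (f x)) +i*
       (\int[mu]_(x in A) complex.Im (f x)))%C
  end.

(* y = pi(f) x, where pi(f) x is the vector-valued integral of f(g) pi(g) x. *)
Definition is_rep_integral (E : banach) (pi : G -> {linear E -> E})
    (f : G -> K) (x y : E) :=
  forall phi : {linear E -> K^o}, continuous phi ->
    phi y = scal_integral setT (fun g => f g * phi (pi g x)).

Definition convolution (f h : G -> K) : G -> K :=
  fun x => scal_integral setT (fun y => f y * h (y^-1 * x)%g).

(* f' dg is the image of the measure f dg under inversion. *)
Definition is_tilde (f f' : G -> K) :=
  is_Cc f' /\ forall A : set (borelType G), measurable A ->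
    scal_integral A f' = scal_integral [set x^-1%g | x in (A : set G)] f.

Context (F : rep_family).

Definition F_norm (f : G -> K) : \bar R :=
  ereal_sup ([set 0%E] `|` [set r | exists (E : banach)
    (pi : G -> {linear E -> E}) (x y : E),
    [/\ F pi, nrm x <= 1, is_rep_integral pi f x y & r = (nrm y)%:E]]).

(* The Hausdorff completion of C_c(G) for [F_norm]: its elements are the
   classes of Cauchy sequences modulo sequences of norm tending to 0. *)
Definition is_cauchy (u : nat -> G -> K) :=
  (forall n, is_Cc (u n)) /\
  forall eps : R, 0 < eps -> exists n0, forall m n, (n0 <= m)%N -> (n0 <= n)%N ->
    (F_norm (u m \- u n)%R <= eps%:E)%E.

Definition seq_equiv (u v : nat -> G -> K) :=
  (fun n => F_norm (u n \- v n)) @ \oo --> 0%E.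

Definition class_of (u : nat -> G -> K) : set (nat -> G -> K) :=
  [set v | is_cauchy v /\ seq_equiv u v].

Definition completion : set (set (nat -> G -> K)) :=
  [set p | exists2 u, is_cauchy u & p = class_of u].

Definition embed (f : G -> K) : set (nat -> G -> K) := class_of (fun=> f).

Implicit Types p q : set (nat -> G -> K).

Definition completion_dist p q : \bar R :=
  ereal_inf [set l | exists u v, [/\ p u, q v &
    (fun n => F_norm (u n \- v n)) @ \oo --> l]].

Definition completion_mul p q : set (nat -> G -> K) :=
  [set w | is_cauchy w /\ exists u v, [/\ p u, q v &
    seq_equiv (fun n => convolution (u n) (v n)) w]].

(* y = pi(p) x, for the continuous extension of pi to the completion. *)
Definition completion_rep (E : banach) (pi : G -> {linear E -> E}) p (x y : E) :=
  exists (u : nat -> G -> K) (z : nat -> E),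
    [/\ p u, (forall n, is_rep_integral pi (u n) x (z n)) & z @ \oo --> y].

Definition invariant_vectors (E : banach) (pi : G -> {linear E -> E}) : set E :=
  [set x | forall g, pi g x = x].

Definition is_kazhdan_projection p :=
  [/\ completion p, completion_mul p p = p,
      (forall eps : R, 0 < eps -> exists f,
         [/\ is_Cc f, scal_integral setT f = 1 &
             (completion_dist p (embed f) < eps%:E)%E]) &
      (forall (E : banach) (pi : G -> {linear E -> E}), F pi ->
         exists P : E -> E,
           [/\ (forall x, completion_rep pi p x (P x)),
               (forall x, P (P x) = P x) &
               range P = invariant_vectors pi])].

Definition tilde_bounded :=
  exists M : R, forall f f', is_Cc f -> is_tilde f f' ->
    (F_norm f' <= M%:E * F_norm f)%E.

Definition completion_tilde p : set (nat -> G -> K) :=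
  [set w | is_cauchy w /\ exists u v,
    [/\ p u, (forall n, is_tilde (u n) (v n)) & seq_equiv v w]].

Definition self_adjoint p := tilde_bounded /\ completion_tilde p = p.

End Representations.

Definition strong_property_T (R : realType) (k : scalar_kind)
    (G : topGroupType) (T : set G) (mu : {measure set (borelType G) -> \bar R})
    (EE : completeNormedModType (scal R k) -> Prop) :=
  exists2 s : R, 0 < s & forall C : R, 0 < C ->
    exists p, is_kazhdan_projection mu
      (family_of EE (fun g => s * (word_length T g)%:R + C)) p.

(* Main.v *)
(* Let N_j be the normal closure of the elements of N of length at most j, and H_j = G/N_j: a
   presentation of H_j is obtained from that of G by adding relators of length at most j.
   Every element of N belongs to N_j for large j, so that an ultraproduct of representations of
   the H_j is a representation of H.

   An averaging operator pi(f) on representations of H_j, with int f = 1, that halves the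
   displacement max_{g in S} |pi(g) x - x| and moves x by at most a multiple of it is as good as
   a Kazhdan projection: its powers converge geometrically to one. Such an f is found for some j
   by contradiction. If vectors x_j of displacement at most 1 violate the contraction, first
   smooth them so that g |-> pi_j(g) x_j - x_j is equicontinuous; the limit of these functions
   is a cocycle b of H with values in an ultraproduct. As E (+) K is again in the class and has
   growth s l + C twisted by b, hence at most 2 s l + C', strong property (T) of H forces
   b(g) = pi(g) z - z, and an average close to the Kazhdan projection contracts z.

   When the class is stable by duality, H_j is unimodular, since a nontrivial modular character
   would yield one-dimensional representations contradicting the contraction. Then f~(g) =
   f(g^-1), and the continuous part of the dual representation shows that f |-> f~ is bounded.
   For the powers u_n of f, u_n~ * u_n is close to u_n, because the range of u_n is almost
   invariant; taking ~ it is also close to u_n~, so the limit is self-adjoint. *)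
Require Import Defs.
From HB Require Import structures.
From mathcomp Require Import all_boot all_order all_algebra.
From mathcomp Require Import all_classical all_reals all_analysis.
From mathcomp Require Import measurable_realfun complex ring lra.

Set Implicit Arguments.
Unset Strict Implicit.
Unset Printing Implicit Defensive.

Import Order.TTheory GRing.Theory Num.Theory.
Import numFieldNormedType.Exports.

Local Open Scope classical_set_scope.
Local Open Scope ring_scope.

(** * Scalars and norms *)

Section Scalars.
Context (R : realType) (k : scalar_kind).
Local Notation K := (scal R k).

(** Vectors that violate the contraction have bounded displacement but no bound on their norms, so
    they define no point of an ultraproduct. Only the maps g |-> pi(g) x - x survive in the limit,
    and this is why cocycles enter. The averaging function has to be fixed before the
    counterexamples are taken, and to make sense on all H_j at once. It is a finite combination of
    translates of a smoothing function psi_j, with coefficients and group elements in K * G that do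
    not depend on j. Only psi_j depends on the Haar measure of H_j, and its effect is controlled by
    neighbourhoods of 1 in G common to all quotients. A cocycle over a representation of growth s l
    + C grows like l exp(s l), whence the loss from s to 2 s. Its size, and the cost of renorming E
    (+) K inside the class, go into the additive constant; so projections for H with arbitrarily
    large constants serve to obtain one for H_j with the given C. The rate is half that of H
    whatever C is: only j depends on C. *)

Definition sc (r : R) : K :=
  match k return scal R k with
  | real_scalars => r
  | complex_scalars => (r%:C)%C
  end.

Definition sc_im (z : K) : R :=
  match k return scal R k -> R with
  | real_scalars => fun=> 0
  | complex_scalars => fun z => complex.Im z
  end z.

(** Zero over the reals, so that [sc_decomp] and the computations that rest on it are the same for
    both kinds of scalars. *)
Definition sc_i : K :=
  match k return scal R k with
  | real_scalars => 0
  | complex_scalars => 'i%C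
  end.

Lemma sc_reK r : sc_re (sc r) = r.
Proof. by rewrite /sc /sc_re; case: k. Qed.

Lemma sc_imK r : sc_im (sc r) = 0.
Proof. by rewrite /sc /sc_im; case: k. Qed.

Lemma sc_decomp (z : K) : z = sc (sc_re z) + sc_i * sc (sc_im z).
Proof.
rewrite /sc /sc_re /sc_im /sc_i; case: k z => /= z; first by rewrite mul0r addr0.
exact: complexE.
Qed.

Lemma sc_im_real (z : K) : sc_i = 0 -> sc_im z = 0.
Proof.
rewrite /sc_i /sc_im; case: k z => //= z /eqP.
by rewrite eq_complex /= oner_eq0 andbF.
Qed.

Lemma scD r s : sc (r + s) = sc r + sc s.
Proof. by rewrite /sc; case: k => //; rewrite rmorphD. Qed.

Lemma scM r s : sc (r * s) = sc r * sc s.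
Proof. by rewrite /sc; case: k => //; rewrite rmorphM. Qed.

Lemma scN r : sc (- r) = - sc r.
Proof. by rewrite /sc; case: k => //; rewrite rmorphN. Qed.

Lemma sc0 : sc 0 = 0. Proof. by rewrite /sc; case: k. Qed.
Lemma sc1 : sc 1 = 1. Proof. by rewrite /sc; case: k. Qed.

Lemma scB r s : sc (r - s) = sc r - sc s.
Proof. by rewrite scD scN. Qed.

Lemma sc_inj : injective sc.
Proof. exact: can_inj sc_reK. Qed.

Lemma scV r : sc r^-1 = (sc r)^-1.
Proof. by rewrite /sc; case: k => //; rewrite fmorphV. Qed.

Lemma ler_sc r s : (sc r <= sc s) = (r <= s).
Proof. by rewrite /sc; case: k => //=; rewrite lecR. Qed.

Lemma ltr_sc r s : (sc r < sc s) = (r < s).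
Proof. by rewrite /sc; case: k => //=; rewrite ltcR. Qed.

Lemma sc_eq0 r : (sc r == 0) = (r == 0).
Proof. by rewrite -sc0 (inj_eq sc_inj). Qed.

Lemma sc_ge0 r : (0 <= sc r) = (0 <= r).
Proof. by rewrite -sc0 ler_sc. Qed.

Lemma scK (x : K) : 0 <= x -> sc (sc_re x) = x.
Proof.
rewrite /sc /sc_re; case: k x => //= -[a b].
by rewrite lecE /= => /andP[/eqP -> _].
Qed.

Lemma sc_re_ge0 (x : K) : 0 <= x -> 0 <= sc_re x.
Proof. by move=> x0; rewrite -sc_ge0 scK. Qed.

Lemma sc_reD (x y : K) : sc_re (x + y) = sc_re x + sc_re y.
Proof. by rewrite /sc_re; case: k x y => //= -[? ?] [? ?]. Qed.

Lemma sc_reN (x : K) : sc_re (- x) = - sc_re x.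
Proof. by rewrite /sc_re; case: k x => //= -[? ?]. Qed.

Lemma sc_reB (x y : K) : sc_re (x - y) = sc_re x - sc_re y.
Proof. by rewrite sc_reD sc_reN. Qed.

Lemma sc_re0 : sc_re (0 : K) = 0. Proof. by rewrite -sc0 sc_reK. Qed.
Lemma sc_re1 : sc_re (1 : K) = 1. Proof. by rewrite -sc1 sc_reK. Qed.

Lemma sc_reZ r (x : K) : sc_re (sc r * x) = r * sc_re x.
Proof. by rewrite /sc_re /sc; case: k x => //= -[? ?] /=; rewrite mul0r subr0. Qed.

Lemma sc_reM (x y : K) : sc_re (x * y) = sc_re x * sc_re y - sc_im x * sc_im y.
Proof.
by rewrite /sc_re /sc_im; case: k x y => /= [x y|[? ?] [? ?]] //; rewrite mulr0 subr0.
Qed.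

Lemma sc_imM (x y : K) : sc_im (x * y) = sc_re x * sc_im y + sc_im x * sc_re y.
Proof.
by rewrite /sc_re /sc_im; case: k x y => /= [x y|[? ?] [? ?]] //; rewrite mulr0 mul0r addr0.
Qed.

Lemma sc_imD (x y : K) : sc_im (x + y) = sc_im x + sc_im y.
Proof. by rewrite /sc_im; case: k x y => /= [x y|[? ?] [? ?]] //; rewrite addr0. Qed.

Definition kabs (z : K) : R := sc_re `|z|.

Lemma sc_kabs (z : K) : sc (kabs z) = `|z|.
Proof. by rewrite /kabs scK. Qed.

Lemma kabs_ge0 z : 0 <= kabs z.
Proof. exact: sc_re_ge0. Qed.

Lemma kabsM y z : kabs (y * z) = kabs y * kabs z.
Proof. by apply: sc_inj; rewrite scM !sc_kabs normrM. Qed.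

Lemma kabsN z : kabs (- z) = kabs z.
Proof. by rewrite /kabs normrN. Qed.

Lemma kabsD y z : kabs (y + z) <= kabs y + kabs z.
Proof. by rewrite -ler_sc scD !sc_kabs ler_normD. Qed.

Lemma kabsV z : kabs z^-1 = (kabs z)^-1.
Proof. by apply: sc_inj; rewrite scV !sc_kabs normfV. Qed.

Lemma kabs0 : kabs 0 = 0. Proof. by rewrite /kabs normr0 sc_re0. Qed.
Lemma kabs1 : kabs 1 = 1. Proof. by rewrite /kabs normr1 sc_re1. Qed.

Lemma kabs_eq0 z : (kabs z == 0) = (z == 0).
Proof. by rewrite -sc_eq0 sc_kabs normr_eq0. Qed.

Lemma kabs_gt0 z : (0 < kabs z) = (z != 0).
Proof. by rewrite lt_neqAle eq_sym kabs_eq0 kabs_ge0 andbT. Qed.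

Lemma kabs_sc r : kabs (sc r) = `|r|.
Proof.
apply: sc_inj; rewrite sc_kabs; case: (lerP 0 r) => r0.
  by rewrite (ger0_norm r0) ger0_norm ?sc_ge0.
by rewrite (ltr0_norm r0) ltr0_norm ?scN // -sc0 ltr_sc.
Qed.

Lemma kabs_re z : `|sc_re z| <= kabs z.
Proof.
rewrite /kabs /sc_re; case: k z => //= -[a b] /=.
by rewrite -[leLHS]sqrtr_sqr ler_sqrt ?addr_ge0 ?sqr_ge0 // lerDl sqr_ge0.
Qed.

Lemma kabs_im z : `|sc_im z| <= kabs z.
Proof.
rewrite /kabs /sc_re /sc_im; case: k z => //= [z|[a b]]; first by rewrite normr0.
by rewrite -[leLHS]sqrtr_sqr ler_sqrt ?addr_ge0 ?sqr_ge0 // lerDr sqr_ge0.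
Qed.

Lemma sc_re_le z : sc_re z <= kabs z.
Proof. exact: le_trans (ler_norm _) (kabs_re z). Qed.

Lemma sc_kabs_re z : sc_re z = kabs z -> z = sc (kabs z).
Proof.
rewrite /sc /kabs /sc_re; case: k z => [z|[a b] h]; first by rewrite /= => {1}->.
rewrite -h /=; congr (_ +i* _)%C.
have := congr1 (fun t => t ^+ 2) h => /=.
rewrite sqr_sqrtr ?addr_ge0 ?sqr_ge0 // => /eqP; rewrite eq_sym -subr_eq0 addrAC subrr add0r.
by rewrite sqrf_eq0 => /eqP.
Qed.

Lemma kabs_sci : kabs sc_i <= 1.
Proof.
rewrite /kabs /sc_i /sc_re; case: k => /=; first by rewrite normr0.
by rewrite expr0n expr1n add0r sqrtr1.
Qed.

(** Rotating by [u] turns bounds on moduli of functionals and integrals into bounds on real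
    parts. *)
Lemma kabs_phase z : exists2 u : K, kabs u = 1 & u * z = sc (kabs z).
Proof.
have [->|z0] := eqVneq z 0; first by exists 1; rewrite ?kabs1 // mulr0 kabs0 sc0.
exists (sc (kabs z) / z); last by rewrite divfK.
by rewrite kabsM kabs_sc kabsV ger0_norm ?kabs_ge0 // divff // kabs_eq0.
Qed.

Section Norms.
Variable E : normedModType K.
Implicit Types x y : E.

Lemma sc_nrm x : sc (nrm x) = `|x|.
Proof. by rewrite /nrm scK. Qed.

Lemma nrm_ge0 x : 0 <= nrm x.
Proof. exact: sc_re_ge0. Qed.

Lemma nrm0 : nrm (0 : E) = 0.
Proof. by rewrite /nrm normr0 sc_re0. Qed.

Lemma nrm_eq0 x : nrm x = 0 -> x = 0.
Proof. by move=> x0; apply/eqP; rewrite -normr_eq0 -sc_nrm x0 sc0. Qed.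

Lemma nrmN x : nrm (- x) = nrm x.
Proof. by rewrite /nrm normrN. Qed.

Lemma nrmD x y : nrm (x + y) <= nrm x + nrm y.
Proof. by rewrite -ler_sc scD !sc_nrm ler_normD. Qed.

Lemma nrmB x y : nrm (x - y) <= nrm x + nrm y.
Proof. by rewrite -[nrm y]nrmN nrmD. Qed.

Lemma nrmBC x y : nrm (x - y) = nrm (y - x).
Proof. by rewrite -nrmN opprB. Qed.

Lemma nrmZ (a : K) x : nrm (a *: x) = kabs a * nrm x.
Proof. by apply: sc_inj; rewrite scM sc_kabs !sc_nrm normrZ. Qed.

Lemma nrm_triangle x y z : nrm (x - z) <= nrm (x - y) + nrm (y - z).
Proof. by rewrite -[x - z](subrKA y) nrmD. Qed.

Lemma nrm_lip x y : `|nrm x - nrm y| <= nrm (x - y).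
Proof.
have := nrmD (x - y) y; have := nrmD (y - x) x; rewrite !subrK (nrmBC y x) => h1 h2.
by rewrite ler_norml; apply/andP; split; lra.
Qed.

Lemma nrm_sum (I : Type) (s : seq I) (P : pred I) (F : I -> E) :
  nrm (\sum_(i <- s | P i) F i) <= \sum_(i <- s | P i) nrm (F i).
Proof.
elim/big_ind2 : _ => //; first by rewrite nrm0.
by move=> x a y b h1 h2; rewrite (le_trans (nrmD _ _)) // lerD.
Qed.

Lemma nrm_small x : (forall e : R, 0 < e -> nrm x <= e) -> x = 0.
Proof.
move=> h; apply: nrm_eq0; apply/eqP; rewrite eq_le nrm_ge0 andbT.
by apply/ler_addgt0Pl => e e0; rewrite addr0 h.
Qed.

Lemma nrm_cvgP (T : Type) (F : set_system T) (FF : Filter F) (z : T -> E) y :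
  z @ F --> y <-> forall e : R, 0 < e -> \forall t \near F, nrm (z t - y) < e.
Proof.
split=> [/cvgrPdist_lt h e e0|h].
  have /h : 0 < sc e by rewrite -sc0 ltr_sc.
  by apply: filterS => t; rewrite -sc_nrm ltr_sc nrmBC.
apply/cvgrPdist_lt => e e0; have e0' := ltW e0; rewrite -(scK e0').
have /h : 0 < sc_re e by rewrite -ltr_sc sc0 scK.
by apply: filterS => t; rewrite -sc_nrm ltr_sc nrmBC.
Qed.

Lemma nrm_continuousP (T : topologicalType) (z : T -> E) :
  continuous z <->
  forall t (e : R), 0 < e -> \forall u \near t, nrm (z u - z t) < e.
Proof.
split=> h; first by move=> t; apply/nrm_cvgP; exact: h.
by move=> t; apply/nrm_cvgP; exact: h.
Qed.

End Norms.

Lemma nrm_kabs (a : K) : nrm (a : K^o) = kabs a.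
Proof. by []. Qed.

Lemma kabs_continuousP (T : topologicalType) (z : T -> K) :
  continuous (z : T -> K^o) <->
  forall t (e : R), 0 < e -> \forall u \near t, kabs (z u - z t) < e.
Proof. exact: (@nrm_continuousP K^o). Qed.

Lemma lin_bounded (E F : normedModType K) (f : {linear E -> F}) :
  continuous f -> exists2 M : R, 0 < M & forall x, nrm (f x) <= M * nrm x.
Proof.
move=> /nrm_continuousP /(_ 0 1 ltr01); rewrite linear0.
move=> /nbhs_ballP [e /= e0 he].
have e0' : 0 < sc_re e by rewrite -ltr_sc sc0 scK // ltW.
exists (2 / sc_re e) => [|x]; first by rewrite divr_gt0.
have [->|x0] := eqVneq x 0; first by rewrite linear0 !nrm0 mulr0.
have nx : 0 < nrm x.
  by rewrite lt_neqAle nrm_ge0 andbT eq_sym; apply: contraNN x0 => /eqP /nrm_eq0 ->.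
(* [sc t *: x] has norm [sc_re e / 2], inside the ball on which [f] stays below 1. *)
pose t := sc_re e / (2 * nrm x).
have t0 : 0 < t by rewrite divr_gt0 ?mulr_gt0.
have := he (sc t *: x); rewrite subr0 linearZ nrmZ kabs_sc gtr0_norm // => h.
have /h : ball 0 e (sc t *: x).
  rewrite -ball_normE /ball_ /= sub0r normrN -sc_nrm nrmZ kabs_sc gtr0_norm //.
  rewrite -(scK (ltW e0)) ltr_sc /t invfM mulrA -mulrA mulVf ?gt_eqF // mulr1.
  by rewrite ltr_pdivrMr // ltr_pMr // ltr1n.
rewrite -ltr_pdivlMl // mulr1 /t invf_div => /ltW h'.
by rewrite (le_trans h') // mulrAC.
Qed.

Lemma bounded_lin (E F : normedModType K) (f : {linear E -> F}) M :
  (forall x, nrm (f x) <= M * nrm x) -> continuous f.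
Proof.
move=> h; apply/nrm_continuousP => x e e0; pose M' := `|M| + 1.
have M0 : 0 < M' by rewrite ltr_pwDr.
have /(nrm_cvgP (nbhs_filter x)) /(_ (e / M')) : (id : E -> E) @ x --> x by exact: cvg_id.
rewrite divr_gt0 // => /(_ isT); apply: filterS => u hu.
rewrite -linearB (le_lt_trans (h _)) // (@le_lt_trans _ _ (M' * nrm (u - x))) //.
  by rewrite ler_wpM2r ?nrm_ge0 // (le_trans (ler_norm _)) // lerDl.
by rewrite -ltr_pdivlMl // mulrC.
Qed.

Lemma nrm_ge0_gt0 (E : normedModType K) (x : E) : x <> 0 -> 0 < nrm x.
Proof.
move=> x0; rewrite lt_neqAle nrm_ge0 andbT eq_sym.
by apply/eqP => /nrm_eq0.
Qed.

Lemma complete_seq (E : completeNormedModType K) (u : nat -> E) :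
  (forall e : R, 0 < e -> exists n0, forall m n, (n0 <= m)%N -> (n0 <= n)%N ->
     nrm (u m - u n) <= e) -> exists y : E, u @ \oo --> y.
Proof.
move=> h; suff : cvg (u @ \oo) by move=> c; exists (lim (u @ \oo)).
apply: cauchy_cvg; apply/cauchyP => e e0.
have e0' : 0 < sc_re e by rewrite -ltr_sc sc0 scK // ltW.
have [|n0 hn0] := h (sc_re e / 2); first by rewrite divr_gt0.
exists (u n0); exists n0 => // n /= n0n.
rewrite -ball_normE /ball_ /= -sc_nrm -(scK (ltW e0)) ltr_sc.
by rewrite (le_lt_trans (hn0 _ _ (leqnn _) n0n)) // ltr_pdivrMr // ltr_pMr // ltr1n.
Qed.

End Scalars.

Arguments sc {R k}.
Arguments sc_i {R k}.

(** * Hahn-Banach theorem and Banach spaces from seminorms *)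

Section HahnBanach.
Context (R : realType) (k : scalar_kind).
Local Notation K := (scal R k).
Variable E : normedModType K.
Implicit Types (x y : E) (G : set (E * R)).

(* Graphs of real-linear functionals, dominated by the norm and defined on a
   real subspace. *)
Definition dominated_graph G :=
  (forall (a : R) x r y s, G (x, r) -> G (y, s) ->
     G (sc a *: x + y, a * r + s)) /\
  (forall x r, G (x, r) -> r <= nrm x).

Lemma dominated_graph_fun G x r s :
  dominated_graph G -> G (x, r) -> G (x, s) -> r = s.
Proof.
move=> [Glin Gdom] xr xs.
have h u v : G (x, u) -> G (x, v) -> v <= u.
  move=> xu xv; have := Glin (-1) _ _ _ _ xu xv.
  by rewrite scN sc1 scaleN1r addNr mulN1r => /Gdom; rewrite nrm0 addrC subr_le0.
by apply/eqP; rewrite eq_le !h.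
Qed.

Lemma dominated_graph_extend G x0 : dominated_graph G -> (exists p, G p) ->
  (forall r, ~ G (x0, r)) -> exists2 G', dominated_graph G' & G `<` G'.
Proof.
move=> Gdg Gne x0G; have [Glin Gdom] := Gdg.
have G0 : G (0, 0).
  have [[x r] xr] := Gne; have := Glin (-1) _ _ _ _ xr xr.
  by rewrite scN sc1 scaleN1r addNr mulN1r addNr.
(* A value [c] at [x0] is admissible when r - |x - x0| <= c <= |x + x0| - r for all (x, r) in the
   graph. The triangle inequality puts every lower bound below every upper bound, so the supremum of
   the lower ones works. *)
pose L := [set c | exists x r, G (x, r) /\ c = r - nrm (x - x0)].
have Lub x r : G (x, r) -> ubound L (nrm (x + x0) - r).
  move=> xr _ [y [s [ys ->]]].
  have := Glin 1 _ _ _ _ xr ys; rewrite sc1 scale1r mul1r => /Gdom h.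
  by have := nrmD (x + x0) (y - x0); rewrite addrACA subrr addr0; lra.
have Lsup : has_sup L.
  split; first by exists (0 - nrm (0 - x0)), 0, 0.
  by exists (nrm (0 + x0) - 0); exact: Lub.
pose c := sup L.
have cl x r : G (x, r) -> r - nrm (x - x0) <= c.
  by move=> xr; apply: sup_upper_bound => //; exists x, r.
have cu x r : G (x, r) -> c <= nrm (x + x0) - r.
  by move=> xr; apply: ge_sup; [exact: Lsup.1 | exact: Lub].
pose G' := [set p : E * R | exists x r t,
  [/\ G (x, r), p.1 = x + sc t *: x0 & p.2 = r + t * c]].
have scaleG a x r : G (x, r) -> G (sc a *: x, a * r).
  by move=> xr; have := Glin a _ _ _ _ xr G0; rewrite !addr0.
exists G'; first split.
- move=> a ? ? ? ? [x [r [t [xr /= -> ->]]]] [y [s [u [ys /= -> ->]]]].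
  exists (sc a *: x + y), (a * r + s), (a * t + u); split => /=.
  + exact: Glin.
  + by rewrite scalerDr addrACA scalerA -scM -scalerDl -scD.
  + by ring.
- move=> ? ? [x [r [t [xr /= -> ->]]]].
  have [t0|t0|->] := ltgtP t 0; last 1 first.
  + by rewrite sc0 scale0r mul0r !addr0; exact: Gdom.
  + have t1 : 0 < - t by rewrite oppr_gt0.
    have := cl _ _ (scaleG (- t)^-1 _ _ xr).
    have -> : sc (- t)^-1 *: x - x0 = sc (- t)^-1 *: (x + sc t *: x0).
      rewrite scalerDr scalerA -scM invrN mulNr mulVf ?lt_eqF //.
      by rewrite [sc (-1)]scN sc1 scaleN1r.
    rewrite nrmZ kabs_sc gtr0_norm ?invr_gt0 // -mulrBr.
    rewrite ler_pdivrMl // mulNr => h; lra.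
  + have := cu _ _ (scaleG t^-1 _ _ xr).
    have -> : sc t^-1 *: x + x0 = sc t^-1 *: (x + sc t *: x0).
      by rewrite scalerDr scalerA -scM mulVf ?gt_eqF // sc1 scale1r.
    rewrite nrmZ kabs_sc gtr0_norm ?invr_gt0 // -mulrBr ler_pdivlMl // => h; lra.
split; first by move=> [x r] xr; exists x, r, 0; rewrite sc0 scale0r mul0r !addr0.
move=> /(_ (x0, c)) h; apply: (x0G c); apply: h.
by exists 0, 0, 1; rewrite sc1 scale1r mul1r !add0r.
Qed.

Lemma real_hahn_banach y : exists f : E -> R,
  [/\ (forall (a : R) x z, f (sc a *: x + z) = a * f x + f z),
      (forall x, f x <= nrm x) & f y = nrm y].
Proof.
(* The alternative [G = set0] accommodates the union of an empty chain; [Ay'] below excludes it for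
   the maximal graph, which the graph on the line of [y] would extend. *)
pose P G := dominated_graph G /\ (G = set0 \/ G (y, nrm y)).
have [F FP tot|A [[Adg Ay] Amax]] := @Zorn_bigcup _ P.
  split; first split.
  - move=> a x r z s [X FX Xx] [Y FY Yz].
    have [XY|YX] := tot _ _ FX FY.
    + by exists Y => //; apply: (FP _ FY).1.1 => //; exact: XY.
    + by exists X => //; apply: (FP _ FX).1.1 => //; exact: YX.
  - by move=> x r [X FX Xx]; exact: (FP _ FX).1.2 Xx.
  have [[X FX Xy]|no] := pselect (exists2 X, F X & X (y, nrm y)).
    by right; exists X.
  left; rewrite -subset0 => p [X FX Xp].
  by have [X0|Xy] := (FP _ FX).2; [rewrite X0 in Xp | case: no; exists X].
have Ay' : A (y, nrm y).
  case: Ay => // A0.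
  pose L := [set p : E * R | exists t, p = (sc t *: y, t * nrm y)].
  case: (Amax L).
    split; first by rewrite A0.
    by move=> /(_ (sc 1 *: y, 1 * nrm y)); rewrite A0; apply; exists 1.
  split; last by right; exists 1; rewrite /= sc1 scale1r mul1r.
  split=> [a _ _ _ _ [t [-> ->]] [u [-> ->]]|_ _ [t [-> ->]]].
    exists (a * t + u); congr (_, _); last by ring.
    by rewrite scalerA -scM -scalerDl -scD.
  by rewrite nrmZ kabs_sc ler_wpM2r ?nrm_ge0 // ler_norm.
have tot x : exists r, A (x, r).
  apply: contrapT => /forallNP no.
  have [|G' G'dg AG'] := dominated_graph_extend Adg _ no; first by exists (y, nrm y).
  by apply: (Amax _ AG'); split => //; right; apply: AG'.1.
have [f fP] := choice tot; exists f; split.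
- move=> a x z; apply: (dominated_graph_fun Adg (fP _)).
  exact: Adg.1.
- by move=> x; apply: Adg.2.
- exact: (dominated_graph_fun Adg (fP _) Ay').
Qed.

Lemma sc_i_sq : sc_i = 0 :> K \/ sc_i * sc_i = -1 :> K.
Proof.
by rewrite /sc_i; case: k => /=; [left | right; rewrite -expr2 sqr_i].
Qed.

Lemma sc_re_iM (z : K) : sc_re (sc_i * z) = - sc_im z.
Proof.
by rewrite sc_reM /sc_i /sc_re /sc_im; case: k z => /= z; rewrite ?mul0r ?mul1r ?sub0r ?oppr0.
Qed.

Lemma hahn_banach y : exists f : {linear E -> K^o},
  (forall x, kabs (f x) <= nrm x) /\ f y = sc (nrm y).
Proof.
have [f [flin fdom fy]] := real_hahn_banach y.
have fD x z : f (x + z) = f x + f z.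
  by have := flin 1 x z; rewrite sc1 scale1r mul1r.
have f0 : f 0 = 0 by apply: (addIr (f 0)); rewrite -fD !add0r.
have fZ a x : f (sc a *: x) = a * f x.
  by have := flin a x 0; rewrite f0 !addr0.
(* The usual complexification f(x) - i f(i x); over the reals [sc_i] is 0 and [g] is [f]. *)
pose g x : K^o := sc (f x) - sc_i * sc (f (sc_i *: x)).
have gD x z : g (x + z) = g x + g z.
  by rewrite /g scalerDr !fD !scD; ring.
have gsc a x : g (sc a *: x) = sc a * g x.
  by rewrite /g [sc_i *: (sc a *: x)]scalerA (mulrC sc_i (sc a)) -scalerA !fZ !scM mulrBr [sc_i * (sc a * _)]mulrCA.
have gi x : g (sc_i *: x) = sc_i * g x.
  rewrite /g scalerA; have [i0|i2] := sc_i_sq.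
    by rewrite i0 !mul0r scale0r f0 sc0 subr0.
  rewrite mulrBr mulrA i2.
  have fN z : f (- z) = - f z by have := fZ (-1) z; rewrite scN sc1 scaleN1r mulN1r.
  by rewrite scaleN1r fN scN mulrN opprK mulN1r opprK addrC.
have glin : linear g.
  move=> a x z; rewrite gD; congr (_ + _).
  rewrite {1}(sc_decomp a) scalerDl gD gsc -scalerA gi gsc mulrA -mulrDl.
  by rewrite -sc_decomp.
pose gl := GRing.isLinear.Build K E K^o _ g glin.
pose G : {linear E -> K^o} := HB.pack g gl.
have Gre x : sc_re (G x) = f x.
  by rewrite /G /= /g sc_reB sc_reK sc_re_iM sc_imK oppr0 subr0.
have Gdom x : kabs (G x) <= nrm x.
  (* After rotation the value of [G] is a nonnegative real, hence equal to the value of [f], to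
     which domination applies. *)
  have [u u1 uG] := kabs_phase (G x).
  have -> : kabs (G x) = f (u *: x).
    by rewrite -Gre linearZ /= -[u *: _]/(u * G x) uG sc_reK.
  by rewrite (le_trans (fdom _)) // nrmZ u1 mul1r.
exists G; split => //.
have h : sc_re (G y) = nrm y by rewrite Gre.
have hk : kabs (G y) = nrm y.
  by apply/eqP; rewrite eq_le Gdom /= -h sc_re_le.
by rewrite -hk; apply: sc_kabs_re; rewrite hk.
Qed.

Lemma hahn_banach_le y c :
  (forall f : {linear E -> K^o}, continuous f ->
     (forall x, kabs (f x) <= nrm x) -> kabs (f y) <= c) -> nrm y <= c.
Proof.
move=> h; have [f [fdom fy]] := hahn_banach y.
have := h f _ fdom; rewrite fy kabs_sc ger0_norm ?nrm_ge0 //; apply.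
by apply: (@bounded_lin _ _ _ _ _ 1) => x; rewrite mul1r nrm_kabs.
Qed.

Lemma functionals_separate x y :
  (forall f : {linear E -> K^o}, continuous f -> f x = f y) -> x = y.
Proof.
move=> h; apply/eqP; rewrite -subr_eq0; apply/eqP; apply: nrm_eq0.
apply/eqP; rewrite eq_le nrm_ge0 andbT; apply: hahn_banach_le => f cf _.
by rewrite linearB h // subrr kabs0.
Qed.

End HahnBanach.

(** Renormed sums, ultraproducts and duals are all obtained below as Hausdorff quotients of such a
    space. The axioms are restricted to [sn_sub], so that the ambient module can be a large product
    or function space on which [sn_norm] means nothing. Completeness is sequential. *)
Record seminormed_space (R : realType) (k : scalar_kind) := SeminormedSpace {
  sn_space : lmodType (scal R k);
  sn_sub : set sn_space;
  sn_norm : sn_space -> R;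
  sn_sub0 : sn_sub 0;
  sn_subP : forall a x y, sn_sub x -> sn_sub y -> sn_sub (a *: x + y);
  sn_normZ : forall a x, sn_sub x -> sn_norm (a *: x) = kabs a * sn_norm x;
  sn_normD : forall x y, sn_sub x -> sn_sub y ->
    sn_norm (x + y) <= sn_norm x + sn_norm y;
  sn_complete : forall u : nat -> sn_space, (forall n, sn_sub (u n)) ->
    (forall e : R, 0 < e -> exists n0, forall m n, (n0 <= m)%N -> (n0 <= n)%N ->
       sn_norm (u m - u n) <= e) ->
    exists2 l, sn_sub l & forall e : R, 0 < e -> exists n0, forall n, (n0 <= n)%N ->
       sn_norm (u n - l) <= e
}.

Section BanachQuotient.
Context (R : realType) (k : scalar_kind) (X : seminormed_space R k).
Local Notation K := (scal R k).
Local Notation V := (sn_space X).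
Local Notation W := (@sn_sub _ _ X).
Local Notation p := (@sn_norm _ _ X).
Implicit Types x y : V.

Lemma sn_subZ a x : W x -> W (a *: x).
Proof. by move=> Wx; have := sn_subP a Wx (sn_sub0 X); rewrite addr0. Qed.

Lemma sn_subD x y : W x -> W y -> W (x + y).
Proof. by move=> Wx Wy; have := sn_subP 1 Wx Wy; rewrite scale1r. Qed.

Lemma sn_subN x : W x -> W (- x).
Proof. by move=> Wx; rewrite -scaleN1r; exact: sn_subZ. Qed.

Lemma sn_subB x y : W x -> W y -> W (x - y).
Proof. by move=> Wx Wy; apply: sn_subD => //; exact: sn_subN. Qed.

Lemma sn_normN x : W x -> p (- x) = p x.
Proof. by move=> Wx; rewrite -scaleN1r sn_normZ // kabsN kabs1 mul1r. Qed.

Lemma sn_norm0 : p 0 = 0.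
Proof. by rewrite -(scale0r (0 : V)) sn_normZ ?kabs0 ?mul0r //; exact: sn_sub0. Qed.

Lemma sn_norm_ge0 x : W x -> 0 <= p x.
Proof.
move=> Wx; have := sn_normD Wx (sn_subN Wx); rewrite subrr sn_norm0 sn_normN //.
by rewrite -mulr2n pmulrn_lge0.
Qed.

Lemma sn_norm_eq x y : W x -> W y -> p (x - y) = 0 -> p x = p y.
Proof.
have h u v : W u -> W v -> p (u - v) = 0 -> p u <= p v.
  move=> Wu Wv uv; have := sn_normD (sn_subB Wu Wv) Wv.
  by rewrite subrK uv add0r.
move=> Wx Wy xy; apply/eqP; rewrite eq_le !h //.
by rewrite -opprB sn_normN //; exact: sn_subB.
Qed.

Definition sn_coset x : set V := [set y | W y /\ p (y - x) = 0].

Definition sn_quot := {A : set V | exists2 x, W x & A = sn_coset x}.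

Definition sn_rep (a : sn_quot) : V := projT1 (cid2 (svalP a)).

Lemma sn_repP (a : sn_quot) : W (sn_rep a).
Proof. by rewrite /sn_rep; case: cid2. Qed.

Lemma sn_coset_rep (a : sn_quot) : sval a = sn_coset (sn_rep a).
Proof. by rewrite /sn_rep; case: cid2. Qed.

(** Outside [sn_sub] the value is the class of 0, a default that keeps the projection total. *)
Definition sn_proj x : sn_quot :=
  match pselect (W x) with
  | left Wx => exist _ (sn_coset x) (ex_intro2 _ _ x Wx erefl)
  | right _ => exist _ (sn_coset 0) (ex_intro2 _ _ 0 (sn_sub0 X) erefl)
  end.

Lemma sn_projE x : W x -> sval (sn_proj x) = sn_coset x.
Proof. by rewrite /sn_proj; case: pselect. Qed.

Lemma sn_repK (a : sn_quot) : sn_proj (sn_rep a) = a.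
Proof.
by apply: eq_sig_hprop => [? ? ?|]; [exact: Prop_irrelevance|rewrite /=]; rewrite sn_projE ?sn_coset_rep //; exact: sn_repP.
Qed.

Lemma sn_proj_eq x y : W x -> W y -> p (x - y) = 0 -> sn_proj x = sn_proj y.
Proof.
move=> Wx Wy xy; apply: eq_sig_hprop => [? ? ?|]; [exact: Prop_irrelevance|rewrite /=]; rewrite !sn_projE //.
apply/seteqP; split=> z [Wz h]; split=> //; apply/eqP; rewrite eq_le.
  rewrite sn_norm_ge0 ?andbT; last exact: sn_subB.
  rewrite -(subrKA x) (le_trans (sn_normD _ _)) ?h ?xy ?addr0 //; exact: sn_subB.
rewrite sn_norm_ge0 ?andbT; last exact: sn_subB.
rewrite -(subrKA y) (le_trans (sn_normD _ _)) ?h ?add0r //; try exact: sn_subB.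
by rewrite -opprB sn_normN ?xy //; exact: sn_subB.
Qed.

Lemma sn_proj_inj x y : W x -> W y -> sn_proj x = sn_proj y -> p (x - y) = 0.
Proof.
move=> Wx Wy /(congr1 sval); rewrite !sn_projE // => xy.
have : sn_coset x x by split=> //; rewrite subrr sn_norm0.
by rewrite xy => -[].
Qed.

Lemma sn_projK x : W x -> p (sn_rep (sn_proj x) - x) = 0.
Proof.
by move=> Wx; apply: sn_proj_inj; rewrite ?sn_repK //; exact: sn_repP.
Qed.

HB.instance Definition _ := gen_eqMixin sn_quot.
HB.instance Definition _ := gen_choiceMixin sn_quot.

Definition sn_add (a b : sn_quot) := sn_proj (sn_rep a + sn_rep b).
Definition sn_opp (a : sn_quot) := sn_proj (- sn_rep a).
Definition sn_scale (c : K) (a : sn_quot) := sn_proj (c *: sn_rep a).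

Lemma sn_projD x y : W x -> W y -> sn_add (sn_proj x) (sn_proj y) = sn_proj (x + y).
Proof.
move=> Wx Wy; have Wx' := sn_repP (sn_proj x); have Wy' := sn_repP (sn_proj y).
apply: sn_proj_eq; try exact: sn_subD.
rewrite opprD addrACA; apply/eqP; rewrite eq_le sn_norm_ge0 ?andbT; last first.
  by apply: sn_subD; exact: sn_subB.
apply: le_trans (sn_normD _ _) _; try exact: sn_subB.
by rewrite !sn_projK // addr0.
Qed.

Lemma sn_projZ c x : W x -> sn_scale c (sn_proj x) = sn_proj (c *: x).
Proof.
move=> Wx; have Wx' := sn_repP (sn_proj x).
apply: sn_proj_eq; try exact: sn_subZ.
by rewrite -scalerBr sn_normZ ?sn_projK ?mulr0 //; exact: sn_subB.
Qed.

Lemma sn_projN x : W x -> sn_opp (sn_proj x) = sn_proj (- x).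
Proof.
by move=> Wx; rewrite /sn_opp -scaleN1r -[LHS]/(sn_scale _ _) sn_projZ // scaleN1r.
Qed.

Lemma sn_quot_ind (P : sn_quot -> Prop) :
  (forall x, W x -> P (sn_proj x)) -> forall a, P a.
Proof. by move=> h a; rewrite -(sn_repK a); apply: h; exact: sn_repP. Qed.

Fact sn_addA : associative sn_add.
Proof.
elim/sn_quot_ind => x Wx; elim/sn_quot_ind => y Wy; elim/sn_quot_ind => z Wz.
by rewrite !sn_projD ?addrA //; exact: sn_subD.
Qed.

Fact sn_addC : commutative sn_add.
Proof. by move=> a b; rewrite /sn_add addrC. Qed.

Fact sn_add0 : left_id (sn_proj 0) sn_add.
Proof.
by elim/sn_quot_ind => x Wx; rewrite sn_projD ?add0r //; exact: sn_sub0.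
Qed.

Fact sn_addN : left_inverse (sn_proj 0) sn_opp sn_add.
Proof.
elim/sn_quot_ind => x Wx; rewrite sn_projN // sn_projD ?addNr //; exact: sn_subN.
Qed.

HB.instance Definition _ :=
  GRing.isZmodule.Build sn_quot sn_addA sn_addC sn_add0 sn_addN.

Fact sn_scaleA a b v : sn_scale a (sn_scale b v) = sn_scale (a * b) v.
Proof.
by elim/sn_quot_ind : v => x Wx; rewrite !sn_projZ ?scalerA //; exact: sn_subZ.
Qed.

Fact sn_scale1 : left_id 1 sn_scale.
Proof. by elim/sn_quot_ind => x Wx; rewrite sn_projZ // scale1r. Qed.

Fact sn_scaleDr : right_distributive sn_scale +%R.
Proof.
move=> a; elim/sn_quot_ind => x Wx; elim/sn_quot_ind => y Wy.
rewrite /GRing.add /= sn_projD // !sn_projZ ?sn_projD ?scalerDr //;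
  by [exact: sn_subZ | exact: sn_subD].
Qed.

Fact sn_scaleDl v : {morph sn_scale^~ v : a b / a + b}.
Proof.
move=> a b; elim/sn_quot_ind : v => x Wx.
by rewrite /= !sn_projZ // scalerDl [RHS]sn_projD //; exact: sn_subZ.
Qed.

HB.instance Definition _ := GRing.Zmodule_isLmodule.Build K sn_quot
  sn_scaleA sn_scale1 sn_scaleDr sn_scaleDl.

Definition sn_qnorm (a : sn_quot) : K := sc (p (sn_rep a)).

Lemma sn_qnormE x : W x -> sn_qnorm (sn_proj x) = sc (p x).
Proof.
move=> Wx; congr sc; apply: sn_norm_eq => //; [exact: sn_repP|exact: sn_projK].
Qed.

Fact sn_qnormD a b : sn_qnorm (a + b) <= sn_qnorm a + sn_qnorm b.
Proof.
elim/sn_quot_ind : a => x Wx; elim/sn_quot_ind : b => y Wy.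
rewrite [_ + _ in leLHS]sn_projD // !sn_qnormE //; last exact: sn_subD.
by rewrite -scD ler_sc sn_normD.
Qed.

Fact sn_qnormZ c a : sn_qnorm (c *: a) = `|c| * sn_qnorm a.
Proof.
elim/sn_quot_ind : a => x Wx.
rewrite [_ *: _ in LHS]sn_projZ // !sn_qnormE //; last exact: sn_subZ.
by rewrite sn_normZ // scM sc_kabs.
Qed.

Fact sn_qnorm_eq0 a : sn_qnorm a = 0 -> a = 0.
Proof.
elim/sn_quot_ind : a => x Wx; rewrite sn_qnormE // => /eqP; rewrite sc_eq0 => /eqP x0.
by apply: sn_proj_eq => //; [exact: sn_sub0 | rewrite subr0].
Qed.

HB.instance Definition _ := Lmodule_isNormed.Build K sn_quot
  sn_qnormD sn_qnormZ sn_qnorm_eq0.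

Lemma nrm_sn_proj x : W x -> nrm (sn_proj x : sn_quot) = p x.
Proof. by move=> Wx; rewrite -[LHS]/(sc_re (sn_qnorm _)) sn_qnormE // sc_reK. Qed.

Lemma sn_proj_linear a x y : W x -> W y ->
  sn_proj (a *: x + y) = a *: sn_proj x + sn_proj y :> sn_quot.
Proof.
move=> Wx Wy; rewrite -[RHS]/(sn_add (sn_scale _ _) _) sn_projZ // sn_projD //.
exact: sn_subZ.
Qed.

Lemma nrm_sn_projB x y : W x -> W y ->
  nrm (sn_proj x - sn_proj y : sn_quot) = p (x - y).
Proof.
move=> Wx Wy.
have -> : sn_proj x - sn_proj y = sn_proj (-1 *: y + x) :> sn_quot.
  by rewrite sn_proj_linear // scaleN1r addrC.
by rewrite nrm_sn_proj ?scaleN1r 1?addrC //; apply: sn_subB.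
Qed.

(** A Cauchy filter contains balls of radius [e n / 2] around points [a n]; these points form a
    Cauchy sequence, and its limit, given by [sn_complete] on representatives, is the limit of the
    filter. *)
Fact sn_quot_complete (F : set_system sn_quot) :
  ProperFilter F -> cauchy F -> cvg F.
Proof.
move=> FF Fc; pose e n : R := n.+1%:R^-1.
have e0 n : 0 < e n by rewrite invr_gt0.
have ball_e (a b : sn_quot) r : ball a (sc r) b = (nrm (a - b) < r) :> Prop.
  by rewrite -ball_normE /ball_ /= -sc_nrm ltr_sc.
have /choice [a aP] n : exists a, F (ball a (sc (e n / 2))).
  by move/cauchyP : Fc; apply; rewrite -sc0 ltr_sc divr_gt0.
have aa m n : nrm (a m - a n) < e m / 2 + e n / 2.
  have /filter_ex [b []] : F (ball (a m) (sc (e m / 2)) `&` ball (a n) (sc (e n / 2))) by exact: filterI.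
  rewrite !ball_e => bm bn.
  by rewrite (le_lt_trans (nrm_triangle _ b _)) // ltrD // nrmBC.
have e_small r : 0 < r -> exists n0, forall n, (n0 <= n)%N -> e n <= r.
  move=> r0; exists (Num.truncn r^-1) => n n0n.
  rewrite invf_ple ?posrE // (le_trans (ltW (truncnS_gt _))) //.
  by rewrite ler_nat.
have [||l Wl lP] := @sn_complete _ _ X (sn_rep \o a).
- by move=> n; exact: sn_repP.
- move=> r r0; have [n0 n0P] := e_small _ r0; exists n0 => m n n0m n0n.
  have := aa m n; rewrite -{1}(sn_repK (a m)) -{1}(sn_repK (a n)).
  rewrite nrm_sn_projB; try exact: sn_repP.
  by rewrite /=; have := n0P _ n0m; have := n0P _ n0n; lra.
apply/cvg_ex; exists (sn_proj l); apply/nrm_cvgP => r r0.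
have [|n0 n0P] := lP (r / 4); first by rewrite divr_gt0.
have [|n1 n1P] := e_small (r / 4); first by rewrite divr_gt0.
pose n := maxn n0 n1; have := aP n; apply: filterS => b; rewrite ball_e => bn.
have := n0P n (leq_maxl _ _); have := n1P n (leq_maxr _ _) => en ln.
have aln : nrm (a n - sn_proj l) <= r / 4.
  by rewrite -{1}(sn_repK (a n)) nrm_sn_projB //; exact: sn_repP.
have := nrm_triangle b (a n) (sn_proj l); rewrite (nrmBC b (a n)); have := e0 n; lra.
Qed.

HB.instance Definition _ := Uniform_isComplete.Build sn_quot sn_quot_complete.

End BanachQuotient.

(** * Scalar integrals *)

Section Compactness.

Lemma compact_finite_cover (X : topologicalType) (A : set X) (O : X -> set X) :
  compact A -> (forall x, A x -> nbhs x (O x)) ->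
  exists s : seq X, (forall x, x \in s -> A x) /\
    forall y, A y -> exists2 x, x \in s & O x y.
Proof.
move=> /compact_near_coveringP Ac OA.
(* [F] is the filter of tails of the directed set of finite subsets of [A]. The near-covering form
   of compactness along [F] yields one finite subset whose sets [O x] cover. *)
pose F : set_system (seq X) := [set P | exists s0 : seq X, (forall x, x \in s0 -> A x) /\
  forall s : seq X, (forall x, x \in s -> A x) -> {subset s0 <= s} -> P s].
have FF : Filter F.
  split=> [|P Q [s [sA sP]] [t [tA tQ]]|P Q PQ [s [sA sP]]].
  - by exists [::].
  - exists (s ++ t); split=> [x|u uA stu].
      by rewrite mem_cat => /orP[/sA|/tA].
    split; first by apply: sP => // x xs; apply: stu; rewrite mem_cat xs.
    by apply: tQ => // x xt; apply: stu; rewrite mem_cat xt orbT.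
  - by exists s; split=> // u uA su; apply: PQ; exact: sP.
have [s0 [s0A h]] : \forall s \near F, A `<=` [set y | (exists2 x, x \in s & O x y)].
  apply: (Ac _ F (fun s y => exists2 x, x \in s & O x y)) => x Ax.
  exists (O x, [set s : seq X | x \in s]) => /=; last first.
    by move=> [y s] [/= Oy xs]; exists x.
  split; first exact: OA.
  exists [:: x]; split=> [y|s sA]; first by rewrite inE => /eqP ->.
  by apply; rewrite inE.
by exists s0; split=> // y Ay; have := h s0 s0A (fun _ => id) y Ay.
Qed.

Lemma compact_bound (R : realType) (X : topologicalType) (A : set X) (f : X -> R) :
  compact A -> continuous f -> exists M : R, 0 <= M /\ forall x, A x -> `|f x| <= M.
Proof.
move=> Ac fc.
have [|s [sA sP]] := @compact_finite_cover _ A (fun x => [set y | `|f y| < `|f x| + 1]) Ac.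
  move=> x _; have /cvgrPdist_lt /(_ 1 ltr01) := fc x.
  apply: filterS => y /= h; rewrite -ltrBlDl (le_lt_trans _ h) //.
  by rewrite distrC (le_trans _ (ler_dist_dist _ _)) // ler_norm.
exists (\sum_(x <- s) (`|f x| + 1)); split; first by apply: sumr_ge0.
move=> y /sP [x xs /ltW h]; rewrite (le_trans h) // (big_rem x) //= lerDl.
by apply: sumr_ge0.
Qed.

Lemma compact_uniform (R : realType) (k : scalar_kind) (X Y : topologicalType)
    (E : normedModType (scal R k)) (F : X -> Y -> E) (B : set Y) :
  compact B -> continuous (fun p : X * Y => F p.1 p.2) ->
  forall x0 (e : R), 0 < e ->
    \forall x \near x0, forall y, B y -> nrm (F x y - F x0 y) < e.
Proof.
move=> /compact_near_coveringP Bc Fc x0 e e0.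
suff : \forall x \near x0, B `<=` [set y | nrm (F x y - F x0 y) < e] by [].
apply: (Bc _ (nbhs x0) (fun x y => nrm (F x y - F x0 y) < e)) => y By.
have e2 : 0 < e / 2 by rewrite divr_gt0.
have /nrm_continuousP /(_ (x0, y) _ e2) := Fc.
case=> -[U V] /= [x0U yV] UV.
exists (V, U) => //= -[y' x] [/= Vy' Ux].
have h1 := UV (x, y') (conj Ux Vy'); have h2 := UV (x0, y') (conj (nbhs_singleton x0U) Vy').
have := nrm_triangle (F x y') (F x0 y) (F x0 y').
by rewrite (nrmBC (F x0 y) (F x0 y')); move: h1 h2 => /=; lra.
Qed.

End Compactness.

Section ScalarIntegral.
Context (R : realType) (k : scalar_kind) (G : topGroupType).
Local Notation K := (scal R k).
Local Notation T := (borelType G).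
Hypothesis G_hausdorff : hausdorff_space G.
Variable mu : {measure set T -> \bar R}.
Hypothesis mu_compact : forall A : set G, compact A -> (mu A < +oo)%E.
Implicit Types (A B : set T) (f : G -> K).
Local Notation kint := (@scal_integral R k G mu).

Lemma borel_open (U : set G) : open U -> measurable (U : set T).
Proof. by move=> oU; apply: sub_sigma_algebra. Qed.

Lemma borel_closed (U : set G) : closed U -> measurable (U : set T).
Proof.
by move=> cU; rewrite -[U]setCK; apply: measurableC; apply: borel_open; exact: closed_openC.
Qed.

Lemma borel_compact (U : set G) : compact U -> measurable (U : set T).
Proof. by move=> cU; apply: borel_closed; exact: compact_closed. Qed.

Lemma borel_continuous (f : G -> R) A :
  measurable A -> continuous f -> measurable_fun A (f : T -> R).
Proof.
move=> mA fc; apply: (measurability _ (RGenOpens.measurableE R)).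
move=> _ [_ [a [b ->]] <-]; apply: measurableI => //; apply: borel_open.
apply: open_comp => [x _|]; [exact: fc | exact: itv_open].
Qed.

Lemma borel_continuous_map (f : G -> G) : continuous f -> measurable_fun setT (f : T -> T).
Proof.
move=> fc; apply: (@measurability _ _ T T setT f (@open G) erefl).
move=> _ [U oU <-]; rewrite setTI; apply: borel_open.
by apply: open_comp => // x _; exact: fc.
Qed.

Lemma continuous_sc_re f : continuous (f : G -> K^o) -> continuous (fun x => sc_re (f x)).
Proof.
move=> /kabs_continuousP fc x; apply/cvgrPdist_lt => e e0.
apply: filterS (fc x e e0) => y; apply: le_lt_trans.
by rewrite distrC -sc_reB kabs_re.
Qed.

Lemma sc_imN (z : K) : sc_im (- z) = - sc_im z.
Proof. by rewrite /sc_im; case: k z => //= [_|[? ?]] //; rewrite oppr0. Qed.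

Lemma continuous_sc_im f : continuous (f : G -> K^o) -> continuous (fun x => sc_im (f x)).
Proof.
move=> /kabs_continuousP fc x; apply/cvgrPdist_lt => e e0.
apply: filterS (fc x e e0) => y; apply: le_lt_trans.
by rewrite distrC -sc_imN -sc_imD kabs_im.
Qed.

Lemma rintegrable_Cc (g : G -> R) (B : set G) A : measurable A -> compact B ->
  continuous g -> (forall x, ~ B x -> g x = 0) ->
  mu.-integrable A (fun x => (g x)%:E).
Proof.
move=> mA Bc gc g0; apply: (@integrableS _ T _ mu setT) => //.
have mB := borel_compact Bc.
have [M [M0 gM]] := compact_bound Bc gc.
have : mu.-integrable B (EFin \o g).
  apply: measurable_bounded_integrable => //; first exact: mu_compact.
    exact: borel_continuous.
  exists M; split; first exact: num_real.
  by move=> N MN x Bx; apply: le_trans (gM _ Bx) (ltW MN).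
move=> /integrable_mkcond -/(_ mB); apply: eq_integrable => // x _.
rewrite /patch; case: ifPn => // /negP xB; rewrite g0 // => Bx.
by apply: xB; rewrite inE.
Qed.

Lemma integrable_ext A (f g : T -> \bar R) :
  f =1 g -> mu.-integrable A f -> mu.-integrable A g.
Proof. by move=> /funext ->. Qed.

Definition kok A f :=
  mu.-integrable A (fun x => (sc_re (f x))%:E) /\
  mu.-integrable A (fun x => (sc_im (f x))%:E).

Lemma kintE A f : kint A f =
  sc (\int[mu]_(x in A) sc_re (f x)) + sc_i * sc (\int[mu]_(x in A) sc_im (f x)).
Proof.
rewrite /scal_integral /sc /sc_re /sc_im /sc_i; case: k f => f.
  by rewrite mul0r addr0.
exact: complexE.
Qed.

Lemma sc_re_kint A f : sc_re (kint A f) = \int[mu]_(x in A) sc_re (f x).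
Proof. by rewrite kintE sc_reD sc_reK sc_re_iM sc_imK oppr0 addr0. Qed.

Lemma kok_Cc A f (B : set G) : measurable A -> compact B ->
  continuous (f : G -> K^o) -> (forall x, ~ B x -> f x = 0) -> kok A f.
Proof.
move=> mA Bc fc f0; split; apply: (rintegrable_Cc mA Bc).
- exact: continuous_sc_re.
- by move=> x /f0 ->; rewrite sc_re0.
- exact: continuous_sc_im.
- by move=> x /f0 ->; rewrite -sc0 sc_imK.
Qed.

Lemma kokS A B f : measurable A -> measurable B -> B `<=` A -> kok A f -> kok B f.
Proof. by move=> mA mB BA [h1 h2]; split; exact: (integrableS mA mB BA). Qed.

Lemma kokD A f (g : G -> K) : measurable A -> kok A f -> kok A g -> kok A (fun x => f x + g x).
Proof.
move=> mA [f1 f2] [g1 g2]; split.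
  by apply: (integrable_ext _ (integrableD mA f1 g1)) => x; rewrite sc_reD EFinD.
by apply: (integrable_ext _ (integrableD mA f2 g2)) => x; rewrite sc_imD EFinD.
Qed.

Lemma kokZ A (c : K) f : measurable A -> kok A f -> kok A (fun x => c * f x).
Proof.
move=> mA [f1 f2]; split.
  apply: (integrable_ext _ (integrableB mA (integrableZl mA (sc_re c) f1)
    (integrableZl mA (sc_im c) f2))) => x.
  by rewrite sc_reM EFinB !EFinM.
apply: (integrable_ext _ (integrableD mA (integrableZl mA (sc_re c) f2)
    (integrableZl mA (sc_im c) f1))) => x.
by rewrite sc_imM EFinD !EFinM.
Qed.

Lemma kokN A f : measurable A -> kok A f -> kok A (fun x => - f x).
Proof.
move=> mA /(kokZ (-1) mA); rewrite (_ : (fun x => -1 * f x) = (fun x => - f x)) //.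
by apply/funext => x; rewrite mulN1r.
Qed.

Lemma kokB A f (g : G -> K) : measurable A -> kok A f -> kok A g -> kok A (fun x => f x - g x).
Proof. by move=> mA fok gok; apply: kokD => //; exact: kokN. Qed.

Lemma kint_ext A f (g : G -> K) : (forall x, A x -> f x = g x) -> kint A f = kint A g.
Proof.
by move=> fg; rewrite !kintE; congr (sc _ + sc_i * sc _);
  apply: eq_Rintegral => x; rewrite inE => /fg ->.
Qed.

Lemma kintD A f (g : G -> K) : measurable A -> kok A f -> kok A g ->
  kint A (fun x => f x + g x) = kint A f + kint A g.
Proof.
move=> mA [f1 f2] [g1 g2]; rewrite !kintE.
under eq_Rintegral do rewrite sc_reD.
under [in X in _ + sc_i * X]eq_Rintegral do rewrite sc_imD.
by rewrite !RintegralD // !scD; ring.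
Qed.

Lemma kintZ A (c : K) f : measurable A -> kok A f ->
  kint A (fun x => c * f x) = c * kint A f.
Proof.
move=> mA [f1 f2]; rewrite !kintE.
under eq_Rintegral do rewrite sc_reM.
under [in X in _ + sc_i * X]eq_Rintegral do rewrite sc_imM.
have zl (a : R) (h : G -> R) : mu.-integrable A (fun x => (h x)%:E) ->
    mu.-integrable A (EFin \o (fun x => a * h x)).
  move=> hi; apply: (integrable_ext _ (integrableZl mA a hi)) => x.
  by rewrite /= EFinM.
rewrite RintegralB ?RintegralD //; try exact: zl.
rewrite !RintegralZl // !(scB, scD, scM) [in RHS](sc_decomp c).
have [i0|i2] := @sc_i_sq R k.
  by rewrite i0 (sc_im_real c i0) sc0 !mul0r !addr0 subr0.
set a := sc (sc_re c); set b := sc (sc_im c); set u := sc _; set v := sc _.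
rewrite (_ : (a + sc_i * b) * (u + sc_i * v) =
  a * u + sc_i * (a * v + b * u) + (sc_i * sc_i) * (b * v)); last by ring.
by rewrite i2; ring.
Qed.

Lemma kintN A f : measurable A -> kok A f -> kint A (fun x => - f x) = - kint A f.
Proof.
move=> mA fok; rewrite -mulN1r -kintZ //; apply: kint_ext => x _.
by rewrite mulN1r.
Qed.

Lemma kintB A f (g : G -> K) : measurable A -> kok A f -> kok A g ->
  kint A (fun x => f x - g x) = kint A f - kint A g.
Proof. by move=> mA fok gok; rewrite kintD ?kintN //; exact: kokN. Qed.

Lemma kint_setU A B f : measurable A -> measurable B -> kok (A `|` B) f ->
  [disjoint A & B] -> kint (A `|` B) f = kint A f + kint B f.
Proof.
by move=> mA mB [f1 f2] AB; rewrite !kintE !Rintegral_setU // !scD; ring.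
Qed.

Lemma kint_set0 f : kint set0 f = 0.
Proof. by rewrite kintE !Rintegral_set0 sc0 mulr0 addr0. Qed.

Lemma kint_cst0 A : measurable A -> kint A (fun=> 0) = 0.
Proof.
move=> mA; rewrite kintE.
under eq_Rintegral do rewrite sc_re0.
under [in X in _ + sc_i * X]eq_Rintegral do rewrite -sc0 sc_imK.
by rewrite !Rintegral_cst // mul0r sc0 mulr0 addr0.
Qed.

Lemma kok_sum (I : Type) (s : seq I) A (c : I -> K) (F : I -> G -> K) : measurable A ->
  (forall i, kok A (F i)) -> kok A (fun x => \sum_(i <- s) c i * F i x).
Proof.
move=> mA Fok; elim: s => [|i s IH].
  under eq_fun do rewrite big_nil.
  have i0 : mu.-integrable A (fun=> (0 : R)%:E) by exact: integrable0.
  by split; apply: (integrable_ext _ i0) => x /=; rewrite -sc0 ?sc_reK ?sc_imK.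
under eq_fun do rewrite big_cons.
by apply: kokD => //; exact: kokZ.
Qed.

Lemma kint_sum (I : Type) (s : seq I) A (c : I -> K) (F : I -> G -> K) : measurable A ->
  (forall i, kok A (F i)) ->
  kint A (fun x => \sum_(i <- s) c i * F i x) = \sum_(i <- s) c i * kint A (F i).
Proof.
move=> mA Fok; elim: s => [|i s IH].
  by under eq_fun do rewrite big_nil; rewrite big_nil kint_cst0.
under eq_fun do rewrite big_cons.
rewrite big_cons -IH kintD ?kintZ //; first exact: kokZ.
exact: kok_sum.
Qed.

Lemma kint_bound A f (w : G -> R) : measurable A -> kok A f ->
  mu.-integrable A (fun x => (w x)%:E) -> (forall x, A x -> kabs (f x) <= w x) ->
  kabs (kint A f) <= \int[mu]_(x in A) w x.
Proof.
move=> mA fok wi fw; have [u u1 uI] := kabs_phase (kint A f).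
have -> : kabs (kint A f) = sc_re (kint A (fun x => u * f x)).
  by rewrite kintZ // uI sc_reK.
rewrite sc_re_kint; apply: le_Rintegral => //; first by case: (kokZ u mA fok).
by move=> x Ax; rewrite (le_trans (sc_re_le _)) // kabsM u1 mul1r fw.
Qed.

Lemma kint_supp A f : measurable A -> (forall x, ~ A x -> f x = 0) ->
  kint setT f = kint A f.
Proof.
move=> mA f0; rewrite !kintE; congr (sc _ + sc_i * sc _);
  rewrite [RHS]Rintegral_mkcond; apply: eq_Rintegral => x _;
  rewrite /patch; case: ifPn => // /negP xA; rewrite f0 -?sc0 ?sc_reK ?sc_imK // => Ax;
  by apply: xA; rewrite inE.
Qed.

Lemma kint_bound_compact f (B : set G) M : kok setT f -> compact B ->
  (forall x, ~ B x -> f x = 0) -> (forall x, B x -> kabs (f x) <= M) ->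
  kabs (kint setT f) <= M * fine (mu B).
Proof.
move=> fok Bc f0 fM; have mB := borel_compact Bc.
rewrite (kint_supp mB) // -Rintegral_cst //; apply: kint_bound => //.
  by apply: kokS fok.
apply: (@measurable_bounded_integrable _ T _ mu (fun=> M)) => //; first exact: mu_compact.
exists `|M|; split; first exact: num_real.
by move=> N MN x _; exact: ltW.
Qed.

(* Replacing a dg by finitely supported measures, uniformly over integrands h. *)
Lemma kint_discretize A (l : seq G) (O : G -> set G) (a : G -> K) (w : G -> R) :
  measurable A -> (forall g, open (O g)) ->
  (forall x, A x -> exists2 g, g \in l & O g x) ->
  kok A a -> mu.-integrable A (fun x => (w x)%:E) ->
  (forall x, A x -> kabs (a x) <= w x) ->
  exists s : seq (K * G),
  [/\ (forall p, p \in s -> p.2 \in l), \sum_(p <- s) p.1 = kint A a &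
      forall (e : R) (h : G -> K), 0 <= e -> kok A (fun x => a x * h x) ->
      (forall g x, g \in l -> A x -> O g x -> kabs (h x - h g) <= e) ->
      kabs (\sum_(p <- s) p.1 * h p.2 - kint A (fun x => a x * h x)) <=
      e * \int[mu]_(x in A) w x].
Proof.
move=> + oO; elim: l A => [|g l IH] A mA AO aok wi aw.
  have -> : A = set0 by rewrite -subset0 => x /AO [].
  exists [::]; split=> // [|e h e0 _ _]; rewrite big_nil !kint_set0 //.
  by rewrite subrr kabs0 Rintegral_set0 mulr0.
have mO : measurable (O g : set T) by exact: borel_open.
(* The cells are made disjoint greedily: [g] receives the mass of [a] on [A1], and the rest of the
   list treats [A2]. The weights depend on [a] and the cover alone, not on the integrand [h]. *)
pose A1 := A `&` O g; pose A2 := A `\` O g.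
have mA1 : measurable A1 by exact: measurableI.
have mA2 : measurable A2 by exact: measurableD.
have A1A : A1 `<=` A by move=> x [].
have A2A : A2 `<=` A by move=> x [].
have disj : [disjoint A1 & A2] by apply/disj_setPS => x [[_ ?] [_ ?]].
have AU : A = A1 `|` A2 by rewrite setUIDK.
have [||||s [sl s1 sP]] := IH A2 mA2; [| exact: kokS aok | exact: integrableS wi | by move=> x /A2A /aw |].
  move=> x [/AO[g']]; rewrite inE => /orP[/eqP ->|]; first by [].
  by exists g'.
exists ((kint A1 a, g) :: s); split.
- by move=> p; rewrite !inE => /orP[/eqP -> /=|/sl ->]; rewrite ?eqxx ?orbT.
- by rewrite big_cons s1 /= [in RHS]AU kint_setU // -AU.
move=> e h e0 ahok hO; rewrite big_cons /=.
have ah1 : kok A1 (fun x => a x * h x) by exact: kokS ahok.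
have a1 : kok A1 a by exact: kokS aok.
have w1 : mu.-integrable A1 (fun x => (w x)%:E) by exact: integrableS wi.
rewrite [in kint A _]AU kint_setU // -?AU // opprD addrACA.
rewrite [in leRHS]AU Rintegral_setU // -?AU // mulrDr.
apply: le_trans (kabsD _ _) _; apply: lerD; last first.
  apply: sP => //; first exact: kokS ahok.
  by move=> g' x g'l /A2A Ax; apply: hO => //; rewrite inE g'l orbT.
rewrite mulrC -kintZ // -kintB //; last exact: kokZ.
rewrite -RintegralZl //; apply: kint_bound => //.
- by apply: kokB => //; exact: kokZ.
- by apply: (integrable_ext _ (integrableZl mA1 e w1)) => x; rewrite EFinM.
- move=> x [Ax Ox]; rewrite [h g * _]mulrC -mulrBr kabsM mulrC.
  apply: ler_pM; rewrite ?kabs_ge0 //; last exact: aw.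
  by rewrite -kabsN opprB hO // inE eqxx.
Qed.

(** * Iterated integrals of compactly supported continuous functions *)

Section Fubini.
Variables (F : G -> G -> K) (A B : set G).
Hypothesis Fc : continuous (fun p : G * G => F p.1 p.2 : K^o).
Hypotheses (Ac : compact A) (Bc : compact B).
Hypothesis F0 : forall x y, ~ (A x /\ B y) -> F x y = 0.

Lemma param_section x : continuous (F x : G -> K^o).
Proof.
move=> y; apply: (@continuous_comp _ _ _ (fun y => (x, y)) (fun p => F p.1 p.2 : K^o)).
  exact: (cvg_pair (cvg_cst _) cvg_id).
exact: Fc.
Qed.

Lemma param_kok D x : measurable D -> kok D (F x).
Proof.
move=> mD; apply: (kok_Cc mD Bc); first exact: param_section.
by move=> y By; apply: F0 => -[].
Qed.

Lemma param_unif x0 (e : R) : 0 < e ->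
  \forall x \near x0, forall y, kabs (F x y - F x0 y) < e.
Proof.
move=> e0; apply: filterS (@compact_uniform R k _ _ K^o F B Bc Fc x0 e e0) => x h y.
have [By|By] := pselect (B y); first exact: h.
by rewrite !F0 ?subrr ?kabs0 // => -[].
Qed.

Lemma param_kint_continuous : continuous (fun x => kint setT (F x) : K^o).
Proof.
apply/kabs_continuousP => x0 e e0; pose M := fine (mu B) + 1.
have B0 : 0 <= fine (mu B) by rewrite fine_ge0.
have M0 : 0 < M by rewrite ltr_pwDr.
have := @param_unif x0 (e / M); rewrite divr_gt0 // => /(_ isT).
apply: filterS => x h; rewrite -kintB //; try exact: param_kok.
apply: (@le_lt_trans _ _ (e / M * fine (mu B))).
  apply: (kint_bound_compact _ Bc) => //.
  - by apply: kokB => //; exact: param_kok.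
  - by move=> y By; rewrite !F0 ?subrr // => -[].
  - by move=> y _; rewrite ltW.
by rewrite mulrAC ltr_pdivrMr // ltr_pM2l // ltrDl.
Qed.

Lemma param_kint_supp x : ~ A x -> kint setT (F x) = 0.
Proof.
move=> Ax; rewrite -(kint_set0 (F x)); apply: (@kint_supp set0) => // y _.
by rewrite F0 // => -[].
Qed.

End Fubini.

Lemma continuous_swap (F : G -> G -> K) : continuous (fun p : G * G => F p.1 p.2 : K^o) ->
  continuous (fun p : G * G => F p.2 p.1 : K^o).
Proof.
move=> Fc p; apply: (@continuous_comp _ _ _ (fun p : G * G => (p.2, p.1)) (fun p => F p.1 p.2 : K^o)).
  by apply: cvg_pair; [exact: cvg_snd | exact: cvg_fst].
exact: Fc.
Qed.

(** Replacing dx on [A] by a finitely supported measure moves each iterated integral by at most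
    [e * a * b], by uniform continuity in the first variable; for such a measure the exchange is
    linearity of the integral in y. Borel sets of [G * G] never enter. *)
Lemma kint_fubini (F : G -> G -> K) (A B : set G) :
  continuous (fun p : G * G => F p.1 p.2 : K^o) -> compact A -> compact B ->
  (forall x y, ~ (A x /\ B y) -> F x y = 0) ->
  kint setT (fun x => kint setT (F x)) = kint setT (fun y => kint setT (fun x => F x y)).
Proof.
move=> Fc Ac Bc F0; apply/eqP; rewrite -subr_eq0 -kabs_eq0 eq_le kabs_ge0 andbT.
apply/ler_addgt0Pl => e' e'0; rewrite addr0.
pose F' y x := F x y.
have F'c : continuous (fun p : G * G => F' p.1 p.2 : K^o) by exact: continuous_swap.
have F'0 y x : ~ (B y /\ A x) -> F' y x = 0 by move=> h; apply: F0 => -[? ?]; exact: h.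
set a := fine (mu A); set b := fine (mu B).
have a0 : 0 <= a by rewrite fine_ge0.
have b0 : 0 <= b by rewrite fine_ge0.
(* The two errors add up to [2 * e * a * b]; the [+ 1] covers the case where [a * b] is 0. *)
pose e := e' / (2 * (a * b + 1)).
have d0 : 0 < 2 * (a * b + 1) by rewrite mulr_gt0 // ltr_wpDl // mulr_ge0.
have e0 : 0 < e by rewrite divr_gt0.
have mA := borel_compact Ac; have mB := borel_compact Bc.
pose O g := interior [set x | forall y, kabs (F x y - F g y) < e].
have [l [lA lO]] := @compact_finite_cover _ A O Ac
  (fun g _ => open_nbhs_nbhs (conj (@open_interior _ _) (param_unif Fc Bc F0 g e0))).
have one_ok D : measurable D -> (mu D < +oo)%E -> kok D (fun=> 1).
  have fin (c : R) : measurable D -> (mu D < +oo)%E -> mu.-integrable D (fun=> c%:E).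
    move=> mD Dfin; apply: (@measurable_bounded_integrable _ T _ mu (fun=> c)) => //.
    exists `|c|; split; first exact: num_real.
    by move=> N MN x _; exact: ltW.
  by move=> mD Dfin; split; exact: fin.
have w1 : mu.-integrable A (fun=> (1 : R)%:E).
  by have [] := one_ok A mA (mu_compact Ac); rewrite sc_re1.
have [||s [sl s1 sP]] := @kint_discretize A l O (fun=> 1) (fun=> 1) mA (fun=> @open_interior _ _) lO _ w1.
- by apply: one_ok => //; exact: mu_compact.
- by move=> x _; rewrite kabs1.
move: sP; rewrite Rintegral_cst // mul1r -/a => sP.
pose I := \sum_(p <- s) p.1 * kint setT (F p.2).
have Fok p : kok setT (F (p : K * G).2) by exact: (param_kok Fc Bc F0).
have sumF_ok : kok setT (fun y => \sum_(p <- s) p.1 * F p.2 y) by exact: kok_sum.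
have sumF : kint setT (fun y => \sum_(p <- s) p.1 * F p.2 y) = I by exact: kint_sum.
have h1 : kabs (I - kint setT (fun x => kint setT (F x))) <= e * b * a.
  rewrite (kint_supp mA); last by move=> x; exact: (param_kint_supp F0).
  have := sP (e * b) (fun x => kint setT (F x)); under eq_fun do rewrite mul1r.
  apply; first by rewrite mulr_ge0 // ltW.
    by apply: (kok_Cc mA Ac); [exact: (param_kint_continuous Fc Bc F0)|move=> x; exact: (param_kint_supp F0)].
  move=> g x _ _ /interior_subset h; rewrite -kintB //; try exact: (param_kok Fc Bc F0).
  apply: (kint_bound_compact _ Bc) => //.
  + by apply: kokB => //; exact: (param_kok Fc Bc F0).
  + by move=> y By; rewrite !F0 ?subrr // => -[].
  + by move=> y _; rewrite ltW.
have h2 : kabs (I - kint setT (fun y => kint setT (F' y))) <= e * a * b.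
  have ok2 : kok setT (fun y => kint setT (F' y)).
    apply: (kok_Cc measurableT Bc); first exact: (param_kint_continuous F'c Ac F'0).
    by move=> y; exact: (param_kint_supp F'0).
  rewrite -sumF -kintB //; apply: (kint_bound_compact _ Bc); first exact: kokB.
    move=> y By; rewrite (param_kint_supp F'0) // subr0 big1_seq // => p _.
    by rewrite F0 ?mulr0 // => -[].
  move=> y _; rewrite (kint_supp mA); last by move=> x Ax; rewrite /F' F0 // => -[].
  have := sP e (fun x => F' y x); under eq_fun do rewrite mul1r.
  apply; first by rewrite ltW.
    exact: (param_kok F'c Ac F'0).
  by move=> g x _ _ /interior_subset h; apply/ltW/h.
have -> : kint setT (fun x => kint setT (F x)) - kint setT (fun y => kint setT (fun x => F x y))
   = (I - kint setT (fun y => kint setT (F' y))) - (I - kint setT (fun x => kint setT (F x))).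
  by rewrite opprB [RHS]addrC addrA subrK.
apply: le_trans (kabsD _ _) _; rewrite kabsN (le_trans (lerD h2 h1)) //.
have -> : e * a * b + e * b * a = e' * (2 * (a * b)) / (2 * (a * b + 1)) by rewrite /e; field; rewrite gt_eqF // ltr_wpDl // mulr_ge0.
rewrite ler_pdivrMr // ler_pM2l //; lra.
Qed.

Hypothesis mu_invariant : forall (g : G) A, measurable A ->
  mu [set (g * x : G)%g | x in (A : set G)] = mu A.

Lemma mulg_cont_l (g : G) : continuous (fun x : G => g * x)%g.
Proof.
move=> x; apply: (@continuous_comp _ _ _ (fun y => (g, y)) (fun p : G * G => p.1 * p.2)%g).
  exact: (cvg_pair (cvg_cst _) cvg_id).
exact: mulg_continuous.
Qed.

Lemma mulg_cont_r (g : G) : continuous (fun x : G => x * g)%g.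
Proof.
move=> x; apply: (@continuous_comp _ _ _ (fun y => (y, g)) (fun p : G * G => p.1 * p.2)%g).
  exact: (cvg_pair cvg_id (cvg_cst _)).
exact: mulg_continuous.
Qed.

Lemma rint_translate (g : G) (h : G -> R) (B : set G) : compact B -> continuous h ->
  (forall x, ~ B x -> h x = 0) ->
  \int[mu]_x h (g * x)%g = \int[mu]_x h x.
Proof.
move=> Bc hc h0; pose phi : T -> T := fun x : G => (g * x)%g.
have mphi : measurable_fun setT phi by apply: borel_continuous_map; exact: mulg_cont_l.
rewrite /Rintegral; congr fine.
transitivity (\int[pushforward mu phi]_x (h x)%:E)%E.
  rewrite [RHS]integral_pushforward ?preimage_setT //.
    by apply/measurable_EFinP; exact: borel_continuous.
  apply: (@rintegrable_Cc (fun x => h (g * x)%g) [set (g^-1 * x : G)%g | x in B]) => //.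
  - by apply: continuous_compact => //; apply: continuous_subspaceT; exact: mulg_cont_l.
  - by move=> x; apply: continuous_comp; [exact: mulg_cont_l | exact: hc].
  - move=> x Bx; apply: h0 => Bgx; apply: Bx; exists (g * x)%g => //.
    by rewrite mulgA mulVg mul1g.
apply: eq_measure_integral => A mA _; rewrite /pushforward.
rewrite -[RHS](mu_invariant (g^-1)%g mA); congr (mu _); apply/seteqP; split=> x /=.
  by move=> Ax; exists (g * x)%g => //; rewrite mulgA mulVg mul1g.
by move=> [y Ay <-]; rewrite /phi mulgA mulgV mul1g.
Qed.

Lemma kint_translate (g : G) f (B : set G) : compact B -> continuous (f : G -> K^o) ->
  (forall x, ~ B x -> f x = 0) ->
  kint setT (fun x => f (g * x)%g) = kint setT f.
Proof.
move=> Bc fc f0; rewrite !kintE; congr (sc _ + sc_i * sc _).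
  apply: (@rint_translate g (fun x => sc_re (f x)) B) => //; first exact: continuous_sc_re.
  by move=> x /f0 ->; rewrite sc_re0.
apply: (@rint_translate g (fun x => sc_im (f x)) B) => //; first exact: continuous_sc_im.
by move=> x /f0 ->; rewrite -sc0 sc_imK.
Qed.

End ScalarIntegral.

(** * Vector-valued integrals and integrated representations *)

Section VectorIntegral.
Context (R : realType) (k : scalar_kind) (G : topGroupType).
Local Notation K := (scal R k).
Local Notation banach := (completeNormedModType K).
Local Notation T := (borelType G).
Hypothesis G_hausdorff : hausdorff_space G.
Variable mu : {measure set T -> \bar R}.
Hypothesis mu_haar : left_haar mu.
Local Notation kint := (@scal_integral R k G mu).
Local Notation Cc := (@is_Cc R k G).

Let mu_compact := haar_compact mu_haar.
Let mu_invariant := haar_invariant mu_haar.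

Lemma Cc_support (f : G -> K) : Cc f ->
  exists2 B : set G, compact B & forall x, ~ B x -> f x = 0.
Proof.
move=> [_ fc]; exists (closure [set g | f g != 0]) => // x h.
by apply/eqP; apply: contra_notT h => fx; exact: subset_closure.
Qed.

Lemma Cc_of_support (f : G -> K) (B : set G) : continuous (f : G -> K^o) ->
  compact B -> (forall x, ~ B x -> f x = 0) -> Cc f.
Proof.
move=> fc Bc f0; split=> //; have Bcl : closed B by exact: compact_closed.
apply: (subclosed_compact _ Bc); first exact: closed_closure.
have BB : B = closure B by exact/closure_id.
rewrite [X in _ `<=` X]BB; apply: closure_subset => x /= /eqP fx.
by apply: contrapT => /f0.
Qed.

Lemma Cc_kok A (f : G -> K) : measurable A -> Cc f -> kok mu A f.
Proof.
move=> mA fC; have [B Bc f0] := Cc_support fC.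
exact: (kok_Cc G_hausdorff mu_compact mA Bc fC.1 f0).
Qed.

Lemma continuous_mulK (X : topologicalType) (f g : X -> K) :
  continuous (f : X -> K^o) -> continuous (g : X -> K^o) ->
  continuous (fun x => f x * g x : K^o).
Proof. by move=> fc gc x; apply: (@cvgZ K K^o); [exact: fc | exact: gc]. Qed.

Lemma Cc_mul (f g : G -> K) : Cc f -> continuous (g : G -> K^o) -> Cc (fun x => f x * g x).
Proof.
move=> fC gc; have [B Bc f0] := Cc_support fC.
apply: (Cc_of_support _ Bc); first exact: continuous_mulK fC.1 gc.
by move=> x /f0 ->; rewrite mul0r.
Qed.

Lemma Cc_add (f g : G -> K) : Cc f -> Cc g -> Cc (fun x => f x + g x).
Proof.
move=> fC gC; have [B Bc f0] := Cc_support fC; have [D Dc g0] := Cc_support gC.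
apply: (@Cc_of_support _ (B `|` D)).
- by move=> x; apply: (@cvgD K K^o); [exact: fC.1 | exact: gC.1].
- exact: compactU.
- by move=> x /not_orP[/f0 -> /g0 ->]; rewrite addr0.
Qed.

Lemma Cc_scale (c : K) (f : G -> K) : Cc f -> Cc (fun x => c * f x).
Proof.
move=> fC; have [B Bc f0] := Cc_support fC.
apply: (Cc_of_support _ Bc); last by move=> x /f0 ->; rewrite mulr0.
by apply: continuous_mulK fC.1 => x; exact: cvg_cst.
Qed.

Lemma Cc_sub (f g : G -> K) : Cc f -> Cc g -> Cc (f \- g).
Proof.
move=> fC gC; have := Cc_add fC (Cc_scale (-1) gC).
by under eq_fun do rewrite mulN1r.
Qed.

Lemma continuous_fun_comp (X Y Z : topologicalType) (f : X -> Y) (g : Y -> Z) :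
  continuous f -> continuous g -> continuous (fun x => g (f x)).
Proof. by move=> fc gc x; apply: continuous_comp; [exact: fc | exact: gc]. Qed.

Lemma Cc_translate (g : G) (f : G -> K) : Cc f -> Cc (fun x => f (g * x)%g).
Proof.
move=> fC; have [B Bc f0] := Cc_support fC.
apply: (@Cc_of_support _ [set (g^-1 * x : G)%g | x in B]).
- exact: (continuous_fun_comp (@mulg_cont_l G g) fC.1).
- by apply: continuous_compact => //; apply: continuous_subspaceT; exact: mulg_cont_l.
- move=> x Bx; apply: f0 => Bgx; apply: Bx; exists (g * x)%g => //.
  by rewrite mulgA mulVg mul1g.
Qed.

Lemma kint_translate_Cc (g : G) (f : G -> K) : Cc f ->
  kint setT (fun x => f (g * x)%g) = kint setT f.
Proof.
move=> fC; have [B Bc f0] := Cc_support fC.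
exact: (kint_translate G_hausdorff mu_compact mu_invariant g Bc fC.1 f0).
Qed.

(** * Weak (Pettis) integrals with values in a Banach space *)

Section Banach.
Variable E : banach.

Definition is_vint (F : G -> E) (y : E) :=
  forall phi : {linear E -> K^o}, continuous phi ->
    phi y = kint setT (fun g => phi (F g)).

Lemma functional_Cc (F : G -> E) (B : set G) (phi : {linear E -> K^o}) :
  continuous F -> compact B -> (forall x, ~ B x -> F x = 0) -> continuous phi ->
  Cc (fun x => phi (F x)).
Proof.
move=> Fc Bc F0 phic; apply: (Cc_of_support _ Bc).
  exact: (continuous_fun_comp Fc phic).
by move=> x /F0 ->; rewrite linear0.
Qed.

(** [y n] is a Riemann sum over a cover on whose cells [F] varies by less than [e n]. Against a
    functional of norm [M] its error is at most [M * e n * b], uniformly in the functional, so by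
    [hahn_banach_le] the sums are Cauchy in norm; their limit is the integral. *)
Lemma vint_exists (F : G -> E) (B : set G) : continuous F -> compact B ->
  (forall x, ~ B x -> F x = 0) -> exists y, is_vint F y.
Proof.
move=> Fc Bc F0; have mB := borel_compact G_hausdorff Bc.
have Bfin := mu_compact Bc.
set b := fine (mu B); have b0 : 0 <= b by rewrite fine_ge0.
pose e n : R := n.+1%:R^-1; have e0 n : 0 < e n by rewrite invr_gt0.
have cst_int (c : R) : mu.-integrable B (fun=> c%:E).
  apply: (@measurable_bounded_integrable _ T _ mu (fun=> c)) => //.
  exists `|c|; split; first exact: num_real.
  by move=> N MN x _; exact: ltW.
have one_ok : kok mu B (fun=> 1 : K) by split; exact: cst_int.
have /choice [y yP] n : exists y, forall (phi : {linear E -> K^o}) M, continuous phi ->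
    0 <= M -> (forall x, nrm (phi x) <= M * nrm x) ->
    kabs (phi y - kint setT (fun g => phi (F g))) <= M * e n * b.
  pose O g := interior [set x | nrm (F x - F g) < e n].
  have [l [lB lO]] := @compact_finite_cover _ B O Bc
    (fun g _ => open_nbhs_nbhs (conj (@open_interior _ _) ((nrm_continuousP F).1 Fc g _ (e0 n)))).
  have [||s [sl s1 sP]] := @kint_discretize R k G mu B l O (fun=> 1) (fun=> 1) mB
    (fun=> @open_interior _ _) lO one_ok _; [exact: cst_int | by move=> x _; rewrite kabs1 |].
  exists (\sum_(p <- s) p.1 *: F p.2) => phi M phic M0 phiM.
  have phiC := functional_Cc Fc Bc F0 phic.
  rewrite (kint_supp mu mB); last by move=> x /F0 ->; rewrite linear0.
  have := sP (M * e n) (fun x => phi (F x)).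
  rewrite Rintegral_cst // mul1r -/b; under eq_fun do rewrite mul1r.
  have -> : phi (\sum_(p <- s) p.1 *: F p.2) = \sum_(p <- s) p.1 * phi (F p.2).
    by rewrite linear_sum; apply: eq_bigr => p _; rewrite linearZ.
  apply; [by rewrite mulr_ge0 // ltW | exact: Cc_kok |].
  move=> g x _ _ /interior_subset h; rewrite -linearB.
  rewrite -[leLHS]/(nrm (phi _)) (le_trans (phiM _)) // ler_wpM2l //.
  exact: ltW h.
have [|z yz] := @complete_seq R k E y.
  move=> r r0; pose n0 := Num.truncn (2 * (b + 1) / r); exists n0 => m n mn0 nn0.
  have en m' : (n0 <= m')%N -> e m' * b <= r / 2.
    move=> h; have : e m' <= r / (2 * (b + 1)).
      rewrite invf_ple ?posrE ?divr_gt0 ?mulr_gt0 ?ltr_wpDl // invf_div.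
      by rewrite (le_trans (ltW (truncnS_gt _))) // ler_nat.
    rewrite ler_pdivlMr ?mulr_gt0 ?ltr_wpDl //.
    have -> : e m' * (2 * (b + 1)) = 2 * (e m' * b) + 2 * e m' by ring.
    by have := e0 m'; lra.
  apply: hahn_banach_le => phi phic phi1.
  have phi1' x : nrm (phi x) <= 1 * nrm x by rewrite mul1r; exact: phi1.
  have h1 := yP m phi 1 phic ler01 phi1'; have h2 := yP n phi 1 phic ler01 phi1'.
  rewrite linearB -(subrKA (kint setT (fun g => phi (F g)))).
  rewrite (le_trans (kabsD _ _)) //; move: h1 h2; rewrite !mul1r.
  rewrite -[in kabs (_ - phi (y n))]opprB kabsN => h1 h2.
  have := en m mn0; have := en n nn0; lra.
exists z => phi phic; have [M M0 phiM] := lin_bounded phic.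
apply/eqP; rewrite -subr_eq0 -kabs_eq0 eq_le kabs_ge0 andbT.
apply/ler_addgt0Pl => r r0; rewrite addr0.
have /nrm_cvgP yz' := yz.
have d0 : 0 < r / (2 * M) by rewrite divr_gt0 ?mulr_gt0.
have [n1 _ n1P] := yz' _ d0.
pose n := maxn n1 (Num.truncn (2 * M * (b + 1) / r)).
have := n1P n (leq_maxl _ _); rewrite /= => yn.
have := yP n phi M phic (ltW M0) phiM.
have h3 : M * e n * b <= r / 2.
  have : e n <= r / (2 * M * (b + 1)).
    rewrite invf_ple ?posrE ?divr_gt0 ?mulr_gt0 ?ltr_wpDl // invf_div.
    by rewrite (le_trans (ltW (truncnS_gt _))) // ler_nat ltnS leq_maxr.
  rewrite ler_pdivlMr ?mulr_gt0 ?ltr_wpDl // => h.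
  have : 0 <= M * e n by rewrite mulr_ge0 // ltW.
  have eE : e n * (2 * M * (b + 1)) = 2 * (M * e n * b) + 2 * (M * e n) by ring.
  by rewrite eE in h; lra.
move=> h4; have h5 : kabs (phi z - phi (y n)) <= r / 2.
  rewrite -linearB -[leLHS]/(nrm (phi _)) (le_trans (phiM _)) // nrmBC.
  have : M * nrm (y n - z) <= M * (r / (2 * M)) by rewrite ler_wpM2l // ltW.
  have -> : M * (r / (2 * M)) = r / 2 by field; rewrite gt_eqF.
  by [].
rewrite -(subrKA (phi (y n))) (le_trans (kabsD _ _)) //; move: h3 h4 h5; lra.
Qed.

Lemma vint_unique (F : G -> E) y z : is_vint F y -> is_vint F z -> y = z.
Proof. by move=> yP zP; apply: functionals_separate => phi phic; rewrite yP // zP. Qed.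

Lemma vint_bound (F : G -> E) (B : set G) (w : G -> R) y : continuous F -> compact B ->
  (forall x, ~ B x -> F x = 0) -> mu.-integrable setT (fun x => (w x)%:E) ->
  (forall x, nrm (F x) <= w x) -> is_vint F y -> nrm y <= \int[mu]_x w x.
Proof.
move=> Fc Bc F0 wi Fw yP; apply: hahn_banach_le => phi phic phi1.
rewrite yP //; apply: kint_bound => //; first exact/Cc_kok/(functional_Cc Fc Bc F0 phic).
by move=> x _; rewrite (le_trans (phi1 _)).
Qed.

End Banach.

(** Exchange of the two integrals, followed by the left translation x := y x in the inner one. With
    [c] constant it computes the total mass of a convolution, with [c] a coefficient it shows that
    pi(a * b) is pi(a) pi(b). *)
Lemma convolution_formula (a b c : G -> K) : Cc a -> Cc b -> continuous (c : G -> K^o) ->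
  kint setT (fun x => convolution mu a b x * c x) =
  kint setT (fun y => a y * kint setT (fun x => b x * c (y * x)%g)).
Proof.
move=> aC bC cc; have [A Ac a0] := Cc_support aC; have [B Bc b0] := Cc_support bC.
pose D := [set (p.1 * p.2)%g | p in A `*` B].
have Dc : compact D.
  apply: continuous_compact; last exact: compact_setX.
  exact/continuous_subspaceT/mulg_continuous.
pose F x y := a y * (b (y^-1 * x)%g * c x).
have F0 x y : ~ (D x /\ A y) -> F x y = 0.
  move=> h; have [Ay|Ay] := pselect (A y); last by rewrite /F a0 ?mul0r.
  rewrite /F b0 ?mul0r ?mulr0 // => Byx; apply: h; split=> //.
  by exists (y, (y^-1 * x)%g) => //=; rewrite mulgA mulgV mul1g.
have Fc : continuous (fun p : G * G => F p.1 p.2 : K^o).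
  apply: continuous_mulK; first exact: (continuous_fun_comp (fun p => cvg_snd) aC.1).
  apply: continuous_mulK; last exact: (continuous_fun_comp (fun p => cvg_fst) cc).
  apply: (@continuous_fun_comp (G * G)%type G K^o (fun p => (p.2^-1 * p.1)%g)); last exact: bC.1.
  apply: (@continuous_fun_comp (G * G)%type (G * G)%type G (fun p => (p.2^-1, p.1)%g) (fun p => p.1 * p.2)%g); last exact: mulg_continuous.
  move=> p; apply: cvg_pair; last exact: cvg_fst.
  exact: (continuous_fun_comp (fun p => cvg_snd) (@invg_continuous G)).
have := kint_fubini G_hausdorff mu_compact Fc Dc Ac F0.
have -> : kint setT (fun x => kint setT (F x)) = kint setT (fun x => convolution mu a b x * c x).
  apply: kint_ext => x _; rewrite mulrC -kintZ //.
    by apply: kint_ext => y _; rewrite /F mulrA mulrC.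
  apply: Cc_kok => //; apply: (Cc_mul aC).
  apply: (@continuous_fun_comp G G K^o (fun y => (y^-1 * x)%g)); last exact: bC.1.
  exact: (continuous_fun_comp (@invg_continuous G) (@mulg_cont_r G x)).
move=> ->; apply: kint_ext => y _.
have byC : Cc (fun x => b (y^-1 * x)%g * c x) by apply: Cc_mul => //; exact: Cc_translate.
rewrite -[in RHS](kint_translate_Cc (y : G)^-1%g); last first.
  apply: Cc_mul => //; exact: (continuous_fun_comp (@mulg_cont_l G y) cc).
rewrite kintZ //; last exact: Cc_kok.
by congr (_ * _); apply: kint_ext => x _; rewrite mulgA mulgV mul1g.
Qed.

Lemma kint_convolution (a b : G -> K) : Cc a -> Cc b ->
  kint setT (convolution mu a b) = kint setT a * kint setT b.
Proof.
move=> aC bC; have := convolution_formula aC bC (fun x => cvg_cst (1 : K^o)).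
have -> : kint setT (fun x => convolution mu a b x * 1) = kint setT (convolution mu a b).
  by apply: kint_ext => x _; rewrite mulr1.
move=> ->; rewrite mulrC -kintZ //; last exact: Cc_kok.
apply: kint_ext => y _; rewrite mulrC; congr (_ * _).
by apply: kint_ext => x _; rewrite mulr1.
Qed.

Lemma Cc_convolution (a b : G -> K) : Cc a -> Cc b -> Cc (convolution mu a b).
Proof.
move=> aC bC; have [A Ac a0] := Cc_support aC; have [B Bc b0] := Cc_support bC.
pose D := [set (p.1 * p.2)%g | p in A `*` B].
have Dc : compact D.
  apply: continuous_compact; last exact: compact_setX.
  exact/continuous_subspaceT/mulg_continuous.
pose F x y := a y * b (y^-1 * x)%g.
have F0 x y : ~ (D x /\ A y) -> F x y = 0.
  move=> h; have [Ay|Ay] := pselect (A y); last by rewrite /F a0 ?mul0r.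
  rewrite /F b0 ?mulr0 // => Byx; apply: h; split=> //.
  by exists (y, (y^-1 * x)%g) => //=; rewrite mulgA mulgV mul1g.
have Fc : continuous (fun p : G * G => F p.1 p.2 : K^o).
  apply: continuous_mulK; first exact: (continuous_fun_comp (fun p => cvg_snd) aC.1).
  apply: (@continuous_fun_comp (G * G)%type G K^o (fun p => (p.2^-1 * p.1)%g)); last exact: bC.1.
  apply: (@continuous_fun_comp (G * G)%type (G * G)%type G (fun p => (p.2^-1, p.1)%g) (fun p => p.1 * p.2)%g); last exact: mulg_continuous.
  move=> p; apply: cvg_pair; last exact: cvg_fst.
  exact: (continuous_fun_comp (fun p => cvg_snd) (@invg_continuous G)).
apply: (Cc_of_support _ Dc).
  exact: (param_kint_continuous G_hausdorff mu_compact Fc Ac F0).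
by move=> x; exact: (param_kint_supp mu F0).
Qed.

(** * Integrated representations *)

Section Representation.
Variables (E : banach) (pi : G -> {linear E -> E}).
Hypothesis pi_rep : is_representation pi.
Local Notation irep := (@is_rep_integral R k G mu E pi).
Implicit Types (f : G -> K) (x y : E).

(** The vector pi(f) x. The default 0 is not reached for [f] in C_c, where [rintP] provides a value
    and [rint_unique] its uniqueness. *)
Definition rint f x : E := xget 0 [set y | irep f x y].

Lemma rep_orbit_continuous x : continuous (fun g => pi g x).
Proof. exact: rep_strongly_continuous. Qed.

Lemma irep_vint f x y : irep f x y <-> is_vint (fun g => f g *: pi g x) y.
Proof.
by split=> h phi phic; rewrite h //; apply: kint_ext => g _; rewrite linearZ.
Qed.

Lemma rep_integrand_continuous f x v : Cc f -> continuous (fun g => f g *: (pi g x - v)).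
Proof.
move=> fC g; apply: cvgZ; first exact: fC.1.
by apply: cvgB; [exact: rep_orbit_continuous | exact: cvg_cst].
Qed.

Lemma rep_integrand_continuous0 f x : Cc f -> continuous (fun g => f g *: pi g x).
Proof.
move=> /(@rep_integrand_continuous f x 0).
by under eq_fun do rewrite subr0.
Qed.

Lemma rintP f x : Cc f -> irep f x (rint f x).
Proof.
move=> fC; have [B Bc f0] := Cc_support fC.
have [|||y yP] := @vint_exists E (fun g => f g *: pi g x) B => //.
- exact: rep_integrand_continuous0.
- by move=> g /f0 ->; rewrite scale0r.
by rewrite /rint; apply: (xgetPex 0 (P := [set y | irep f x y])); exists y; exact/irep_vint.
Qed.

Lemma rint_unique f x y z : irep f x y -> irep f x z -> y = z.
Proof. by move=> /irep_vint h1 /irep_vint h2; exact: vint_unique h1 h2. Qed.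

Lemma rint_eq f x y : Cc f -> irep f x y -> rint f x = y.
Proof. by move=> fC; apply: rint_unique; exact: rintP. Qed.

Lemma functional_orbit_continuous (phi : {linear E -> K^o}) x :
  continuous phi -> continuous (fun g => phi (pi g x) : K^o).
Proof. by move=> phic; exact: (continuous_fun_comp (@rep_orbit_continuous x) phic). Qed.

Lemma integrand_Cc f (phi : {linear E -> K^o}) x : Cc f -> continuous phi ->
  Cc (fun g => f g * phi (pi g x)).
Proof. by move=> fC phic; apply: Cc_mul => //; exact: functional_orbit_continuous. Qed.

Lemma rint_linear f (a : K) x y : Cc f -> rint f (a *: x + y) = a *: rint f x + rint f y.
Proof.
move=> fC; apply: rint_eq => // phi phic.
rewrite linearP /= (rintP x fC) // (rintP y fC) //.
rewrite -[_ *: _]/(a * _) -kintZ //; last exact/Cc_kok/integrand_Cc.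
rewrite -kintD //; last exact/Cc_kok/integrand_Cc.
  by apply: kint_ext => g _; rewrite !linearP /= -[_ *: _]/(a * _); ring.
by apply: kokZ => //; exact/Cc_kok/integrand_Cc.
Qed.

Lemma rintBr f x y : Cc f -> rint f (x - y) = rint f x - rint f y.
Proof.
by move=> fC; have := rint_linear (-1) y x fC; rewrite !scaleN1r addrC => ->; rewrite addrC.
Qed.

Lemma rintZr f (a : K) x : Cc f -> rint f (a *: x) = a *: rint f x.
Proof.
move=> fC; have r0 : rint f 0 = 0 by have := rintBr 0 0 fC; rewrite !subrr.
by have := rint_linear a x 0 fC; rewrite !addr0 r0 addr0.
Qed.

Lemma rintB f g x : Cc f -> Cc g -> rint (f \- g) x = rint f x - rint g x.
Proof.
move=> fC gC; apply: rint_eq => [|phi phic]; first exact: Cc_sub.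
rewrite linearB (rintP x fC) // (rintP x gC) // -kintB //; try exact/Cc_kok/integrand_Cc.
by apply: kint_ext => h _ /=; rewrite mulrBl.
Qed.

Lemma rintD f g x : Cc f -> Cc g -> rint (fun h => f h + g h) x = rint f x + rint g x.
Proof.
move=> fC gC; apply: rint_eq => [|phi phic]; first exact: Cc_add.
rewrite linearD (rintP x fC) // (rintP x gC) // -kintD //; try exact/Cc_kok/integrand_Cc.
by apply: kint_ext => h _ /=; rewrite mulrDl.
Qed.

Lemma rintZ (c : K) f x : Cc f -> rint (fun h => c * f h) x = c *: rint f x.
Proof.
move=> fC; apply: rint_eq => [|phi phic]; first exact: Cc_scale.
rewrite linearZ /= (rintP x fC) // -[_ *: _]/(c * _) -kintZ //; last exact/Cc_kok/integrand_Cc.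
by apply: kint_ext => h _; rewrite mulrA.
Qed.

(** As [f] has integral 1, pi(f) x - v is the integral of [f g *: (pi g x - v)]. All displacement
    estimates for averages go through this form, in which the norm of [x] does not appear. *)
Lemma rint_sub_bound f x v (w : G -> R) : Cc f -> kint setT f = 1 ->
  mu.-integrable setT (fun g => (w g)%:E) ->
  (forall g, kabs (f g) * nrm (pi g x - v) <= w g) ->
  nrm (rint f x - v) <= \int[mu]_g w g.
Proof.
move=> fC f1 wi fw; have [B Bc f0] := Cc_support fC.
apply: (@vint_bound E (fun g => f g *: (pi g x - v)) B) => //.
- exact: rep_integrand_continuous.
- by move=> g /f0 ->; rewrite scale0r.
- by move=> g; rewrite nrmZ.
move=> phi phic; rewrite linearB (rintP x fC) //.
rewrite -[phi v]mulr1 -f1 -kintZ //; last exact: Cc_kok.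
rewrite -kintB //; [|exact/Cc_kok/integrand_Cc|exact/Cc_kok/Cc_scale].
apply: kint_ext => g _; transitivity (f g * (phi (pi g x) - phi v)); first by ring.
by rewrite linearZ linearB.
Qed.

Lemma rint_bound f x (w : G -> R) : Cc f ->
  mu.-integrable setT (fun g => (w g)%:E) ->
  (forall g, kabs (f g) * nrm (pi g x) <= w g) ->
  nrm (rint f x) <= \int[mu]_g w g.
Proof.
move=> fC wi fw; have [B Bc f0] := Cc_support fC.
apply: (@vint_bound E (fun g => f g *: pi g x) B) => //.
- exact: rep_integrand_continuous0.
- by move=> g /f0 ->; rewrite scale0r.
- by move=> g; rewrite nrmZ.
- exact/irep_vint/rintP.
Qed.

Lemma kabs_integrable f : Cc f -> mu.-integrable setT (fun g => (kabs (f g))%:E).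
Proof.
move=> fC; have [B Bc f0] := Cc_support fC.
apply: (@rintegrable_Cc R G G_hausdorff mu mu_compact _ B) => //.
  move=> x; apply/cvgrPdist_lt => e e0.
  have /kabs_continuousP fc := fC.1; apply: filterS (fc x e e0) => y.
  by apply: le_lt_trans; rewrite distrC; exact: (@nrm_lip R k K^o).
by move=> x /f0 ->; rewrite kabs0.
Qed.

Lemma rint_near f x v L : Cc f -> kint setT f = 1 ->
  (forall g, f g != 0 -> nrm (pi g x - v) <= L) ->
  nrm (rint f x - v) <= L * \int[mu]_g kabs (f g).
Proof.
move=> fC f1 fL; rewrite -RintegralZl //; last exact: kabs_integrable.
apply: rint_sub_bound => //.
  apply: (integrable_ext _ (integrableZl measurableT L (kabs_integrable fC))) => g.
  by rewrite EFinM.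
move=> g; have [->|fg] := eqVneq (f g) 0; first by rewrite kabs0 mul0r mulr0.
by rewrite mulrC ler_wpM2r ?kabs_ge0 ?fL.
Qed.

Lemma rint_bounded f x L : Cc f -> (forall g, f g != 0 -> nrm (pi g x) <= L) ->
  nrm (rint f x) <= L * \int[mu]_g kabs (f g).
Proof.
move=> fC fL; rewrite -RintegralZl //; last exact: kabs_integrable.
apply: rint_bound => //.
  apply: (integrable_ext _ (integrableZl measurableT L (kabs_integrable fC))) => g.
  by rewrite EFinM.
move=> g; have [->|fg] := eqVneq (f g) 0; first by rewrite kabs0 mul0r mulr0.
by rewrite mulrC ler_wpM2r ?kabs_ge0 ?fL.
Qed.

Lemma rint_invariant f x : Cc f -> kint setT f = 1 -> (forall g, pi g x = x) ->
  rint f x = x.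
Proof.
move=> fC f1 px; apply/eqP; rewrite -subr_eq0; apply/eqP/nrm_eq0/eqP.
rewrite eq_le nrm_ge0 andbT; have := @rint_near f x x 0 fC f1.
by rewrite mul0r; apply => g _; rewrite px subrr nrm0.
Qed.

Lemma rint_translate_fun f g x : Cc f ->
  pi g (rint f x) = rint (fun h => f (g^-1 * h)%g) x.
Proof.
move=> fC; apply/esym/rint_eq => [|phi phic]; first exact: Cc_translate.
have pgc : continuous (phi \o pi g).
  by move=> v; apply: continuous_comp; [exact: rep_bounded | exact: phic].
have := rintP x fC (phi := (phi \o pi g : {linear E -> K^o})) pgc => /= ->.
rewrite -(kint_translate_Cc g^-1%g) ?integrand_Cc //; last exact: (integrand_Cc x fC pgc).
apply: kint_ext => h _; rewrite -(repM pi_rep) mulgA mulgV mul1g //.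
Qed.

Lemma rint_convolution a b x : Cc a -> Cc b ->
  rint (convolution mu a b) x = rint a (rint b x).
Proof.
move=> aC bC; apply: rint_eq => [|phi phic]; first exact: Cc_convolution.
rewrite (rintP _ aC) // convolution_formula //; last exact: functional_orbit_continuous.
apply: kint_ext => y _; congr (_ * _).
have pyc : continuous (phi \o pi y).
  by move=> v; apply: continuous_comp; [exact: rep_bounded | exact: phic].
have := rintP x bC (phi := (phi \o pi y : {linear E -> K^o})) pyc => /= ->.
by apply: kint_ext => z _; rewrite (repM pi_rep).
Qed.

End Representation.

End VectorIntegral.

(** * Kazhdan projections and contractions *)

Lemma half_pow_small (R : realType) (C e : R) : 0 < e ->
  exists n0, forall n, (n0 <= n)%N -> C * 2^-1 ^+ n <= e.
Proof.
move=> e0; exists (Num.truncn (`|C| / e)) => n n0n.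
have Cn : `|C| / e <= n.+1%:R.
  by rewrite (le_trans (ltW (truncnS_gt _))) // ler_nat ltnS.
have n2 : n.+1%:R <= 2 ^+ n :> R.
  by rewrite -natrX ler_nat ltn_expl.
rewrite (le_trans (ler_wpM2r _ (ler_norm C))) ?exprn_ge0 ?invr_ge0 //.
rewrite exprVn ler_pdivrMr ?exprn_gt0 // mulrC.
by rewrite -ler_pdivrMr // (le_trans Cn).
Qed.

Section FNorm.
Context (R : realType) (k : scalar_kind) (G : topGroupType).
Local Notation K := (scal R k).
Local Notation banach := (completeNormedModType K).
Local Notation T := (borelType G).
Hypothesis G_hausdorff : hausdorff_space G.
Variable mu : {measure set T -> \bar R}.
Hypothesis mu_haar : left_haar mu.
Local Notation kint := (@scal_integral R k G mu).
Local Notation Cc := (@is_Cc R k G).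

Variable F : rep_family R k G.
Variable m : G -> R.
Hypothesis F_rep : forall (E : banach) (pi : G -> {linear E -> E}), F pi ->
  is_representation pi.
Hypothesis F_growth : forall (E : banach) (pi : G -> {linear E -> E}), F pi ->
  forall g x, nrm (pi g x) <= expR (m g) * nrm x.
Hypothesis m_bounded : forall B : set G, compact B -> exists M, forall g, B g -> m g <= M.

Local Notation Fn := (F_norm mu F).
Local Notation rint := (rint mu).
Let Cc_sub := @Cc_sub R k G G_hausdorff.
Let rintP := @rintP R k G G_hausdorff mu mu_haar.
Let rint_eq := @rint_eq R k G G_hausdorff mu mu_haar.
Let rintZr := @rintZr R k G G_hausdorff mu mu_haar.
Let rintB := @rintB R k G G_hausdorff mu mu_haar.

Lemma F_norm_ge0 f : (0 <= Fn f)%E.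
Proof. by apply: ereal_sup_ubound; left. Qed.

Lemma F_norm_le f r : Cc f -> 0 <= r ->
  (forall (E : banach) (pi : G -> {linear E -> E}) x, F pi ->
     nrm (rint pi f x) <= r * nrm x) -> (Fn f <= r%:E)%E.
Proof.
move=> fC r0 h; apply: ge_ereal_sup => ? [->|]; first by rewrite lee_fin.
move=> [E [pi [x [y [Fpi x1 xy ->]]]]]; rewrite lee_fin.
rewrite -(rint_eq (F_rep Fpi) fC xy) (le_trans (h _ _ _ Fpi)) //.
by rewrite ler_piMr.
Qed.

Lemma nrm_rint_le f r (E : banach) (pi : G -> {linear E -> E}) x : Cc f -> F pi ->
  (Fn f <= r%:E)%E -> nrm (rint pi f x) <= r * nrm x.
Proof.
move=> fC Fpi fr; have pr := F_rep Fpi; have [->|x0] := pselect (x = 0).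
  by have := rintZr pr 0 0 fC; rewrite !scale0r => ->; rewrite nrm0 mulr0.
have nx := nrm_ge0_gt0 x0.
pose a : K := sc (nrm x)^-1.
have na : kabs a = (nrm x)^-1 by rewrite kabs_sc ger0_norm // invr_ge0 ltW.
have : ((nrm (rint pi f (a *: x)))%:E <= Fn f)%E.
  apply: ereal_sup_ubound; right.
  exists E, pi, (a *: x), (rint pi f (a *: x)); split=> //.
    by rewrite nrmZ na mulVf // gt_eqF.
  exact: rintP.
move=> /le_trans /(_ fr); rewrite lee_fin (rintZr pr) // nrmZ na.
by rewrite ler_pdivrMl // mulrC.
Qed.

(** The exponent [m] is bounded on the compact support, so a multiple of the L1 norm bounds all the
    operators pi(f) at once. *)
Lemma F_norm_finite f : Cc f -> exists2 r, 0 <= r & (Fn f <= r%:E)%E.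
Proof.
move=> fC; have [B Bc f0] := Cc_support fC; have [M BM] := m_bounded Bc.
have i0 : 0 <= \int[mu]_g kabs (f g) by apply: Rintegral_ge0 => g _; exact: kabs_ge0.
exists (expR M * \int[mu]_g kabs (f g)); first by rewrite mulr_ge0 ?expR_ge0.
apply: F_norm_le => //; first by rewrite mulr_ge0 ?expR_ge0.
move=> E pi x Fpi; rewrite mulrAC.
apply: (rint_bounded G_hausdorff mu_haar (F_rep Fpi)) => // g fg.
rewrite (le_trans (F_growth Fpi _ _)) // ler_wpM2r ?nrm_ge0 // ler_expR BM //.
by apply: contrapT => /f0 fg0; rewrite fg0 eqxx in fg.
Qed.

Definition fnorm f : R := fine (Fn f).

Lemma fnormE f : Cc f -> Fn f = (fnorm f)%:E.
Proof.
move=> /F_norm_finite [r r0 fr]; rewrite fineK // ge0_fin_numE ?F_norm_ge0 //.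
by rewrite (le_lt_trans fr) // ltry.
Qed.

Lemma fnorm_ge0 f : 0 <= fnorm f.
Proof. by rewrite fine_ge0 // F_norm_ge0. Qed.

Lemma fnorm_le f r : Cc f -> 0 <= r ->
  (forall (E : banach) (pi : G -> {linear E -> E}) x, F pi ->
     nrm (rint pi f x) <= r * nrm x) -> fnorm f <= r.
Proof. by move=> fC r0 h; rewrite -lee_fin -fnormE //; exact: F_norm_le. Qed.

Lemma le_fnorm f (E : banach) (pi : G -> {linear E -> E}) x : Cc f -> F pi ->
  nrm (rint pi f x) <= fnorm f * nrm x.
Proof. by move=> fC Fpi; apply: nrm_rint_le => //; rewrite fnormE. Qed.

Lemma fnorm_triangle f g h : Cc f -> Cc g -> Cc h ->
  fnorm (f \- h) <= fnorm (f \- g) + fnorm (g \- h).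
Proof.
move=> fC gC hC; apply: fnorm_le; [exact: Cc_sub | by rewrite addr_ge0 ?fnorm_ge0 |].
move=> E pi x Fpi; have pr := F_rep Fpi.
rewrite rintB // (le_trans (nrm_triangle _ (rint pi g x) _)) // mulrDl -!rintB //.
by rewrite lerD // le_fnorm //; exact: Cc_sub.
Qed.

Lemma fnormC f g : Cc f -> Cc g -> fnorm (f \- g) = fnorm (g \- f).
Proof.
have h f1 g1 : Cc f1 -> Cc g1 -> fnorm (f1 \- g1) <= fnorm (g1 \- f1).
  move=> fC gC; apply: fnorm_le; [exact: Cc_sub | exact: fnorm_ge0 |].
  move=> E pi x Fpi; have pr := F_rep Fpi.
  by rewrite rintB // nrmBC -rintB // le_fnorm //; exact: Cc_sub.
by move=> fC gC; apply/eqP; rewrite eq_le !h.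
Qed.

Lemma fnorm_lip f g : Cc f -> Cc g -> `|fnorm f - fnorm g| <= fnorm (f \- g).
Proof.
have h f1 g1 : Cc f1 -> Cc g1 -> fnorm f1 <= fnorm (f1 \- g1) + fnorm g1.
  move=> fC gC; apply: fnorm_le => //; first by rewrite addr_ge0 ?fnorm_ge0.
  move=> E pi x Fpi; have pr := F_rep Fpi.
  rewrite -[rint pi f1 x](subrK (rint pi g1 x)) (le_trans (nrmD _ _)) // mulrDl.
  by rewrite lerD ?le_fnorm // -rintB // le_fnorm //; exact: Cc_sub.
move=> fC gC; have := h f g fC gC; have := h g f gC fC; rewrite (fnormC gC fC) => h1 h2.
by rewrite ler_norml; apply/andP; split; lra.
Qed.

Lemma fnorm_convolution_sub a b a' b' : Cc a -> Cc b -> Cc a' -> Cc b' ->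
  fnorm (convolution mu a b \- convolution mu a' b') <=
  fnorm a * fnorm (b \- b') + fnorm (a \- a') * fnorm b'.
Proof.
move=> aC bC a'C b'C; have cC := @Cc_convolution R k G G_hausdorff mu mu_haar.
apply: fnorm_le.
- by apply: Cc_sub; exact: cC.
- by rewrite addr_ge0 // mulr_ge0 ?fnorm_ge0.
move=> E pi x Fpi; have pr := F_rep Fpi.
rewrite rintB ?(rint_convolution G_hausdorff mu_haar) //; try exact: cC.
rewrite (le_trans (nrm_triangle _ (rint pi a (rint pi b' x)) _)) // mulrDl lerD //.
  rewrite -(rintBr G_hausdorff mu_haar) // -rintB // (le_trans (le_fnorm _ aC Fpi)) //.
  by rewrite -mulrA ler_wpM2l ?fnorm_ge0 // le_fnorm //; exact: Cc_sub.
rewrite -rintB // (le_trans (le_fnorm _ _ Fpi)) //; first exact: Cc_sub.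
by rewrite -mulrA ler_wpM2l ?fnorm_ge0 // le_fnorm.
Qed.

Definition fcauchy (u : nat -> G -> K) := (forall n, Cc (u n)) /\
  forall e : R, 0 < e -> exists n0, forall i j, (n0 <= i)%N -> (n0 <= j)%N ->
    fnorm (u i \- u j) <= e.

Definition fequiv (u v : nat -> G -> K) :=
  forall e : R, 0 < e -> exists n0, forall n, (n0 <= n)%N -> fnorm (u n \- v n) <= e.

Lemma is_cauchyE u : is_cauchy mu F u <-> fcauchy u.
Proof.
by split=> -[uC h]; split=> // e /h [n0 n0P]; exists n0 => i j ni nj;
  have := n0P i j ni nj; rewrite fnormE ?lee_fin //; exact: Cc_sub.
Qed.

Lemma seq_equivE u v : (forall n, Cc (u n)) -> (forall n, Cc (v n)) ->
  seq_equiv mu F u v <-> fequiv u v.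
Proof.
move=> uC vC; have uvC n : Cc (u n \- v n) by exact: Cc_sub.
have -> : seq_equiv mu F u v <-> (fun n => fnorm (u n \- v n)) @ \oo --> (0 : R).
  rewrite /seq_equiv (_ : (fun n => Fn (u n \- v n)) = (fun n => (fnorm (u n \- v n))%:E)).
    by split; [move=> /fine_cvg | move=> h; apply: cvg_EFin => //; near=> n].
  by apply/funext => n; rewrite fnormE.
split=> [/cvgrPdist_le h e /h [n0 _ n0P]|h].
  exists n0 => n /n0P; rewrite /= sub0r normrN; exact: le_trans (ler_norm _).
apply/cvgrPdist_le => e /h [n0 n0P]; exists n0 => // n /= /n0P.
by rewrite sub0r normrN ger0_norm // fnorm_ge0.
Unshelve. all: by end_near. Qed.

Lemma fequiv_trans u v w : (forall n, Cc (u n)) -> (forall n, Cc (v n)) ->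
  (forall n, Cc (w n)) -> fequiv u v -> fequiv v w -> fequiv u w.
Proof.
move=> uC vC wC uv vw e e0; have e2 : 0 < e / 2 by rewrite divr_gt0.
have [n1 h1] := uv _ e2; have [n2 h2] := vw _ e2; exists (maxn n1 n2) => n.
rewrite geq_max => /andP[/h1 a1 /h2 a2].
by rewrite (le_trans (fnorm_triangle (uC n) (vC n) (wC n))) //; lra.
Qed.

Lemma fequiv_sym u v : (forall n, Cc (u n)) -> (forall n, Cc (v n)) ->
  fequiv u v -> fequiv v u.
Proof.
by move=> uC vC uv e /uv [n0 n0P]; exists n0 => n /n0P; rewrite fnormC.
Qed.

Lemma fequiv_refl u : (forall n, Cc (u n)) -> fequiv u u.
Proof.
move=> uC e e0; exists 0%N => n _; apply: fnorm_le; [exact: Cc_sub|exact: ltW|].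
move=> E pi x Fpi; rewrite rintB //; last exact: F_rep Fpi.
by rewrite subrr nrm0 mulr_ge0 ?nrm_ge0 ?ltW.
Qed.

Lemma class_ofE u v : fcauchy u -> class_of mu F u v <-> fcauchy v /\ fequiv u v.
Proof.
move=> [uC _]; split=> [[/is_cauchyE [vC vc] /seq_equivE h]|[[vC vc] h]].
  by split; [split | exact: h].
by split; [exact/is_cauchyE | apply/seq_equivE].
Qed.

Lemma fcauchy_cst f : Cc f -> fcauchy (fun=> f).
Proof.
move=> fC; split=> // e e0; exists 0%N => i j _ _.
by have [n0 h] := @fequiv_refl (fun=> f) (fun=> fC) e e0; exact: (h n0 (leqnn _)).
Qed.

(** Translates the closeness of [p] to C_c in the completion into an operator estimate uniform over
    [F]. From here on the completion is used only through such an [f]. *)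
Lemma kazhdan_approx p e : is_kazhdan_projection mu F p -> 0 < e ->
  exists f, [/\ Cc f, kint setT f = 1 &
    forall (E : banach) (pi : G -> {linear E -> E}) P, F pi ->
      (forall x, completion_rep mu pi p x (P x)) ->
      forall x, nrm (rint pi f x - P x) <= e * nrm x].
Proof.
move=> [[w /is_cauchyE wc ->] _ papprox _] e0.
(* The comparison of [f] with the sequence [u'] that computes [P x] passes through [v n], [u n] and
   [w n]: four gaps of e / 4. *)
have e4 : 0 < e / 4 by rewrite divr_gt0.
have [f [fC f1 fd]] := papprox _ e4.
have [l [u [v [/(class_ofE _ wc) [uc wu] /(class_ofE _ (fcauchy_cst fC)) [vc fv] uvl]]] ule] := ereal_inf_lt fd.
have [n1 n1P] : exists n1, forall n, (n1 <= n)%N -> fnorm (u n \- v n) <= e / 4.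
  have [n0 _ n0P] := uvl _ (open_ereal_lt' ule); exists n0 => n /n0P /=.
  have [uC _] := uc; have [vC _] := vc.
  by rewrite fnormE ?lte_fin => [/ltW|]; last exact: Cc_sub.
exists f; split=> // E pi P Fpi PP x; have pr := F_rep Fpi.
have [u' [z [/(class_ofE _ wc) [u'c wu'] zP /nrm_cvgP zc]]] := PP x.
apply/ler_addgt0Pl => r r0; have [n2 _ n2P] := zc _ r0.
have [n3 n3P] := fv _ e4; have [n4 n4P] := wu _ e4; have [n5 n5P] := wu' _ e4.
pose n := maxn (maxn n1 n2) (maxn n3 (maxn n4 n5)).
have := leqnn n; rewrite {1}/n !geq_max => /andP[/andP[/n1P a1 /n2P a2] /and3P[/n3P a3 /n4P a4 /n5P a5]].
have [uC _] := uc; have [vC _] := vc; have [wC _] := wc; have [u'C _] := u'c.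
rewrite (le_trans (nrm_triangle _ (z n) _)) // [r + _]addrC lerD //; last exact: ltW.
rewrite -(rint_eq pr (u'C n) (zP n)) -rintB // (le_trans (le_fnorm _ _ Fpi)) //.
  exact: Cc_sub.
rewrite ler_wpM2r ?nrm_ge0 //.
have t1 := fnorm_triangle fC (vC n) (u'C n).
have t2 := fnorm_triangle (vC n) (uC n) (u'C n).
have t3 := fnorm_triangle (uC n) (wC n) (u'C n).
by have := fnormC (vC n) (uC n); have := fnormC (uC n) (wC n); lra.
Qed.

(** * From a contraction of displacements to a Kazhdan projection *)

Section Contraction.
Variables (S : set G) (f : G -> K) (c0 a0 : R).
Hypothesis S_generates : forall g, exists n, spow S n g.
Hypotheses (fC : Cc f) (f1 : kint setT f = 1) (c0_ge0 : 0 <= c0) (a0_ge0 : 0 <= a0).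
Hypothesis f_contracts : forall (E : banach) (pi : G -> {linear E -> E}) x d, F pi ->
  0 <= d -> (forall g, S g -> nrm (pi g x - x) <= d) ->
  nrm (rint pi f x - x) <= c0 * d /\
  forall g, S g -> nrm (pi g (rint pi f x) - rint pi f x) <= d / 2.
Hypothesis S_bounded : forall (E : banach) (pi : G -> {linear E -> E}) x g, F pi ->
  S g -> nrm (pi g x - x) <= a0 * nrm x.

(** [conv_pow n] is the power of exponent n + 1: in general C_c has no unit to start from. *)
Fixpoint conv_pow n : G -> K :=
  if n is n'.+1 then convolution mu f (conv_pow n') else f.

Lemma Cc_conv_pow n : Cc (conv_pow n).
Proof. by elim: n => //= n IH; exact: (Cc_convolution G_hausdorff mu_haar). Qed.

Lemma kint_conv_pow n : kint setT (conv_pow n) = 1.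
Proof.
elim: n => //= n IH.
by rewrite (kint_convolution G_hausdorff mu_haar fC (Cc_conv_pow n)) f1 IH mulr1.
Qed.

Lemma rint_conv_pow (E : banach) (pi : G -> {linear E -> E}) x n : F pi ->
  rint pi (conv_pow n) x = iter n.+1 (rint pi f) x.
Proof.
move=> Fpi; have pr := F_rep Fpi; elim: n => //= n IH.
by rewrite (rint_convolution G_hausdorff mu_haar pr _ fC (Cc_conv_pow n)) IH.
Qed.

Lemma spow_invariant (E : banach) (pi : G -> {linear E -> E}) x : F pi ->
  (forall g, S g -> pi g x = x) -> forall g, pi g x = x.
Proof.
move=> Fpi px g; have pr := F_rep Fpi; have [n] := S_generates g.
elim: n g => [g ->|n IH g [y [z [yn zS ->]]]]; first exact: rep1.
by rewrite (repM pr) px // IH.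
Qed.

Lemma contraction_orbit (E : banach) (pi : G -> {linear E -> E}) x n : F pi ->
  (forall g, S g -> nrm (pi g (iter n (rint pi f) x) - iter n (rint pi f) x) <=
     a0 * nrm x * 2^-1 ^+ n).
Proof.
move=> Fpi; have d0 j : 0 <= a0 * nrm x * 2^-1 ^+ j.
  by rewrite !mulr_ge0 ?nrm_ge0 ?exprn_ge0 ?invr_ge0.
elim: n => [|n IH] g Sg; first by rewrite expr0 mulr1 S_bounded.
rewrite exprSr mulrA; exact: (f_contracts Fpi (d0 n) IH).2.
Qed.

Lemma contraction_cauchy (E : banach) (pi : G -> {linear E -> E}) x i j : F pi ->
  (i <= j)%N ->
  nrm (iter j (rint pi f) x - iter i (rint pi f) x) <= 2 * c0 * a0 * nrm x * 2^-1 ^+ i.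
Proof.
move=> Fpi ij; have d0 n : 0 <= a0 * nrm x * 2^-1 ^+ n.
  by rewrite !mulr_ge0 ?nrm_ge0 ?exprn_ge0 ?invr_ge0.
(* Each step moves the vector by at most [c0] times a displacement that halves every time. The
   telescoped bound, with [2^-1 ^+ j] subtracted, is the one that passes through the induction on
   [j]. *)
suff h : nrm (iter j (rint pi f) x - iter i (rint pi f) x) <=
    2 * c0 * (a0 * nrm x) * (2^-1 ^+ i - 2^-1 ^+ j).
  apply: (le_trans h); rewrite -!mulrA !ler_wpM2l ?nrm_ge0 //.
  by rewrite gerBl exprn_ge0 ?invr_ge0.
elim: j ij => [|j IH]; first by rewrite leqn0 => /eqP ->; rewrite !subrr nrm0 mulr0.
rewrite leq_eqVlt ltnS => /orP[/eqP ->|ij]; first by rewrite !subrr nrm0 mulr0.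
have := (f_contracts Fpi (d0 j) (contraction_orbit x j Fpi)).1; have := IH ij.
have := nrm_triangle (iter j.+1 (rint pi f) x) (iter j (rint pi f) x) (iter i (rint pi f) x).
rewrite [2^-1 ^+ j.+1]exprSr /= => h1 h2 h3; apply: (le_trans h1).
apply: (le_trans (lerD h3 h2)); rewrite le_eqVlt; apply/orP; left; apply/eqP.
by field.
Qed.

Let C := 2 * c0 * a0.

Let C_ge0 : 0 <= C. Proof. by rewrite !mulr_ge0. Qed.

Lemma fnorm_conv_pow i j : (i <= j)%N ->
  fnorm (conv_pow j \- conv_pow i) <= C * 2^-1 ^+ i.
Proof.
move=> ij; apply: fnorm_le; first by apply: Cc_sub; exact: Cc_conv_pow.
  by rewrite mulr_ge0 ?exprn_ge0 ?invr_ge0.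
move=> E pi x Fpi; rewrite rintB; try exact: Cc_conv_pow; last exact: F_rep.
rewrite !rint_conv_pow // (le_trans (contraction_cauchy _ Fpi _)) ?ltnS //.
rewrite mulrAC ler_wpM2r ?nrm_ge0 // ler_wpM2l // exprS ler_piMl ?exprn_ge0 ?invr_ge0 //.
by rewrite invf_le1 // ler1n.
Qed.

Lemma conv_pow_cauchy : fcauchy conv_pow.
Proof.
split=> [|e e0]; first exact: Cc_conv_pow.
have [n0 h] := half_pow_small C e0; exists n0 => i j ni nj.
have [ij|/ltnW ij] := leqP i j; last by rewrite (le_trans (fnorm_conv_pow ij)) // h.
rewrite fnormC; try exact: Cc_conv_pow.
by rewrite (le_trans (fnorm_conv_pow ij)) // h.
Qed.

Lemma fcauchy_bounded u : fcauchy u -> exists2 M, 0 <= M & forall n, fnorm (u n) <= M.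
Proof.
move=> [uC uc]; have [n0 h] := uc 1 ltr01.
exists (fnorm (u n0) + 1 + \sum_(i < n0) fnorm (u i)).
  by rewrite !addr_ge0 ?fnorm_ge0 //; apply: sumr_ge0 => i _; exact: fnorm_ge0.
move=> n; have [nn0|n0n] := ltnP n n0.
  rewrite (bigD1 (Ordinal nn0)) //= addrCA lerDl !addr_ge0 ?fnorm_ge0 //.
  by apply: sumr_ge0 => i _; exact: fnorm_ge0.
have := h n n0 n0n (leqnn _); have := fnorm_lip (uC n) (uC n0).
rewrite ler_norml => /andP[_ h1] h2.
apply: (@le_trans _ _ (fnorm (u n0) + 1)); first lra.
by rewrite lerDl; apply: sumr_ge0 => i _; exact: fnorm_ge0.
Qed.

Lemma fequiv_convolution u v u' v' : fcauchy u -> fcauchy v -> fcauchy u' -> fcauchy v' ->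
  fequiv u u' -> fequiv v v' ->
  fequiv (fun n => convolution mu (u n) (v n)) (fun n => convolution mu (u' n) (v' n)).
Proof.
move=> uc vc u'c v'c uu' vv' e e0.
have [M M0 uM] := fcauchy_bounded uc; have [L L0 vL] := fcauchy_bounded v'c.
have e1 : 0 < e / (M + L + 1) by rewrite divr_gt0 // ltr_wpDl // addr_ge0.
have [n1 h1] := uu' _ e1; have [n2 h2] := vv' _ e1; exists (maxn n1 n2) => n.
rewrite geq_max => /andP[/h1 a1 /h2 a2].
apply: le_trans (fnorm_convolution_sub (uc.1 n) (vc.1 n) (u'c.1 n) (v'c.1 n)) _.
apply: (@le_trans _ _ (M * (e / (M + L + 1)) + (e / (M + L + 1)) * L)).
  by apply: lerD; apply: ler_pM; rewrite ?fnorm_ge0.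
rewrite [M * _]mulrC -mulrDr mulrAC ler_pdivrMr ?ltr_wpDl ?addr_ge0 //.
by rewrite ler_pM2l //; lra.
Qed.

Lemma conv_pow_square :
  fequiv (fun n => convolution mu (conv_pow n) (conv_pow n)) conv_pow.
Proof.
move=> e e0; have [n0 h] := half_pow_small C e0; exists n0 => n n0n.
apply: le_trans (h n n0n).
have cC : Cc (convolution mu (conv_pow n) (conv_pow n)).
  by apply: (Cc_convolution G_hausdorff mu_haar); exact: Cc_conv_pow.
apply: fnorm_le; [by apply: Cc_sub => //; exact: Cc_conv_pow | by rewrite mulr_ge0 ?exprn_ge0 ?invr_ge0 |].
move=> E pi x Fpi; have pr := F_rep Fpi; rewrite rintB //; last exact: Cc_conv_pow.
rewrite (rint_convolution G_hausdorff mu_haar pr); try exact: Cc_conv_pow.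
rewrite !rint_conv_pow // -iterD (le_trans (contraction_cauchy _ Fpi _)) ?leq_addl //.
rewrite mulrAC ler_wpM2r ?nrm_ge0 // ler_wpM2l // exprS ler_piMl ?exprn_ge0 ?invr_ge0 //.
by rewrite invf_le1 // ler1n.
Qed.

(** [completion_dist] is an infimum of limits that exist, so a bound on the norms is not enough: the
    sequence of norms has to converge, which it does because it is Cauchy by [fnorm_lip]. *)
Lemma conv_pow_approx n : exists2 l : R, l <= C * 2^-1 ^+ n &
  (fun i => Fn (conv_pow i \- conv_pow n)) @ \oo --> l%:E.
Proof.
have sC i : Cc (conv_pow i \- conv_pow n) by apply: Cc_sub; exact: Cc_conv_pow.
pose a i : R := fnorm (conv_pow i \- conv_pow n).
have [|l al] := @complete_seq R real_scalars (R : completeNormedModType R) a.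
  move=> e e0; have [n0 h] := conv_pow_cauchy.2 _ e0; exists n0 => i j ni nj.
  rewrite -[leLHS]/(`|a i - a j|) /a.
  apply: le_trans (fnorm_lip (sC i) (sC j)) _; apply: le_trans (h i j ni nj).
  rewrite le_eqVlt; apply/orP; left; apply/eqP; congr (fine (Fn _)).
  by apply/funext => g /=; rewrite opprB addrA subrK.
exists l.
  apply: (cvgr_to_le al) => //; exists n => // i /= ni.
  exact: fnorm_conv_pow.
rewrite (_ : (fun i => _) = EFin \o a); last by apply/funext => i; rewrite fnormE.
by apply: cvg_EFin => //; exact: nearW.
Qed.

Lemma contraction_limit (E : banach) (pi : G -> {linear E -> E}) : F pi ->
  exists P : E -> E, (forall x, (fun n => iter n (rint pi f) x) @ \oo --> P x) /\
    forall x g, pi g (P x) = P x.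
Proof.
move=> Fpi; have pr := F_rep Fpi.
have /choice [P PP] x : exists y : E, (fun n => iter n (rint pi f) x) @ \oo --> y.
  apply: complete_seq => e e0; have [n0 h] := half_pow_small (C * nrm x) e0.
  exists n0 => i j ni nj; have [ij|/ltnW ij] := leqP i j.
    by rewrite nrmBC (le_trans (contraction_cauchy _ Fpi ij)) // h.
  by rewrite (le_trans (contraction_cauchy _ Fpi ij)) // h.
exists P; split=> // x g.
apply: spow_invariant => // s Ss; apply/eqP; rewrite -subr_eq0; apply/eqP/nrm_small => e e0.
have [M M0 pM] := lin_bounded (@rep_bounded _ _ _ _ _ pr s).
have e1 : 0 < e / (2 * (M + 1)) by rewrite divr_gt0 // mulr_gt0 // ltr_wpDr // ltW.
have [n1 _ h1] := (nrm_cvgP _ _ _).1 (PP x) _ e1.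
have e2 : 0 < e / 2 by rewrite divr_gt0.
have [n2 h2] := half_pow_small (a0 * nrm x) e2.
pose n := maxn n1 n2; set y := iter n (rint pi f) x.
have := h1 n (leq_maxl _ _); rewrite /= -/y => hy.
have := contraction_orbit x n Fpi Ss; rewrite -/y => hy2.
have := h2 n (leq_maxr _ _) => hy3.
have t1 := nrm_triangle (pi s (P x)) (pi s y) (P x).
have t2 := nrm_triangle (pi s y) y (P x).
have t3 : nrm (pi s (P x) - pi s y) <= M * nrm (y - P x) by rewrite -linearB nrmBC pM.
have : (M + 1) * nrm (y - P x) <= e / 2.
  have M1 : 0 < M + 1 by rewrite addr_gt0.
  by move: (ltW hy); rewrite ler_pdivlMr ?mulr_gt0 // [_ * (2 * _)]mulrCA [_ * (M + 1)]mulrC; lra.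
by lra.
Qed.

Lemma contraction_kazhdan : is_kazhdan_projection mu F (class_of mu F conv_pow).
Proof.
have uc := conv_pow_cauchy; have uC := Cc_conv_pow.
have cC := @Cc_convolution R k G G_hausdorff mu mu_haar.
split.
- by exists conv_pow => //; exact/is_cauchyE.
- apply/seteqP; split=> w.
    move=> [/is_cauchyE wc [u1 [v1 [/(class_ofE _ uc) [u1c h1] /(class_ofE _ uc) [v1c h2]]]]].
    move=> /(seq_equivE (fun n => cC _ _ (u1c.1 n) (v1c.1 n)) wc.1) h3.
    apply/class_ofE => //; split=> //.
    have cc1 n : Cc (convolution mu (conv_pow n) (conv_pow n)) by exact: cC.
    have cc2 n : Cc (convolution mu (u1 n) (v1 n)) by apply: cC; [exact: u1c.1|exact: v1c.1].
    apply: (fequiv_trans uC cc1 wc.1); first exact: (fequiv_sym cc1 uC conv_pow_square).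
    apply: (fequiv_trans cc1 cc2 wc.1) => //.
    exact: (fequiv_convolution uc uc u1c v1c h1 h2).
  move=> /(class_ofE _ uc) [wc uw]; split; first exact/is_cauchyE.
  have pu : class_of mu F conv_pow conv_pow.
    by apply/class_ofE => //; split=> //; exact: fequiv_refl.
  exists conv_pow, conv_pow; split=> //.
  have cc1 n : Cc (convolution mu (conv_pow n) (conv_pow n)) by exact: cC.
  apply/(seq_equivE cc1 wc.1); apply: (fequiv_trans cc1 uC wc.1) => //.
  exact: conv_pow_square.
- move=> e e0; have e2 : 0 < e / 2 by rewrite divr_gt0.
  have [n h] := half_pow_small C e2.
  exists (conv_pow n); split; [exact: uC | exact: kint_conv_pow |].
  have [l ln al] := conv_pow_approx n.
  apply: (@le_lt_trans _ _ l%:E); last first.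
    by rewrite lte_fin (le_lt_trans ln) // (le_lt_trans (h _ (leqnn _))) // ltr_pdivrMr // ltr_pMr // ltr1n.
  apply: ereal_inf_lbound; exists conv_pow, (fun=> conv_pow n); split=> //.
    by apply/class_ofE => //; split=> //; exact: fequiv_refl.
  apply/(class_ofE _ (fcauchy_cst (uC n))); split; first exact: fcauchy_cst.
  by apply: fequiv_refl => ?; exact: uC.
- move=> E pi Fpi; have pr := F_rep Fpi.
  have [P [PP Pinv]] := contraction_limit Fpi.
  have Pfix x : (forall g, pi g x = x) -> P x = x.
    move=> px; have fx n : iter n (rint pi f) x = x.
      elim: n => //= n ->; exact: (rint_invariant G_hausdorff mu_haar pr).
    have /nrm_cvgP h := PP x; apply/esym/eqP; rewrite -subr_eq0; apply/eqP/nrm_small => e e0.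
    by have [n _ hn] := h _ e0; have := hn n (leqnn _); rewrite /= fx => /ltW.
  exists P; split.
  + move=> x; exists conv_pow, (fun n => rint pi (conv_pow n) x); split.
    * by apply/class_ofE => //; split=> //; exact: fequiv_refl.
    * by move=> n; exact: rintP.
    * under eq_fun do rewrite rint_conv_pow //.
      by have := PP x; rewrite -(cvg_shiftS (fun n => iter n (rint pi f) x)).
  + by move=> x; rewrite Pfix //; exact: Pinv.
  + apply/seteqP; split=> [_ [x _ <-] g|x px]; first exact: Pinv.
    by exists x => //; exact: Pfix.
Qed.

End Contraction.

End FNorm.

(** * Quotients and presentations of topological groups *)

Section Words.
Implicit Types G H : topGroupType.

Lemma spow_mono G (S : set G) m n : S 1%g -> (m <= n)%N -> spow S m `<=` spow S n.
Proof.
move=> S1; elim: n => [|n IH]; first by rewrite leqn0 => /eqP ->.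
rewrite leq_eqVlt ltnS => /orP[/eqP -> //|mn] x /(IH mn) xn.
by exists x, 1%g; split=> //; rewrite mulg1.
Qed.

Lemma spow_mul G (S : set G) m n x y : spow S m x -> spow S n y -> spow S (m + n) (x * y)%g.
Proof.
move=> xm; elim: n y => [y ->|n IH y [a [b [an Sb ->]]]]; first by rewrite addn0 mulg1.
by rewrite addnS; exists (x * a)%g, b; split=> //; [exact: IH | rewrite mulgA].
Qed.

Lemma spow1 G (S : set G) x : S x -> spow S 1 x.
Proof. by move=> Sx; exists 1%g, x; split=> //; rewrite mul1g. Qed.

Lemma spow_inv G (S : set G) n x : (forall y, S y -> S y^-1%g) -> spow S n x ->
  spow S n x^-1%g.
Proof.
move=> Ssym; elim: n x => [x ->|n IH x [a [b [an Sb ->]]]]; first by rewrite invg1.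
by rewrite invgM -add1n; apply: spow_mul; [apply/spow1/Ssym | exact: IH].
Qed.

Lemma spow_compact G (S : set G) n : compact S -> compact (spow S n).
Proof.
move=> Sc; elim: n => [|n IH]; first exact: compact_set1.
have -> : spow S n.+1 = [set (p.1 * p.2)%g | p in spow S n `*` S].
  apply/seteqP; split=> x; first by move=> [a [b [an Sb ->]]]; exists (a, b).
  by move=> [[a b] [an Sb] <-]; exists a, b.
apply: continuous_compact; last exact: compact_setX.
exact/continuous_subspaceT/mulg_continuous.
Qed.

Lemma word_lengthP G (S : set G) g : (exists n, spow S n g) ->
  spow S (word_length S g) g.
Proof.
move=> [n ng]; rewrite /word_length.
have [n0 n0g n0min] : exists2 n0, spow S n0 g & forall m, spow S m g -> (n0 <= m)%N.
  have h : exists n, `[< spow S n g >] by exists n; apply/asboolP.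
  exists (ex_minn h); case: ex_minnP => m /asboolP // mg mmin.
  by move=> j jg; apply: mmin; apply/asboolP.
by have [] : [set n | spow S n g /\ forall m, spow S m g -> (n <= m)%N]
  (xget 0%N [set n | spow S n g /\ forall m, spow S m g -> (n <= m)%N])
  by apply: xgetPex; exists n0.
Qed.

Lemma word_length_le G (S : set G) g n : spow S n g -> (word_length S g <= n)%N.
Proof.
move=> ng; rewrite /word_length.
have [n0 n0g n0min] : exists2 n0, spow S n0 g & forall m, spow S m g -> (n0 <= m)%N.
  have h : exists n, `[< spow S n g >] by exists n; apply/asboolP.
  exists (ex_minn h); case: ex_minnP => m /asboolP // mg mmin.
  by move=> j jg; apply: mmin; apply/asboolP.
have [_] : [set n | spow S n g /\ forall m, spow S m g -> (n <= m)%N]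
  (xget 0%N [set n | spow S n g /\ forall m, spow S m g -> (n <= m)%N])
  by apply: xgetPex; exists n0.
by apply.
Qed.

End Words.

(** * Topological quotients of groups *)

Section QuotientFacts.
Variables (G H : topGroupType) (N : set G) (q : G -> H).
Hypothesis Hq : is_quotient N q.

Lemma quotientM x y : q (x * y)%g = (q x * q y)%g.
Proof. by case: Hq. Qed.

Lemma quotient1 : q 1%g = 1%g.
Proof. by apply: (mulgI (q 1%g)); rewrite -quotientM !mulg1. Qed.

Lemma quotientV x : q x^-1%g = (q x)^-1%g.
Proof. by apply: (mulgI (q x)); rewrite -quotientM !mulgV quotient1. Qed.

Lemma quotient_eq x y : q x = q y <-> N (x^-1 * y)%g.
Proof.
case: Hq => _ _ _ _ <-; rewrite quotientM quotientV; split=> [->|h]; first by rewrite mulVg.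
by rewrite -[q x]mulg1 -h mulgA mulgV mul1g.
Qed.

Lemma quotient_cont : continuous q.
Proof. by case: Hq. Qed.

Lemma quotient_open_map (U : set G) : open U -> open (q @` U).
Proof. by case: Hq => _ _ + _ _; exact. Qed.

Lemma quotient_surj h : exists g, q g = h.
Proof. by case: Hq. Qed.

Lemma quotient_nbhs g (U : set G) : nbhs g U -> nbhs (q g) (q @` U).
Proof.
rewrite nbhsE => -[V [oV Vg] VU]; rewrite nbhsE; exists (q @` V).
  by split; [exact: quotient_open_map | exists g].
exact: image_subset.
Qed.

Lemma quotient_spow (S : set G) n x : spow S n x -> spow (q @` S) n (q x).
Proof.
elim: n x => [x ->|n IH x [a [b [an Sb ->]]]]; first exact: quotient1.
by exists (q a), (q b); split; [exact: IH | exists b | exact: quotientM].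
Qed.

Lemma quotient_spow_lift (S : set G) n h : spow (q @` S) n h -> exists2 x, spow S n x & q x = h.
Proof.
elim: n h => [h ->|n IH h [a [b [/IH [x xn xa] [s Ss sb] ->]]]].
  by exists 1%g => //; exact: quotient1.
by exists (x * s)%g; [exists x, s | rewrite quotientM xa sb].
Qed.

Lemma quotient_generates (S : set G) : (forall g, exists n, spow S n g) ->
  forall h, exists n, spow (q @` S) n h.
Proof.
move=> Sg h; have [g <-] := quotient_surj h; have [n ng] := Sg g.
by exists n; exact: quotient_spow.
Qed.

Lemma quotient_compact (A : set G) : compact A -> compact (q @` A).
Proof.
move=> Ac; apply: continuous_compact => //.
exact/continuous_subspaceT/quotient_cont.
Qed.

Lemma mulV_cont (G' : topGroupType) : continuous (fun p : G' * G' => p.1^-1 * p.2)%g.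
Proof.
move=> p; apply: (@continuous_comp _ _ _ (fun p : G' * G' => (p.1^-1, p.2)%g) (fun p => p.1 * p.2)%g).
  apply: cvg_pair; last exact: cvg_snd.
  by apply: (@continuous_comp _ _ _ fst (fun x : G' => x^-1%g)); [exact: cvg_fst | exact: invg_continuous].
exact: mulg_continuous.
Qed.

Lemma quotient_hausdorff : closed N -> hausdorff_space H.
Proof.
move=> Ncl a b; have [x <-] := quotient_surj a; have [y <-] := quotient_surj b => ab.
apply: contrapT => xy.
have nxy : (~` N) (x^-1 * y)%g by move=> /quotient_eq.
have : nbhs (x^-1 * y)%g (~` N) by apply: open_nbhs_nbhs; split=> //; exact: closed_openC.
move=> /(@mulV_cont G (x, y)) [[U V] /= [Ux Vy] UV].
have [_ [[u Uu <-] [v Vv uv]]] := ab _ _ (quotient_nbhs Ux) (quotient_nbhs Vy).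
by apply: (UV (u, v)) => //; apply/quotient_eq; rewrite uv.
Qed.

Lemma quotient_locally_compact : locally_compact [set: G] -> closed N ->
  locally_compact [set: H].
Proof.
move=> Glc Ncl h _; have [g <-] := quotient_surj h.
have [U /= Ug [Uc _]] := Glc g I; exists (q @` U).
  have Ug' : nbhs g U by have : nbhs g [set x | [set: G] x -> U x] := Ug; apply: filterS => x; exact.
  by apply: filterS (quotient_nbhs Ug').
split; first exact: quotient_compact.
by apply: compact_closed; [exact: quotient_hausdorff | exact: quotient_compact].
Qed.

End QuotientFacts.

(** * Baire property and bump functions on locally compact spaces *)

Section LocallyCompact.
Variable X : topologicalType.
Hypothesis X_hausdorff : hausdorff_space X.
Hypothesis X_lc : locally_compact [set: X].

Lemma compact_nbhs (x : X) (O : set X) : nbhs x O ->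
  exists K : set X, [/\ compact K, nbhs x K & K `<=` O].
Proof.
move=> Ox; have [U /= Ux [Uc Ucl]] := @X_lc x I.
have Ux' : nbhs x U by have : nbhs x [set y | [set: X] y -> U y] := Ux; apply: filterS => y; exact.
have [i ix iO] := compact_regular X_hausdorff Uc Ux' Ox.
exists (closure i `&` U); split.
- apply: (subclosed_compact _ Uc); last by move=> y [].
  by apply: closedI => //; exact: closed_closure.
- by apply: filterI => //; apply: filterS ix; exact: subset_closure.
- by move=> y [/iO].
Qed.

(** Were all the [C n] of empty interior, compact sets with interior could be shrunk step by step so
    as to leave [C n] at the n-th step. Being nested and nonempty they have a common point, which
    would lie in no [C n]. *)
Lemma locally_compact_baire (C : nat -> set X) (x0 : X) :
  (forall n, closed (C n)) -> (forall x, exists n, C n x) ->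
  exists n, exists x : X, nbhs x (C n).
Proof.
move=> Ccl Ccov; apply: contrapT => no.
pose good (K : set X) := compact K /\ exists x : X, nbhs x K.
have /choice [next nextP] (p : nat * set X) : exists K', good p.2 ->
    good K' /\ K' `<=` p.2 `\` C p.1.
  have [gp|] := pselect (good p.2); last by move=> ngp; exists set0.
  case: p gp => n K /= [Kc [x Kx]].
  have [y [Ky Cy]] : exists y, interior K y /\ ~ C n y.
    apply: contrapT => h; apply: no; exists n, x.
    have : nbhs x (interior K) by exact: nbhs_interior.
    apply: filterS => y Ky.
    by apply: contrapT => Cy; apply: h; exists y.
  have : nbhs y (K `\` C n).
    apply: filterI => //; apply: open_nbhs_nbhs; split=> //; exact: closed_openC.
  move=> /compact_nbhs [K' [K'c K'y K'sub]]; exists K' => _; split=> //.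
  by split=> //; exists y.
have [K0 [K0c K0x _]] := @compact_nbhs x0 setT filterT.
pose K := fix K n := if n is n'.+1 then next (n', K n') else K0.
have Kgood n : good (K n).
  elim: n => [|n IH]; first by split=> //; exists x0.
  by have [] := nextP (n, K n) IH.
have Kstep n : K n.+1 `<=` K n `\` C n by have [] := nextP (n, K n) (Kgood n).
have Kdec m n : (m <= n)%N -> K n `<=` K m.
  elim: n => [|n IH]; first by rewrite leqn0 => /eqP ->.
  rewrite leq_eqVlt ltnS => /orP[/eqP -> //|/IH h] x /Kstep [Kx _].
  exact: h.
have /choice [nx nxP] x : exists n, ~ K n x.
  by have [n Cx] := Ccov x; exists n.+1 => /Kstep [].
have Kcl n : closed (K n) by apply: compact_closed => //; exact: (Kgood n).1.
have [|s [_ sP]] := @compact_finite_cover X K0 (fun x => ~` K (nx x)) K0c.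
  by move=> x _; apply: open_nbhs_nbhs; split; [exact: closed_openC | exact: nxP].
pose M := \max_(x <- s) nx x.
have [_ [y /nbhs_singleton yM]] := Kgood M.
have [x xs] := sP y (Kdec 0%N M (leq0n _) _ yM); apply; apply: Kdec yM.
by rewrite /M (big_rem x) //= leq_maxl.
Qed.

Lemma bump_exists (R : realType) (x : X) (O : set X) : nbhs x O -> exists f : X -> R,
  [/\ continuous f, (forall y, 0 <= f y <= 1), f x = 1 & forall y, ~ O y -> f y = 0].
Proof.
rewrite nbhsE => -[V [oV Vx] VO].
have : uniform_separator [set x] (~` V).
  by apply: (@locally_compact_completely_regular X R X_lc X_hausdorff x _ (open_closedC oV)); exact.
move=> /(uniform_separatorP (R := R)) [f [fc f01 fx fV]].
exists (fun y => 1 - f y); split.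
- by move=> y; apply: cvgB; [exact: cvg_cst | exact: fc].
- move=> y; have : `[0, 1]%classic (f y) by apply: f01; exists y.
  by rewrite /= in_itv /= => /andP[h1 h2]; rewrite subr_ge0 h2 /= gerBl.
- by rewrite (fx (f x)) ?subr0 //; exists x.
- move=> y Oy; rewrite (fV (f y)) ?subrr //; exists y => // Vy; apply: Oy; exact: VO.
Qed.

End LocallyCompact.

Section GroupCompactness.
Variable G : topGroupType.
Hypothesis G_hausdorff : hausdorff_space G.
Hypothesis G_lc : locally_compact [set: G].

(** By Baire some power of [S] has an interior point [x]. Translating it by [g * x^-1], which lies
    in another power, puts a neighbourhood of any [g] inside a power, and finitely many of these
    cover [B]. *)
Lemma compact_sub_spow (S B : set G) : compact S -> S 1%g ->
  (forall g, exists n, spow S n g) -> compact B -> exists n, B `<=` spow S n.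
Proof.
move=> Sc S1 Sg Bc.
have Scl n : closed (spow S n) by apply: compact_closed => //; exact: spow_compact.
have [n [x nx]] := @locally_compact_baire G G_hausdorff G_lc (spow S) 1%g Scl Sg.
have /choice [k kP] (g : G) : exists k : nat, nbhs g (spow S k).
  have [j jP] := Sg (g * x^-1)%g; exists (j + n)%N.
  have nxg : nbhs (x * g^-1 * g)%g (spow S n) by rewrite -mulgA mulVg mulg1.
  have ng : nbhs g [set y | spow S n (x * g^-1 * y)%g] := @mulg_cont_l G (x * g^-1)%g g _ nxg.
  apply: filterS ng => y yn.
  have -> : y = (g * x^-1 * (x * g^-1 * y))%g.
    by rewrite !mulgA mulgVK mulgV mul1g.
  exact: spow_mul.
have [s [_ sP]] := @compact_finite_cover G B (fun g => spow S (k g)) Bc (fun g _ => kP g).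
exists (\max_(g <- s) k g)%N => y /sP [g gs]; apply: spow_mono => //.
by rewrite (big_rem g) //= leq_maxl.
Qed.

(** If [U] isolates 1 in [N] and V^-1 V is inside [U], the translate of [V] by a point outside [N]
    meets [N] at most once; removing that point, which is closed, leaves a neighbourhood disjoint
    from [N]. *)
Lemma discrete_subgroup_closed (N : set G) : normal_subgroup N -> discrete_subset N ->
  closed N.
Proof.
move=> [N1 NM NV _] Nd; have [_ [U U1 UN]] := Nd _ N1.
have oC : open (~` N).
  rewrite openE => g Ng; rewrite /interior /=.
  have : nbhs (1^-1 * 1 : G)%g U by rewrite mulVg.
  move=> /(@mulV_cont G (1%g, 1%g)) [[V1 V2] /= [h1 h2] V12].
  pose V := V1 `&` V2; have V1' : nbhs (1%g : G) V by exact: filterI.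
  have gV : nbhs g [set y | V (g^-1 * y)%g].
    by apply: mulg_cont_l; rewrite mulVg.
  have [[n [Nn gn]]|no] := pselect (exists n, N n /\ V (g^-1 * n)%g); last first.
    by apply: filterS gV => y Vy Ny; apply: no; exists y.
  have ng : g <> n by move=> h; apply: Ng; rewrite h.
  have : nbhs g (~` [set n]).
    apply: open_nbhs_nbhs; split=> //; apply: closed_openC.
    exact: (accessible_closed_set1 (hausdorff_accessible G_hausdorff)).
  move=> h; apply: filterS (filterI h gV) => y [/= yn Vy] Ny; apply: yn.
  have : U ((g^-1 * n)^-1 * (g^-1 * y))%g by apply: (V12 (_, _)); split; [exact: gn.1 | exact: Vy.2].
  rewrite invgM invgK -!mulgA mulVKg => Uny.
  have : (U `&` N) (n^-1 * y)%g by split=> //; apply: NM => //; exact: NV.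
  by rewrite UN /= => /(congr1 (fun z => n * z)%g); rewrite mulVKg mulg1.
by rewrite -[N]setCK; exact: open_closedC.
Qed.

Lemma uniform_modulus (R : realType) (f : G -> R) (B : set G) : continuous f ->
  compact B -> (forall x, ~ B x -> f x = 0) -> forall e, 0 < e ->
  \forall g \near (1%g : G), forall x, `|f (g^-1 * x)%g - f x| <= e.
Proof.
move=> fc Bc f0 e e0.
have [K [Kc K1 _]] := @compact_nbhs G G_hausdorff G_lc 1%g setT filterT.
pose B' := [set (p.1 * p.2)%g | p in K `*` B].
have B'c : compact B'.
  apply: continuous_compact; last exact: compact_setX.
  exact/continuous_subspaceT/mulg_continuous.
have Fc : continuous (fun p : G * G => f (p.1^-1 * p.2)%g).
  exact: (continuous_fun_comp (@mulV_cont G) fc).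
have h := @compact_uniform R real_scalars G G R^o (fun g x => f (g^-1 * x)%g) B' B'c Fc 1%g e e0.
apply: filterS (filterI K1 h) => g [Kg hg] x.
have [B'x|B'x] := pselect (B' x).
  by have := hg x B'x; rewrite /nrm /= invg1 mul1g => /ltW.
rewrite !f0 ?subrr ?normr0 ?ltW // => Bx; apply: B'x.
  by exists (1%g, x); [split=> //; exact: nbhs_singleton | rewrite /= mul1g].
by exists (g, (g^-1 * x)%g) => //=; rewrite mulVKg.
Qed.

End GroupCompactness.

(** * Normal closures and presentations of quotients *)

Section NormalClosure.
Variables (G : topGroupType) (X : set G).

Inductive normal_closure : set G :=
| normal_closure_gen x : X x -> normal_closure x
| normal_closure1 : normal_closure 1%g
| normal_closureM x y : normal_closure x -> normal_closure y -> normal_closure (x * y)%g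
| normal_closureV x : normal_closure x -> normal_closure x^-1%g
| normal_closureJ x g : normal_closure x -> normal_closure (g * x * g^-1)%g.

Lemma normal_closure_normal : normal_subgroup normal_closure.
Proof.
by split; [exact: normal_closure1 | exact: normal_closureM | exact: normal_closureV | exact: normal_closureJ].
Qed.

Lemma normal_closure_sub (N : set G) : normal_subgroup N -> X `<=` N -> normal_closure `<=` N.
Proof.
by move=> [N1 NM NV NJ] XN x; elim=> {x} //; [move=> x y _ Nx _ Ny; exact: NM | move=> x _; exact: NV | move=> x g _; exact: NJ].
Qed.

End NormalClosure.

Section Presentation.
Implicit Types G H : topGroupType.

Definition word_inv G (w : word G) : word G := rev [seq (l.1, ~~ l.2) | l <- w].

Definition word_map G H (q : G -> H) (w : word G) : word H := [seq (q l.1, l.2) | l <- w].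

Lemma word_eval_cat G (u v : word G) : word_eval (u ++ v) = (word_eval u * word_eval v)%g.
Proof. by elim: u => [|l u IH] /=; [rewrite mul1g | rewrite IH mulgA]. Qed.

Lemma word_inv_cons G l (w : word G) : word_inv (l :: w) = word_inv w ++ [:: (l.1, ~~ l.2)].
Proof. by rewrite /word_inv /= rev_cons cats1. Qed.

Lemma word_eval_inv G (w : word G) : word_eval (word_inv w) = (word_eval w)^-1%g.
Proof.
elim: w => [|[x b] w IH] /=; first by rewrite invg1.
by rewrite word_inv_cons word_eval_cat IH /= mulg1 invgM; case: b; rewrite ?invgK.
Qed.

Lemma word_on_cat G (S : set G) (u v : word G) : word_on S u -> word_on S v -> word_on S (u ++ v).
Proof. by move=> uS vS l; rewrite mem_cat => /orP[/uS|/vS]. Qed.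

Lemma word_on_inv G (S : set G) (w : word G) : word_on S w -> word_on S (word_inv w).
Proof. by move=> wS l; rewrite /word_inv mem_rev => /mapP[l' /wS ? ->]. Qed.

Lemma word_map_cat G H (q : G -> H) (u v : word G) :
  word_map q (u ++ v) = word_map q u ++ word_map q v.
Proof. exact: map_cat. Qed.

Lemma word_on_map G H (q : G -> H) (S : set G) (w : word G) :
  word_on S w -> word_on (q @` S) (word_map q w).
Proof. by move=> wS l /mapP[l' /wS Sl' ->]; exists l'.1. Qed.

Lemma presented_congr G (S : set G) Rel (a b u v : word G) :
  presented_eq S Rel u v -> presented_eq S Rel (a ++ u ++ b) (a ++ v ++ b).
Proof.
elim=> {u v} [w|w w' _ IH|w w' w'' _ IH1 _ IH2|u v t c St|u v r Rr].
- exact: presented_refl.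
- exact: presented_sym.
- exact: presented_trans IH1 IH2.
- have := @presented_cancel _ _ Rel (a ++ u) (v ++ b) t c St.
  by rewrite !catA.
- have := @presented_relator _ S _ (a ++ u) (v ++ b) r Rr.
  by rewrite !catA.
Qed.

Lemma presented_cat_inv G (S : set G) Rel (w : word G) : word_on S w ->
  presented_eq S Rel (w ++ word_inv w) [::].
Proof.
elim: w => [_|[x b] w IH wS]; first exact: presented_refl.
have Sx : S x by apply: (wS (x, b)); rewrite inE eqxx.
have {}IH : presented_eq S Rel (w ++ word_inv w) [::].
  by apply: IH => l lw; apply: wS; rewrite inE lw orbT.
have h := presented_congr [:: (x, b)] [:: (x, ~~ b)] IH.
rewrite -catA in h; rewrite word_inv_cons; apply: presented_trans h _.
exact: (@presented_cancel _ _ Rel [::] [::] x b Sx).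
Qed.

Lemma word_invK G (w : word G) : word_inv (word_inv w) = w.
Proof.
rewrite /word_inv map_rev revK -map_comp -[RHS]map_id; apply: eq_map => -[x b] /=.
by rewrite negbK.
Qed.

Lemma presented_inv_cat G (S : set G) Rel (w : word G) : word_on S w ->
  presented_eq S Rel (word_inv w ++ w) [::].
Proof.
by move=> wS; have := presented_cat_inv Rel (word_on_inv wS); rewrite word_invK.
Qed.

Lemma presented_map G H (q : G -> H) (S : set G) Rel Rel' (u v : word G) :
  (forall r, Rel r -> Rel' (word_map q r)) ->
  presented_eq S Rel u v -> presented_eq (q @` S) Rel' (word_map q u) (word_map q v).
Proof.
move=> RR; elim=> {u v} [w|w w' _ IH|w w' w'' _ IH1 _ IH2|u v t c St|u v r Rr].
- exact: presented_refl.
- exact: presented_sym.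
- exact: presented_trans IH1 IH2.
- by rewrite !word_map_cat /=; apply: presented_cancel; exists t.
- by rewrite !word_map_cat; apply: presented_relator; exact: RR.
Qed.

Lemma spow_word G (S : set G) n x : spow S n x ->
  exists w, [/\ word_on S w, (size w <= n)%N & word_eval w = x].
Proof.
elim: n x => [x ->|n IH x [a [b [/IH [w [wS wn wa]] Sb ->]]]]; first by exists [::].
exists (w ++ [:: (b, false)]); split.
- by apply: word_on_cat => // l; rewrite inE => /eqP ->.
- by rewrite size_cat addn1 ltnS.
- by rewrite word_eval_cat wa /= mulg1.
Qed.

(* Short words representing elements of N serve as the additional relators. *)
Lemma quotient_presented G H (S N : set G) j (q : G -> H) :
  compactly_presented S ->
  is_quotient (normal_closure [set x | N x /\ spow S j x]) q ->
  compactly_presented (q @` S).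
Proof.
set X := [set x | _]; move=> [Sc Sgen [L [Rel [RelP RelC]]]] Hq.
pose Rel' := [set r : word H | (exists2 r0, Rel r0 & r = word_map q r0) \/
  [/\ word_on (q @` S) r, (size r <= j)%N & word_eval r = 1%g]].
have evalq w : word_eval (word_map q w) = q (word_eval w).
  elim: w => [|[x b] w IH] /=; first by rewrite (quotient1 Hq).
  by rewrite IH (quotientM Hq); case: b; rewrite ?(quotientV Hq).
have lift w' : word_on (q @` S) w' -> exists2 w, word_on S w & word_map q w = w'.
  elim: w' => [_|[h b] w' IH hw]; first by exists [::].
  have [l lw|w wS ww'] := IH; first by apply: hw; rewrite inE lw orbT.
  have [s Ss sh] : (q @` S) h by apply: (hw (h, b)); rewrite inE eqxx.
  exists ((s, b) :: w); last by rewrite /= sh ww'.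
  by move=> l; rewrite inE => /orP[/eqP -> //|/wS].
have Geq w w' : word_on S w -> word_on S w' -> word_eval w = word_eval w' ->
    presented_eq S Rel w w'.
  move=> wS w'S ww'.
  have h : presented_eq S Rel (w ++ word_inv w') [::].
    apply: RelC; first by apply: word_on_cat => //; exact: word_on_inv.
    by rewrite word_eval_cat word_eval_inv ww' mulgV.
  have h1 := presented_congr [::] w' h; have h2 := presented_congr w [::] (presented_inv_cat Rel w'S).
  rewrite /= ?cats0 -catA in h1 h2 *.
  by apply: presented_trans (presented_sym h2) h1.
have mapE u v : presented_eq S Rel u v -> presented_eq (q @` S) Rel' (word_map q u) (word_map q v).
  by apply: presented_map => r Rr; left; exists r.
(* [P g] concerns all words for [g]; by [Pword] it is enough to treat one, since two words with the
   same value in [G] are already equal modulo [Rel]. The proof is then an induction on the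
   construction of the normal closure. *)
pose P g := forall w, word_on S w -> word_eval w = g -> presented_eq (q @` S) Rel' (word_map q w) [::].
have Pword g w0 : word_on S w0 -> word_eval w0 = g ->
    presented_eq (q @` S) Rel' (word_map q w0) [::] -> P g.
  move=> w0S w0g h w wS wg; apply: presented_trans h; apply: mapE.
  by apply: Geq => //; rewrite wg.
have Pinv w : word_on S w -> presented_eq (q @` S) Rel' (word_map q w) [::] ->
    presented_eq (q @` S) Rel' (word_map q (word_inv w)) [::].
  move=> wS h; have h1 := presented_congr (word_map q (word_inv w)) [::] h.
  rewrite /= !cats0 -word_map_cat in h1; apply: presented_trans (presented_sym h1) _.
  by apply: (mapE _ [::]); exact: presented_inv_cat.
have Pall g : normal_closure X g -> P g.
  elim=> {g} [x [Nx xj]||x y Xx Px Xy Py|x _ Px|x g _ Px].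
  - have [w [wS wj wx]] := spow_word xj.
    apply: (Pword _ w) => //; rewrite -[word_map q w]cats0 -[_ ++ _]cat0s.
    apply: (@presented_relator _ _ _ [::] [::]); right; split.
    + exact: word_on_map.
    + by rewrite size_map.
    + have [_ _ _ _ qN] := Hq; rewrite evalq wx; by apply/qN; apply: normal_closure_gen.
  - by apply: (Pword _ [::]) => //; exact: presented_refl.
  - have [u uS ux] := Sgen x; have [v vS vy] := Sgen y.
    apply: (Pword _ (u ++ v)); rewrite ?word_map_cat ?word_eval_cat ?ux ?vy //.
      exact: word_on_cat.
    have := presented_congr [::] (word_map q v) (Px u uS ux).
    by rewrite /= => h; apply: presented_trans h (Py v vS vy).
  - have [u uS ux] := Sgen x; apply: (Pword _ (word_inv u)).
    + exact: word_on_inv.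
    + by rewrite word_eval_inv ux.
    + by apply: Pinv => //; exact: Px.
  - have [u uS ux] := Sgen x; have [v vS vg] := Sgen g.
    apply: (Pword _ (v ++ u ++ word_inv v)).
    + by do 2! apply: word_on_cat => //; exact: word_on_inv.
    + by rewrite !word_eval_cat word_eval_inv ux vg mulgA.
    rewrite !word_map_cat; apply: presented_trans (presented_congr _ _ (Px u uS ux)) _.
    by rewrite /= -word_map_cat; apply: (mapE _ [::]); exact: presented_cat_inv.
split; first exact: (quotient_compact Hq).
  move=> h; have [g <-] := quotient_surj Hq h; have [w wS wg] := Sgen g.
  by exists (word_map q w); [exact: word_on_map | rewrite evalq wg].
exists (maxn L j), Rel'; split.
  move=> r [[r0 /RelP [r0S r0L r01] ->]|[rS rj r1]]; split=> //.
  - exact: word_on_map.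
  - by rewrite size_map leq_max r0L.
  - by rewrite evalq r01 (quotient1 Hq).
  - by rewrite leq_max rj orbT.
move=> w' /lift [w wS <-]; rewrite evalq => qw1.
have [_ _ _ _ qN] := Hq; exact: (Pall (word_eval w) ((qN _).1 qw1)).
Qed.

End Presentation.

(** * Construction of the topological group G/N *)

Section QuotientGroup.
Variables (G : topGroupType) (N : set G).
Hypothesis N_normal : normal_subgroup N.

Definition quot_coset (x : G) : set G := [set y | N (x^-1 * y)%g].

(* The normality proof is a phantom parameter, on which the group structure of the cosets
   depends. *)
Definition quot_group : Type := let _ := N_normal in {A : set G | exists x, A = quot_coset x}.

Definition quot_proj (x : G) : quot_group := exist _ (quot_coset x) (ex_intro _ x erefl).

Definition quot_rep (a : quot_group) : G := projT1 (cid (svalP a)).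

Lemma quot_repK a : quot_proj (quot_rep a) = a.
Proof.
apply: eq_sig_hprop => [? ? ?|]; first exact: Prop_irrelevance.
by rewrite /= /quot_rep; case: cid.
Qed.

Lemma quot_proj_eq x y : quot_proj x = quot_proj y <-> N (x^-1 * y)%g.
Proof.
have [N1 NM NV _] := N_normal; split=> [/(congr1 sval) /= xy|xy].
  have : quot_coset y y by rewrite /quot_coset /= mulVg.
  by rewrite -xy.
apply: eq_sig_hprop => [? ? ?|]; first exact: Prop_irrelevance.
apply/seteqP; split=> z /= h; rewrite /quot_coset /=.
  have -> : (y^-1 * z = (x^-1 * y)^-1 * (x^-1 * z))%g by rewrite invgM invgK -!mulgA mulVKg.
  by apply: NM => //; exact: NV.
have -> : (x^-1 * z = x^-1 * y * (y^-1 * z))%g by rewrite -!mulgA mulVKg.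
exact: NM.
Qed.

HB.instance Definition _ := gen_eqMixin quot_group.
HB.instance Definition _ := gen_choiceMixin quot_group.

Lemma quot_group_ind (P : quot_group -> Prop) : (forall x, P (quot_proj x)) -> forall a, P a.
Proof. by move=> h a; rewrite -(quot_repK a). Qed.

Definition quot_mul (a b : quot_group) := quot_proj (quot_rep a * quot_rep b)%g.
Definition quot_inv (a : quot_group) := quot_proj (quot_rep a)^-1%g.

Lemma quot_rep_proj x : N (x^-1 * quot_rep (quot_proj x))%g.
Proof. by apply/quot_proj_eq; rewrite quot_repK. Qed.

Lemma quot_projM x y : quot_mul (quot_proj x) (quot_proj y) = quot_proj (x * y)%g.
Proof.
have [N1 NM NV NJ] := N_normal; apply/esym/quot_proj_eq.
set x' := quot_rep _; set y' := quot_rep _.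
have -> : ((x * y)^-1 * (x' * y') = (y^-1 * (x^-1 * x') * y) * (y^-1 * y'))%g.
  by rewrite invgM -!mulgA mulVKg.
apply: NM; last exact: quot_rep_proj.
by have := NJ _ y^-1%g (quot_rep_proj x); rewrite invgK.
Qed.

Lemma quot_projV x : quot_inv (quot_proj x) = quot_proj x^-1%g.
Proof.
have [N1 NM NV NJ] := N_normal; apply/esym/quot_proj_eq; rewrite invgK.
set x' := quot_rep _.
have -> : (x * x'^-1 = x * (x^-1 * x')^-1 * x^-1)%g by rewrite invgM invgK -!mulgA mulgV mulg1.
by apply: NJ; apply: NV; exact: quot_rep_proj.
Qed.

Fact quot_mulA : associative quot_mul.
Proof.
by elim/quot_group_ind => x; elim/quot_group_ind => y; elim/quot_group_ind => z; rewrite !quot_projM mulgA.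
Qed.

Fact quot_mul1g : left_id (quot_proj 1%g) quot_mul.
Proof. by elim/quot_group_ind => x; rewrite quot_projM mul1g. Qed.

Fact quot_mulg1 : right_id (quot_proj 1%g) quot_mul.
Proof. by elim/quot_group_ind => x; rewrite quot_projM mulg1. Qed.

Fact quot_mulVg : left_inverse (quot_proj 1%g) quot_inv quot_mul.
Proof. by elim/quot_group_ind => x; rewrite quot_projV quot_projM mulVg. Qed.

Fact quot_mulgV : right_inverse (quot_proj 1%g) quot_inv quot_mul.
Proof. by elim/quot_group_ind => x; rewrite quot_projV quot_projM mulgV. Qed.

HB.instance Definition _ := isGroup.Build quot_group
  quot_mulA quot_mul1g quot_mulg1 quot_mulVg quot_mulgV.

Definition quot_op (U : set quot_group) := open (quot_proj @^-1` U).

Fact quot_opT : quot_op setT.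
Proof. by rewrite /quot_op preimage_setT; exact: openT. Qed.

Fact quot_opI : setI_closed quot_op.
Proof. by move=> A B; exact: openI. Qed.

Fact quot_op_bigU (I : Type) (f : I -> set quot_group) :
  (forall i, quot_op (f i)) -> quot_op (\bigcup_i f i).
Proof. by move=> fo; apply: bigcup_open => i _; exact: fo. Qed.

HB.instance Definition _ := isOpenTopological.Build quot_group
  quot_opT quot_opI quot_op_bigU.

Lemma quot_proj_continuous : continuous quot_proj.
Proof. by apply/continuousP => U; exact. Qed.

Lemma quot_proj_open (U : set G) : open U -> open (quot_proj @` U).
Proof.
move=> oU; rewrite -[open _]/(quot_op _) /quot_op.
have -> : quot_proj @^-1` (quot_proj @` U) =
    \bigcup_(n in N) [set x | U (x * n)%g].
  apply/seteqP; split=> x /=.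
    move=> [u Uu /esym/quot_proj_eq xu]; exists (x^-1 * u)%g => //=.
    by rewrite mulVKg.
  by move=> [n Nn Uxn]; exists (x * n)%g => //; apply/esym/quot_proj_eq; rewrite mulKg.
apply: bigcup_open => n _; apply: open_comp => // x _; exact: mulg_cont_r.
Qed.

Lemma quot_proj_nbhs x (U : set G) : nbhs x U -> nbhs (quot_proj x) (quot_proj @` U).
Proof.
rewrite nbhsE => -[V [oV Vx] VU]; rewrite nbhsE; exists (quot_proj @` V).
  by split; [exact: quot_proj_open | exists x].
exact: image_subset.
Qed.

Fact quot_mul_continuous : continuous (fun p : quot_group * quot_group => (p.1 * p.2)%g).
Proof.
move=> [a b]; rewrite -(quot_repK a) -(quot_repK b); move: (quot_rep a) (quot_rep b) => {a b} x y.
move=> A /= hA; have h : nbhs (quot_proj (x * y)%g) A by rewrite -quot_projM.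
have := quot_proj_continuous h => /(@mulg_continuous G (x, y)) [[U V] /= [Ux Vy] UV].
exists (quot_proj @` U, quot_proj @` V); first by split; exact: quot_proj_nbhs.
move=> [_ _] [/= [u Uu <-] [v Vv <-]].
by rewrite -[(_ * _)%g]/(quot_mul _ _) quot_projM; apply: (UV (u, v)).
Qed.

Fact quot_inv_continuous : continuous (fun x : quot_group => x^-1%g).
Proof.
move=> a; rewrite -(quot_repK a); move: (quot_rep a) => {a} x A /= hA.
have h : nbhs (quot_proj x^-1%g) A by rewrite -quot_projV.
have := @invg_continuous G x _ (quot_proj_continuous h) => U.
apply: filterS (quot_proj_nbhs U) => _ [u Uu <-].
by rewrite /= -[X in A X]/(quot_inv _) quot_projV.
Qed.

HB.instance Definition _ := isTopologicalGroup.Build quot_group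
  quot_mul_continuous quot_inv_continuous.

Lemma quot_groupP : is_quotient N (quot_proj : G -> (quot_group : topGroupType)).
Proof.
split.
- by move=> x y; rewrite -quot_projM.
- exact: quot_proj_continuous.
- exact: quot_proj_open.
- by move=> a; exists (quot_rep a); exact: quot_repK.
move=> g; rewrite -[1%g]/(quot_proj 1%g); split.
  by move=> /esym/quot_proj_eq; rewrite invg1 mul1g.
by move=> Ng; apply/esym/quot_proj_eq; rewrite invg1 mul1g.
Qed.

End QuotientGroup.

(** * Ultralimits and finite-dimensional subspaces *)

Lemma ultra_map (I T : Type) (U : set_system I) (a : I -> T) :
  UltraFilter U -> UltraFilter (nbhs (a @ U)).
Proof.
move=> UU; split=> [|V VP UV]; first exact: fmap_proper_filter.
apply/seteqP; split=> // B VB.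
have [//|UB] := in_ultra_setVsetC (a @^-1` B) UU.
have /filter_ex [x []//] : V (B `&` ~` B) by apply: filterI => //; exact: UV.
Qed.

Section UltraLimit.
Context (R : realType) (J : Type) (U : set_system J).

Definition ucvg (a : J -> R) (l : R) :=
  forall e : R, 0 < e -> \forall j \near U, `|a j - l| <= e.

Lemma ucvg_cst {FF : Filter U} (l : R) : ucvg (fun=> l) l.
Proof. by move=> e e0; apply: nearW => j; rewrite subrr normr0 ltW. Qed.

Lemma ucvg_le {FF : ProperFilter U} a b l m : ucvg a l -> ucvg b m ->
  (\forall j \near U, a j <= b j) -> l <= m.
Proof.
move=> al bm ab; apply/ler_addgt0Pl => e e0.
have e2 : 0 < e / 2 by rewrite divr_gt0.
have : U ([set j | `|a j - l| <= e / 2] `&` [set j | `|b j - m| <= e / 2] `&` [set j | a j <= b j]).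
  by apply: filterI ab; apply: filterI; [exact: al | exact: bm].
move=> /filter_ex [j [[/= h1 h2] /= h3]].
by move: h1 h2; rewrite !ler_norml => /andP[h1 _] /andP[_ h2]; lra.
Qed.

Lemma ucvg_unique {FF : ProperFilter U} a l m : ucvg a l -> ucvg a m -> l = m.
Proof.
move=> al am; have aa : \forall j \near U, a j <= a j by exact: nearW.
by apply/eqP; rewrite eq_le (ucvg_le al am aa) (ucvg_le am al aa).
Qed.

Lemma ucvgD {FF : Filter U} a b l m : ucvg a l -> ucvg b m ->
  ucvg (fun j => a j + b j) (l + m).
Proof.
move=> al bm e e0; have e2 : 0 < e / 2 by rewrite divr_gt0.
apply: filterS (filterI (al _ e2) (bm _ e2)) => j [].
by rewrite /= !ler_norml => /andP[h1 h2] /andP[h3 h4]; apply/andP; split; lra.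
Qed.

Lemma ucvgZ {FF : Filter U} (c : R) a l : ucvg a l -> ucvg (fun j => c * a j) (c * l).
Proof.
move=> al e e0; have c0 : 0 < `|c| + 1 by rewrite ltr_wpDl.
have e1 : 0 < e / (`|c| + 1) by rewrite divr_gt0.
apply: filterS (al _ e1) => j h.
rewrite -mulrBr normrM; apply: (@le_trans _ _ (`|c| * (e / (`|c| + 1)))).
  by rewrite ler_wpM2l.
by rewrite mulrCA ler_piMr ?ltW // ltr_pdivrMr // mul1r ltrDl.
Qed.

Lemma ucvg_le_cst {FF : ProperFilter U} a l c : ucvg a l -> (\forall j \near U, a j <= c) -> l <= c.
Proof. by move=> al; apply: ucvg_le al (ucvg_cst c). Qed.

Hypothesis UU : UltraFilter U.

Definition ulim (a : J -> R) : R := xget 0 [set l | ucvg a l].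

Lemma ulimP a (M : R) : (forall j, `|a j| <= M) -> ucvg a (ulim a).
Proof.
move=> aM.
have [l [_ al]] : exists l, `[- M, M]%classic l /\ a @ U --> l.
  have := @segment_compact R (- M) M; rewrite compact_ultra.
  move=> /(_ (a @ U) (ultra_map a UU)); apply.
  by apply: nearW => j; rewrite /= in_itv /= -ler_norml.
apply: (@xgetPex _ 0 [set l | ucvg a l]); exists l => e e0.
have : nbhs l [set y | `|y - l| <= e].
  apply: filterS (nbhsx_ballx l e e0) => y.
  by rewrite /ball /= distrC => /ltW.
exact: al.
Qed.

Lemma ulim_unique a l : ucvg a l -> ulim a = l.
Proof.
move=> al; apply: (@ucvg_unique _ a) => //.
by apply: (@xgetPex _ 0 [set l | ucvg a l]); exists l.
Qed.

End UltraLimit.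

(** * Dual bases, nets and almost orthogonal vectors *)

Section FiniteDimension.
Context (R : realType) (k : scalar_kind).
Local Notation K := (scal R k).

Definition lin_of (E F : lmodType K) (f : E -> F) (hf : linear f) : {linear E -> F} :=
  HB.pack f (GRing.isLinear.Build K E F _ f hf).

Lemma lin_ofE (E F : lmodType K) (f : E -> F) (hf : linear f) x : lin_of hf x = f x.
Proof. by []. Qed.

Section Independence.
Variable E : completeNormedModType K.

Definition independent n (v : 'I_n -> E) :=
  forall c : 'I_n -> K, \sum_(i < n) c i *: v i = 0 -> forall i, c i = 0.

Definition span_of n (v : 'I_n -> E) : set E :=
  [set x | exists c : 'I_n -> K, x = \sum_(i < n) c i *: v i].

Definition snoc n (v : 'I_n -> E) (y : E) (i : 'I_n.+1) : E :=
  if unlift ord_max i is Some j then v j else y.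

Lemma snoc_widen n (v : 'I_n -> E) y i : snoc v y (widen_ord (leqnSn n) i) = v i.
Proof.
rewrite /snoc (_ : widen_ord _ _ = lift ord_max i) ?liftK //.
by apply: val_inj; rewrite /= /bump leqNgt ltn_ord.
Qed.

Lemma snoc_max n (v : 'I_n -> E) y : snoc v y ord_max = y.
Proof. by rewrite /snoc unlift_none. Qed.

Lemma sum_snoc n (v : 'I_n -> E) y (c : 'I_n.+1 -> K) :
  \sum_(i < n.+1) c i *: snoc v y i =
  \sum_(i < n) c (widen_ord (leqnSn n) i) *: v i + c ord_max *: y.
Proof.
by rewrite big_ord_recr /= snoc_max; congr (_ + _); apply: eq_bigr => i _; rewrite snoc_widen.
Qed.

Lemma independent_snoc n (v : 'I_n -> E) y :
  independent v -> ~ span_of v y -> independent (snoc v y).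
Proof.
move=> vi yv c; rewrite sum_snoc => c0.
have cm : c ord_max = 0.
  apply: contrapT => /eqP cm; apply: yv; exists (fun i => - (c ord_max)^-1 * c (widen_ord (leqnSn n) i)).
  under eq_bigr do rewrite -scalerA; rewrite -scaler_sumr.
  have -> : \sum_(i < n) c (widen_ord (leqnSn n) i) *: v i = - (c ord_max *: y).
    by apply/eqP; rewrite -addr_eq0 c0.
  by rewrite scalerN scaleNr opprK scalerA mulVf // scale1r.
move: c0; rewrite cm scale0r addr0 => /vi c0 i.
case: (unliftP ord_max i) => [j ->|-> //]; have -> : lift ord_max j = widen_ord (leqnSn n) j; last exact: c0.
by apply: val_inj; rewrite /= /bump leqNgt ltn_ord.
Qed.

Lemma span_ofW n (v : 'I_n -> E) y x : span_of v x -> span_of (snoc v y) x.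
Proof.
move=> [c ->]; exists (fun i => if unlift ord_max i is Some j then c j else 0).
rewrite sum_snoc unlift_none scale0r addr0; apply: eq_bigr => i _.
rewrite (_ : widen_ord _ _ = lift ord_max i) ?liftK //.
by apply: val_inj; rewrite /= /bump leqNgt ltn_ord.
Qed.

Lemma span_of_snoc n (v : 'I_n -> E) y : span_of (snoc v y) y.
Proof.
exists (fun i => if unlift ord_max i is Some j then 0 else 1).
rewrite sum_snoc unlift_none scale1r big1 ?add0r // => i _.
rewrite (_ : widen_ord _ _ = lift ord_max i) ?liftK ?scale0r //.
by apply: val_inj; rewrite /= /bump leqNgt ltn_ord.
Qed.

Lemma span_of_lin n (v : 'I_n -> E) a x y : span_of v x -> span_of v y -> span_of v (a *: x + y).
Proof.
move=> [c ->] [d ->]; exists (fun i => a * c i + d i).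
rewrite scaler_sumr -big_split; apply: eq_bigr => i _.
by rewrite scalerDl scalerA.
Qed.

Lemma span_of0 n (v : 'I_n -> E) : span_of v 0.
Proof. by exists (fun=> 0); rewrite big1 // => i _; rewrite scale0r. Qed.

Lemma span_sub n m (v : 'I_n -> E) (w : 'I_m -> E) :
  (forall i, span_of w (v i)) -> span_of v `<=` span_of w.
Proof.
move=> vw _ [c ->]; elim/big_ind : _ => [|x y hx hy|i _]; first exact: span_of0.
  by rewrite -[x]scale1r; exact: span_of_lin.
by rewrite -[_ *: _]addr0; apply: span_of_lin => //; exact: span_of0.
Qed.

Lemma span_independent n (v : 'I_n -> E) : exists m (w : 'I_m -> E),
  independent w /\ span_of w = span_of v.
Proof.
suff h : forall s : seq E, exists m (w : 'I_m -> E), [/\ independent w,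
    (forall x, x \in s -> span_of w x) & forall i, w i \in s].
  have [m [w [wi ws sw]]] := h [seq v i | i <- enum 'I_n].
  exists m, w; split=> //; apply/seteqP; split; apply: span_sub => i.
    have /mapP [j _ ->] := sw i; exists (fun l => (l == j)%:R).
    rewrite (bigD1 j) //= eqxx scale1r big1 ?addr0 // => l /negPf ->.
    by rewrite scale0r.
  by apply: ws; apply: map_f; rewrite mem_enum.
elim=> [|y s [m [w [wi ws sw]]]].
  exists 0%N, (fun=> 0); split=> [c _ i||i]; by [case: i | ].
have [wy|wy] := pselect (span_of w y).
  exists m, w; split=> // [x|i]; last by rewrite inE sw orbT.
  by rewrite inE => /orP[/eqP ->|/ws].
exists m.+1, (snoc w y); split; first exact: independent_snoc.
  by move=> x; rewrite inE => /orP[/eqP ->|/ws]; [exact: span_of_snoc | exact: span_ofW].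
move=> i; rewrite /snoc inE; case: unlift => [j|]; last by rewrite eqxx.
by rewrite sw orbT.
Qed.

Lemma finite_dimE (V : set E) : finite_dim V -> exists n (v : 'I_n -> E),
  independent v /\ V = span_of v.
Proof. by move=> [n [v ->]]; have [m [w [wi wv]]] := span_independent v; exists m, w; split; last by rewrite wv. Qed.

Lemma dual_basis n (v : 'I_n -> E) : independent v ->
  exists f : 'I_n -> {linear E -> K^o},
    (forall i, continuous (f i)) /\ forall i j, f i (v j) = (i == j)%:R.
Proof.
elim: n v => [v _|n IH v vi]; first by exists (fun=> \0); split=> -[].
pose w i := lift ord_max i : 'I_n.+1.
pose v' i := v (w i); pose y := v ord_max.
have vE i : v i = snoc v' y i.
  by rewrite /snoc; case: unliftP => [j ->|->].
have v'i : independent v'.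
  move=> c c0 i; pose c' j := if unlift ord_max j is Some l then c l else 0.
  have : \sum_(j < n.+1) c' j *: v j = 0.
    under eq_bigr do rewrite vE.
    rewrite sum_snoc /c' unlift_none scale0r addr0 -[RHS]c0; apply: eq_bigr => j _.
    rewrite (_ : widen_ord _ _ = lift ord_max j) ?liftK //.
    by apply: val_inj; rewrite /= /bump leqNgt ltn_ord.
  by move=> /vi /(_ (w i)); rewrite /c' liftK.
have [f [fc fv]] := IH v' v'i.
(* [u] is the component of the last vector killed by all the [f i]. A functional [g] with
   [g u != 0], corrected by the [f i], becomes [h0], which is 0 on the [v' i] and 1 on [y];
   subtracting multiples of [h0] then corrects the [f i] at [y]. *)
pose u := y - \sum_(i < n) f i y *: v' i.
have u0 : u <> 0.
  move=> /eqP; rewrite subr_eq0 => /eqP yE.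
  have := vi (fun j => if unlift ord_max j is Some l then - f l y else 1).
  under eq_bigr do rewrite vE; rewrite sum_snoc unlift_none scale1r.
  rewrite (eq_bigr (fun i => - (f i y *: v' i))); last first.
    move=> i _; rewrite (_ : widen_ord _ _ = lift ord_max i) ?liftK ?scaleNr //.
    by apply: val_inj; rewrite /= /bump leqNgt ltn_ord.
  rewrite sumrN {2}yE addNr => /(_ erefl ord_max); rewrite unlift_none => /eqP.
  by rewrite oner_eq0.
have [g [gdom gu]] := hahn_banach u.
have gc : continuous g by apply: (@bounded_lin _ _ _ _ _ 1) => x; rewrite mul1r nrm_kabs.
have gu0 : g u != 0 by rewrite gu sc_eq0 gt_eqF // nrm_ge0_gt0.
have fu i : f i u = 0.
  rewrite linearB linear_sum (bigD1 i) //= linearZ /= fv eqxx big1.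
    by rewrite addr0 -[_ *: _]/(_ * _) mulr1 subrr.
  by move=> j ji; rewrite linearZ /= fv eq_sym (negPf ji) -[_ *: _]/(_ * _) mulr0.
pose h0 x : K^o := (g u)^-1 * (g x - \sum_(i < n) f i x * g (v' i)).
have h0lin : linear h0.
  move=> a x z; rewrite /h0 linearP -[_ *: g x]/(a * g x).
  under eq_bigr do rewrite linearP -[_ *: f _ x]/(a * f _ x) mulrDl -mulrA.
  by rewrite big_split /= -mulr_sumr -[_ *: _]/(a * _); ring.
have h0c : continuous (lin_of h0lin).
  have [M M0 gM] := lin_bounded gc.
  have /choice [L LP] i : exists L, 0 < L /\ forall x, nrm (f i x) <= L * nrm x.
    by have [L L0 fL] := lin_bounded (fc i); exists L.
  apply: (@bounded_lin _ _ _ _ _ (kabs (g u)^-1 * (M + \sum_(i < n) L i * kabs (g (v' i))))) => x.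
  rewrite lin_ofE nrm_kabs kabsM -mulrA ler_wpM2l ?kabs_ge0 //.
  rewrite (le_trans (kabsD _ _)) // kabsN mulrDl lerD //; first exact: gM.
  rewrite mulr_suml; apply: le_trans (@nrm_sum R k K^o _ _ _ _) _; apply: ler_sum => i _.
  rewrite nrm_kabs kabsM mulrAC ler_wpM2r ?kabs_ge0 //; exact: (LP i).2.
have h0v i : h0 (v' i) = 0.
  rewrite /h0 (bigD1 i) //= fv eqxx mul1r big1 ?addr0 ?subrr ?mulr0 // => j ji.
  by rewrite fv (negPf ji) mul0r.
have h0y : h0 y = 1.
  have guE : g u = g y - \sum_(i < n) f i y * g (v' i).
    rewrite [in LHS]/u linearB linear_sum; congr (g y - _).
    by apply: eq_bigr => i _; rewrite linearZ.
  by rewrite /h0 -guE mulVf.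
pose hh i x : K^o := if unlift ord_max i is Some j then f j x - f j y * h0 x else h0 x.
have hhlin i : linear (hh i).
  move=> a x z; rewrite /hh; case: unlift => [j|]; last exact: h0lin.
  by rewrite linearP h0lin -![_ *: _]/(_ * _); ring.
exists (fun i => lin_of (hhlin i)); split.
  move=> i; have [M M0 hM] := lin_bounded h0c.
  apply: (@bounded_lin _ _ _ _ _ (if unlift ord_max i is Some j then
    projT1 (cid2 (lin_bounded (fc j))) + kabs (f j y) * M else M)) => x.
  rewrite lin_ofE /hh; case: unlift => [j|]; last exact: hM.
  case: cid2 => L L0 fL /=; rewrite nrm_kabs (le_trans (kabsD _ _)) // kabsN kabsM mulrDl.
  by rewrite lerD //; [exact: fL | rewrite -mulrA ler_wpM2l ?kabs_ge0 //; exact: hM].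
move=> i j; rewrite lin_ofE /hh.
have [i'|] := unliftP ord_max i; have [j'|] := unliftP ord_max j.
- by move=> -> ->; rewrite (inj_eq (@lift_inj _ _)) -[v _]/(v' _) fv h0v mulr0 subr0.
- by move=> -> ->; rewrite -[v _]/y h0y mulr1 subrr eq_sym (negPf (neq_lift _ _)).
- by move=> -> ->; rewrite -[v _]/(v' _) h0v (negPf (neq_lift _ _)).
- by move=> -> ->; rewrite -[v _]/y h0y eqxx.
Qed.

Lemma coord_bound n (v : 'I_n -> E) : independent v ->
  exists2 L : R, 0 < L & forall c : 'I_n -> K, forall i,
    kabs (c i) <= L * nrm (\sum_(i < n) c i *: v i).
Proof.
move=> /dual_basis [f [fc fv]].
have /choice [L LP] i : exists L, 0 < L /\ forall x, nrm (f i x) <= L * nrm x.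
  by have [L L0 fL] := lin_bounded (fc i); exists L.
exists (1 + \sum_(i < n) L i) => [|c i].
  by rewrite ltr_pwDl // sumr_ge0 // => i _; exact: ltW (LP i).1.
have := (LP i).2 (\sum_(j < n) c j *: v j).
rewrite linear_sum (bigD1 i) //= linearZ /= fv eqxx big1 ?addr0; last first.
  by move=> j ji; rewrite linearZ /= fv eq_sym (negPf ji) -[_ *: _]/(_ * _) mulr0.
rewrite -[_ *: _]/(_ * _) mulr1 nrm_kabs => h; apply: (le_trans h).
rewrite ler_wpM2r ?nrm_ge0 // (bigD1 i) //= addrCA lerDl addr_ge0 //.
by apply: sumr_ge0 => j _; exact: ltW (LP j).1.
Qed.

Lemma infinite_dim_independent : ~ finite_dim [set: E] ->
  forall n, exists v : 'I_n -> E, independent v.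
Proof.
move=> Einf; elim=> [|n [v vi]]; first by exists (fun=> 0) => c _ [].
have [y yv] : exists y, ~ span_of v y.
  apply: contrapT => /forallNP h; apply: Einf; exists n, v; apply/seteqP; split=> // y _.
  exact: contrapT (h y).
by exists (snoc v y); exact: independent_snoc.
Qed.

(** Riesz's lemma: take a nonzero continuous functional [g] that vanishes on [s], and [z] in the
    unit ball with |g z| more than half the norm of [g]. Then |g| |x - z| >= |g z| for every [x] in
    [s]. *)
Lemma riesz_vector (s : seq E) : ~ finite_dim [set: E] ->
  exists z, nrm z <= 1 /\ forall x, x \in s -> 1 / 2 <= nrm (x - z).
Proof.
move=> Einf; pose v (i : 'I_(size s)) := nth 0 s i.
have [m [w [wi wv]]] := span_independent v.
have [y yw] : exists y, ~ span_of w y.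
  apply: contrapT => /forallNP h; apply: Einf; exists m, w; apply/seteqP; split=> // y _.
  exact: contrapT (h y).
have [f [fc fw]] := dual_basis (independent_snoc wi yw).
pose g := f ord_max.
have gs x : x \in s -> g x = 0.
  move=> xs; have : span_of w x.
    rewrite wv; have xi : (index x s < size s)%N by rewrite index_mem.
    exists (fun i => (i == Ordinal xi)%:R); rewrite (bigD1 (Ordinal xi)) //= eqxx scale1r.
    by rewrite /v /= nth_index // big1 ?addr0 // => i /negPf ->; rewrite scale0r.
  move=> [c ->]; rewrite linear_sum big1 // => i _; rewrite linearZ /=.
  have := fw ord_max (widen_ord (leqnSn m) i); rewrite snoc_widen => ->.
  rewrite (_ : _ == _ = false) -?[_ *: _]/(_ * _) ?mulr0 //.
  by apply/eqP => /(congr1 val) /=; have := ltn_ord i; rewrite ltn_neqAle => /andP[/eqP h _] /esym.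
have gy : g y = 1 by have := fw ord_max ord_max; rewrite snoc_max eqxx.
have [M M0 gM] := lin_bounded (fc ord_max).
pose A := [set kabs (g x) | x in [set x | nrm x <= 1]].
have Asup : has_sup A.
  split; first by exists (kabs (g 0)), 0 => //=; rewrite nrm0.
  exists M => _ [x /= x1 <-]; rewrite (le_trans (gM x)) // ler_piMr // ltW //.
have y0 : y <> 0 by move=> y0; move: gy; rewrite y0 linear0 => /esym/eqP; rewrite oner_eq0.
have ny := nrm_ge0_gt0 y0.
have A0 : 0 < sup A.
  apply: (@lt_le_trans _ _ (nrm y)^-1); first by rewrite invr_gt0.
  apply: sup_upper_bound => //; exists (sc (nrm y)^-1 *: y) => /=.
    by rewrite nrmZ kabs_sc gtr0_norm ?invr_gt0 // mulVf // gt_eqF.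
  by rewrite linearZ /= gy -[_ *: _]/(_ * _) mulr1 kabs_sc gtr0_norm ?invr_gt0.
have A2 : 0 < sup A / 2 by rewrite divr_gt0.
have [_ [z /= z1 <-] zA] := sup_adherent A2 Asup.
exists z; split=> // x xs.
have xz : x <> z.
  move=> xz; move: zA; rewrite -xz gs // kabs0; lra.
have nxz : 0 < nrm (x - z) by apply: nrm_ge0_gt0 => /eqP; rewrite subr_eq0 => /eqP.
have : kabs (g (sc (nrm (x - z))^-1 *: (x - z))) <= sup A.
  apply: sup_upper_bound => //; exists (sc (nrm (x - z))^-1 *: (x - z)) => //=.
  by rewrite nrmZ kabs_sc gtr0_norm ?invr_gt0 // mulVf // gt_eqF.
rewrite linearZ /= linearB gs // sub0r -[_ *: _]/(_ * _) kabsM kabsN kabs_sc.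
rewrite gtr0_norm ?invr_gt0 // ler_pdivrMl // => h.
by rewrite -(ler_pM2r A0); lra.
Qed.

Lemma separated_sequence : ~ finite_dim [set: E] -> exists z : nat -> E,
  (forall n, nrm (z n) <= 1) /\ forall m n, (m < n)%N -> 1 / 2 <= nrm (z m - z n).
Proof.
move=> Einf; have /choice [f fP] s := riesz_vector s Einf.
pose l := fix l n := if n is n'.+1 then f (l n') :: l n' else [::].
exists (fun n => f (l n)); split=> [n|m n mn]; first exact: (fP _).1.
apply: (fP _).2; elim: n mn => // n IH; rewrite ltnS leq_eqVlt => /orP[/eqP ->|/IH h] /=.
  by rewrite inE eqxx.
by rewrite inE h orbT.
Qed.

End Independence.

Lemma scalar_net (e : R) : 0 < e -> exists s : seq K, forall z : K, kabs z <= 1 ->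
  exists2 z', z' \in s & kabs (z - z') <= e.
Proof.
move=> e0; pose d := e / 2; have d0 : 0 < d by rewrite divr_gt0.
pose M := (Num.truncn (2 / d)).+1.
pose g i : R := i%:R * d - 1.
pose s := [seq sc (g i) + sc_i * sc (g j) | i <- iota 0 M, j <- iota 0 M] : seq K.
have grid (r : R) : `|r| <= 1 -> exists2 i, i \in iota 0 M & `|r - g i| <= d.
  rewrite ler_norml => /andP[r1 r2].
  have rd : 0 <= (r + 1) / d by apply: divr_ge0; [lra | exact: ltW].
  exists (Num.truncn ((r + 1) / d)).
    rewrite mem_iota add0n /M ltnS; apply: le_truncn.
    by rewrite ler_pM2r ?invr_gt0 //; lra.
  have /andP[h1 h2] := truncn_itv rd; rewrite ler_pdivlMr // in h1.
  rewrite ltr_pdivrMr // in h2; rewrite -natr1 mulrDl mul1r in h2.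
  by rewrite /g ler_norml; apply/andP; split; lra.
exists s => z z1.
have [i iM ri] := grid _ (le_trans (kabs_re z) z1).
have [j jM rj] := grid _ (le_trans (kabs_im z) z1).
exists (sc (g i) + sc_i * sc (g j)); first by apply/allpairsP; exists (i, j).
rewrite {1}(sc_decomp z) opprD addrACA -mulrBr -!scB.
rewrite (le_trans (kabsD _ _)) // kabsM !kabs_sc.
have := ler_wpM2r (normr_ge0 (sc_im z - g j)) (@kabs_sci R k).
by rewrite mul1r => h; move: ri rj; rewrite /d; lra.
Qed.

Lemma vector_net n (e : R) : 0 < e -> exists s : seq {ffun 'I_n -> K},
  forall c : 'I_n -> K, (forall i, kabs (c i) <= 1) ->
  exists2 c', c' \in s & forall i, kabs (c i - c' i) <= e.
Proof.
move=> /scalar_net [s sP].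
exists [seq [ffun i => nth 0 s (f i)] | f : {ffun 'I_n -> 'I_(size s).+1} <- enum {ffun 'I_n -> 'I_(size s).+1}] => c c1.
have /choice [f fP] i : exists z, z \in s /\ kabs (c i - z) <= e.
  by have [z zs cz] := sP _ (c1 i); exists z.
exists [ffun i => f i]; last by move=> i; rewrite ffunE; exact: (fP i).2.
apply/mapP; exists [ffun i => inord (index (f i) s)]; first by rewrite mem_enum.
apply/ffunP => i; rewrite !ffunE inordK ?nth_index ?(fP i).1 //.
by rewrite ltnS index_size.
Qed.

End FiniteDimension.

(** * Finite representability *)

Section FiniteRepresentability.
Context (R : realType) (k : scalar_kind).
Local Notation K := (scal R k).
Local Notation banach := (completeNormedModType K).

Lemma near_all_seq (J : Type) (I : eqType) (U : set_system J) {FF : Filter U} (s : seq I)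
    (P : I -> J -> Prop) :
  (forall i, i \in s -> \forall j \near U, P i j) ->
  \forall j \near U, forall i, i \in s -> P i j.
Proof.
elim: s => [|x s IH] h; first by apply: nearW => j i.
have hx : U [set j | P x j] by apply: h; rewrite inE eqxx.
have hs : U [set j | forall i, i \in s -> P i j].
  by apply: IH => i si; apply: h; rewrite inE si orbT.
by apply: filterS (filterI hx hs) => j [/= h1 h2] i; rewrite inE => /orP[/eqP ->|/h2].
Qed.

Lemma nrm_comb_lip (E : banach) n (v : 'I_n -> E) (c d : 'I_n -> K) e :
  (forall i, kabs (c i - d i) <= e) ->
  `|nrm (\sum_(i < n) c i *: v i) - nrm (\sum_(i < n) d i *: v i)| <=
  e * \sum_(i < n) nrm (v i).
Proof.
move=> cd; apply: le_trans (nrm_lip _ _) _.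
rewrite -sumrB mulr_sumr; apply: le_trans (nrm_sum _ _ _) _; apply: ler_sum => i _.
by rewrite -scalerBl nrmZ ler_wpM2r ?nrm_ge0.
Qed.

Section Limit.
Variables (J : Type) (U : set_system J).
Context {UP : ProperFilter U}.
Variable E : J -> banach.

(** Turns convergence for each coefficient vector into a relative error uniform in the coefficients.
    A finite net settles the polydisc |c i| <= 1, on which the norms are Lipschitz; the rest is
    homogeneity, because by [coord_bound] dividing by [L * nrm y] brings the coefficients into the
    polydisc. *)
Lemma comb_uniform (Y : banach) n (v : 'I_n -> Y) (w : forall j, 'I_n -> E j) (e : R) :
  independent v -> 0 < e ->
  (forall c : 'I_n -> K, ucvg U (fun j => nrm (\sum_(i < n) c i *: w j i))
     (nrm (\sum_(i < n) c i *: v i))) ->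
  \forall j \near U, forall c : 'I_n -> K,
    `|nrm (\sum_(i < n) c i *: w j i) - nrm (\sum_(i < n) c i *: v i)| <=
    e * nrm (\sum_(i < n) c i *: v i).
Proof.
move=> vi e0 wv; have [L L0 vL] := coord_bound vi.
pose eta := e / L; have eta0 : 0 < eta by rewrite divr_gt0.
pose B := \sum_(i < n) (2 * nrm (v i) + 1).
have B0 : 0 <= B by apply: sumr_ge0 => i _; rewrite addr_ge0 // mulr_ge0 // nrm_ge0.
pose d := eta / (2 * (B + 1)).
have d0 : 0 < d by rewrite divr_gt0 // mulr_gt0 // ltr_wpDl.
have dB : d * B <= eta / 2.
  rewrite /d -mulrA ler_wpM2l ?(ltW eta0) // ler_pdivrMl ?mulr_gt0 ?ltr_wpDl //; lra.
have eta2 : 0 < eta / 2 by rewrite divr_gt0.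
have [s sP] := @vector_net R k n _ d0.
have near1 : \forall j \near U, forall c, c \in s ->
    `|nrm (\sum_(i < n) c i *: w j i) - nrm (\sum_(i < n) c i *: v i)| <= eta / 2.
  by apply: near_all_seq => c _; exact: wv.
have delta (X : banach) (x : 'I_n -> X) i :
    \sum_(l < n) (l == i)%:R *: x l = x i.
  by rewrite (bigD1 i) //= eqxx scale1r big1 ?addr0 // => l /negPf ->; rewrite scale0r.
have near2 : \forall j \near U, forall i, i \in enum 'I_n -> nrm (w j i) <= nrm (v i) + 1.
  apply: near_all_seq => i _; have := wv (fun l => (l == i)%:R) 1 ltr01.
  apply: filterS => j; rewrite !delta ler_norml => /andP[_]; lra.
apply: filterS (filterI near1 near2) => j [/= h1 h2].
have unif c : (forall i, kabs (c i) <= 1) ->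
    `|nrm (\sum_(i < n) c i *: w j i) - nrm (\sum_(i < n) c i *: v i)| <= eta.
  move=> /sP [c' c's cc'].
  have := nrm_comb_lip (w j) cc'; have := nrm_comb_lip v cc'; have := h1 _ c's.
  have : d * (\sum_(i < n) nrm (v i)) + d * (\sum_(i < n) nrm (w j i)) <= d * B.
    rewrite -mulrDr ler_wpM2l ?(ltW d0) // -big_split; apply: ler_sum => i _ /=.
    by have := h2 i; rewrite mem_enum => /(_ isT); lra.
  rewrite !ler_norml => k1 /andP[k2 k3] /andP[k4 k5] /andP[k6 k7].
  by apply/andP; split; lra.
move=> c; set y := \sum_(i < n) c i *: v i.
have [y0|/eqP y0] := eqVneq (nrm y) 0.
  have c0 i : c i = 0.
    apply/eqP; rewrite -kabs_eq0 eq_le kabs_ge0 andbT.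
    by have := vL c i; rewrite -/y y0 mulr0.
  by rewrite y0 big1 ?nrm0 ?subrr ?normr0 ?mulr0 // => i _; rewrite c0 scale0r.
have yp : 0 < nrm y by rewrite lt_neqAle eq_sym nrm_ge0 andbT; apply/eqP.
pose r := (L * nrm y)^-1; have r0 : 0 < r by rewrite invr_gt0 mulr_gt0.
have /unif : forall i, kabs (sc r * c i) <= 1.
  move=> i; rewrite kabsM kabs_sc gtr0_norm // /r ler_pdivrMl ?mulr_gt0 //.
  by rewrite mulr1; exact: vL.
have sumZ (X : banach) (x : 'I_n -> X) :
    nrm (\sum_(i < n) (sc r * c i) *: x i) = r * nrm (\sum_(i < n) c i *: x i).
  under eq_bigr do rewrite -scalerA.
  by rewrite -scaler_sumr nrmZ kabs_sc gtr0_norm.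
rewrite !sumZ -/y -mulrBr normrM gtr0_norm // /r ler_pdivrMl ?mulr_gt0 //.
by rewrite /eta mulrC mulrA divfK ?gt_eqF.
Qed.

(** Most memberships in the class are obtained from this criterion: it suffices to realize the norms
    of finite families of [Y] as limits of norms in members of the class. The map of [v] to [w j] is
    then almost isometric on the span for a suitable [j]. *)
Lemma fr_limit (EE : banach -> Prop) (Y : banach) :
  stable_by_finite_representability EE -> (forall j, EE (E j)) ->
  (forall n (v : 'I_n -> Y), exists w : forall j, 'I_n -> E j,
     forall c : 'I_n -> K, ucvg U (fun j => nrm (\sum_(i < n) c i *: w j i))
       (nrm (\sum_(i < n) c i *: v i))) -> EE Y.
Proof.
move=> EEs EEE lim; apply: EEs => V /finite_dimE [n [v [vi ->]]] eps eps0.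
have [w wv] := lim n v.
have [f [fc fv]] := dual_basis vi.
(* Makes the distortion (1 + e) / (1 - e) equal to 1 + 2 eps / 3. *)
pose e := eps / (3 + eps).
have e3 : 0 < 3 + eps by rewrite addr_gt0.
have e0 : 0 < e by rewrite divr_gt0.
have e1 : e * (3 + eps) = eps by rewrite /e divfK // gt_eqF.
have elt1 : e < 1 by rewrite /e ltr_pdivrMr // mul1r; lra.
have /filter_ex [j jP] := comb_uniform vi e0 wv.
pose T y := \sum_(i < n) f i y *: w j i.
have Tlin a x y : T (a *: x + y) = a *: T x + T y.
  rewrite /T scaler_sumr -big_split; apply: eq_bigr => i _.
  by rewrite linearP scalerDl scalerA.
have TB x y : T (x - y) = T x - T y.
  by have := Tlin (-1) y x; rewrite !scaleN1r addrC => ->; rewrite addrC.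
have fE x : span_of v x -> x = \sum_(i < n) f i x *: v i.
  move=> [c ->]; apply: eq_bigr => i _; congr (_ *: _).
  rewrite linear_sum (bigD1 i) //= linearZ /= fv eqxx big1 ?addr0.
    by rewrite -[_ *: _]/(_ * _) mulr1.
  by move=> l li; rewrite linearZ /= fv eq_sym (negPf li) -[_ *: _]/(_ * _) mulr0.
have Tn x : span_of v x -> `|nrm (T x) - nrm x| <= e * nrm x.
  by move=> /fE xE; have := jP (fun i => f i x); rewrite -xE.
have b0 : 0 < 1 - e by lra.
exists (E j), (T @` span_of v); split=> //.
  split; first by exists 0; [exact: span_of0 | rewrite -(subrr 0) TB subrr].
  by move=> a _ _ [x Vx <-] [y Vy <-]; exists (a *: x + y); [exact: span_of_lin | rewrite Tlin].
apply: (@le_lt_trans _ _ ((1 + e) * (1 - e)^-1)%:E); last first.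
  rewrite lte_fin ltr_pdivrMr //; nra.
apply: ereal_inf_lbound; exists T, (1 + e), (1 - e)^-1; split=> //.
- split=> [x Vx|x y|//]; first by exists x.
  rewrite !inE => Vx Vy Txy.
  have := Tn (x - y); rewrite TB Txy subrr nrm0 sub0r normrN.
  have -> : x - y = (-1) *: y + x by rewrite scaleN1r addrC.
  move=> /(_ (span_of_lin _ Vy Vx)); set z := _ + x; rewrite ger0_norm ?nrm_ge0 // => h.
  have z0 : nrm z = 0.
    apply/eqP; rewrite eq_le nrm_ge0 andbT leNgt; apply/negP => z0.
    by move: h; rewrite -{1}[nrm z]mul1r ler_pM2r //; lra.
  by apply/eqP; rewrite -subr_eq0; apply/eqP; rewrite -(nrm_eq0 z0) /z scaleN1r addrC.
- split; first by lra.
  by move=> x Vx; have := Tn x Vx; rewrite ler_norml => /andP[h1 h2]; nra.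
- split; first by rewrite invr_ge0 ltW.
  by move=> x Vx; rewrite ler_pdivlMl //; have := Tn x Vx; rewrite ler_norml => /andP[h1 h2]; nra.
Qed.

End Limit.

(** A constant family along the filter of a one-point set. The same choice serves below whenever a
    space embeds isometrically in a member of the class. *)
Lemma EE_isometric (EE : banach -> Prop) (X Y : banach) :
  stable_by_finite_representability EE -> EE X -> isometric Y X -> EE Y.
Proof.
move=> EEs EX [T [_ TY]].
apply: (@fr_limit unit (principal_filter tt) (principal_filter_proper tt) (fun=> X)) => // n v.
exists (fun _ i => T (v i)) => c; rewrite (_ : (fun _ => _) = fun=> nrm (\sum_(i < n) c i *: v i)).
  exact: ucvg_cst.
apply/funext => _; rewrite /nrm -TY linear_sum; congr (sc_re `|_|).
by apply: eq_bigr => i _; rewrite linearZ.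
Qed.

Lemma real_complete (u : nat -> R) :
  (forall e : R, 0 < e -> exists n0, forall m n, (n0 <= m)%N -> (n0 <= n)%N ->
     `|u m - u n| <= e) ->
  exists l, forall e : R, 0 < e -> exists n0, forall n, (n0 <= n)%N -> `|u n - l| <= e.
Proof.
move=> h; have [l ul] : exists l : R, u @ \oo --> l.
  suff : cvg (u @ \oo) by move=> c; exists (lim (u @ \oo)).
  apply: cauchy_cvg; apply/cauchyP => e e0.
  have [|n0 hn0] := h (e / 2); first by rewrite divr_gt0.
  exists (u n0); exists n0 => // n /= n0n.
  rewrite /ball /= (le_lt_trans (hn0 _ _ (leqnn _) n0n)) //.
  by rewrite ltr_pdivrMr // ltr_pMr // ltr1n.
exists l => e e0; move/cvgrPdist_le : ul => /(_ e e0) [n0 _ hn0].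
by exists n0 => n /hn0 /=; rewrite distrC.
Qed.

Lemma scal_complete (u : nat -> K) :
  (forall e : R, 0 < e -> exists n0, forall m n, (n0 <= m)%N -> (n0 <= n)%N ->
     kabs (u m - u n) <= e) ->
  exists l, forall e : R, 0 < e -> exists n0, forall n, (n0 <= n)%N -> kabs (u n - l) <= e.
Proof.
move=> h.
have imB (x y : K) : sc_im (x - y) = sc_im x - sc_im y.
  have -> : sc_im x = sc_im (x - y) + sc_im y by rewrite -sc_imD subrK.
  by rewrite addrK.
have [a ua] : exists l, forall e : R, 0 < e -> exists n0, forall n, (n0 <= n)%N ->
    `|sc_re (u n) - l| <= e.
  apply: real_complete => e /h [n0 hn0]; exists n0 => m n m0 n1.
  by rewrite -sc_reB (le_trans (kabs_re _)) // hn0.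
have [b ub] : exists l, forall e : R, 0 < e -> exists n0, forall n, (n0 <= n)%N ->
    `|sc_im (u n) - l| <= e.
  apply: real_complete => e /h [n0 hn0]; exists n0 => m n m0 n1.
  by rewrite -imB (le_trans (kabs_im _)) // hn0.
exists (sc a + sc_i * sc b) => e e0; have e2 : 0 < e / 2 by rewrite divr_gt0.
have [n1 h1] := ua _ e2; have [n2 h2] := ub _ e2; exists (maxn n1 n2) => n.
rewrite geq_max => /andP[/h1 k1 /h2 k2].
rewrite {1}(sc_decomp (u n)) opprD addrACA -mulrBr -!scB.
rewrite (le_trans (kabsD _ _)) // kabsM !kabs_sc.
have := ler_wpM2r (normr_ge0 (sc_im (u n) - b)) (@kabs_sci R k).
rewrite mul1r; lra.
Qed.

(** The space E (+) K with a prescribed norm [p]; [L x t] is the pair (x, t). Equivalence with the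
    sum norm gives completeness. *)
Lemma sum_norm_space (E : banach) (p : E -> K -> R) (c1 c2 : R) :
  (forall a x t, p (a *: x) (a * t) = kabs a * p x t) ->
  (forall x y s t, p (x + y) (s + t) <= p x s + p y t) ->
  0 < c1 -> (forall x t, c1 * (nrm x + kabs t) <= p x t) ->
  (forall x t, p x t <= c2 * (nrm x + kabs t)) ->
  exists (Y : banach) (L : E -> K -> Y),
    [/\ (forall a x y s t, L (a *: x + y) (a * s + t) = a *: L x s + L y t),
        (forall y, exists x t, y = L x t) & (forall x t, nrm (L x t) = p x t)].
Proof.
move=> pZ pD c10 plb pub.
pose V : lmodType K := (E * K^o)%type.
have VT (A : set V) : A = setT -> forall x, A x by move=> ->.
have hc : forall u : nat -> V, (forall n, setT (u n)) ->
    (forall e : R, 0 < e -> exists n0, forall m n, (n0 <= m)%N -> (n0 <= n)%N ->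
       p (u m - u n).1 (u m - u n).2 <= e) ->
    exists2 l, setT l & forall e : R, 0 < e -> exists n0, forall n, (n0 <= n)%N ->
       p (u n - l).1 (u n - l).2 <= e.
  move=> u _ h.
  have h' e : 0 < e -> exists n0, forall m n, (n0 <= m)%N -> (n0 <= n)%N ->
      nrm ((u m).1 - (u n).1) + kabs ((u m).2 - (u n).2) <= e.
    move=> e0; have [|n0 hn0] := h (c1 * e); first by rewrite mulr_gt0.
    exists n0 => m n hm hn; have := hn0 _ _ hm hn.
    by move=> /(le_trans (plb _ _)); rewrite ler_pM2l.
  have [x xP] : exists x : E, (fun n => (u n).1) @ \oo --> x.
    apply: complete_seq => e /h' [n0 hn0]; exists n0 => m n hm hn.
    by have := hn0 _ _ hm hn; have := kabs_ge0 ((u m).2 - (u n).2); lra.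
  have [t tP] : exists l, forall e : R, 0 < e -> exists n0, forall n, (n0 <= n)%N ->
      kabs ((u n).2 - l) <= e.
    apply: scal_complete => e /h' [n0 hn0]; exists n0 => m n hm hn.
    by have := hn0 _ _ hm hn; have := nrm_ge0 ((u m).1 - (u n).1); lra.
  exists (x, t) => // e e0; pose d := e / (2 * (`|c2| + 1)).
  have c20 : 0 < `|c2| + 1 by rewrite ltr_wpDl.
  have d0 : 0 < d by rewrite divr_gt0 // mulr_gt0.
  have [n1 _ h1] := proj1 (nrm_cvgP _ _ _) xP d d0.
  have [n2 h2] := tP _ d0; exists (maxn n1 n2) => n.
  rewrite geq_max => /andP[/h1 /= k1 /h2 k2].
  rewrite (le_trans (pub _ _)) //= (@le_trans _ _ ((`|c2| + 1) * (d + d))) //.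
    apply: (@le_trans _ _ ((`|c2| + 1) * (nrm ((u n).1 - x) + kabs ((u n).2 - t)))).
      rewrite ler_wpM2r ?addr_ge0 ?nrm_ge0 ?kabs_ge0 //.
      by rewrite (le_trans (ler_norm _)) // lerDl.
    by rewrite ler_pM2l // lerD // ltW.
  rewrite -mulr2n -[d *+ 2]mulr_natl /d.
  suff -> : (`|c2| + 1) * (2 * (e / (2 * (`|c2| + 1)))) = e by [].
  by field; rewrite gt_eqF.
pose X := @SeminormedSpace R k V setT (fun z => p z.1 z.2) I (fun _ _ _ _ _ => I)
  (fun a z _ => pZ a z.1 z.2) (fun z w _ _ => pD z.1 w.1 z.2 w.2) hc.
exists (sn_quot X), (fun x t => @sn_proj R k X (x, t)); split.
- by move=> a x y s t; rewrite -sn_proj_linear.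
- by move=> y; exists (sn_rep y).1, (sn_rep y).2; rewrite -surjective_pairing sn_repK.
- by move=> x t; rewrite nrm_sn_proj.
Qed.

(** Linearity in the pair [(x, t)], not bilinearity. *)
Definition bilin (E F : banach) (T : E -> K -> F) :=
  forall a x y s t, T (a *: x + y) (a * s + t) = a *: T x s + T y t.

Lemma bilin0 (E F : banach) (T : E -> K -> F) : bilin T -> T 0 0 = 0.
Proof.
move=> TL; have := TL (-1) 0 0 0 0; rewrite !scaler0 mulr0 !addr0 scaleN1r => ->.
by rewrite addNr.
Qed.

Lemma bilin_sum (E F : banach) (T : E -> K -> F) n (c t : 'I_n -> K) (x : 'I_n -> E) :
  bilin T -> \sum_(i < n) c i *: T (x i) (t i) = T (\sum_(i < n) c i *: x i) (\sum_(i < n) c i * t i).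
Proof.
move=> TL; elim: n c t x => [|n IH] c t x; first by rewrite !big_ord0 bilin0.
by rewrite !big_ord_recl IH TL.
Qed.

Lemma sum_limit (EE : banach -> Prop) (E : banach) (J : Type) (U : set_system J)
    {UP : ProperFilter U} (F : J -> banach) (T : forall j, E -> K -> F j)
    (p : E -> K -> R) (c1 c2 : R) :
  stable_by_finite_representability EE -> (forall j, EE (F j)) ->
  (forall j, bilin (T j)) -> (forall x t, ucvg U (fun j => nrm (T j x t)) (p x t)) ->
  0 < c1 -> (forall x t, c1 * (nrm x + kabs t) <= p x t) ->
  (forall x t, p x t <= c2 * (nrm x + kabs t)) ->
  exists (Y : banach) (L : E -> K -> Y), [/\ EE Y, bilin L,
    (forall y, exists x t, y = L x t) & (forall x t, nrm (L x t) = p x t)].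
Proof.
move=> EEs EF TL Tp c10 plb pub.
have TZ j a x t : T j (a *: x) (a * t) = a *: T j x t.
  by have := TL j a x 0 t 0; rewrite !addr0 (bilin0 (TL j)) addr0.
have TD j x y s t : T j (x + y) (s + t) = T j x s + T j y t.
  by have := TL j 1 x y s t; rewrite !scale1r mul1r.
have pZ a x t : p (a *: x) (a * t) = kabs a * p x t.
  apply: (@ucvg_unique _ _ U _ _ _ _ (Tp _ _)).
  rewrite (_ : (fun j => _) = fun j => kabs a * nrm (T j x t)); first exact: ucvgZ.
  by apply/funext => j; rewrite TZ nrmZ.
have pD x y s t : p (x + y) (s + t) <= p x s + p y t.
  apply: (@ucvg_le _ _ U _ _ _ _ _ (Tp _ _) (ucvgD (Tp x s) (Tp y t))).
  by apply: nearW => j; rewrite TD nrmD.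
have [Y [L [LL Ls Lp]]] := @sum_norm_space E p c1 c2 pZ pD c10 plb pub.
exists Y, L; split=> //; apply: (@fr_limit J U UP F) => // n v.
have /choice [xt xtP] i : exists xt : E * K, v i = L xt.1 xt.2.
  by have [x [t ->]] := Ls (v i); exists (x, t).
exists (fun j i => T j (xt i).1 (xt i).2) => c.
have -> : \sum_(i < n) c i *: v i = L (\sum_(i < n) c i *: (xt i).1) (\sum_(i < n) c i * (xt i).2).
  by rewrite -bilin_sum //; apply: eq_bigr => i _; rewrite xtP.
rewrite Lp (_ : (fun j => _) = fun j =>
  nrm (T j (\sum_(i < n) c i *: (xt i).1) (\sum_(i < n) c i * (xt i).2))); first exact: Tp.
by apply/funext => j; rewrite bilin_sum.
Qed.

(** If [E] is infinite dimensional, the new direction is the limit along an ultrafilter of a bounded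
    separated sequence: the norm is the limit of |x + t z_n|, and separation forbids [x] to cancel t
    z_n for two indices at once. If [E] is finite dimensional, a linear embedding of E (+) K in the
    infinite dimensional member of the class induces the norm, equivalent to the sum norm by
    finiteness of the dimension. *)
Lemma sum_in_class (EE : banach -> Prop) (E : banach) :
  stable_by_finite_representability EE ->
  (exists2 X : banach, EE X & ~ finite_dim [set: X]) -> EE E ->
  exists (Y : banach) (L : E -> K -> Y) (c1 c2 : R),
    [/\ EE Y, bilin L, (forall y, exists x t, y = L x t), (0 < c1 /\ 0 < c2) &
        (forall x t, c1 * (nrm x + kabs t) <= nrm (L x t) /\
                     nrm (L x t) <= c2 * (nrm x + kabs t))].
Proof.
move=> EEs [X EX Xinf] EEE.
have [/finite_dimE [n [v [vi vE]]]|Einf] := pselect (finite_dim [set: E]).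
  have [w wi] := infinite_dim_independent Xinf n.+1.
  have [f [fc fv]] := dual_basis vi.
  have fE x : x = \sum_(i < n) f i x *: v i.
    have : span_of v x by rewrite -vE.
    move=> [c ->]; apply: eq_bigr => i _; congr (_ *: _).
    rewrite linear_sum (bigD1 i) //= linearZ /= fv eqxx big1 ?addr0.
      by rewrite -[_ *: _]/(_ * _) mulr1.
    by move=> l li; rewrite linearZ /= fv eq_sym (negPf li) -[_ *: _]/(_ * _) mulr0.
  pose T x (t : K) := \sum_(i < n) f i x *: w (widen_ord (leqnSn n) i) + t *: w ord_max.
  have TL : bilin T.
    move=> a x y s t; rewrite /T scalerDr scaler_sumr addrACA -big_split scalerA -scalerDl.
    by congr (_ + _); apply: eq_bigr => i _; rewrite linearP scalerDl scalerA.
  have [L L0 Lw] := coord_bound wi.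
  have Tc x t : T x t = \sum_(i < n.+1) (if unlift ord_max i is Some j then f j x else t) *: w i.
    rewrite big_ord_recr /= unlift_none; congr (_ + _); apply: eq_bigr => i _.
    rewrite (_ : widen_ord _ _ = lift ord_max i) ?liftK //.
    by apply: val_inj; rewrite /= /bump leqNgt ltn_ord.
  pose D := L * (1 + \sum_(i < n) nrm (v i)).
  have D0 : 0 < D by rewrite mulr_gt0 // ltr_pwDl // sumr_ge0 // => i _; exact: nrm_ge0.
  have /choice [M MP] i : exists M, 0 < M /\ forall x, nrm (f i x) <= M * nrm x.
    by have [M M0 fM] := lin_bounded (fc i); exists M.
  pose D2 := nrm (w ord_max) + \sum_(i < n) M i * nrm (w (widen_ord (leqnSn n) i)) + 1.
  have S0 : 0 <= \sum_(i < n) M i * nrm (w (widen_ord (leqnSn n) i)).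
    by apply: sumr_ge0 => i _; rewrite mulr_ge0 ?nrm_ge0 ?ltW ?(MP i).1.
  have D20 : 0 < D2 by rewrite /D2 ltr_wpDl // addr_ge0 // nrm_ge0.
  have plb x t : D^-1 * (nrm x + kabs t) <= nrm (T x t).
    rewrite ler_pdivrMl // /D -mulrA mulrDl mul1r mulrDr addrC lerD //.
      by have := Lw (fun i => if unlift ord_max i is Some j then f j x else t) ord_max;
        rewrite -Tc unlift_none.
    rewrite {1}(fE x) (le_trans (nrm_sum _ _ _)) // mulr_suml mulr_sumr; apply: ler_sum => i _.
    rewrite nrmZ mulrCA mulrC ler_wpM2l ?nrm_ge0 // -nrm_kabs.
    have := Lw (fun i => if unlift ord_max i is Some j then f j x else t) (lift ord_max i).
    by rewrite -Tc liftK.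
  have pub x t : nrm (T x t) <= D2 * (nrm x + kabs t).
    rewrite (le_trans (nrmD _ _)) // nrmZ.
    have h1 : nrm (\sum_(i < n) f i x *: w (widen_ord (leqnSn n) i)) <=
        nrm x * \sum_(i < n) M i * nrm (w (widen_ord (leqnSn n) i)).
      rewrite (le_trans (nrm_sum _ _ _)) // mulr_sumr; apply: ler_sum => i _.
      by rewrite nrmZ mulrA ler_wpM2r ?nrm_ge0 // mulrC; exact: (MP i).2.
    have := nrm_ge0 x; have := kabs_ge0 t; have := nrm_ge0 (w ord_max).
    rewrite /D2 => k1 k2 k3; nra.
  have Di : 0 < D^-1 by rewrite invr_gt0.
  have [|Y [L' [EY LL Ls Lp]]] := @sum_limit EE E unit (principal_filter tt)
    (principal_filter_proper tt) (fun=> X) (fun=> T) (fun x t => nrm (T x t)) _ _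
    EEs (fun=> EX) (fun=> TL) _ Di plb pub.
    by move=> x t; exact: ucvg_cst.
  exists Y, L', D^-1, D2; split=> // x t; rewrite Lp; split; [exact: plb | exact: pub].
have [z [z1 zsep]] := separated_sequence Einf.
have [U [UU Uoo]] := @ultraFilterLemma nat \oo _.
pose T n x (t : K) := x + t *: z n.
pose p x t := ulim U (fun n => nrm (T n x t)).
have Tb n x t : nrm (T n x t) <= nrm x + kabs t.
  by rewrite (le_trans (nrmD _ _)) // lerD2l nrmZ ler_piMr ?kabs_ge0.
have Tp x t : ucvg U (fun n => nrm (T n x t)) (p x t).
  by apply: (@ulimP _ _ _ UU _ (nrm x + kabs t)) => n; rewrite ger0_norm ?nrm_ge0.
have TL n : bilin (T n).
  move=> a x y s t; rewrite /T scalerDr scalerDl -scalerA.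
  by rewrite addrACA.
have pub x t : p x t <= 1 * (nrm x + kabs t).
  by rewrite mul1r; apply: (ucvg_le_cst (Tp x t)); apply: nearW => n.
(* For two indices m < n where |x + t z| is at most p + e, the separation of [z] gives |t| <= 4 (p +
   e), then |x| <= 5 (p + e). *)
have plb x t : 9^-1 * (nrm x + kabs t) <= p x t.
  suff h e : 0 < e -> nrm x + kabs t <= 9 * (p x t + e).
    apply/ler_addgt0Pl => e e0; by rewrite ler_pdivrMl //; have := h e e0; rewrite mulrDr; lra.
  move=> e0.
  have A0 : U [set n | nrm (T n x t) <= p x t + e].
    by apply: filterS (Tp x t e e0) => n /=; rewrite ler_norml => /andP[_]; lra.
  have [m mA] := filter_ex A0.
  have A1 : U ([set n | nrm (T n x t) <= p x t + e] `&` [set n | (m < n)%N]).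
    by apply: filterI A0 _; apply: Uoo; exists m.+1.
  have [n [/= nA mn]] := filter_ex A1.
  have h1 : kabs t * (1 / 2) <= nrm (T m x t) + nrm (T n x t).
    apply: le_trans (nrmB _ _); rewrite /T opprD addrACA subrr add0r -scalerBr nrmZ.
    by rewrite ler_wpM2l ?kabs_ge0 // zsep.
  have h2 : nrm x <= nrm (T m x t) + kabs t.
    rewrite -{1}(addrK (t *: z m) x) (le_trans (nrmB _ _)) // lerD2l nrmZ.
    by rewrite ler_piMr ?kabs_ge0.
  move: mA => /=; lra.
have [|Y [L' [EY LL Ls Lp]]] := @sum_limit EE E nat U _ (fun=> E) T p _ _
  EEs (fun=> EEE) TL Tp _ plb pub; first by [].
exists Y, L', 9^-1, 1; split=> // x t; rewrite Lp; split; [exact: plb | exact: pub].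
Qed.

End FiniteRepresentability.

(** * Cocycles *)

Section Coboundary.
Context (R : realType) (k : scalar_kind) (H : topGroupType).
Local Notation K := (scal R k).
Local Notation banach := (completeNormedModType K).
Hypothesis H_hausdorff : hausdorff_space H.
Hypothesis H_lc : locally_compact [set: H].
Variable S : set H.
Hypothesis S_compact : compact S.
Hypothesis S_one : S 1%g.
Hypothesis S_generates : forall g, exists n, spow S n g.
Local Notation len g := ((word_length S g)%:R : R).

Lemma word_length_bounded (B : set H) : compact B -> exists M : R, forall g, B g -> len g <= M.
Proof.
move=> /(compact_sub_spow H_hausdorff H_lc S_compact S_one S_generates) [n Bn].
by exists n%:R => g /Bn /word_length_le h; rewrite ler_nat.
Qed.

Lemma growth_bounded (s C : R) (B : set H) : 0 <= s -> compact B ->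
  exists M : R, forall g, B g -> s * len g + C <= M.
Proof.
move=> s0 /word_length_bounded [M BM]; exists (s * M + C) => g /BM gM.
by rewrite lerD2r ler_wpM2l.
Qed.

Section Cocycle.
Variables (E : banach) (pi : H -> {linear E -> E}) (b : H -> E) (s C : R).
Hypothesis s0 : 0 < s.
Hypothesis pi_rep : is_representation pi.
Hypothesis pi_growth : forall g x, nrm (pi g x) <= expR (s * len g + C) * nrm x.
Hypothesis bM : forall g h, b (g * h)%g = b g + pi g (b h).
Hypothesis b_cont : continuous b.

Lemma cocycle1 : b 1%g = 0.
Proof.
have := bM 1%g 1%g; rewrite mulg1 (rep1 pi_rep) -{1}[b 1%g]addr0.
by move=> /addrI.
Qed.

(** Along a word of length n the cocycle is a sum of n terms of size at most D exp(s n + C). The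
    factor n is absorbed by s n <= exp(s n), and this is the origin of the rate 2 s. *)
Lemma cocycle_growth : exists2 D : R, 0 <= D &
  forall g, nrm (b g) <= D * expR (2 * s * len g).
Proof.
have [D [D0 bD]] : exists D : R, 0 <= D /\ forall g, S g -> nrm (b g) <= D.
  have bc : continuous (fun g => nrm (b g)).
    move=> g; apply/(@cvgrPdist_lt R R) => e e0.
    have := proj1 (nrm_continuousP b) b_cont g e e0.
    by apply: filterS => y; rewrite distrC => /(le_lt_trans (nrm_lip _ _)).
  have [D [D0 h]] := compact_bound S_compact bc.
  by exists D; split=> // g /h; rewrite ger0_norm ?nrm_ge0.
have eC (n m : nat) : (n <= m)%N -> expR (s * n%:R + C) <= expR (s * m%:R + C).
  by move=> nm; rewrite ler_expR lerD2r ler_wpM2l ?ler_nat // ltW.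
have hn n g : spow S n g -> nrm (b g) <= n%:R * (expR (s * n%:R + C) * D).
  elim: n g => [|n IH] g; first by move=> /= ->; rewrite cocycle1 nrm0 mul0r.
  move=> [x [y [Sx Sy ->]]]; rewrite bM -natr1 mulrDl mul1r (le_trans (nrmD _ _)) // lerD //.
    apply: le_trans (IH _ Sx) _; rewrite ler_wpM2l ?ler0n // ler_wpM2r // natr1.
    exact: eC.
  apply: le_trans (pi_growth _ _) _; apply: ler_pM; rewrite ?expR_ge0 ?nrm_ge0 ?bD //.
  by rewrite natr1; apply: eC; rewrite (leq_trans (word_length_le Sx)).
exists (expR C * D / s); first by rewrite divr_ge0 ?mulr_ge0 ?expR_ge0 // ltW.
move=> g; apply: le_trans (hn _ _ (word_lengthP (S_generates g))) _.
set l := len g; have l0 : 0 <= l by rewrite ler0n.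
have h : s * l <= expR (s * l).
  by apply: le_trans (expR_ge1Dx _); rewrite lerDr.
have -> : expR (2 * s * l) = expR (s * l) * expR (s * l) by rewrite -expRD; congr expR; ring.
rewrite expRD.
have -> : expR C * D / s * (expR (s * l) * expR (s * l)) =
  (expR (s * l) / s) * ((expR (s * l) * expR C) * D) by field; rewrite gt_eqF.
by rewrite ler_wpM2r ?mulr_ge0 ?expR_ge0 // ler_pdivlMr // mulrC.
Qed.

End Cocycle.

(* A cocycle [b] is made invariant: [h (x, t) = (pi h x + t b h, t)] is a representation on
   [E + K], and a projection onto its invariant vectors close to averaging preserves [t]
   approximately, hence yields an invariant vector with [t <> 0]. *)
Lemma coboundary (EE : banach -> Prop) (mu : {measure set (borelType H) -> \bar R})
    (s : R) (E : banach) (pi : H -> {linear E -> E}) (b : H -> E) (C : R) :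
  stable_by_finite_representability EE ->
  (exists2 X : banach, EE X & ~ finite_dim [set: X]) ->
  left_haar mu -> 0 < s ->
  (forall C, 0 < C -> exists p, is_kazhdan_projection mu
     (family_of EE (fun g => 2 * s * len g + C)) p) ->
  EE E -> is_representation pi ->
  (forall g x, nrm (pi g x) <= expR (s * len g + C) * nrm x) ->
  (forall g h, b (g * h)%g = b g + pi g (b h)) -> continuous b ->
  exists z, forall g, b g = pi g z - z.
Proof.
move=> EEs EEinf mu_haar s0 kaz EEE pi_rep pi_growth bM b_cont.
have [Y [L [c1 [c2 [EY LL Ls [c10 c20] Lb]]]]] := sum_in_class EEs EEinf EEE.
have [D D0 bD] := cocycle_growth s0 pi_rep pi_growth bM b_cont.
have LB x y t u : L x t - L y u = L (x - y) (t - u).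
  have := LL (-1) y x u t; rewrite !scaleN1r mulN1r => h.
  by rewrite [x - y]addrC [t - u]addrC h addrC.
have Linj x y t u : L x t = L y u -> x = y /\ t = u.
  move=> h; have := (Lb (x - y) (t - u)).1; rewrite -LB h subrr nrm0.
  have := nrm_ge0 (x - y); have := kabs_ge0 (t - u) => h1 h2.
  rewrite pmulr_rle0 // => h3; split; apply/eqP; rewrite -subr_eq0.
    by apply/eqP/nrm_eq0/eqP; rewrite eq_le h2 andbT; lra.
  by rewrite -kabs_eq0 eq_le h1 andbT; lra.
have /choice [X XP] y : exists x, exists t, y = L x t by exact: Ls.
have /choice [t tP] y : exists t, y = L (X y) t by exact: XP.
have XL x u : X (L x u) = x by have [] := Linj _ _ _ _ (tP (L x u)).
have tL x u : t (L x u) = u by have [] := Linj _ _ _ _ (tP (L x u)).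
have Xlin a y z : X (a *: y + z) = a *: X y + X z.
  by rewrite {1}(tP y) {1}(tP z) -LL XL.
have tlin : linear (t : Y -> K^o).
  by move=> a y z; rewrite {1}(tP y) {1}(tP z) -LL tL.
pose tau := lin_of tlin.
have Yb y : c1 * (nrm (X y) + kabs (t y)) <= nrm y /\ nrm y <= c2 * (nrm (X y) + kabs (t y)).
  by have := Lb (X y) (t y); rewrite -tP.
have tau_cont : continuous tau.
  apply: (@bounded_lin _ _ _ _ _ c1^-1) => y; rewrite lin_ofE nrm_kabs ler_pdivlMl //.
  by apply: le_trans (Yb y).1; rewrite ler_pM2l // lerDr nrm_ge0.
pose sg g y := L (pi g (X y) + t y *: b g) (t y).
have sglin g : linear (sg g).
  move=> a y z; rewrite /sg -LL Xlin linearP tlin; congr L.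
  by rewrite scalerDr scalerDl -[a *: (t y : K^o)]/(a * t y) scalerA addrACA.
pose sgl g := lin_of (sglin g).
pose Q := c2 / c1 * (expR C + D + 1).
have Q0 : 0 <= Q by rewrite mulr_ge0 ?divr_ge0 ?addr_ge0 ?expR_ge0 // ltW.
have sg_growth g y : nrm (sg g y) <= Q * expR (2 * s * len g) * nrm y.
  have l0 : 0 <= len g by rewrite ler0n.
  have e1 : 1 <= expR (s * len g) by rewrite -expR0 ler_expR mulr_ge0 // ltW.
  have e2 : expR (2 * s * len g) = expR (s * len g) * expR (s * len g).
    by rewrite -expRD; congr expR; ring.
  have e3 : expR (s * len g) <= expR (2 * s * len g) by rewrite e2 ler_peMr ?expR_ge0.
  set W := expR (2 * s * len g) in e2 e3 *.
  have W1 : 1 <= W by exact: le_trans e3.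
  have h1 : nrm (pi g (X y)) <= expR C * W * nrm (X y).
    apply: le_trans (pi_growth _ _) _; rewrite ler_wpM2r ?nrm_ge0 // addrC expRD.
    by rewrite ler_wpM2l ?expR_ge0.
  have h2 : nrm (t y *: b g) <= D * W * kabs (t y).
    by rewrite nrmZ mulrC ler_wpM2r ?kabs_ge0 // bD.
  have hx := nrm_ge0 (X y); have ht := kabs_ge0 (t y); have eC := expR_ge0 C.
  apply: le_trans (Lb _ _).2 _.
  apply: (@le_trans _ _ (c2 * ((expR C + D + 1) * W * (nrm (X y) + kabs (t y))))).
    rewrite ler_pM2l //.
    apply: (@le_trans _ _ (expR C * W * nrm (X y) + D * W * kabs (t y) + W * kabs (t y))).
      by apply: lerD; [exact: le_trans (nrmD _ _) (lerD h1 h2) | rewrite ler_peMl].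
    have k1 : 0 <= D * W * nrm (X y) by rewrite !mulr_ge0 // (le_trans _ W1).
    have k2 : 0 <= expR C * W * kabs (t y) by rewrite !mulr_ge0 // (le_trans _ W1).
    have k3 : 0 <= W * nrm (X y) by rewrite !mulr_ge0 // (le_trans _ W1).
    by lra.
  rewrite /Q -!mulrA ler_pM2l // [leRHS]mulrCA ler_wpM2l ?addr_ge0 ?expR_ge0 //.
  rewrite [leRHS]mulrCA ler_wpM2l ?(le_trans _ W1) // ler_pdivlMl //.
  exact: (Yb y).1.
(* [Q] collects the renorming constants [c1], [c2] and the size [D] of the cocycle, so [C'] depends
   on the cocycle; projections are available for every positive additive constant. The [+ 2] makes
   [C'] positive. *)
pose C' := ln (Q + 2).
have Q2 : 0 < Q + 2 by rewrite ltr_wpDl.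
have C'0 : 0 < C' by rewrite ln_gt0 // ltr_wpDl // ltr1n.
have sg_rep : is_representation sgl.
  split.
  - move=> y; rewrite lin_ofE /sg (rep1 pi_rep) (cocycle1 pi_rep bM) scaler0 addr0.
    by rewrite -tP.
  - move=> g h y; rewrite !lin_ofE /sg XL tL (repM pi_rep) bM.
    have -> : pi g (pi h (X y) + t y *: b h) = pi g (pi h (X y)) + t y *: pi g (b h).
      by rewrite addrC linearP addrC.
    by rewrite scalerDr addrAC addrA.
  - by move=> g; apply: bounded_lin => y; exact: sg_growth.
  - move=> y; apply/nrm_continuousP => g e e0; rewrite lin_ofE.
    pose d := e / (c2 * (2 + kabs (t y))).
    have ty : 0 < 2 + kabs (t y) by rewrite ltr_pwDl ?kabs_ge0.
    have d0 : 0 < d by rewrite divr_gt0 // mulr_gt0.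
    have n1 := proj1 (nrm_continuousP _) (@rep_strongly_continuous _ _ _ _ _ pi_rep (X y)) g d d0.
    have n2 := proj1 (nrm_continuousP _) b_cont g d d0.
    apply: filterS (filterI n1 n2) => h [/= h1 h2].
    rewrite /sg LB subrr; apply: le_lt_trans (Lb _ _).2 _.
    rewrite kabs0 addr0 opprD addrACA -scalerBr.
    have -> : e = c2 * (d * (2 + kabs (t y))) by rewrite /d; field; rewrite !gt_eqF.
    rewrite ltr_pM2l // (le_lt_trans (nrmD _ _)) // nrmZ.
    have k1 : kabs (t y) * nrm (b h - b g) <= kabs (t y) * d.
      by rewrite ler_wpM2l ?kabs_ge0 // ltW.
    by rewrite mulrDr [d * kabs _]mulrC; lra.
have sgF : family_of EE (fun g => 2 * s * len g + C') sgl.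
  split=> //; first by exists Y => //; exists idfun; split=> //; exists idfun.
  move=> g y; apply: le_trans (sg_growth g y) _; rewrite ler_wpM2r ?nrm_ge0 //.
  by rewrite expRD lnK ?posrE // mulrC ler_wpM2l ?expR_ge0 // lerDl.
have [p pK] := kaz _ C'0.
pose y0 := L 0 1.
(* Averaging preserves the coordinate [t], so the average of [y0] has [t] equal to 1. Were [t w]
   equal to 0, the distance from this average to [w] would be at least [c1], while the approximation
   bounds it by less than [c1]. *)
have e0 : 0 < c1 / (2 * (nrm y0 + 1)).
  by rewrite divr_gt0 // mulr_gt0 // ltr_wpDl ?nrm_ge0.
have Frep (E' : banach) (r : H -> {linear E' -> E'}) :
  family_of EE (fun g => 2 * s * len g + C') r -> is_representation r by case.
have Fgr (E' : banach) (r : H -> {linear E' -> E'}) :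
  family_of EE (fun g => 2 * s * len g + C') r ->
  forall g x, nrm (r g x) <= expR (2 * s * len g + C') * nrm x by case.
have mb (B : set H) : compact B -> exists M, forall g, B g -> 2 * s * len g + C' <= M.
  by apply: growth_bounded; rewrite mulr_ge0 // ltW.
have [f [fC f1 fP]] := kazhdan_approx H_hausdorff mu_haar Frep Fgr mb pK e0.
have [_ _ _ /(_ _ _ sgF) [P [Pc PP Pr]]] := pK.
have := fP _ _ _ sgF Pc y0; set w := P y0.
have winv g : sg g w = w.
  have : range P w by exists y0.
  by rewrite Pr => /(_ g).
have trint : tau (rint mu sgl f y0) = 1.
  rewrite (rintP H_hausdorff mu_haar sg_rep y0 fC tau_cont) -f1.
  by apply: kint_ext => g _; rewrite !lin_ofE /sg !tL mulr1.
move=> h.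
have tw : t w != 0.
  apply/eqP => tw0; have := (Yb (rint mu sgl f y0 - w)).1.
  have -> : t (rint mu sgl f y0 - w) = 1.
    have := linearB tau (rint mu sgl f y0) w; rewrite trint !lin_ofE tw0 subr0.
    by move=> ->.
  rewrite kabs1 => h1.
  have h2 : c1 <= c1 / (2 * (nrm y0 + 1)) * nrm y0.
    apply: le_trans h; apply: le_trans h1.
    by rewrite mulrDr mulr1 lerDr mulr_ge0 ?nrm_ge0 // ltW.
  move: h2; rewrite -mulrA -{1}[c1]mulr1 ler_pM2l // ler_pdivlMl ?mulr_gt0 ?ltr_wpDl ?nrm_ge0 //.
  by have := nrm_ge0 y0; lra.
exists (- (t w)^-1 *: X w) => g.
(* The first coordinate of the invariance of [w] reads pi(g) X + t b(g) = X, which is solved for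
   [b g]. *)
have [hX _] := Linj _ _ _ _ (etrans (winv g) (tP w)).
have -> : b g = (t w)^-1 *: (X w - pi g (X w)).
  by rewrite -{1}hX addrAC subrr add0r scalerA mulVf // scale1r.
by rewrite linearZ /= !scaleNr opprK scalerBr addrC.
Qed.

End Coboundary.

(** * Ultraproducts of representations *)

Section DependentProduct.
Context (R : realType) (k : scalar_kind) (J : Type).
Local Notation K := (scal R k).
Variable E : J -> completeNormedModType K.

Definition dprod := forall j, E j.

HB.instance Definition _ := gen_eqMixin dprod.
HB.instance Definition _ := gen_choiceMixin dprod.

Definition dprod_add (x y : dprod) : dprod := fun j => x j + y j.
Definition dprod_opp (x : dprod) : dprod := fun j => - x j.
Definition dprod_zero : dprod := fun j => 0.
Definition dprod_scale (a : K) (x : dprod) : dprod := fun j => a *: x j.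

Lemma dprodP (x y : dprod) : (forall j, x j = y j) -> x = y.
Proof. exact: functional_extensionality_dep. Qed.

Fact dprod_addA : associative dprod_add.
Proof. by move=> x y z; apply: dprodP => j; exact: addrA. Qed.
Fact dprod_addC : commutative dprod_add.
Proof. by move=> x y; apply: dprodP => j; exact: addrC. Qed.
Fact dprod_add0 : left_id dprod_zero dprod_add.
Proof. by move=> x; apply: dprodP => j; exact: add0r. Qed.
Fact dprod_addN : left_inverse dprod_zero dprod_opp dprod_add.
Proof. by move=> x; apply: dprodP => j; exact: addNr. Qed.

HB.instance Definition _ :=
  GRing.isZmodule.Build dprod dprod_addA dprod_addC dprod_add0 dprod_addN.

Fact dprod_scaleA a b v : dprod_scale a (dprod_scale b v) = dprod_scale (a * b) v.
Proof. by apply: dprodP => j; exact: scalerA. Qed.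
Fact dprod_scale1 : left_id 1 dprod_scale.
Proof. by move=> x; apply: dprodP => j; exact: scale1r. Qed.
Fact dprod_scaleDr : right_distributive dprod_scale +%R.
Proof. by move=> a x y; apply: dprodP => j; exact: scalerDr. Qed.
Fact dprod_scaleDl v : {morph dprod_scale^~ v : a b / a + b}.
Proof. by move=> a b; apply: dprodP => j; exact: scalerDl. Qed.

HB.instance Definition _ := GRing.Zmodule_isLmodule.Build K dprod
  dprod_scaleA dprod_scale1 dprod_scaleDr dprod_scaleDl.

Lemma dprodDE (x y : dprod) j : (x + y) j = x j + y j. Proof. by []. Qed.

Lemma dprodBE (x y : dprod) j : (x - y) j = x j - y j. Proof. by []. Qed.

End DependentProduct.

(** * Ultraproducts of bounded equicontinuous families *)

Section Ultraproduct.
Context (R : realType) (k : scalar_kind) (G : topGroupType).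
Local Notation K := (scal R k).
Local Notation banach := (completeNormedModType K).
Variable U : set_system nat.
Hypothesis UU : UltraFilter U.
Hypothesis U_oo : \oo `<=` U.
Variable E : nat -> banach.
Variable rho : forall j, G -> {linear E j -> E j}.
Hypothesis rho1 : forall j x, rho j 1%g x = x.
Hypothesis rhoM : forall j g h x, rho j (g * h)%g x = rho j g (rho j h x).
Variables (S : set G) (M : nat -> R) (n0 : nat).
Hypothesis S_generates : forall g, exists n, spow S n g.
Hypothesis S_nbhs : nbhs (1%g : G) (spow S n0).
Hypothesis rho_growth : forall j n g x, spow S n g -> nrm (rho j g x) <= M n * nrm x.
Local Notation V := (dprod E).

Definition uact (g : G) (x : V) : V := fun j => rho j g (x j).

Definition ubounded (x : V) := exists B : R, forall j, nrm (x j) <= B.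

Definition uequi (x : V) := forall e : R, 0 < e ->
  \forall g \near (1%g : G), forall j, nrm (rho j g (x j) - x j) <= e.

(* Equicontinuity is what makes the action on the ultraproduct strongly continuous. *)
Definition uW : set V := [set x | ubounded x /\ uequi x].

Definition unorm (x : V) : R := ulim U (fun j => nrm (x j)).

Lemma unormP x : ubounded x -> ucvg U (fun j => nrm (x j)) (unorm x).
Proof.
move=> [B xB]; apply: (@ulimP _ _ _ UU _ B) => j.
by rewrite ger0_norm ?nrm_ge0.
Qed.

Lemma uboundedP (a : K) (x y : V) : ubounded x -> ubounded y -> ubounded (a *: x + y).
Proof.
move=> [B xB] [D yD]; exists (kabs a * B + D) => j.
by rewrite (le_trans (nrmD _ _)) // nrmZ lerD // ler_wpM2l ?kabs_ge0.
Qed.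

Lemma uW0 : uW 0.
Proof.
split; first by exists 0 => j; rewrite nrm0.
by move=> e e0; apply: nearW => g j; rewrite linear0 subrr nrm0 ltW.
Qed.

Lemma uWP (a : K) (x y : V) : uW x -> uW y -> uW (a *: x + y).
Proof.
move=> [xb xe] [yb ye]; split; first exact: uboundedP.
move=> e e0; pose d := e / (kabs a + 1).
have a0 : 0 < kabs a + 1 by rewrite ltr_wpDl ?kabs_ge0.
have d0 : 0 < d by rewrite divr_gt0.
apply: filterS (filterI (xe _ d0) (ye _ d0)) => g [/= h1 h2] j.
have -> : (a *: x + y) j = a *: x j + y j by [].
rewrite linearP opprD addrACA -scalerBr (le_trans (nrmD _ _)) // nrmZ.
apply: (@le_trans _ _ (kabs a * d + d)).
  by apply: lerD => //; rewrite ler_wpM2l ?kabs_ge0.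
by rewrite /d -{2}[_ / _]mul1r -mulrDl mulrCA divff ?mulr1 // gt_eqF.
Qed.

Lemma unormZ (a : K) (x : V) : uW x -> unorm (a *: x) = kabs a * unorm x.
Proof.
move=> [xb _]; apply: (@ulim_unique _ _ _ UU).
rewrite (_ : (fun j => _) = fun j => kabs a * nrm (x j)); first by apply: ucvgZ; exact: unormP.
by apply/funext => j; rewrite -nrmZ.
Qed.

Lemma unormD (x y : V) : uW x -> uW y -> unorm (x + y) <= unorm x + unorm y.
Proof.
move=> [xb _] [yb _]; have xyb : ubounded (x + y).
  by have := uboundedP 1 xb yb; rewrite scale1r.
apply: (ucvg_le (unormP xyb) (ucvgD (unormP xb) (unormP yb))).
by apply: nearW => j; exact: nrmD.
Qed.

Lemma unorm_eq (x y : V) : (\forall j \near U, x j = y j) -> unorm (x - y) = 0.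
Proof.
move=> xy; apply: (@ulim_unique _ _ _ UU) => e e0.
apply: filterS xy => j xy; rewrite dprodBE xy subrr nrm0 subr0 normr0.
exact: ltW.
Qed.

Lemma uW_limit (x : V) : (forall e : R, 0 < e -> exists2 y, uW y & forall j, nrm (x j - y j) <= e) ->
  uW x.
Proof.
move=> h; split.
  have [y [[B yB] _] xy] := h 1 ltr01; exists (1 + B) => j.
  by rewrite -[x j](subrK (y j)) (le_trans (nrmD _ _)) // lerD.
move=> e e0; pose d := e / (2 * (`|M n0| + 1)).
have M0 : 0 < `|M n0| + 1 by rewrite ltr_wpDl.
have d0 : 0 < d by rewrite divr_gt0 // mulr_gt0.
have [y [_ ye] xy] := h d d0.
have e2 : 0 < e / 2 by rewrite divr_gt0.
apply: filterS (filterI S_nbhs (ye _ e2)) => g [Sg /= yg] j.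
have -> : rho j g (x j) - x j =
    rho j g (x j - y j) + (rho j g (y j) - y j) + (y j - x j).
  by rewrite linearB !subrKA.
have k1 : nrm (rho j g (x j - y j)) <= `|M n0| * d.
  have := rho_growth (x j - y j) Sg => h'; apply: (le_trans h').
  apply: (@le_trans _ _ (`|M n0| * nrm (x j - y j))); first by rewrite ler_wpM2r ?nrm_ge0 ?ler_norm.
  by rewrite ler_wpM2l.
have k2 : 2 * (`|M n0| * d + d) = e by rewrite /d; field; rewrite gt_eqF.
have := xy j; rewrite nrmBC => k3; have k4 := yg j.
apply: le_trans (nrmD _ _) _; apply: le_trans (lerD (nrmD _ _) (lexx _)) _; lra.
Qed.

Lemma unorm_le (x : V) (B : R) : (forall j, nrm (x j) <= B) -> unorm x <= B.
Proof.
by move=> xB; apply: (ucvg_le_cst (unormP _)); [exists B | apply: nearW].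
Qed.

Lemma uW_restrict (A : set nat) (x : V) : uW x -> uW (fun j => if `[< A j >] then x j else 0).
Proof.
move=> [[B xB] xe]; split.
  by exists B => j; case: asboolP => _ //; rewrite nrm0 (le_trans _ (xB j)) ?nrm_ge0.
move=> e e0; apply: filterS (xe e e0) => g h j; case: asboolP => _; first exact: h.
by rewrite linear0 subrr nrm0 ltW.
Qed.

(** The seminorm sees only [U]-many indices, whereas equicontinuity is required uniformly in [j]. A
    fast subsequence is therefore corrected, off sets of [U], into one that converges uniformly in
    [j], whose limit is equicontinuous by [uW_limit]. *)
Lemma uW_complete (u : nat -> V) : (forall n, uW (u n)) ->
  (forall e : R, 0 < e -> exists n1, forall m n, (n1 <= m)%N -> (n1 <= n)%N ->
     unorm (u m - u n) <= e) ->
  exists2 l, uW l & forall e : R, 0 < e -> exists n1, forall n, (n1 <= n)%N ->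
     unorm (u n - l) <= e.
Proof.
move=> uu uc; have uB x y : uW x -> uW y -> uW (x - y).
  by move=> hx hy; rewrite addrC -scaleN1r; exact: uWP.
pose r n : R := 2^-1 ^+ n; have r0 n : 0 < r n by rewrite exprn_gt0.
have r2 n : 0 < r n / 2 by rewrite divr_gt0.
have rS n : r n.+1 = r n / 2 by rewrite /r exprSr.
have /choice [c cP] i := uc _ (r2 i).
pose N i := (\max_(l < i.+1) c l)%N.
have cN i : (c i <= N i)%N by exact: (@leq_bigmax _ (fun l : 'I_i.+1 => c l) ord_max).
have NS i : (c i <= N i.+1)%N.
  exact: (@leq_bigmax _ (fun l : 'I_i.+2 => c l) (widen_ord (leqnSn _) ord_max)).
pose small i := [set j | nrm (u (N i.+1) j - u (N i) j) <= r i].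
have Usmall i : U (small i).
  have ub : ubounded (u (N i.+1) - u (N i)) by have [] := uB _ _ (uu (N i.+1)) (uu (N i)).
  apply: filterS (unormP ub (r2 i)) => j /=; rewrite ler_norml => /andP[_ h].
  by have := cP i _ _ (NS i) (cN i) => h'; rewrite /small /=; move: h; rewrite dprodBE; lra.
(* Increments are kept only on [small i], which belongs to [U]. Hence [v i] agrees with [u (N i)] on
   a set of [U], while the increments decay geometrically for every [j]. *)
pose d i : V := fun j => if `[< small i j >] then (u (N i.+1) - u (N i)) j else 0.
pose v := fix v i : V := if i is i'.+1 then v i' + d i' else u (N 0%N).
have vW i : uW (v i).
  elim: i => [|i IH] /=; first exact: uu.
  rewrite addrC -[d i]scale1r; apply: uWP => //; apply: uW_restrict; exact: uB.
have dr i j : nrm (d i j) <= r i.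
  by rewrite /d; case: asboolP => // _; rewrite nrm0 ltW.
have vv i m j : nrm (v (i + m)%N j - v i j) <= 2 * (r i - r (i + m)%N).
  elim: m => [|m IH]; first by rewrite addn0 !subrr nrm0 mulr0.
  rewrite addnS /= dprodDE addrAC.
  by apply: le_trans (nrmD _ _) _; have := dr (i + m)%N j; rewrite rS; lra.
have vv' i m j : (i <= m)%N -> nrm (v m j - v i j) <= 2 * r i.
  move=> im; have := vv i (m - i)%N j; rewrite subnKC // => h; apply: (le_trans h).
  by rewrite ler_wpM2l // lerBlDr lerDl ltW.
have uv i : U [set j | u (N i) j = v i j].
  elim: i => [|i IH]; first by apply: nearW.
  apply: filterS (filterI IH (Usmall i)) => j [/= h1 h2].
  by rewrite dprodDE -h1 /d asboolT // dprodBE addrC subrK.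
have xE j : exists y : E j, (fun i => v i j) @ \oo --> y.
  apply: complete_seq => e e0; have [i0 h0] := half_pow_small 4 e0.
  exists i0 => m n h1 h2; apply: le_trans (h0 i0 (leqnn _)).
  apply: le_trans (nrm_triangle _ (v i0 j) _) _; rewrite (nrmBC (v i0 j)).
  by have := vv' _ _ j h1; have := vv' _ _ j h2; rewrite /r; lra.
pose x : V := fun j => projT1 (cid (xE j)).
have xP j : (fun i => v i j) @ \oo --> (x j : E j) by rewrite /x; case: cid.
have xv i j : nrm (x j - v i j) <= 2 * r i.
  apply/ler_addgt0Pl => e e0; have := proj1 (nrm_cvgP _ _ _) (xP j) e e0.
  move=> [m _ /(_ (maxn m i)) /= h].
  have := h (leq_maxl _ _); have := vv' i _ j (leq_maxr m i) => h1 h2.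
  by apply: le_trans (nrm_triangle _ (v (maxn m i) j) _) _; rewrite nrmBC; lra.
have xW : uW x.
  apply: uW_limit => e e0; have [i h] := half_pow_small 2 e0.
  by exists (v i) => // j; apply: le_trans (xv i j) _; exact: h.
exists x => // e e0; have [i h] := half_pow_small 3 e0.
exists (c i) => n cn; apply: le_trans (h i (leqnn _)).
have -> : u n - x = (u n - u (N i)) + ((u (N i) - v i) + (v i - x)) by rewrite !subrKA.
have W1 : uW (u n - u (N i)) by exact: uB.
have W2 : uW (u (N i) - v i) by exact: uB.
have W3 : uW (v i - x) by exact: uB.
have W4 : uW ((u (N i) - v i) + (v i - x)) by rewrite -[_ - v i]scale1r; exact: uWP.
have k1 := unormD W1 W4; have k2 := unormD W2 W3.
have k3 := cP i n (N i) cn (cN i).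
have k4 : unorm (u (N i) - v i) = 0 by apply: unorm_eq; exact: uv.
have k5 : unorm (v i - x) <= 2 * r i.
  by apply: unorm_le => j; rewrite dprodBE nrmBC.
by have := r0 i; rewrite -/(r i); lra.
Qed.

Definition uspace := @SeminormedSpace R k V uW unorm uW0 uWP unormZ unormD uW_complete.
Definition uprod : banach := sn_quot uspace.
Definition uproj (x : V) : uprod := @sn_proj R k uspace x.


Lemma uproj_lin (a : K) x y : uW x -> uW y -> uproj (a *: x + y) = a *: uproj x + uproj y.
Proof. exact: (@sn_proj_linear R k uspace). Qed.

Lemma nrm_uproj x : uW x -> nrm (uproj x) = unorm x.
Proof. exact: (@nrm_sn_proj R k uspace). Qed.

Lemma uproj_eq x y : uW x -> uW y -> unorm (x - y) = 0 -> uproj x = uproj y.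
Proof. exact: (@sn_proj_eq R k uspace). Qed.

Lemma uproj_rep (xi : uprod) : exists2 x, uW x & xi = uproj x.
Proof.
by exists (@sn_rep R k uspace xi); [exact: (@sn_repP R k uspace) | rewrite /uproj sn_repK].
Qed.

Lemma uproj_sum (I : Type) (l : seq I) (c : I -> K) (x : I -> V) : (forall i, uW (x i)) ->
  uW (\sum_(i <- l) c i *: x i) /\
  uproj (\sum_(i <- l) c i *: x i) = \sum_(i <- l) c i *: uproj (x i).
Proof.
move=> xW; elim: l => [|i l [IH1 IH2]].
  rewrite !big_nil; split; first exact: uW0.
  by have := uproj_lin (-1) uW0 uW0; rewrite scaler0 addr0 => ->; rewrite scaleN1r addNr.
by rewrite !big_cons; split; [exact: uWP | rewrite uproj_lin // IH2].
Qed.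

Lemma dprod_sumE (I : Type) (l : seq I) (c : I -> K) (x : I -> V) j :
  (\sum_(i <- l) c i *: x i) j = \sum_(i <- l) c i *: x i j.
Proof.
by elim: l => [|i l IH]; rewrite ?big_nil // !big_cons dprodDE IH.
Qed.

Lemma uprod_EE (EE : banach -> Prop) : stable_by_finite_representability EE ->
  (forall j, EE (E j)) -> EE uprod.
Proof.
move=> EEs EEE; apply: (@fr_limit R k nat U _ E) => // n v.
have /choice [x xP] i : exists x, uW x /\ v i = uproj x.
  by have [x] := uproj_rep (v i); exists x.
exists (fun j i => x i j) => c.
have [xW xE] := @uproj_sum _ (index_enum 'I_n) c x (fun i => (xP i).1).
rewrite (eq_bigr (fun i => c i *: uproj (x i))) => [|i _]; last by rewrite (xP i).2.
rewrite -xE nrm_uproj //; have [/unormP xb _] := xW.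
move=> e e0; apply: filterS (xb e e0) => j; by rewrite dprod_sumE.
Qed.

Lemma conj_near (P : G -> Prop) g : (\forall h \near (1%g : G), P h) ->
  \forall h \near (1%g : G), P (g^-1 * h * g)%g.
Proof.
move=> P1; have c1 : continuous (fun h : G => g^-1 * h * g)%g.
  exact: continuous_fun_comp (@mulg_cont_l G g^-1%g) (@mulg_cont_r G g).
by apply: c1; rewrite mulg1 mulVg.
Qed.

Lemma translate_near (P : G -> Prop) g : (\forall h \near (1%g : G), P h) ->
  nbhs g [set x | P (g^-1 * x)%g].
Proof. by move=> P1; apply: (@mulg_cont_l G g^-1%g g); rewrite mulVg. Qed.

Lemma uactW g x : uW x -> uW (uact g x).
Proof.
move=> [[B xB] xe]; have [n Sg] := S_generates g; have Mx j := rho_growth (x j) Sg.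
split.
  exists (`|M n| * B) => j; apply: le_trans (Mx j) _.
  apply: (@le_trans _ _ (`|M n| * nrm (x j))); first by rewrite ler_wpM2r ?nrm_ge0 ?ler_norm.
  by rewrite ler_wpM2l.
move=> e e0; pose d := e / (`|M n| + 1).
have M0 : 0 < `|M n| + 1 by rewrite ltr_wpDl.
have d0 : 0 < d by rewrite divr_gt0.
apply: filterS (conj_near g (xe d d0)) => h hP j.
have -> : rho j h (uact g x j) - uact g x j = rho j g (rho j (g^-1 * h * g)%g (x j) - x j).
  by rewrite linearB /uact -!rhoM !mulgA mulgV mul1g.
apply: le_trans (rho_growth _ Sg) _.
apply: (@le_trans _ _ (`|M n| * d)).
  apply: (@le_trans _ _ (`|M n| * nrm (rho j (g^-1 * h * g)%g (x j) - x j))).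
    by rewrite ler_wpM2r ?nrm_ge0 ?ler_norm.
  by rewrite ler_wpM2l.
by rewrite /d mulrCA ler_piMr ?(ltW e0) // ler_pdivrMr // mul1r lerDl.
Qed.

Lemma unorm_act n g x : spow S n g -> uW x -> unorm (uact g x) <= M n * unorm x.
Proof.
move=> Sg xW; have [[/unormP gx _] [/unormP xb _]] := (uactW g xW, xW).
apply: (ucvg_le gx (ucvgZ (M n) xb)); apply: nearW => j; exact: rho_growth.
Qed.

Lemma uact_lin g (a : K) x y : uact g (a *: x + y) = a *: uact g x + uact g y.
Proof. by apply: dprodP => j; rewrite /uact linearP. Qed.

Definition uhat g (xi : uprod) : uprod := uproj (uact g (sn_rep xi)).

Lemma uWB x y : uW x -> uW y -> uW (x - y).
Proof. by move=> hx hy; rewrite addrC -scaleN1r; exact: uWP. Qed.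

Lemma uactB g x y : uact g (x - y) = uact g x - uact g y.
Proof. by apply: dprodP => j; rewrite dprodBE /uact -linearB. Qed.

Lemma unorm_ge0 x : uW x -> 0 <= unorm x.
Proof. by move=> xW; rewrite -nrm_uproj // nrm_ge0. Qed.

Lemma uhatE g x : uW x -> uhat g (uproj x) = uproj (uact g x).
Proof.
move=> xW; have rW : uW (sn_rep (uproj x)) by exact: (@sn_repP R k uspace).
have r0 : unorm (sn_rep (uproj x) - x) = 0 by exact: (@sn_projK R k uspace).
apply: uproj_eq; try exact: uactW.
have [n Sg] := S_generates g; rewrite -uactB.
have := unorm_act Sg (uWB rW xW); rewrite r0 mulr0 => h.
by apply/eqP; rewrite eq_le h unorm_ge0 //; apply/uactW/uWB.
Qed.

Lemma uhat_linear g : linear (uhat g).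
Proof.
move=> a xi eta; have [x xW ->] := uproj_rep xi; have [y yW ->] := uproj_rep eta.
rewrite -uproj_lin // !uhatE // ?uact_lin ?uproj_lin //; try exact: uactW.
exact: uWP.
Qed.

Lemma uhat0 g : uhat g 0 = 0.
Proof. exact: linear0 (lin_of (uhat_linear g)). Qed.

Lemma nrm_uhat n g xi : spow S n g -> nrm (uhat g xi) <= M n * nrm xi.
Proof.
move=> Sg; have [x xW ->] := uproj_rep xi; rewrite uhatE // !nrm_uproj //; last exact: uactW.
exact: unorm_act.
Qed.

Lemma uhat1 xi : uhat 1%g xi = xi.
Proof.
have [x xW ->] := uproj_rep xi; rewrite uhatE //; congr uproj.
by apply: dprodP => j; rewrite /uact rho1.
Qed.

Lemma uhatM g h xi : uhat (g * h)%g xi = uhat g (uhat h xi).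
Proof.
have [x xW ->] := uproj_rep xi; rewrite !uhatE //; last exact: uactW.
by congr uproj; apply: dprodP => j; rewrite /uact rhoM.
Qed.

Lemma uhat_near xi e : 0 < e -> \forall g \near (1%g : G), nrm (uhat g xi - xi) <= e.
Proof.
move=> e0; have [x xW ->] := uproj_rep xi; apply: filterS (xW.2 e e0) => g gx.
have -> : uhat g (uproj x) - uproj x = uproj (uact g x - x).
  rewrite uhatE // addrC -scaleN1r -uproj_lin //; last exact: uactW.
  by rewrite scaleN1r addrC.
rewrite nrm_uproj; last by apply: uWB => //; exact: uactW.
exact: unorm_le.
Qed.

Section Quotient.
Variables (H : topGroupType) (N : set G) (q : G -> H).
Hypothesis Hq : is_quotient N q.
Hypothesis rho_N : forall x, N x -> \forall j \near U, forall y, rho j x y = y.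

(** A section without any continuity: by [usigmaE] and [ucocycleE] the objects built from it do not
    depend on it, and their continuity comes from openness of [q]. *)
Definition lift (h : H) : G := projT1 (cid (quotient_surj Hq h)).

Lemma liftP h : q (lift h) = h. Proof. by rewrite /lift; case: cid. Qed.

Lemma uhat_N x xi : N x -> uhat x xi = xi.
Proof.
move=> Nx; have [y yW ->] := uproj_rep xi; rewrite uhatE //.
apply: uproj_eq => //; first exact: uactW.
by apply: unorm_eq; apply: filterS (rho_N Nx) => j h; exact: h.
Qed.

Definition usigma h := lin_of (uhat_linear (lift h)).

Lemma usigmaE g xi : usigma (q g) xi = uhat g xi.
Proof.
rewrite lin_ofE; have /(quotient_eq Hq) Ng : q g = q (lift (q g)) by rewrite liftP.
by rewrite -{1}(mulVKg g (lift (q g))) uhatM (uhat_N _ Ng).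
Qed.

Lemma usigma_rep : is_representation usigma.
Proof.
split.
- by move=> xi; rewrite -(quotient1 Hq) usigmaE uhat1.
- move=> g h xi; rewrite -(liftP g) -(liftP h) -(quotientM Hq) !usigmaE; exact: uhatM.
- move=> h; have [n Sh] := S_generates (lift h).
  by apply: (@bounded_lin _ _ _ _ _ (M n)) => xi; exact: nrm_uhat.
- move=> xi; apply/nrm_continuousP => h e e0; have [n Sh] := S_generates (lift h).
  pose d := e / (2 * (`|M n| + 1)).
  have M0 : 0 < `|M n| + 1 by rewrite ltr_wpDl.
  have d0 : 0 < d by rewrite divr_gt0 // mulr_gt0.
  have : nbhs (lift h) [set g | nrm (uhat ((lift h)^-1 * g)%g xi - xi) <= d].
    by apply: (translate_near (P := fun g => nrm (uhat g xi - xi) <= d)); exact: uhat_near.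
  move=> /(quotient_nbhs Hq); rewrite liftP; apply: filterS => _ [g /= hg <-].
  rewrite -[_ < e]/(nrm (usigma (q g) xi - uhat (lift h) xi) < e).
  rewrite usigmaE -{1}(mulVKg (lift h) g) uhatM.
  have -> x y : uhat (lift h) x - uhat (lift h) y = uhat (lift h) (x - y).
    by have := linearB (usigma h) x y; rewrite !lin_ofE => ->.
  apply: le_lt_trans (nrm_uhat _ Sh) _.
  apply: (@le_lt_trans _ _ (`|M n| * d)).
    apply: (@le_trans _ _ (`|M n| * nrm (uhat ((lift h)^-1 * g)%g xi - xi))).
      by rewrite ler_wpM2r ?nrm_ge0 ?ler_norm.
    by rewrite ler_wpM2l.
  have : 2 * (`|M n| * d + d) = e by rewrite /d; field; rewrite gt_eqF.
  by have := mulr_ge0 (normr_ge0 (M n)) (ltW d0); lra.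
Qed.

Lemma usigma_growth n h xi : spow (q @` S) n h -> nrm (usigma h xi) <= M n * nrm xi.
Proof.
by move=> /(quotient_spow_lift Hq) [g Sg <-]; rewrite usigmaE; exact: nrm_uhat.
Qed.

(** * The limit cocycle *)

Section Cocycle.
Variables (y : forall j, E j) (D : R).
Let ub g : V := fun j => rho j g (y j) - y j.
Hypothesis ub_S : forall j g, S g -> nrm (ub g j) <= D.
Hypothesis ub_near : forall e : R, 0 < e ->
  \forall g \near (1%g : G), forall j, nrm (ub g j) <= e.

Lemma ubM g h j : ub (g * h)%g j = ub g j + rho j g (ub h j).
Proof. by rewrite /ub linearB rhoM [RHS]addrC subrKA. Qed.

Lemma ub_bounded g : ubounded (ub g).
Proof.
have [n] := S_generates g; elim: n g => [|n IH] g.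
  by move=> /= ->; exists 0 => j; rewrite /ub rho1 subrr nrm0.
move=> [x [h [Sx Sh ->]]]; have [B xB] := IH _ Sx; exists (B + `|M n| * D) => j.
rewrite ubM (le_trans (nrmD _ _)) // lerD //; apply: le_trans (rho_growth _ Sx) _.
apply: (@le_trans _ _ (`|M n| * nrm (ub h j))); first by rewrite ler_wpM2r ?nrm_ge0 ?ler_norm.
by rewrite ler_wpM2l // ub_S.
Qed.

(** Writing h g = g (g^-1 h g), the cocycle relation gives rho(h) b(g) - b(g) = rho(g) b(g^-1 h g) -
    b(h), and both terms are small, uniformly in [j], for h near 1. So the displacements lie in the
    ultraproduct, although the vectors [y j] themselves may be unbounded. *)
Lemma ubW g : uW (ub g).
Proof.
split; first exact: ub_bounded.
move=> e e0; have [n Sg] := S_generates g; pose d := e / (`|M n| + 1).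
have M0 : 0 < `|M n| + 1 by rewrite ltr_wpDl.
have d0 : 0 < d by rewrite divr_gt0.
apply: filterS (filterI (ub_near d0) (conj_near g (ub_near d0))) => h [/= h1 h2] j.
have -> : rho j h (ub g j) - ub g j = rho j g (ub (g^-1 * h * g)%g j) - ub h j.
  have e1 := ubM h g j; have := ubM g (g^-1 * h * g)%g j.
  rewrite !mulgA mulgV mul1g e1 => e2.
  by apply/eqP; rewrite subr_eq addrAC eq_sym subr_eq addrC -e2 addrC.
apply: le_trans (nrmB _ _) _; apply: (@le_trans _ _ (`|M n| * d + d)).
  apply: lerD => //; apply: le_trans (rho_growth _ Sg) _.
  apply: (@le_trans _ _ (`|M n| * nrm (ub (g^-1 * h * g)%g j))).
    by rewrite ler_wpM2r ?nrm_ge0 ?ler_norm.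
  by rewrite ler_wpM2l.
by rewrite /d -{2}[_ / _]mul1r -mulrDl mulrCA divff ?mulr1 // gt_eqF.
Qed.

Let bb g := uproj (ub g).

Lemma bbM g h : bb (g * h)%g = bb g + uhat g (bb h).
Proof.
rewrite /bb uhatE; last exact: ubW.
have -> : ub (g * h)%g = 1 *: ub g + uact g (ub h).
  by rewrite scale1r; apply: dprodP => j; rewrite ubM.
by rewrite uproj_lin ?scale1r //; [exact: ubW | apply/uactW/ubW].
Qed.

Lemma bb_N x : N x -> bb x = 0.
Proof.
move=> Nx; have -> : 0 = uproj 0.
  by have := uproj_lin (-1) uW0 uW0; rewrite scaler0 addr0 => ->; rewrite scaleN1r addNr.
apply: uproj_eq; [exact: ubW | exact: uW0 |].
by apply: unorm_eq; apply: filterS (rho_N Nx) => j h; rewrite /ub h subrr.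
Qed.

Definition ucocycle h := bb (lift h).

Lemma ucocycleE g : ucocycle (q g) = bb g.
Proof.
have /(quotient_eq Hq) Ng : q g = q (lift (q g)) by rewrite liftP.
by rewrite /ucocycle -{1}(mulVKg g (lift (q g))) bbM (bb_N Ng) uhat0 addr0.
Qed.

Lemma ucocycleM g h : ucocycle (g * h)%g = ucocycle g + usigma g (ucocycle h).
Proof.
rewrite -(liftP g) -(liftP h) -(quotientM Hq) !ucocycleE usigmaE; exact: bbM.
Qed.

Lemma bb_near e : 0 < e -> \forall g \near (1%g : G), nrm (bb g) <= e.
Proof.
move=> e0; apply: filterS (ub_near e0) => g h; rewrite nrm_uproj; last exact: ubW.
exact: unorm_le.
Qed.

Lemma ucocycle_continuous : continuous ucocycle.
Proof.
apply/nrm_continuousP => h e e0; have [n Sh] := S_generates (lift h).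
pose d := e / (2 * (`|M n| + 1)).
have M0 : 0 < `|M n| + 1 by rewrite ltr_wpDl.
have d0 : 0 < d by rewrite divr_gt0 // mulr_gt0.
have : nbhs (lift h) [set g | nrm (bb ((lift h)^-1 * g)%g) <= d].
  by apply: (translate_near (P := fun g => nrm (bb g) <= d)); exact: bb_near.
move=> /(quotient_nbhs Hq); rewrite liftP; apply: filterS => _ [g /= hg <-].
have -> : ucocycle h = bb (lift h) by [].
rewrite ucocycleE -{1}(mulVKg (lift h) g) bbM addrC addKr.
apply: le_lt_trans (nrm_uhat _ Sh) _.
apply: (@le_lt_trans _ _ (`|M n| * d)).
  apply: (@le_trans _ _ (`|M n| * nrm (bb ((lift h)^-1 * g)%g))).
    by rewrite ler_wpM2r ?nrm_ge0 ?ler_norm.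
  by rewrite ler_wpM2l.
have : 2 * (`|M n| * d + d) = e by rewrite /d; field; rewrite gt_eqF.
by have := mulr_ge0 (normr_ge0 (M n)) (ltW d0); lra.
Qed.

(** Norms of finite combinations of displacements are the information that passes back from the
    ultraproduct to the [rho j]; averages over [H] have to be discretized for this reason. *)
Lemma ucocycle_limit (l : seq (K * G)) :
  ucvg U (fun j => nrm (\sum_(p <- l) p.1 *: (rho j p.2 (y j) - y j)))
    (nrm (\sum_(p <- l) p.1 *: ucocycle (q p.2))).
Proof.
have [xW xE] := uproj_sum l (fun p => p.1) (fun p => ubW p.2).
rewrite (eq_bigr (fun p => p.1 *: bb p.2)) => [|p _]; last by rewrite ucocycleE.
rewrite -xE nrm_uproj //; have [/unormP xb _] := xW.
by move=> e e0; apply: filterS (xb e e0) => j; rewrite dprod_sumE.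
Qed.

Lemma ultraproduct_cocycle (EE : banach -> Prop) :
  stable_by_finite_representability EE -> (forall j, EE (E j)) ->
  exists (X : banach) (sg : H -> {linear X -> X}) (b : H -> X), [/\ EE X,
    is_representation sg,
    (forall n h x, spow (q @` S) n h -> nrm (sg h x) <= M n * nrm x),
    (forall g h, b (g * h)%g = b g + sg g (b h)) /\ continuous b &
    forall l : seq (K * G),
      ucvg U (fun j => nrm (\sum_(p <- l) p.1 *: (rho j p.2 (y j) - y j)))
        (nrm (\sum_(p <- l) p.1 *: b (q p.2)))].
Proof.
move=> EEs EEE; exists uprod, usigma, ucocycle; split.
- exact: uprod_EE.
- exact: usigma_rep.
- by move=> n h x; exact: usigma_growth.
- by split; [exact: ucocycleM | exact: ucocycle_continuous].
- exact: ucocycle_limit.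
Qed.

End Cocycle.
End Quotient.

End Ultraproduct.

(** * Smoothing on quotients *)

Section HaarPositivity.
Context (R : realType) (G : topGroupType).
Hypothesis G_hausdorff : hausdorff_space G.
Variable mu : {measure set (borelType G) -> \bar R}.
Hypothesis mu_haar : left_haar mu.

Lemma translateE (g : G) (O : set G) : [set (g * x)%g | x in O] = [set x | O (g^-1 * x)%g].
Proof.
apply/seteqP; split=> [_ [x Ox <-]|x /= Ox]; first by rewrite /= mulKg.
by exists (g^-1 * x)%g => //; rewrite mulVKg.
Qed.

Lemma open_translate (g : G) (O : set G) : open O -> open [set x | O (g^-1 * x)%g].
Proof. by move=> Oo; apply: (open_comp _ Oo) => x _; exact: mulg_cont_l. Qed.

Lemma cover_measure (O A : set G) (s : seq G) : open O -> measurable (A : set (borelType G)) ->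
  (forall x, A x -> exists2 g, g \in s & O (g^-1 * x)%g) ->
  (mu A <= (size s)%:R%:E * mu O)%E.
Proof.
move=> Oo Am As.
pose Us := fix Us (s : seq G) : set G :=
  if s is g :: s' then [set x | O (g^-1 * x)%g] `|` Us s' else set0.
have Uo l : open (Us l).
  by elim: l => [|g l IH] /=; [exact: open0 | apply: openU => //; exact: open_translate].
have muU l : (mu (Us l) <= (size l)%:R%:E * mu O)%E.
  elim: l => [|g l IH] /=; first by rewrite measure0 mul0e.
  apply: (@le_trans _ _ (mu [set x | O (g^-1 * x)%g] + mu (Us l))%E).
    by apply: measureU2; apply: borel_open => //; exact: open_translate.
  rewrite -natr1 EFinD ge0_muleDl ?lee_fin // mul1e addeC; apply: leeD => //.
  by rewrite -translateE (haar_invariant mu_haar) //; exact: borel_open.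
apply: le_trans (muU s); apply: le_measure; rewrite ?inE //; first exact: borel_open.
move=> x /As [g]; elim: s {As} => // h s IH; rewrite inE => /orP[/eqP -> ?|gs Og]; first by left.
by right; exact: IH.
Qed.

(** Finitely many translates of [O] cover a compact set; if [O] were null, all compact sets would
    be, and by inner regularity the whole group. *)
Lemma haar_open_gt0 (O : set G) : open O -> O 1%g -> (0 < mu O)%E.
Proof.
move=> Oo O1; rewrite lt0e measure_ge0 andbT; apply/eqP => muO.
apply: (negP (haar_neq0 mu_haar)); rewrite (haar_inner mu_haar openT).
rewrite eq_le; apply/andP; split.
  apply: ge_ereal_sup => _ [A [Ac _] <-].
  have [|s [_ sP]] := @compact_finite_cover G A (fun g => [set x | O (g^-1 * x)%g]) Ac.
    by move=> g _; apply: open_nbhs_nbhs; split; [exact: open_translate | rewrite /= mulVg].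
  by have := cover_measure Oo (borel_compact G_hausdorff Ac) sP; rewrite muO mule0.
apply: ereal_sup_ubound; exists set0; last exact: measure0.
by split; [exact: compact0 | ].
Qed.

End HaarPositivity.

(** * Bumps pushed forward to a quotient *)

Section FibreBump.
Context (R : realType) (G H : topGroupType) (N : set G) (q : G -> H).
Hypothesis Hq : is_quotient N q.
Variable phi : G -> R.
Hypothesis phi01 : forall x, 0 <= phi x <= 1.

(** A supremum over the fibre, rather than a sum over [N], keeps the values between 0 and 1 and does
    not increase the modulus of continuity for left translations, whatever the quotient. *)
Definition fibre_sup (h : H) : R := sup [set phi g | g in [set g | q g = h]].

Lemma fibre_has_sup h : has_sup [set phi g | g in [set g | q g = h]].
Proof.
split; first by have [g qg] := quotient_surj Hq h; exists (phi g), g.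
by exists 1 => _ [g _ <-]; have /andP[] := phi01 g.
Qed.

Lemma le_fibre_sup g : phi g <= fibre_sup (q g).
Proof. by apply: sup_upper_bound; [exact: fibre_has_sup | exists g]. Qed.

Lemma fibre_sup_le h c : (forall g, q g = h -> phi g <= c) -> fibre_sup h <= c.
Proof.
move=> hc; apply: sup_le_ub; first by have [] := fibre_has_sup h.
by move=> _ [g /hc ? <-].
Qed.

Lemma fibre_sup_ge0 h : 0 <= fibre_sup h.
Proof.
have [g <-] := quotient_surj Hq h; apply: le_trans (le_fibre_sup g).
by have /andP[] := phi01 g.
Qed.

Lemma fibre_sup_supp (B : set G) : (forall x, ~ B x -> phi x = 0) ->
  forall h, ~ (q @` B) h -> fibre_sup h = 0.
Proof.
move=> phi0 h hB; apply/eqP; rewrite eq_le fibre_sup_ge0 andbT.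
by apply: fibre_sup_le => g qg; rewrite phi0 // => Bg; apply: hB; exists g.
Qed.

Lemma fibre_sup_modulus g w : (forall x, `|phi (g^-1 * x)%g - phi x| <= w) ->
  forall h, `|fibre_sup ((q g)^-1 * h)%g - fibre_sup h| <= w.
Proof.
move=> gw h; rewrite ler_distl; apply/andP; split.
  rewrite lerBlDr; apply: fibre_sup_le => x qx.
  have := gw x; rewrite ler_distl => /andP[h1 _].
  have := le_fibre_sup (g^-1 * x)%g; rewrite (quotientM Hq) (quotientV Hq) qx; lra.
apply: fibre_sup_le => x qx; have := gw (g * x)%g; rewrite mulKg ler_distl => /andP[_ h2].
have := le_fibre_sup (g * x)%g; rewrite (quotientM Hq) qx mulVKg; lra.
Qed.

Lemma fibre_sup_continuous :
  (forall e : R, 0 < e -> \forall g \near (1%g : G), forall x, `|phi (g^-1 * x)%g - phi x| <= e) ->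
  continuous fibre_sup.
Proof.
move=> phiu h; apply/(@cvgrPdist_le R R) => e e0.
have := quotient_nbhs Hq (phiu e e0); rewrite (quotient1 Hq) => Wn.
have c : continuous (fun x : H => h * x^-1)%g.
  exact: continuous_fun_comp (@invg_continuous H) (@mulg_cont_l H h).
have : nbhs h ((fun x : H => h * x^-1)%g @^-1` (q @` [set g | forall x, `|phi (g^-1 * x)%g - phi x| <= e])).
  by apply: c; rewrite mulgV.
apply: filterS => x [g /= gP qg].
have := fibre_sup_modulus gP h; rewrite qg invgM invgK -mulgA mulVg mulg1.
by rewrite distrC.
Qed.

End FibreBump.

Section Smoothing.
Context (R : realType) (k : scalar_kind).
Local Notation K := (scal R k).
Local Notation banach := (completeNormedModType K).

Lemma sc_continuous (X : topologicalType) (f : X -> R) : continuous f ->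
  continuous (fun x => sc (f x) : K^o).
Proof.
move=> fc; apply/kabs_continuousP => x e e0.
have /(@cvgrPdist_lt R R) /(_ e e0) := fc x.
by apply: filterS => y; rewrite -scB kabs_sc distrC.
Qed.

Lemma kint_sc (G : topGroupType) (mu : {measure set (borelType G) -> \bar R}) (f : G -> R) :
  scal_integral mu setT (fun x => sc (f x) : K) = sc (\int[mu]_x f x).
Proof.
rewrite kintE; under eq_Rintegral do rewrite sc_reK.
have -> : \int[mu]_(x in setT) sc_im (sc (f x) : K) = 0.
  by under eq_Rintegral do rewrite sc_imK; rewrite Rintegral_cst // mul0r.
by rewrite sc0 mulr0 addr0.
Qed.

(** As [f] has integral 0, pi(g) x may be replaced by pi(g) x - x under the integral, so that only
    the displacement of [x] counts. This is applied to the difference of [psi] and a translate. *)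
Lemma rint_zero_bound (G : topGroupType) (mu : {measure set (borelType G) -> \bar R})
    (E : banach) (pi : G -> {linear E -> E}) (f : G -> K) x (B : set G) (c L : R) :
  hausdorff_space G -> left_haar mu -> is_representation pi -> is_Cc f ->
  scal_integral mu setT f = 0 -> compact B -> (forall g, ~ B g -> f g = 0) ->
  (forall g, kabs (f g) <= c) -> (forall g, B g -> nrm (pi g x - x) <= L) ->
  nrm (rint mu pi f x) <= c * L * fine (mu B).
Proof.
move=> Gh mu_haar pi_rep fC f0 Bc fB fc piL; apply: hahn_banach_le => phi phic phi1.
have k1 : kok mu setT (fun g => f g * phi (pi g x)) by exact/Cc_kok/integrand_Cc.
have k2 : kok mu setT (fun g => f g * phi x).
  apply: Cc_kok => //; apply: Cc_mul => // g; exact: cst_continuous.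
rewrite (rintP Gh mu_haar pi_rep x fC phic).
have -> : scal_integral mu setT (fun g => f g * phi (pi g x)) =
    scal_integral mu setT (fun g => f g * phi (pi g x) - f g * phi x).
  rewrite kintB //.
  have -> : scal_integral mu setT (fun g => f g * phi x) = 0.
    rewrite (_ : (fun g => _) = fun g => phi x * f g); last by apply/funext => g; rewrite mulrC.
    by rewrite kintZ ?f0 ?mulr0 //; exact: Cc_kok.
  by rewrite subr0.
apply: (kint_bound_compact Gh (haar_compact mu_haar)) => //.
- exact: kokB.
- by move=> g /fB ->; rewrite !mul0r subrr.
move=> g Bg; rewrite -mulrBr kabsM.
have -> : phi (pi g x) - phi x = phi (pi g x - x) by rewrite linearB.
have h := phi1 (pi g x - x); apply: ler_pM; rewrite ?kabs_ge0 //.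
exact: le_trans h (piL g Bg).
Qed.

Variable G : topGroupType.
Hypothesis G_hausdorff : hausdorff_space G.
Hypothesis G_lc : locally_compact [set: G].
Variable S : set G.
Hypothesis S_compact : compact S.
Hypothesis S_one : S 1%g.
Hypothesis S_generates : forall g, exists n, spow S n g.

(* Averaging against [psi] makes the displacement of a vector equicontinuous, with a modulus
   that only depends on [G]: [psi] is the normalized supremum over the fibres of a bump on [G],
   whose translates cover its support a number of times that does not depend on the quotient. *)
Lemma smoothing : exists (n1 : nat) (W : R -> set G),
  (forall e : R, 0 < e -> nbhs (1%g : G) (W e)) /\
  forall (N : set G) (H : topGroupType) (q : G -> H), closed N -> is_quotient N q ->
  forall mu : {measure set (borelType H) -> \bar R}, left_haar mu ->
  exists psi : H -> K, [/\ is_Cc psi, scal_integral mu setT psi = 1,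
    (forall h, psi h != 0 -> spow (q @` S) n1 h) &
    forall (E : banach) (pi : H -> {linear E -> E}) x (L : R), is_representation pi ->
      (forall h, spow (q @` S) n1 h -> nrm (pi h x - x) <= L) ->
      nrm (rint mu pi psi x - x) <= L /\
      forall e g, 0 < e -> W e g ->
        nrm (pi (q g) (rint mu pi psi x) - rint mu pi psi x) <= e * L].
Proof.
have [B [Bc B1 _]] := compact_nbhs G_hausdorff G_lc (@filterT _ (nbhs (1%g : G)) _).
have [phi [phic phi01 phi1 phiB]] := bump_exists G_hausdorff G_lc R B1.
pose V : set G := [set x | 1 / 2 < phi x].
have Vo : open V by apply: open_comp (@open_gt R (1 / 2)) => x _; exact: phic.
have V1 : V 1%g by rewrite /V /= phi1; lra.
have VB : V `<=` B.
  by move=> x Vx; apply: contrapT => /phiB phix; move: Vx; rewrite /V /= phix; lra.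
have [|s [_ sP]] := @compact_finite_cover G B (fun g => [set x | V (g^-1 * x)%g]) Bc.
  by move=> g _; apply: open_nbhs_nbhs; split; [exact: open_translate | rewrite /= mulVg].
pose m : R := (size s)%:R; have m0 : 0 <= m by rewrite ler0n.
have m1 : 0 < 4 * (m + 1) by rewrite mulr_gt0 // ltr_wpDl.
have [nb Bnb] := compact_sub_spow G_hausdorff G_lc S_compact S_one S_generates Bc.
have phiu := uniform_modulus G_hausdorff G_lc phic Bc phiB.
(* Translating the support of [psi] by [g] in [B] leads into the image of B B, hence twice [nb]. The
   factor 4 (m + 1) compensates the measure of the two supports together, which is at most
   [4 * m * I] below. *)
exists (nb + nb)%N, (fun e => [set g | B g /\ forall x, `|phi (g^-1 * x)%g - phi x| <= e / (4 * (m + 1))]).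
split=> [e e0|N H q Ncl Hq mu mu_haar].
  by apply: filterI B1 _; apply: phiu; rewrite divr_gt0.
have Hh := quotient_hausdorff Hq Ncl.
pose fb := fibre_sup q phi.
have fb0 h : 0 <= fb h := fibre_sup_ge0 Hq phi01 h.
have fbc : continuous fb := fibre_sup_continuous Hq phi01 phiu.
have fbs := fibre_sup_supp Hq phi01 phiB.
have qBc : compact (q @` B) := quotient_compact Hq Bc.
have qVo : open (q @` V) := @quotient_open_map _ _ _ _ Hq V Vo.
have mqV := borel_open qVo; have mqB := borel_compact Hh qBc.
have muB : (mu (q @` B) < +oo)%E := haar_compact mu_haar qBc.
have muV : (mu (q @` V) < +oo)%E.
  by apply: le_lt_trans muB; apply: le_measure; rewrite ?inE //; exact: image_subset.
have fbi := rintegrable_Cc Hh (haar_compact mu_haar) (@measurableT _ (borelType H)) qBc fbc fbs.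
pose I := \int[mu]_h fb h.
(* On the image of [V] the pushed bump exceeds 1 / 2, and [size s] translates of this image cover
   that of [B]. So the measure of the support is at most [2 * m * I], with [m] independent of the
   quotient. *)
have IV : 1 / 2 * fine (mu (q @` V)) <= I.
  rewrite -Rintegral_cst //; apply: (@le_trans _ _ (\int[mu]_(h in q @` V) fb h)).
    apply: le_Rintegral => //.
    - apply: (@measurable_bounded_integrable _ (borelType H) _ mu (fun=> 1 / 2)) => //.
      exists `|1 / 2|; split; first exact: num_real.
      by move=> M MN x _; exact: ltW.
    - exact: integrableS fbi.
    move=> _ [x Vx <-]; apply: le_trans (le_fibre_sup Hq phi01 x); exact: ltW.
  rewrite /I /Rintegral; apply: fine_le.
  - by apply: integrable_fin_num => //; exact: integrableS fbi.
  - exact: integrable_fin_num.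
  apply: ge0_subset_integral => //; first by case/integrableP : fbi.
  by move=> h _; rewrite lee_fin.
have V0 : 0 < fine (mu (q @` V)).
  rewrite fine_gt0 // muV andbT; apply: (haar_open_gt0 Hh mu_haar) => //.
  by exists 1%g; rewrite ?(quotient1 Hq).
have I0 : 0 < I by lra.
have muBI : fine (mu (q @` B)) <= 2 * m * I.
  apply: (@le_trans _ _ (m * fine (mu (q @` V)))); last by rewrite (mulrC 2) -mulrA ler_wpM2l //; lra.
  rewrite -lee_fin EFinM !fineK ?ge0_fin_numE //.
  rewrite /m -(size_map q s); apply: cover_measure => //.
  move=> _ [x Bx <-]; have [g gs Vg] := sP x Bx.
  exists (q g); first exact: map_f.
  by exists (g^-1 * x)%g => //; rewrite (quotientM Hq) (quotientV Hq).
pose psi h : K := sc (fb h / I).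
have psic : continuous (fun h => fb h / I).
  by move=> h; apply: cvgM; [exact: fbc | exact: cvg_cst].
have psi0 h : ~ (q @` B) h -> psi h = 0 by move=> /fbs fh; rewrite /psi /fb fh mul0r sc0.
have psiC : is_Cc psi by apply: (Cc_of_support Hh (sc_continuous psic) qBc psi0).
have intpsi : \int[mu]_h (fb h / I) = 1.
  by rewrite RintegralZr // divff // gt_eqF.
have psi1 : scal_integral mu setT psi = 1 by rewrite kint_sc intpsi sc1.
have BS h : (q @` B) h -> spow (q @` S) (nb + nb) h.
  move=> [x Bx <-]; apply: (quotient_spow Hq).
  exact: (spow_mono S_one (leq_addr nb nb) (Bnb _ Bx)).
exists psi; split=> //.
  by move=> h; apply: contraNP => hS; apply/eqP/psi0 => /BS.
move=> E pi x L pi_rep piL; split.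
  have := @rint_near R k H Hh mu mu_haar E pi pi_rep psi x x L psiC psi1.
  have -> : \int[mu]_h kabs (psi h) = 1.
    rewrite -intpsi; apply: eq_Rintegral => h _.
    by rewrite kabs_sc ger0_norm // divr_ge0 // ltW.
  rewrite mulr1; apply => h; apply: contraNP => hL; apply/eqP/psi0 => /BS /piL.
  by move/hL.
move=> e g e0 [Bg gP].
have L0 : 0 <= L.
  apply: le_trans (piL 1%g _); first exact: nrm_ge0.
  rewrite -(quotient1 Hq); apply: (quotient_spow Hq).
  exact: (@spow_mono _ S 0 (nb + nb) S_one).
rewrite (rint_translate_fun Hh mu_haar pi_rep (q g) x psiC).
pose f := (fun h => psi ((q g)^-1 * h)%g) \- psi.
have tC : is_Cc (fun h => psi ((q g)^-1 * h)%g) by exact: Cc_translate.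
have fC : is_Cc f by exact: Cc_sub.
have := rintB Hh mu_haar pi_rep x tC psiC; rewrite -/f => <-.
pose B' := q @` B `|` [set h | (q @` B) ((q g)^-1 * h)%g].
have B'c : compact B'.
  apply: compactU => //; rewrite -translateE; apply: continuous_compact => //.
  by apply: continuous_subspaceT; exact: mulg_cont_l.
have muB' : fine (mu B') <= 4 * m * I.
  have m2 : measurable ([set h | (q @` B) ((q g)^-1 * h)%g] : set (borelType H)).
    apply: borel_compact => //; rewrite -translateE; apply: continuous_compact => //.
    by apply: continuous_subspaceT; exact: mulg_cont_l.
  have : (mu B' <= mu (q @` B) + mu (q @` B))%E.
    have := measureU2 mu mqB m2; rewrite -/B' => h; apply: (le_trans h); rewrite leeD2l //.
    have e1 := haar_invariant mu_haar (q g) mqB; rewrite translateE in e1.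
    by rewrite le_eqVlt; apply/orP; left; apply/eqP; exact: e1.
  move=> h; have : fine (mu B') <= fine (mu (q @` B) + mu (q @` B))%E.
    apply: fine_le => //; rewrite ge0_fin_numE ?adde_ge0 //; first exact: haar_compact B'c.
    by rewrite lte_add_pinfty.
  by rewrite fineD ?ge0_fin_numE //; lra.
have f0 : scal_integral mu setT f = 0.
  by rewrite kintB ?kint_translate_Cc ?psi1 ?subrr //; exact: Cc_kok.
have fB h : ~ B' h -> f h = 0.
  move=> /not_orP [h1 h2]; rewrite /f /= !psi0 ?subrr //.
pose c := e / (4 * (m + 1)) / I.
have fle h : kabs (f h) <= c.
  rewrite /f /= -scB kabs_sc -mulrBl normrM [`|I^-1|]gtr0_norm ?invr_gt0 //.
  by rewrite ler_pM2r ?invr_gt0 //; exact: (fibre_sup_modulus Hq phi01 gP).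
have piB' h : B' h -> nrm (pi h x - x) <= L.
  move=> [/BS /piL //|[y By qy]]; apply: piL.
  have -> : h = q (g * y)%g by rewrite (quotientM Hq) qy mulVKg.
  by apply: (quotient_spow Hq); apply: spow_mul; exact: Bnb.
apply: le_trans (rint_zero_bound Hh mu_haar pi_rep fC f0 B'c fB fle piB') _.
have c0 : 0 <= c by rewrite !divr_ge0 // ltW.
apply: (@le_trans _ _ (c * L * (4 * m * I))); first by rewrite ler_wpM2l // mulr_ge0.
have -> : c * L * (4 * m * I) = e * L * (m / (m + 1)).
  by rewrite /c; field; rewrite !gt_eqF // ltr_wpDl.
by rewrite ler_piMr ?mulr_ge0 ?(ltW e0) // ler_pdivrMr ?ltr_wpDl // mul1r lerDl.
Qed.

End Smoothing.

(** * Transfer of contractions *)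

Section Gap.
Context (R : realType) (k : scalar_kind) (H : topGroupType).
Local Notation K := (scal R k).
Local Notation banach := (completeNormedModType K).
Hypothesis H_hausdorff : hausdorff_space H.
Hypothesis H_lc : locally_compact [set: H].
Variable S : set H.
Hypothesis S_compact : compact S.
Hypothesis S_one : S 1%g.
Hypothesis S_generates : forall g, exists n, spow S n g.
Local Notation len g := ((word_length S g)%:R : R).
Variables (EE : banach -> Prop) (s C : R).
Hypothesis s0 : 0 < s.
Local Notation F := (family_of EE (fun g => s * len g + C)).

Lemma growth_spow (E : banach) (pi : H -> {linear E -> E}) n g x : F pi -> spow S n g ->
  nrm (pi g x) <= expR (s * n%:R + C) * nrm x.
Proof.
move=> [_ _ h] Sg; apply: le_trans (h g x) _; rewrite ler_wpM2r ?nrm_ge0 //.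
by rewrite ler_expR lerD2r ler_wpM2l ?(ltW s0) // ler_nat; exact: word_length_le.
Qed.

Lemma orbit_bound (E : banach) (pi : H -> {linear E -> E}) x d : F pi ->
  (forall g, S g -> nrm (pi g x - x) <= d) ->
  forall n g, spow S n g -> nrm (pi g x - x) <= n%:R * expR (s * n%:R + C) * d.
Proof.
move=> Fpi xd; have [pr _ _] := Fpi.
have d0 : 0 <= d by apply: le_trans (xd 1%g S_one); exact: nrm_ge0.
elim=> [|n IH] g; first by move=> /= ->; rewrite (rep1 pr) subrr nrm0 !mul0r.
have eS : expR (s * n%:R + C) <= expR (s * n.+1%:R + C).
  by rewrite ler_expR lerD2r ler_wpM2l ?(ltW s0) // ler_nat.
move=> [a [b [Sa Sb ->]]]; rewrite (repM pr).
have -> : pi a (pi b x) - x = pi a (pi b x - x) + (pi a x - x) by rewrite linearB subrKA.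
rewrite -{1}natr1 mulrDl mul1r mulrDl [leRHS]addrC (le_trans (nrmD _ _)) // lerD //.
  apply: le_trans (growth_spow _ Fpi Sa) _.
  by apply: ler_pM; rewrite ?expR_ge0 ?nrm_ge0 ?xd.
by apply: le_trans (IH _ Sa) _; rewrite ler_wpM2r // ler_wpM2l ?ler0n.
Qed.

Variable mu : {measure set (borelType H) -> \bar R}.
Hypothesis mu_haar : left_haar mu.

Let Frep (E : banach) (r : H -> {linear E -> E}) : F r -> is_representation r.
Proof. by case. Qed.
Let Fgr (E : banach) (r : H -> {linear E -> E}) : F r ->
  forall g x, nrm (r g x) <= expR (s * len g + C) * nrm x.
Proof. by case. Qed.
Let mb (B : set H) : compact B -> exists M : R, forall g, B g -> s * len g + C <= M.
Proof. exact: (growth_bounded H_hausdorff H_lc S_compact S_one S_generates C (ltW s0)). Qed.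

Lemma Cc_orbit_bound f : is_Cc (f : H -> K) -> scal_integral mu setT f = 1 ->
  exists2 c : R, 0 <= c & forall (E : banach) (pi : H -> {linear E -> E}) x d, F pi ->
    (forall g, S g -> nrm (pi g x - x) <= d) -> nrm (rint mu pi f x - x) <= c * d.
Proof.
move=> fC f1; have [B Bc fB] := Cc_support fC.
have [n Bn] := compact_sub_spow H_hausdorff H_lc S_compact S_one S_generates Bc.
have A0 : 0 <= \int[mu]_g kabs (f g) by apply: Rintegral_ge0 => g _; exact: kabs_ge0.
exists (n%:R * expR (s * n%:R + C) * \int[mu]_g kabs (f g)).
  by rewrite !mulr_ge0 ?ler0n ?expR_ge0.
move=> E pi x d Fpi xd; rewrite mulrAC.
apply: (rint_near H_hausdorff mu_haar (Frep Fpi) fC f1) => g fg.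
apply: orbit_bound => //; apply: Bn; apply: contrapT => /fB f0.
by move: fg; rewrite f0 eqxx.
Qed.

(** Subtracting the invariant vector [P z] leaves all displacements unchanged and gives a vector
    whose norm is bounded by its displacement; an average close to the projection then makes it
    small. This converts information on displacements into information on norms. *)
Lemma kazhdan_shift p : is_kazhdan_projection mu F p -> forall e : R, 0 < e ->
  exists f : H -> K, [/\ is_Cc f, scal_integral mu setT f = 1 &
    forall (E : banach) (pi : H -> {linear E -> E}) z d, F pi ->
    (forall g, S g -> nrm (pi g z - z) <= d) ->
    exists2 z', (forall h, pi h z' - z' = pi h z - z) & nrm (rint mu pi f z') <= e * d].
Proof.
move=> pK e e0; have approx := kazhdan_approx H_hausdorff mu_haar Frep Fgr mb pK.
have [f0 [f0C f01 f0P]] := approx (1 / 2) ltac:(by rewrite divr_gt0).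
have [c c0 cP] := Cc_orbit_bound f0C f01.
(* As [P z'] is 0, [f0] at least halves the norm of [z'] while moving it by at most [c * d], so
   [nrm z' <= 2 * c * d]; the [+ 1] only makes the constant positive. *)
have K0 : 0 < 2 * c + 1 by rewrite ltr_wpDl // mulr_ge0.
have [f [fC f1 fP]] := approx (e / (2 * c + 1)) ltac:(by rewrite divr_gt0).
exists f; split=> // E pi z d Fpi zd; have pr := Frep Fpi.
have [_ _ _ /(_ _ _ Fpi) [P [Pc PP Pr]]] := pK.
have Pinv x g : pi g (P x) = P x.
  have : range P (P x) by exists x.
  by rewrite Pr => /(_ g).
pose z' := z - P z.
have z'E h : pi h z' - z' = pi h z - z.
  by rewrite /z' linearB Pinv opprB addrA subrK.
(* [P] comes as a bare map, so this is obtained by comparison with averages pi(g), which are linear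
   and fix [P z]. *)
have Pz' : P z' = 0.
  apply: nrm_small => r r0; pose a := nrm z' + nrm z + 1.
  have a0 : 0 < a by rewrite ltr_wpDl // addr_ge0 // nrm_ge0.
  have [g [gC g1 gP]] := approx (r / a) ltac:(by rewrite divr_gt0).
  have h1 := gP _ _ _ Fpi Pc z'; have h2 := gP _ _ _ Fpi Pc z.
  have := rintBr H_hausdorff mu_haar pr z (P z) gC; rewrite -/z'.
  rewrite (rint_invariant H_hausdorff mu_haar pr gC g1 (Pinv z)) => h3.
  rewrite h3 in h1; have -> : P z' = (rint mu pi g z - P z) - (rint mu pi g z - P z - P z').
    by rewrite opprB addrC subrK.
  apply: le_trans (nrmB _ _) _; apply: le_trans (lerD h2 h1) _.
  rewrite -mulrDr mulrAC ler_pdivrMr // ler_wpM2l ?(ltW r0) // /a; lra.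
have d0 : 0 <= d by apply: le_trans (zd 1%g S_one); exact: nrm_ge0.
have z'n : nrm z' <= (2 * c + 1) * d.
  have h1 := f0P _ _ _ Fpi Pc z'; rewrite Pz' subr0 in h1.
  have h2 : nrm (rint mu pi f0 z' - z') <= c * d.
    by apply: cP => // g Sg; rewrite z'E; exact: zd.
  have h3 := nrm_triangle z' (rint mu pi f0 z') 0; rewrite !subr0 nrmBC in h3.
  lra.
exists z' => //; have := fP _ _ _ Fpi Pc z'; rewrite Pz' subr0 => h.
apply: le_trans h _; rewrite mulrAC ler_pdivrMr // -mulrA ler_wpM2l ?(ltW e0) //.
by rewrite mulrC.
Qed.

(** The orbit of [z] has the modulus [O], known before the representation, so a compactly supported
    average can be replaced by one finite average valid for all of them. The conclusion is written
    with displacements of [z] only, because it is to be read on a cocycle. *)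
Lemma discrete_average p (D : R) (O : R -> set H) : is_kazhdan_projection mu F p -> 0 <= D ->
  (forall e : R, 0 < e -> nbhs (1%g : H) (O e)) ->
  exists l : seq (K * H), \sum_(p <- l) p.1 = 1 /\
    forall (E : banach) (pi : H -> {linear E -> E}) z, F pi ->
    (forall g, S g -> nrm (pi g z - z) <= D) ->
    (forall e g, 0 < e -> O e g -> nrm (pi g z - z) <= e) ->
    forall g, S g ->
    nrm (\sum_(p <- l) p.1 *: ((pi (g * p.2)%g z - z) - (pi p.2 z - z))) <= 1 / 4.
Proof.
(* [a] bounds the norm of pi(g) - 1 for [g] in [S]. The errors of averaging ([eps]) and of
   discretization ([eta]) are each allowed 1 / (8 a), so that [nrm v <= 1 / (4 * a)]. *)
move=> pK D0 O1; pose a := expR (s + C) + 1.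
have a0 : 0 < a by rewrite ltr_wpDl ?expR_ge0.
have D1 : 0 < D + 1 by rewrite ltr_wpDl.
pose eps := (8 * a * (D + 1))^-1.
have eps0 : 0 < eps by rewrite invr_gt0 !mulr_gt0.
have [f [fC f1 fP]] := kazhdan_shift pK eps0.
have [B Bc fB] := Cc_support fC.
have [M BM] := word_length_bounded R H_hausdorff H_lc S_compact S_one S_generates Bc.
pose Q := expR (s * M + C); have Q0 : 0 <= Q by exact: expR_ge0.
pose A := \int[mu]_(g in B) kabs (f g).
have A0 : 0 <= A by apply: Rintegral_ge0 => g _; exact: kabs_ge0.
have QA : 0 < Q * A + 1 by rewrite ltr_wpDl // mulr_ge0.
pose eta := (8 * a * (Q * A + 1))^-1.
have eta0 : 0 < eta by rewrite invr_gt0 !mulr_gt0.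
pose cell g : set H := interior [set x | O eta (g^-1 * x)%g].
have cellg g : nbhs g (cell g).
  by apply: nbhs_interior; apply: (translate_near (P := O eta)); exact: O1.
have [|l [lB lP]] := @compact_finite_cover H B cell Bc; first by move=> g _.
have mB := borel_compact H_hausdorff Bc.
have fk : kok mu B f by exact: Cc_kok.
have wi : mu.-integrable B (fun x => (kabs (f x))%:E).
  by apply: integrableS (kabs_integrable H_hausdorff mu_haar fC).
have [t [tl t1 tP]] := @kint_discretize R k H mu B l cell f (fun g => kabs (f g))
  mB (fun g => @open_interior _ _) lP fk wi (fun x _ => lexx _).
exists t; split; first by rewrite t1 -(@kint_supp R k H mu B f mB).
move=> E pi z Fpi zD zO g Sg; have pr := Frep Fpi.
have [z' z'E z'n] := fP _ _ _ _ Fpi zD.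
pose v := \sum_(p <- t) p.1 *: pi p.2 z'.
have -> : \sum_(p <- t) p.1 *: ((pi (g * p.2)%g z - z) - (pi p.2 z - z)) = pi g v - v.
  rewrite /v linear_sum -sumrB; apply: eq_bigr => p' _.
  rewrite -!z'E linearZ /= -scalerBr (repM pr); congr (_ *: _).
  by rewrite opprB addrA subrK.
have vn : nrm (v - rint mu pi f z') <= Q * eta * A.
  apply: hahn_banach_le => phi phic phi1.
  have := tP (Q * eta) (fun x => phi (pi x z')) _ _ _.
  rewrite -(@kint_supp R k H mu B _ mB) => [|x /fB ->]; last by rewrite mul0r.
  rewrite -(rintP H_hausdorff mu_haar pr z' fC phic) linearB /v linear_sum => h.
  under eq_bigr do rewrite linearZ.
  apply: h; first by rewrite mulr_ge0 // ltW.
    by apply: Cc_kok => //; exact: integrand_Cc.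
  move=> y x yl Bx /interior_subset Ox.
  rewrite -linearB (le_trans (phi1 _)) //.
  have -> : pi x z' - pi y z' = pi y (pi (y^-1 * x)%g z' - z').
    by rewrite linearB -(repM pr) mulVKg.
  apply: le_trans (Fgr Fpi _ _) _; apply: ler_pM; rewrite ?expR_ge0 ?nrm_ge0 //.
    by rewrite ler_expR lerD2r ler_wpM2l ?(ltW s0) //; apply: BM; exact: lB.
  by rewrite z'E; exact: zO.
have vb : nrm v <= 1 / (4 * a).
  have h := nrmD (v - rint mu pi f z') (rint mu pi f z'); rewrite subrK in h.
  have h1 : Q * eta * A <= 1 / (8 * a).
    have -> : Q * eta * A = 1 / (8 * a) * (Q * A / (Q * A + 1)).
      by rewrite /eta; field; rewrite !gt_eqF.
    by rewrite ler_piMr ?divr_ge0 ?mulr_ge0 ?(ltW a0) // ler_pdivrMr // mul1r lerDl.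
  have h2 : eps * D <= 1 / (8 * a).
    have -> : eps * D = 1 / (8 * a) * (D / (D + 1)).
      by rewrite /eps; field; rewrite !gt_eqF.
    by rewrite ler_piMr ?divr_ge0 ?mulr_ge0 ?(ltW a0) // ler_pdivrMr // mul1r lerDl.
  have e2 : 1 / (4 * a) = 1 / (8 * a) + 1 / (8 * a) by field; rewrite gt_eqF.
  by rewrite e2; lra.
apply: le_trans (nrmB _ _) _.
have h1 : nrm (pi g v) <= expR (s + C) * nrm v.
  have := growth_spow v Fpi (spow1 Sg); by rewrite mulr1.
apply: (@le_trans _ _ (a * nrm v)); first by rewrite /a mulrDl mul1r lerD2r.
apply: (@le_trans _ _ (a * (1 / (4 * a)))); first by rewrite ler_pM2l.
by rewrite le_eqVlt; apply/orP; left; apply/eqP; field; rewrite gt_eqF.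
Qed.

End Gap.

(** * From the quotient [H] to the quotients [Hj j] *)

Section Transfer.
Context (R : realType) (k : scalar_kind) (G H : topGroupType).
Local Notation K := (scal R k).
Local Notation banach := (completeNormedModType K).
Hypothesis G_hausdorff : hausdorff_space G.
Hypothesis G_lc : locally_compact [set: G].
Variable S : set G.
Hypothesis S_compact : compact S.
Hypothesis S_one : S 1%g.
Hypothesis S_generates : forall g, exists n, spow S n g.
Variables (N : set G) (q : G -> H).
Hypothesis N_closed : closed N.
Hypothesis Hq : is_quotient N q.
Variables (Nj : nat -> set G) (Hj : nat -> topGroupType) (qj : forall j, G -> Hj j).
Hypothesis Nj_closed : forall j, closed (Nj j).
Hypothesis Hqj : forall j, is_quotient (Nj j) (qj j).
Hypothesis Nj_N : forall x, N x -> \forall j \near \oo, Nj j x.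
Variables (EE : banach -> Prop) (mu : {measure set (borelType H) -> \bar R}).
Hypothesis EEs : stable_by_finite_representability EE.
Hypothesis EEinf : exists2 X : banach, EE X & ~ finite_dim [set: X].
Hypothesis mu_haar : left_haar mu.
Variables (s C : R).
Hypothesis s0 : 0 < s.
Hypothesis C0 : 0 < C.
Hypothesis kaz : forall C, 0 < C -> exists p, is_kazhdan_projection mu
  (family_of EE (fun h => 2 * s * (word_length (q @` S) h)%:R + C)) p.
Local Notation F j :=
  (family_of EE (fun h => s * (word_length (qj j @` S) h)%:R + C)).

Let qS_compact (G' : topGroupType) (N' : set G) (q' : G -> G') :
  is_quotient N' q' -> compact (q' @` S).
Proof. by move=> h; exact: (quotient_compact h). Qed.

Let qS_one (G' : topGroupType) (N' : set G) (q' : G -> G') :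
  is_quotient N' q' -> (q' @` S) 1%g.
Proof. by move=> h; exists 1%g; rewrite ?(quotient1 h). Qed.

Let qS_gen (G' : topGroupType) (N' : set G) (q' : G -> G') :
  is_quotient N' q' -> forall h, exists n, spow (q' @` S) n h.
Proof. by move=> h; exact: (quotient_generates h). Qed.

(* Counterexamples on the H_j would give, on their ultraproduct, a cocycle of H: it is a
   coboundary, which the averaging over a finite subset of H contracts. *)
Lemma average_transfer (D : R) (W : R -> set G) :
  0 <= D -> (forall e : R, 0 < e -> nbhs (1%g : G) (W e)) ->
  exists (l : seq (K * G)) (j : nat), \sum_(p <- l) p.1 = 1 /\
    forall (E : banach) (pi : Hj j -> {linear E -> E}) y, F j pi ->
    (forall g, S g -> nrm (pi (qj j g) y - y) <= D) ->
    (forall e g, 0 < e -> W e g -> nrm (pi (qj j g) y - y) <= e) ->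
    forall g, S g ->
    nrm (\sum_(p <- l) p.1 *: (pi (qj j (g * p.2)%g) y - pi (qj j p.2) y)) <= 1 / 2.
Proof.
move=> D0 W1.
have Hh := quotient_hausdorff Hq N_closed.
have Hlc := quotient_locally_compact Hq G_lc N_closed.
have s20 : 0 < 2 * s by rewrite mulr_gt0.
have [p pK] := kaz C0.
have [|lH [lH1 lHP]] := discrete_average Hh Hlc (qS_compact Hq) (qS_one Hq) (qS_gen Hq)
  s20 mu_haar (O := fun e => q @` W e) pK D0.
  by move=> e e0; rewrite -(quotient1 Hq); apply: (quotient_nbhs Hq); exact: W1.
have /choice [lift liftP] h : exists g, q g = h by exact: (quotient_surj Hq).
pose l := [seq (p.1, lift p.2) | p <- lH] : seq (K * G).
exists l; apply: contrapT => /forallNP bad.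
have l1 : \sum_(p <- l) p.1 = 1 by rewrite big_map.
have bad1 j : exists (E : banach) (pi : Hj j -> {linear E -> E}) (y : E) (g : G),
  [/\ F j pi, (forall g, S g -> nrm (pi (qj j g) y - y) <= D),
    (forall e g, 0 < e -> W e g -> nrm (pi (qj j g) y - y) <= e), S g &
    1 / 2 < nrm (\sum_(p <- l) p.1 *: (pi (qj j (g * p.2)%g) y - pi (qj j p.2) y))].
  apply: contrapT => nex; apply: (bad j); split=> // E pi y Fpi yD yW g Sg.
  rewrite leNgt; apply/negP => h; apply: nex; exists E, pi, y, g; split=> //.
(* The counterexamples are chosen one component at a time: the types of the later ones depend on the
   space [E j] already chosen. *)
pose E j := projT1 (cid (bad1 j)).
have bad2 j : exists (pi : Hj j -> {linear E j -> E j}) (y : E j) (g : G),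
  [/\ F j pi, (forall g, S g -> nrm (pi (qj j g) y - y) <= D),
    (forall e g, 0 < e -> W e g -> nrm (pi (qj j g) y - y) <= e), S g &
    1 / 2 < nrm (\sum_(p <- l) p.1 *: (pi (qj j (g * p.2)%g) y - pi (qj j p.2) y))].
  exact: projT2 (cid (bad1 j)).
pose pi j := projT1 (cid (bad2 j)).
have bad3 j : exists (y : E j) (g : G),
  [/\ F j (pi j), (forall g, S g -> nrm (pi j (qj j g) y - y) <= D),
    (forall e g, 0 < e -> W e g -> nrm (pi j (qj j g) y - y) <= e), S g &
    1 / 2 < nrm (\sum_(p <- l) p.1 *: (pi j (qj j (g * p.2)%g) y - pi j (qj j p.2) y))].
  exact: projT2 (cid (bad2 j)).
pose y j := projT1 (cid (bad3 j)).
have bad4 j : exists (g : G),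
  [/\ F j (pi j), (forall g, S g -> nrm (pi j (qj j g) (y j) - y j) <= D),
    (forall e g, 0 < e -> W e g -> nrm (pi j (qj j g) (y j) - y j) <= e), S g &
    1 / 2 < nrm (\sum_(p <- l) p.1 *: (pi j (qj j (g * p.2)%g) (y j) - pi j (qj j p.2) (y j)))].
  exact: projT2 (cid (bad3 j)).
clearbody y; clear bad3; clearbody pi; clear bad2; clearbody E; clear bad1.
have Fpi j : F j (pi j) by have [g []] := bad4 j.
have yD j g : S g -> nrm (pi j (qj j g) (y j) - y j) <= D.
  by have [? [_ h _ _ _]] := bad4 j; exact: h.
have yW j e g : 0 < e -> W e g -> nrm (pi j (qj j g) (y j) - y j) <= e.
  by have [? [_ _ h _ _]] := bad4 j; exact: h.
have bigj j : exists2 g, S g &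
    1 / 2 < nrm (\sum_(p <- l) p.1 *: (pi j (qj j (g * p.2)%g) (y j) - pi j (qj j p.2) (y j))).
  by have [g [_ _ _ h1 h2]] := bad4 j; exists g.
have pr j : is_representation (pi j) by have [] := Fpi j.
have EEE j : EE (E j).
  by have [_ [X EX XE] _] := Fpi j; exact: EE_isometric EEs EX XE.
pose rho j g := pi j (qj j g).
pose M n : R := expR (s * n%:R + C).
have M0 n : 0 <= M n by exact: expR_ge0.
have rho1 j x : rho j 1%g x = x by rewrite /rho (quotient1 (Hqj j)) (rep1 (pr j)).
have rhoM j g h x : rho j (g * h)%g x = rho j g (rho j h x).
  by rewrite /rho (quotientM (Hqj j)) (repM (pr j)).
have rho_growth j n g x : spow S n g -> nrm (rho j g x) <= M n * nrm x.
  move=> Sg; apply: (growth_spow s0 _ (Fpi j)); exact: (quotient_spow (Hqj j)).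
have [B [Bc B1 _]] := compact_nbhs G_hausdorff G_lc (@filterT _ (nbhs (1%g : G)) _).
have [n0 Bn0] := compact_sub_spow G_hausdorff G_lc S_compact S_one S_generates Bc.
have Sn0 : nbhs (1%g : G) (spow S n0) by exact: filterS B1.
have [U [UU Uoo]] := @ultraFilterLemma nat \oo _.
have rho_N x : N x -> \forall j \near U, forall z, rho j x z = z.
  move=> /Nj_N /Uoo; apply: filterS => j Njx z.
  have := quotient_eq (Hqj j) 1%g x; rewrite invg1 mul1g => -[_ /(_ Njx) h].
  by rewrite /rho -h (quotient1 (Hqj j)) (rep1 (pr j)).
have bW (e : R) : 0 < e -> \forall g \near (1%g : G), forall j, nrm (rho j g (y j) - y j) <= e.
  by move=> e0; apply: filterS (W1 e e0) => g Wg j; exact: yW.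
have [X [sg [b [EX sgr sgg [bM bc] blim]]]] := ultraproduct_cocycle UU rho1 rhoM
  S_generates Sn0 rho_growth Hq rho_N yD bW EEs EEE.
have sgg' h x : nrm (sg h x) <= expR (s * (word_length (q @` S) h)%:R + C) * nrm x.
  by apply: sgg; apply: word_lengthP; exact: qS_gen Hq h.
have [z bz] := coboundary Hh Hlc (qS_compact Hq) (qS_one Hq) (qS_gen Hq) EEs EEinf mu_haar s0
  kaz EX sgr sgg' bM bc.
have bq g c : (\forall j \near U, nrm (rho j g (y j) - y j) <= c) -> nrm (b (q g)) <= c.
  have := blim [:: (1, g)]; rewrite big_seq1 scale1r => lim h.
  apply: (ucvg_le_cst lim); apply: filterS h => j; by rewrite big_seq1 scale1r.
have sgF : family_of EE (fun h => 2 * s * (word_length (q @` S) h)%:R + C) sg.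
  split=> //; first by exists X => //; exists idfun; split=> //; exists idfun.
  move=> h x; apply: le_trans (sgg' h x) _; rewrite ler_wpM2r ?nrm_ge0 // ler_expR lerD2r.
  by rewrite ler_wpM2r ?ler0n //; have := s0; lra.
have small g : S g ->
    nrm (\sum_(p <- lH) p.1 *: (b (q g * p.2)%g - b p.2)) <= 1 / 4.
  move=> Sg; under eq_bigr do rewrite !bz.
  apply: (lHP X sg z sgF); [ | | by exists g].
    by move=> _ [h Sh <-]; rewrite -bz; apply: bq; apply: nearW => j; exact: yD.
  by move=> e _ e0 [h Wh <-]; rewrite -bz; apply: bq; apply: nearW => j; exact: yW.
pose Phi j g := \sum_(p <- l) p.1 *: (rho j (g * p.2)%g (y j) - rho j p.2 (y j)).
(* Of the 1 / 2 that the counterexamples exceed, 1 / 4 is spent on the average over [H], 1 / 8 on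
   the limit along [U], and 1 / 8 is left for varying [g] in [S]. *)
have Phi_lim g : S g -> \forall j \near U, nrm (Phi j g) <= 1 / 4 + 1 / 8.
  move=> Sg.
  have := blim ([seq (p.1, (g * p.2)%g) | p <- l] ++ [seq (- p.1, p.2) | p <- l]).
  have e1 (V : lmodType K) (f : G -> V) :
    \sum_(p <- [seq (p.1, (g * p.2)%g) | p <- l] ++ [seq (- p.1, p.2) | p <- l]) p.1 *: f p.2 =
    \sum_(p <- l) p.1 *: (f (g * p.2)%g - f p.2).
    rewrite big_cat !big_map /= -big_split; apply: eq_bigr => p' _ /=.
    by rewrite scaleNr scalerBr.
  rewrite (e1 _ (fun h => b (q h))).
  have -> : \sum_(p <- l) p.1 *: (b (q (g * p.2)%g) - b (q p.2)) =
      \sum_(p <- lH) p.1 *: (b (q g * p.2)%g - b p.2).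
    by rewrite big_map; apply: eq_bigr => p' _; rewrite (quotientM Hq) !liftP.
  move=> /(_ (1 / 8) ltac:(by rewrite divr_gt0)); apply: filterS => j.
  rewrite (e1 _ (fun h => rho j h (y j) - y j)).
  have -> : \sum_(p <- l) p.1 *: (rho j (g * p.2)%g (y j) - y j - (rho j p.2 (y j) - y j)) = Phi j g.
    by apply: eq_bigr => p' _; rewrite opprB addrA subrK.
  by rewrite ler_norml => /andP[_]; have := small g Sg; lra.
pose A := \sum_(p <- l) kabs p.1.
have A0 : 0 <= A by apply: sumr_ge0 => p' _; exact: kabs_ge0.
(* The limit controls a fixed [g] for [U]-many [j], whereas the offending [g] depends on [j].
   Equicontinuity of the [Phi j] and compactness of [S] reduce the matter to finitely many [g]. *)
have Phi_mod g : \forall h \near g, forall j, nrm (Phi j h - Phi j g) <= 1 / 8.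
  have [n Sn] : exists n, forall p, p \in l -> spow S n (g * p.2)%g.
    elim: (l) => [|p' l' [n IH]]; first by exists 0%N.
    have [m Sm] := S_generates (g * p'.2)%g; exists (maxn n m) => p''; rewrite inE.
    move=> /orP[/eqP ->|/IH]; first exact: (spow_mono S_one (leq_maxr n m)).
    exact: (spow_mono S_one (leq_maxl n m)).
  pose e := (8 * (A * M n + 1))^-1.
  have AM : 0 < A * M n + 1 by rewrite ltr_wpDl // mulr_ge0.
  have e0 : 0 < e by rewrite invr_gt0 mulr_gt0.
  have near1 : \forall w \near (1%g : G), forall p, p \in l -> W e (p.2^-1 * w * p.2)%g.
    by apply: near_all_seq => p' _; apply: (conj_near (P := W e)); exact: W1.
  have := translate_near g near1; apply: filterS => h /= hP j.
  rewrite /Phi -sumrB big_seq.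
  apply: (@le_trans _ _ (\sum_(p <- l | p \in l) kabs p.1 * (M n * e))).
    apply: le_trans (nrm_sum _ _ _) _; apply: ler_sum => p' pl.
    rewrite -scalerBr nrmZ ler_wpM2l ?kabs_ge0 // opprB addrA subrK.
    have -> : (h * p'.2)%g = (g * p'.2 * (p'.2^-1 * (g^-1 * h) * p'.2))%g.
      by rewrite !mulgA mulgK mulgV mul1g.
    rewrite (rhoM j (g * p'.2)%g (p'.2^-1 * (g^-1 * h) * p'.2)%g).
    have -> u : rho j (g * p'.2)%g u - rho j (g * p'.2)%g (y j) = rho j (g * p'.2)%g (u - y j).
      by rewrite /rho linearB.
    apply: le_trans (rho_growth _ _ _ _ (Sn _ pl)) _.
    by rewrite ler_wpM2l //; apply: yW => //; exact: hP.
  rewrite -big_seq -mulr_suml -/A mulrA.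
  have -> : A * M n * e = 1 / 8 * (A * M n / (A * M n + 1)).
    by rewrite /e; field; rewrite gt_eqF.
  by rewrite ler_piMr // ler_pdivrMr // mul1r lerDl.
have [|t [tS tP]] := @compact_finite_cover G S
    (fun g => [set h | forall j, nrm (Phi j h - Phi j g) <= 1 / 8]) S_compact.
  by move=> g _; exact: Phi_mod.
have /filter_ex [j jP] : \forall j \near U, forall g, g \in t -> nrm (Phi j g) <= 1 / 4 + 1 / 8.
  by apply: near_all_seq => g /tS; exact: Phi_lim.
have [g Sg] := bigj j; apply/negP; rewrite -leNgt -[X in nrm X]/(Phi j g).
have [h ht /(_ j) hP] := tP g Sg; have := jP h ht.
by have := nrmD (Phi j g - Phi j h) (Phi j h); rewrite subrK; lra.
Qed.

(** [f] is a combination of translates of [psi] by the images of the elements of [l], so pi(f) x is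
    the finite average of the smoothed vector pi(psi) x. Neither [l] nor [j] depends on the Haar
    measure [nu]. *)
Lemma contraction_transfer : exists j, forall nu : {measure set (borelType (Hj j)) -> \bar R},
  left_haar nu -> exists (f : Hj j -> K) (c0 : R), [/\ 0 <= c0, is_Cc f,
    scal_integral nu setT f = 1 &
    forall (E : banach) (pi : Hj j -> {linear E -> E}) x d, F j pi -> 0 <= d ->
      (forall g, (qj j @` S) g -> nrm (pi g x - x) <= d) ->
      nrm (rint nu pi f x - x) <= c0 * d /\
      forall g, (qj j @` S) g -> nrm (pi g (rint nu pi f x) - rint nu pi f x) <= d / 2].
Proof.
have [n1 [W [W1 smooth]]] := smoothing R k G_hausdorff G_lc S_compact S_one S_generates.
pose cB : R := n1%:R * expR (s * n1%:R + C).
have cB0 : 0 <= cB by rewrite mulr_ge0 ?ler0n ?expR_ge0.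
have cB1 : 0 < cB + 1 by rewrite ltr_wpDl.
(* Bounds the displacement on [S] of a smoothed vector y = pi(psi) x': the displacement of x' is at
   most 1, and y - x', of norm at most [cB], contributes once under pi(g) and once without. *)
pose D := 1 + (expR (s + C) + 1) * cB.
have D0 : 0 <= D by rewrite addr_ge0 // mulr_ge0 // addr_ge0 // expR_ge0.
(* Smoothing a vector whose orbit deviates by at most [cB] gives the modulus [e * cB] on [W e],
   hence the rescaling. *)
have [|l [j [l1 lP]]] := @average_transfer D (fun e => W (e / (cB + 1))) D0.
  by move=> e e0; apply: W1; rewrite divr_gt0.
exists j => nu nu_haar; have [psi [psiC psi1 psiS psiP]] := smooth (Nj j) (Hj j) (qj j) (@Nj_closed j) (Hqj j) nu nu_haar.
have Hh := quotient_hausdorff (Hqj j) (@Nj_closed j).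
have Hlc := quotient_locally_compact (Hqj j) G_lc (@Nj_closed j).
pose f := fun h => \sum_(p <- l) p.1 * psi ((qj j p.2)^-1 * h)%g.
have tC g : is_Cc (fun h => psi (g^-1 * h)%g) by exact: Cc_translate.
have [fC frint] : is_Cc f /\ forall (E : banach) (pi : Hj j -> {linear E -> E}) x,
    is_representation pi ->
    rint nu pi f x = \sum_(p <- l) p.1 *: pi (qj j p.2) (rint nu pi psi x).
  rewrite /f; elim: (l) => [|p l' [IH1 IH2]].
    have z0 : (fun h : Hj j => \sum_(p <- [::] : seq (K * G)) p.1 * psi ((qj j p.2)^-1 * h)%g) =
        fun h => 0 * psi h by apply/funext => h; rewrite big_nil mul0r.
    rewrite z0; split; first exact: Cc_scale.
    by move=> E pi x pr; rewrite rintZ // scale0r big_nil.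
  have z0 : (fun h : Hj j => \sum_(p <- p :: l') p.1 * psi ((qj j p.2)^-1 * h)%g) =
      fun h => p.1 * psi ((qj j p.2)^-1 * h)%g + \sum_(p <- l') p.1 * psi ((qj j p.2)^-1 * h)%g.
    by apply/funext => h; rewrite big_cons.
  rewrite z0; split; first by apply: Cc_add => //; exact: Cc_scale.
  move=> E pi x pr; rewrite rintD //; last exact: Cc_scale.
  rewrite rintZ // -rint_translate_fun // IH2 // big_cons //.
have f1 : scal_integral nu setT f = 1.
  have -> := @kint_sum R k (Hj j) nu _ l setT (fun p => p.1)
    (fun p h => psi ((qj j p.2)^-1 * h)%g) measurableT.
    rewrite -l1; apply: eq_bigr => p _.
    by rewrite (kint_translate_Cc Hh nu_haar) // psi1 mulr1.
  by move=> p; exact: Cc_kok.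
have [c0 c00 c0P] := Cc_orbit_bound Hh Hlc (qS_compact (Hqj j)) (qS_one (Hqj j))
  (qS_gen (Hqj j)) EE C s0 nu_haar fC f1.
exists f, c0; split=> // E pi x d Fpi d0 xd; split; first exact: c0P.
have pr : is_representation pi by case: Fpi.
have unit x' : (forall g, (qj j @` S) g -> nrm (pi g x' - x') <= 1) ->
    forall g, (qj j @` S) g -> nrm (pi g (rint nu pi f x') - rint nu pi f x') <= 1 / 2.
  move=> x'1 _ [g Sg <-].
  have ob h : spow (qj j @` S) n1 h -> nrm (pi h x' - x') <= cB.
    move=> Sh; have := orbit_bound (qS_one (Hqj j)) s0 Fpi x'1 Sh; by rewrite mulr1.
  have [y1 y2] := psiP E pi x' cB pr ob.
  set y := rint nu pi psi x' in y1 y2.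
  rewrite frint // -/y.
  have -> : pi (qj j g) (\sum_(p <- l) p.1 *: pi (qj j p.2) y) - \sum_(p <- l) p.1 *: pi (qj j p.2) y =
      \sum_(p <- l) p.1 *: (pi (qj j (g * p.2)%g) y - pi (qj j p.2) y).
    rewrite linear_sum -sumrB; apply: eq_bigr => p _.
    by rewrite linearZ /= -scalerBr (quotientM (Hqj j)) (repM pr).
  apply: lP => // [h Sh|e h e0 Wh].
    have -> : pi (qj j h) y - y = pi (qj j h) (y - x') + (pi (qj j h) x' - x') + (x' - y).
      by rewrite linearB !subrKA.
    have k1 : nrm (pi (qj j h) (y - x')) <= expR (s + C) * cB.
      have Sqh : spow (qj j @` S) 1 (qj j h) by apply: (quotient_spow (Hqj j)); exact: spow1.
      apply: le_trans (growth_spow s0 _ Fpi Sqh) _; rewrite mulr1.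
      by rewrite ler_wpM2l ?expR_ge0.
    have k2 : nrm (pi (qj j h) x' - x') <= 1 by apply: x'1; exists h.
    have k3 : nrm (x' - y) <= cB by rewrite nrmBC.
    have := nrmD (pi (qj j h) (y - x') + (pi (qj j h) x' - x')) (x' - y).
    have := nrmD (pi (qj j h) (y - x')) (pi (qj j h) x' - x').
    by rewrite /D mulrDl mul1r; lra.
  have e1 : 0 < e / (cB + 1) by rewrite divr_gt0.
  apply: le_trans (y2 _ _ e1 Wh) _; rewrite mulrAC ler_pdivrMr // ler_wpM2l ?(ltW e0) //.
  by rewrite lerDl.
move=> g Sg; apply/ler_addgt0Pl => e e0.
(* Normalizing by d + e instead of d covers the case d = 0. *)
pose r := d + e; have r0 : 0 < r by rewrite ltr_wpDl.
have r1 (u : E) : nrm (sc r^-1 *: u) = r^-1 * nrm u.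
  by rewrite nrmZ kabs_sc gtr0_norm ?invr_gt0.
have piB h u : nrm (pi h (sc r^-1 *: u) - sc r^-1 *: u) = r^-1 * nrm (pi h u - u).
  by rewrite linearZ /= -scalerBr r1.
have x1 h : (qj j @` S) h -> nrm (pi h (sc r^-1 *: x) - sc r^-1 *: x) <= 1.
  by move=> /xd hd; rewrite piB ler_pdivrMl // mulr1 /r; lra.
have := unit _ x1 g Sg; rewrite (rintZr Hh nu_haar pr) // piB ler_pdivrMl //.
by rewrite /r; lra.
Qed.

End Transfer.

(** * Unimodularity *)

Section Bumps.
Variable X : topologicalType.
Hypothesis X_hausdorff : hausdorff_space X.
Hypothesis X_lc : locally_compact [set: X].

(** Bumps at finitely many points of [A] add up to a function exceeding 1 / 2 on [A]; doubling and
    truncating at 1 makes it equal to 1 there. *)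
Lemma compact_bump (R : realType) (A U : set X) : compact A -> open U -> A `<=` U ->
  exists (f : X -> R) (B : set X), [/\ continuous f, (forall x, 0 <= f x <= 1),
    (forall x, A x -> f x = 1), compact B & B `<=` U /\ forall x, ~ B x -> f x = 0].
Proof.
move=> Ac Uo AU.
have h x : exists gB : (X -> R) * set X, A x -> [/\ continuous gB.1, (forall y, 0 <= gB.1 y <= 1),
    gB.1 x = 1, compact gB.2 & gB.2 `<=` U /\ forall y, ~ gB.2 y -> gB.1 y = 0].
  have [Ax|nAx] := pselect (A x); last by exists (fun=> 0, set0).
  have [B [Bc Bx BU]] := compact_nbhs X_hausdorff X_lc (open_nbhs_nbhs (conj Uo (AU x Ax))).
  by have [g [gc g01 gx gB]] := bump_exists X_hausdorff X_lc R Bx; exists (g, B).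
have /choice [gB gBP] := h.
have [|s [sA sP]] := @compact_finite_cover X A (fun x => [set y | A x -> 1 / 2 < (gB x).1 y]) Ac.
  move=> x Ax; have [gc _ gx _ _] := gBP x Ax.
  have /(@cvgrPdist_lt R R) /(_ (1 / 2)) := gc x; rewrite gx => /(_ ltac:(by rewrite divr_gt0)).
  by apply: filterS => y; rewrite ltr_norml => /andP[_ h2] _; lra.
have [g [B [gc g0 g1 Bc [BU gB0]]]] : exists (g : X -> R) (B : set X),
    [/\ continuous g, (forall x, 0 <= g x),
      (forall y, (exists2 x, x \in s & 1 / 2 < (gB x).1 y) -> 1 / 2 < g y), compact B &
      B `<=` U /\ forall y, ~ B y -> g y = 0].
  elim: s {sP} sA => [|x s IH] sA.
    exists (fun=> 0), set0; split=> //; [exact: cst_continuous | by move=> y [] | exact: compact0 | by split].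
  have [|g [B [gc g0 g1 Bc [BU gB0]]]] := IH; first by move=> y ys; apply: sA; rewrite inE ys orbT.
  have [|hc h01 hx hB [hBU hB0]] := gBP x; first by apply: sA; rewrite inE eqxx.
  exists (fun y => g y + (gB x).1 y), (B `|` (gB x).2); split.
  - by move=> y; apply: cvgD; [exact: gc | exact: hc].
  - by move=> y; rewrite addr_ge0 //; have /andP[] := h01 y.
  - move=> y [z]; rewrite inE => /orP[/eqP ->|zs] zy.
      by have := g0 y; lra.
    have := g1 y (ex_intro2 _ _ z zs zy); have /andP[] := h01 y; lra.
  - exact: compactU.
  - by split=> [y [/BU|/hBU]//|y /not_orP[/gB0 -> /hB0 ->]]; rewrite addr0.
(* The minimum of 1 and [2 * g x], written so that continuity is immediate. *)
pose f x := (1 + 2 * g x - `|1 - 2 * g x|) / 2.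
have fE x : f x = Num.min 1 (2 * g x).
  rewrite /f minEle; case: ifPn => [h'|]; last rewrite -ltNge => h'.
    by rewrite ler0_norm; [field | lra].
  by rewrite gtr0_norm; [field | lra].
exists f, B; split=> //.
- have c2 : continuous (fun x => 2 * g x).
    by move=> x; apply: cvgM; [exact: cvg_cst | exact: gc].
  move=> x; apply: cvgM; last exact: cvg_cst.
  apply: cvgB; first by apply: cvgD; [exact: cvg_cst | exact: c2].
  by apply: cvg_norm; apply: cvgB; [exact: cvg_cst | exact: c2].
- move=> x; rewrite fE ge_min lexx /= le_min ler01 /= mulr_ge0 //.
- move=> x Ax; rewrite fE; apply/min_idPl; have [y ys yx] := sP x Ax.
  have := g1 x (ex_intro2 _ _ y ys (yx (sA y ys))); lra.
- by split=> // x /gB0 gx; rewrite fE gx mulr0; apply/min_idPr.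
Qed.

End Bumps.

Section Unimodular.
Context (R : realType) (k : scalar_kind) (G : topGroupType).
Local Notation K := (scal R k).
Local Notation banach := (completeNormedModType K).
Hypothesis G_hausdorff : hausdorff_space G.
Hypothesis G_lc : locally_compact [set: G].
Variable mu : {measure set (borelType G) -> \bar R}.
Hypothesis mu_haar : left_haar mu.
Local Notation kint := (@scal_integral R k G mu).

Lemma haar_nonempty_open_gt0 (O : set G) x : open O -> O x -> (0 < mu O)%E.
Proof.
move=> Oo Ox; pose O' : set G := [set y | O (x * y)%g].
have O'o : open O' by apply: (open_comp _ Oo) => y _; exact: mulg_cont_l.
have e1 := haar_invariant mu_haar x (borel_open O'o); rewrite translateE in e1.
have -> : O = [set y | O' (x^-1 * y)%g].
  by apply/funext => y; rewrite /O' /= mulVKg.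
by rewrite e1; apply: (haar_open_gt0 G_hausdorff mu_haar) => //; rewrite /O' /= mulg1.
Qed.

Lemma mass_le_integral (g : G -> R) (B O : set G) c : continuous g -> compact B ->
  (forall x, ~ B x -> g x = 0) -> (forall x, 0 <= g x) ->
  measurable (O : set (borelType G)) -> O `<=` B ->
  (forall x, O x -> c <= g x) -> c * fine (mu O) <= \int[mu]_x g x.
Proof.
move=> gc Bc gB g0 mO OB Oc.
have gi := rintegrable_Cc G_hausdorff (haar_compact mu_haar) (@measurableT _ (borelType G)) Bc gc gB.
have muO : (mu O < +oo)%E.
  apply: le_lt_trans (haar_compact mu_haar Bc); apply: le_measure; rewrite ?inE //.
  exact: borel_compact.
rewrite -Rintegral_cst //; apply: (@le_trans _ _ (\int[mu]_(h in O) g h)).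
  apply: le_Rintegral => //.
  - apply: (@measurable_bounded_integrable _ (borelType G) _ mu (fun=> c)) => //.
    exists `|c|; split; first exact: num_real.
    by move=> M MN x _; exact: ltW.
  - exact: integrableS gi.
rewrite /Rintegral; apply: fine_le.
- by apply: integrable_fin_num => //; exact: integrableS gi.
- exact: integrable_fin_num.
apply: ge0_subset_integral => //; first by case/integrableP : gi.
by move=> h _; rewrite lee_fin.
Qed.

Lemma nonneg_integral_zero (g : G -> R) (B : set G) : continuous g -> compact B ->
  (forall x, ~ B x -> g x = 0) -> (forall x, 0 <= g x) -> \int[mu]_x g x = 0 ->
  forall x, g x = 0.
Proof.
move=> gc Bc gB g0 gint x; apply/eqP; rewrite eq_le g0 andbT leNgt; apply/negP => gx.
pose O : set G := [set y | g x / 2 < g y].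
have Oo : open O by apply: open_comp (@open_gt R (g x / 2)) => y _; exact: gc.
have Ox : O x by rewrite /O /=; lra.
have OB : O `<=` B by move=> y Oy; apply: contrapT => /gB gy; move: Oy; rewrite /O /= gy; lra.
have := @mass_le_integral g B O (g x / 2) gc Bc gB g0 (borel_open Oo) OB (fun y => @ltW _ _ _ _).
have muO : (mu O < +oo)%E.
  apply: le_lt_trans (haar_compact mu_haar Bc); apply: le_measure; rewrite ?inE //.
    exact: borel_open.
  exact: borel_compact.
have : 0 < fine (mu O) by rewrite fine_gt0 // muO (haar_nonempty_open_gt0 Oo Ox).
by rewrite gint => h1 h2; have := mulr_gt0 gx h1; lra.
Qed.

Lemma sc_im_kint A (f : G -> K) : sc_im (kint A f) = \int[mu]_(x in A) sc_im (f x).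
Proof.
rewrite /sc_im /scal_integral; case: k f => //= f.
by rewrite /Rintegral; under eq_integral do rewrite -[0%:E]/0%E; rewrite integral0.
Qed.

(** Tested against [b * sc_re u] and [b * sc_im u], with [b] a bump at [x], the hypothesis makes
    integrals of nonnegative functions vanish. *)
Lemma test_zero (u : G -> K) : continuous (u : G -> K^o) ->
  (forall phi, is_Cc phi -> kint setT (fun x => phi x * u x) = 0) -> forall x, u x = 0.
Proof.
move=> uc u0 x.
have [B [Bc Bx _]] := compact_nbhs G_hausdorff G_lc (@filterT _ (nbhs x) _).
have [b [bc b01 b1 bB]] := bump_exists G_hausdorff G_lc R Bx.
have key (p : G -> R) : continuous p -> \int[mu]_y (b y * p y * p y) = 0 -> p x = 0.
  move=> pc pint; have gc : continuous (fun y => b y * p y * p y).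
    by move=> y; apply: cvgM; [apply: cvgM; [exact: bc | exact: pc] | exact: pc].
  have := @nonneg_integral_zero _ B gc Bc _ _ pint x; rewrite b1 mul1r => h.
  apply/eqP; rewrite -[_ == 0]orbb -mulf_eq0; apply/eqP; apply: h.
    by move=> y /bB ->; rewrite !mul0r.
  by move=> y; rewrite -mulrA mulr_ge0 // -?expr2 ?sqr_ge0 //; have /andP[] := b01 y.
have Cp (p : G -> R) : continuous p -> is_Cc (fun y => sc (b y * p y) : K).
  move=> pc; apply: (Cc_of_support G_hausdorff _ Bc) => [|y /bB ->]; last by rewrite mul0r sc0.
  by apply: sc_continuous => y; apply: cvgM; [exact: bc | exact: pc].
have re0 : sc_re (u x) = 0.
  apply: (key (fun y => sc_re (u y))); first exact: continuous_sc_re.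
  have := u0 _ (Cp _ (continuous_sc_re uc)); move/(congr1 (@sc_re R k)).
  by rewrite sc_re_kint sc_re0 => <-; apply: eq_Rintegral => y _; rewrite sc_reZ.
have im0 : sc_im (u x) = 0.
  apply: (key (fun y => sc_im (u y))); first exact: continuous_sc_im.
  have := u0 _ (Cp _ (continuous_sc_im uc)); move/(congr1 (@sc_im R k)).
  rewrite sc_im_kint -sc0 sc_imK => <-; apply: eq_Rintegral => y _.
  by rewrite sc_imM sc_reK sc_imK mul0r addr0.
by rewrite (sc_decomp (u x)) re0 im0 sc0 mulr0 addr0.
Qed.

Lemma Cc_comp (h : G -> K) (a b : G -> G) : continuous a -> continuous b ->
  (forall x, b (a x) = x) -> is_Cc h -> is_Cc (fun x => h (a x)).
Proof.
move=> ac bc ba hC; have [B Bc hB] := Cc_support hC.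
have bBc : compact (b @` B).
  by apply: continuous_compact => //; exact: continuous_subspaceT.
apply: (Cc_of_support G_hausdorff _ bBc).
  by apply: (continuous_fun_comp ac); exact: hC.1.
by move=> x hx; apply: hB => Bx; apply: hx; exists (a x).
Qed.

Lemma Cc_inv (h : G -> K) : is_Cc h -> is_Cc (fun x => h x^-1%g).
Proof.
by apply: (@Cc_comp h (fun x => x^-1)%g (fun x => x^-1)%g) => [||x];
  [exact: invg_continuous | exact: invg_continuous | exact: invgK].
Qed.

Lemma Cc_rtranslate g (h : G -> K) : is_Cc h -> is_Cc (fun x => h (x * g)%g).
Proof.
apply: (@Cc_comp h (fun x => x * g)%g (fun x => x * g^-1)%g) => [||x].
- exact: mulg_cont_r.
- exact: mulg_cont_r.
- by rewrite mulgK.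
Qed.

Let mulG_cont : continuous (fun p : G * G => p.1 * p.2)%g := @mulg_continuous G.

Lemma compact_mulV (A B : set G) : compact A -> compact B ->
  compact [set z | exists x y, [/\ A x, B y & z = (x * y^-1)%g]].
Proof.
move=> Ac Bc; rewrite (_ : mkset _ = (fun p : G * G => p.1 * p.2^-1)%g @` (A `*` B)).
  apply: continuous_compact; last exact: compact_setX.
  apply: continuous_subspaceT.
  have sw : continuous (fun p : G * G => (p.1, p.2^-1)%g).
    move=> p; apply: cvg_pair; first exact: cvg_fst.
    by apply: (@cvg_comp _ _ _ snd (fun x : G => x^-1)%g); [exact: cvg_snd | exact: invg_continuous].
  exact: continuous_fun_comp sw mulG_cont.
apply/seteqP; split=> [_ [x [y [Ax By ->]]]|_ [[x y] [/= Ax By] <-]]; first by exists (x, y).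
by exists x, y.
Qed.

Lemma rtrans_continuous (h : G -> K) : is_Cc h ->
  continuous (fun x => kint setT (fun y => h (y * x)%g) : K^o).
Proof.
move=> hC; apply/kabs_continuousP => x0 e e0; have [B Bc hB] := Cc_support hC.
have [D [Dc Dx _]] := compact_nbhs G_hausdorff G_lc (@filterT _ (nbhs x0) _).
have Ec := compact_mulV Bc Dc; set E := mkset _ in Ec.
pose d := e / (2 * (fine (mu E) + 1)).
have muE : 0 < fine (mu E) + 1 by rewrite ltr_wpDl // fine_ge0.
have d0 : 0 < d by rewrite divr_gt0 // mulr_gt0.
have hcont : continuous (fun p : G * G => h (p.2 * p.1)%g : K^o).
  have sw : continuous (fun p : G * G => (p.2, p.1)).
    by move=> p; apply: cvg_pair; [exact: cvg_snd | exact: cvg_fst].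
  by apply: continuous_fun_comp hC.1; exact: continuous_fun_comp sw mulG_cont.
have near1 := @compact_uniform R k G G K^o (fun x y => h (y * x)%g) E Ec hcont x0 d d0.
have x0D := nbhs_singleton Dx.
apply: filterS (filterI near1 Dx) => x [/= hx xD].
rewrite -kintB ?[X in kok _ _ X]/(fun _ => _) //; try exact/Cc_kok/Cc_rtranslate.
apply: (@le_lt_trans _ _ (d * fine (mu E))).
  apply: (kint_bound_compact G_hausdorff (haar_compact mu_haar)) => //.
  - by apply: kokB => //; exact/Cc_kok/Cc_rtranslate.
  - have zero z y : D z -> ~ E y -> h (y * z)%g = 0.
      move=> Dz Ey; apply: hB => Byz; apply: Ey; exists (y * z)%g, z; split=> //.
      by rewrite mulgK.
    by move=> y Ey; rewrite !zero // subrr.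
  by move=> y Ey; apply: ltW; exact: hx.
have -> : e = d * (2 * (fine (mu E) + 1)) by rewrite /d divfK // gt_eqF // mulr_gt0.
by rewrite ltr_pM2l // mulrDr; lra.
Qed.

(* Fubini on [(x, y) |-> h x * phi (y^-1 x)], after the substitution [x := y x]. *)
Lemma kint_inv_formula (phi h : G -> K) : is_Cc phi -> is_Cc h ->
  kint setT (fun x => phi x^-1%g) * kint setT h =
  kint setT (fun x => phi x * kint setT (fun y => h (y * x)%g)).
Proof.
move=> pC hC; have [Bp Bpc pB] := Cc_support pC; have [Bh Bhc hB] := Cc_support hC.
have Ec := compact_mulV Bhc Bpc; set E := mkset _ in Ec.
have inner x : kint setT (fun y => phi (y^-1 * x)%g) = kint setT (fun y => phi y^-1%g).
  rewrite -(kint_translate_Cc G_hausdorff mu_haar x^-1%g (Cc_inv pC)).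
  by apply: kint_ext => y _; rewrite invgM invgK.
have -> : kint setT (fun x => phi x^-1%g) * kint setT h =
    kint setT (fun x => kint setT (fun y => h x * phi (y^-1 * x)%g)).
  rewrite -kintZ //; last exact: Cc_kok.
  apply: kint_ext => x _; rewrite kintZ ?inner 1?mulrC //.
  apply: Cc_kok => //.
  have -> : (fun y => phi (y^-1 * x)%g) = fun y => (fun z => phi z^-1%g) (x^-1 * y)%g.
    by apply/funext => y; rewrite invgM invgK.
  exact: (Cc_translate G_hausdorff x^-1%g (Cc_inv pC)).
have hc := hC.1; have pc := pC.1.
have mulK (f g : G * G -> K) : continuous (f : G * G -> K^o) -> continuous (g : G * G -> K^o) ->
    continuous (fun p => f p * g p : K^o) by exact: continuous_mulK.
rewrite (@kint_fubini R k G G_hausdorff mu (haar_compact mu_haar) (fun x y => h x * phi (y^-1 * x)%g) Bh E) //.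
- transitivity (kint setT (fun y => kint setT (fun x => h (y * x)%g * phi x))).
    apply: kint_ext => y _.
    have tC : is_Cc (fun x => h x * phi (y^-1 * x)%g).
      by apply: Cc_mul => //; apply: continuous_fun_comp pc; exact: mulg_cont_l.
    rewrite -(kint_translate_Cc G_hausdorff mu_haar y tC).
    by apply: kint_ext => x _; rewrite mulKg.
  rewrite (@kint_fubini R k G G_hausdorff mu (haar_compact mu_haar) (fun y x => h (y * x)%g * phi x) E Bp) //.
  + apply: kint_ext => x _; rewrite -kintZ //; last exact/Cc_kok/Cc_rtranslate.
    by apply: kint_ext => y _; rewrite mulrC.
  + apply: mulK.
      by apply: continuous_fun_comp hc; exact: mulG_cont.
    by apply: continuous_fun_comp pc => p; exact: cvg_snd.
  + move=> y x /not_andP[nE|nB]; last by rewrite pB ?mulr0.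
    have [Bx|/pB ->] := pselect (Bp x); last by rewrite mulr0.
    rewrite hB ?mul0r // => Byx; apply: nE; exists (y * x)%g, x; split=> //.
    by rewrite mulgK.
- apply: mulK; first by apply: continuous_fun_comp hc => p; exact: cvg_fst.
  apply: continuous_fun_comp pc.
  have sw : continuous (fun p : G * G => (p.2, p.1)).
    by move=> p; apply: cvg_pair; [exact: cvg_snd | exact: cvg_fst].
  exact: continuous_fun_comp sw (@mulV_cont G).
- move=> x y /not_andP[nB|nE]; first by rewrite hB ?mul0r.
  have [Bx|/hB ->] := pselect (Bh x); last by rewrite mul0r.
  rewrite pB ?mulr0 // => Byx; apply: nE; exists x, (y^-1 * x)%g; split=> //.
  by rewrite invgM invgK mulVKg.
Qed.

(** [W x] compares the integral of a right translate of a bump with that of the bump. By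
    [kint_inv_formula] it is the density of the inverted measure. The same formula for arbitrary
    [h], with [test_zero], shows that right translation by [x] multiplies every integral by [W x],
    whence multiplicativity. *)
Lemma modular_function : exists W : G -> R, [/\ continuous W, (forall x, 0 < W x),
  (forall x y, W (x * y)%g = W x * W y) &
  forall phi : G -> K, is_Cc phi ->
    kint setT (fun x => phi x^-1%g) = kint setT (fun x => phi x * sc (W x))].
Proof.
have [B [Bc B1 _]] := compact_nbhs G_hausdorff G_lc (@filterT _ (nbhs (1%g : G)) _).
have [b [bc b01 b1 bB]] := bump_exists G_hausdorff G_lc R B1.
pose h0 x : K := sc (b x).
have h0C : is_Cc h0.
  by apply: (Cc_of_support G_hausdorff (sc_continuous bc) Bc) => x /bB; rewrite /h0 => ->; rewrite sc0.
pose I := \int[mu]_x b x.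
have b0 x : 0 <= b x by have /andP[] := b01 x.
have I0 : 0 < I.
  rewrite lt_neqAle Rintegral_ge0 ?andbT //; apply/eqP => /esym I0.
  by have := nonneg_integral_zero bc Bc bB b0 I0 1%g; rewrite b1 => /eqP; rewrite oner_eq0.
have scI : sc I != 0 :> K by rewrite sc_eq0 gt_eqF.
have h0I : kint setT h0 = sc I by exact: kint_sc.
pose W x := \int[mu]_y b (y * x)%g / I.
have h0W x : kint setT (fun y => h0 (y * x)%g) = sc (W x) * sc I.
  by rewrite -scM /W divfK ?gt_eqF //; exact: (@kint_sc R k G mu (fun y => b (y * x)%g)).
have Wc : continuous W.
  have -> : W = fun x => sc_re (kint setT (fun y => h0 (y * x)%g)) / I.
    by apply/funext => x; rewrite h0W -scM sc_reK mulfK // gt_eqF.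
  move=> x; apply: cvgM; last exact: cvg_cst.
  by apply: (@continuous_sc_re R k G (fun x => kint setT (fun y => h0 (y * x)%g))); exact: rtrans_continuous.
have WC phi : is_Cc phi -> is_Cc (fun x => phi x * sc (W x) : K).
  by move=> pC; apply: Cc_mul => //; exact: sc_continuous.
have Winv phi : is_Cc phi -> kint setT (fun x => phi x^-1%g) = kint setT (fun x => phi x * sc (W x)).
  move=> pC; apply: (mulIf scI); rewrite -{1}h0I kint_inv_formula // mulrC -kintZ //; last exact/Cc_kok/WC.
  by apply: kint_ext => x _; rewrite h0W; ring.
have Wh h x : is_Cc h -> kint setT (fun y => h (y * x)%g) = sc (W x) * kint setT h.
  move=> hC; apply/eqP; rewrite -subr_eq0; apply/eqP.
  have uc : continuous (fun x => kint setT (fun y => h (y * x)%g) - sc (W x) * kint setT h : K^o).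
    have c1 := rtrans_continuous hC.
    have c2 : continuous (fun x => sc (W x) * kint setT h : K^o).
      by apply: continuous_mulK; [exact: sc_continuous | move=> y; exact: cst_continuous].
    by move=> y; apply: cvgB; [exact: c1 | exact: c2].
  apply: (test_zero uc) => phi pC.
  have k1 : is_Cc (fun x => phi x * kint setT (fun y => h (y * x)%g)).
    by apply: Cc_mul => //; exact: rtrans_continuous.
  have k2 : is_Cc (fun x => kint setT h * (phi x * sc (W x))) by apply: Cc_scale => //; exact: WC.
  transitivity (kint setT (fun x => phi x * kint setT (fun y => h (y * x)%g)
      - kint setT h * (phi x * sc (W x)))); first by apply: kint_ext => y _; ring.
  rewrite kintB; [|exact: measurableT | exact: Cc_kok | exact: Cc_kok].
  rewrite kintZ; [|exact: measurableT | exact/Cc_kok/WC].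
  by rewrite -kint_inv_formula // Winv // mulrC subrr.
have WM x y : W (x * y)%g = W x * W y.
  apply: (@sc_inj R k); apply: (mulIf scI); rewrite -h0W scM -mulrA -h0W.
  rewrite -(@Wh (fun z => h0 (z * y)%g)); last exact: Cc_rtranslate.
  by apply: kint_ext => z _; rewrite mulgA.
have W0 x : 0 <= W x by rewrite /W divr_ge0 ?(ltW I0) // Rintegral_ge0.
have W1 : W 1%g = 1.
  rewrite /W; have -> : (fun y => b (y * 1)%g) = b by apply/funext => y; rewrite mulg1.
  by rewrite divff // gt_eqF.
exists W; split=> // x; rewrite lt_neqAle W0 andbT; apply/eqP => Wx.
have := WM x x^-1%g; rewrite mulgV W1 -Wx mul0r => /eqP; by rewrite oner_eq0.
Qed.

(** The scalars embed isometrically in any nonzero member of the class. This line carries the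
    characters used against a nontrivial modular function. *)
Lemma line_in_class (EE : banach -> Prop) : stable_by_finite_representability EE ->
  (exists2 X : banach, EE X & ~ finite_dim [set: X]) ->
  exists2 Y : banach, EE Y & exists2 y : Y, nrm y = 1 & forall z, exists a : K, z = a *: y.
Proof.
move=> EEs [X EX Xinf].
have [x x1] : exists x : X, nrm x = 1.
  have [v vi] := infinite_dim_independent Xinf 1.
  have v0 : v ord0 <> 0.
    move=> v0; have := vi (fun=> 1); rewrite big_ord1 v0 scaler0 => /(_ erefl ord0) /eqP.
    by rewrite oner_eq0.
  have nv := nrm_ge0_gt0 v0.
  exists (sc (nrm (v ord0))^-1 *: v ord0).
  by rewrite nrmZ kabs_sc gtr0_norm ?invr_gt0 // mulVf // gt_eqF.
have hc : forall u : nat -> K^o, (forall n, setT (u n)) ->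
    (forall e : R, 0 < e -> exists n0, forall m n, (n0 <= m)%N -> (n0 <= n)%N ->
       kabs (u m - u n) <= e) ->
    exists2 l, setT l & forall e : R, 0 < e -> exists n0, forall n, (n0 <= n)%N ->
       kabs (u n - l) <= e.
  by move=> u _ /scal_complete [l lP]; exists l.
pose L := @SeminormedSpace R k K^o setT (@kabs R k) Logic.I (fun _ _ _ _ _ => Logic.I)
  (fun a z _ => kabsM a z) (fun z w _ _ => kabsD z w) hc.
pose P a : sn_quot L := @sn_proj R k L a.
have PZ a : P a = a *: P 1.
  have := @sn_proj_linear R k L a 1 0 Logic.I Logic.I; rewrite addr0.
  have -> : @sn_proj R k L 0 = 0 :> sn_quot L.
    have := @sn_proj_linear R k L (-1) 0 0 Logic.I Logic.I.
    by rewrite scaler0 addr0 => ->; rewrite scaleN1r addNr.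
  by rewrite addr0 => <-; congr (P _); rewrite -[RHS]/(a * 1) mulr1.
have Pn a : nrm (P a) = kabs a by exact: (@nrm_sn_proj R k L).
have Ps z : exists a : K, z = P a by exists (sn_rep z); rewrite /P sn_repK.
exists (sn_quot L); last first.
  exists (P 1); first by rewrite Pn kabs1.
  by move=> z; have [a ->] := Ps z; exists a; exact: PZ.
apply: (@fr_limit R k unit (principal_filter tt) (principal_filter_proper tt) (fun=> X)) => // n v.
have /choice [a aP] i := Ps (v i).
exists (fun _ i => a i *: x) => c.
rewrite (_ : (fun _ => _) = fun=> nrm (\sum_(i < n) c i *: v i)); first exact: ucvg_cst.
apply/funext => _; under eq_bigr do rewrite scalerA.
rewrite -scaler_suml nrmZ x1 mulr1.
rewrite [in RHS](eq_bigr (fun i => (c i * a i) *: P 1)); last by move=> i _; rewrite aP PZ scalerA.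
by rewrite -scaler_suml nrmZ Pn kabs1 mulr1.
Qed.

(** * Triviality of the modular function and invariance under inversion *)

Section Inversion.
Variable S : set G.
Hypothesis S_compact : compact S.
Hypothesis S_one : S 1%g.
Hypothesis S_generates : forall g, exists n, spow S n g.
Variables (EE : banach -> Prop) (s C : R).
Hypothesis EEs : stable_by_finite_representability EE.
Hypothesis EEinf : exists2 X : banach, EE X & ~ finite_dim [set: X].
Hypothesis s0 : 0 < s.
Hypothesis C0 : 0 < C.
Local Notation F := (family_of EE (fun g => s * (word_length S g)%:R + C)).
Variables (f : G -> K) (c0 : R).
Hypothesis c00 : 0 <= c0.
Hypothesis fC : is_Cc f.
Hypothesis f_contracts : forall (E : banach) (pi : G -> {linear E -> E}) x d, F pi ->
  0 <= d -> (forall g, S g -> nrm (pi g x - x) <= d) ->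
  nrm (rint mu pi f x - x) <= c0 * d /\
  forall g, S g -> nrm (pi g (rint mu pi f x) - rint mu pi f x) <= d / 2.

(* A nontrivial character [W] would give, for small [t], one-dimensional representations
   [W^t] in [F] whose vectors are moved a little, but not less by averaging. *)
Lemma character_trivial (W : G -> R) : continuous W -> (forall x, 0 < W x) ->
  (forall x y, W (x * y)%g = W x * W y) -> forall x, W x = 1.
Proof.
move=> Wc W0 WM.
pose la x := ln (W x).
have laM x y : la (x * y)%g = la x + la y by rewrite /la WM lnM ?posrE.
have lac : continuous la.
  by move=> x; apply: (@cvg_comp _ _ _ W (@ln R)); [exact: Wc | exact: continuous_ln].
have [M [M0 laS]] := compact_bound S_compact lac.
have la1 : la 1%g = 0 by have := laM 1%g 1%g; rewrite mulg1; lra.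
have lan n g : spow S n g -> `|la g| <= M * n%:R.
  elim: n g => [|n IH] g; first by move=> /= ->; rewrite la1 normr0 mulr0.
  move=> [x [y [Sx Sy ->]]]; rewrite laM -natr1 mulrDr mulr1.
  by rewrite (le_trans (ler_normD _ _)) // lerD ?laS // IH.
have [Y EY [y y1 yY]] := line_in_class EEs EEinf.
(* Then c0 e <= 1 / 4: if [S] moves the unit vector [y] by at most [e], averaging keeps its norm
   above 3 / 4. *)
pose e := (4 * (c0 + 1))^-1.
have c1 : 0 < 4 * (c0 + 1) by rewrite mulr_gt0 // ltr_wpDl.
have e0 : 0 < e by rewrite invr_gt0.
have ec : c0 * e <= 1 / 4.
  by rewrite /e ler_pdivrMr //; lra.
have e14 : e <= 1 / 4.
  have c0' : 0 <= c0 by exact: c00.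
  rewrite /e -div1r ler_pdivrMr //; lra.
(* On [S], |t la| is at most e / 2, which keeps the character within [e] of 1, and at most [s],
   which keeps its growth below s l. *)
pose t := Num.min (e / 2) s / (M + 1).
have M1 : 0 < M + 1 by rewrite ltr_wpDl.
have mn0 : 0 < Num.min (e / 2) s by rewrite lt_min s0 divr_gt0.
have t0 : 0 < t by rewrite divr_gt0.
have tM : t * M <= Num.min (e / 2) s.
  by rewrite /t mulrAC ler_pdivrMr // ler_wpM2l ?(ltW mn0) // lerDl.
have tMe : t * M <= e / 2 by apply: le_trans tM _; rewrite ge_min lexx.
have tMs : t * M <= s by apply: le_trans tM _; rewrite ge_min lexx orbT.
pose chi g := expR (t * la g).
have chiM g h : chi (g * h)%g = chi g * chi h by rewrite /chi laM mulrDr expRD.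
have chilin g : linear (fun z : Y => sc (chi g) *: z).
  by move=> a u v; rewrite scalerDr !scalerA mulrC.
pose pi g := lin_of (chilin g).
have pin g z : nrm (pi g z) = chi g * nrm z.
  by rewrite lin_ofE nrmZ kabs_sc gtr0_norm ?expR_gt0.
have piB g z : nrm (pi g z - z) = `|chi g - 1| * nrm z.
  by rewrite lin_ofE -{2}[z]scale1r -scalerBl nrmZ -sc1 -scB kabs_sc.
have Fpi : F pi.
  split; last first.
  - move=> g z; rewrite pin ler_wpM2r ?nrm_ge0 // ler_expR.
    have := lan _ _ (word_lengthP (S_generates g)); set l := (word_length S g)%:R => h.
    have l0 : 0 <= l by rewrite ler0n.
    have : t * la g <= t * (M * l).
      by rewrite ler_pM2l // (le_trans (ler_norm _)).
    have : t * M * l <= s * l by rewrite ler_wpM2r.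
    by have := C0; lra.
  - by exists Y => //; exists idfun; split=> //; exists idfun.
  split.
  - by move=> z; rewrite lin_ofE /chi la1 mulr0 expR0 sc1 scale1r.
  - by move=> g h z; rewrite !lin_ofE chiM scM scalerA.
  - by move=> g; apply: (@bounded_lin _ _ _ _ _ (chi g)) => z; rewrite pin.
  - move=> z; apply/nrm_continuousP => g r r0.
    have chic : continuous chi.
      move=> x; apply: (@cvg_comp _ _ _ (fun x => t * la x) (@expR R)); last exact: continuous_expR.
      by apply: cvgM; [exact: cvg_cst | exact: lac].
    have z1 : 0 < nrm z + 1 by rewrite ltr_wpDl ?nrm_ge0.
    have /(@cvgrPdist_lt R R) /(_ (r / (nrm z + 1))) := chic g.
    move=> /(_ ltac:(by rewrite divr_gt0)); apply: filterS => h.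
    rewrite !lin_ofE -scalerBl nrmZ -scB kabs_sc distrC => hr.
    apply: (@le_lt_trans _ _ (`|chi h - chi g| * (nrm z + 1))).
      by rewrite ler_wpM2l // lerDl.
    by rewrite -ltr_pdivlMr.
pose A := [set `|chi g - 1| | g in S].
have chiS g : S g -> `|chi g - 1| <= e.
  move=> Sg; have tl : `|t * la g| <= e / 2.
    by rewrite normrM gtr0_norm // (le_trans _ tMe) // ler_pM2l // laS.
  have h1 := expR_ge1Dx (t * la g); have h2 := expR_ge1Dx (- (t * la g)).
  rewrite -/(chi g) in h1; move: tl h1 h2; rewrite ler_norml => /andP[k1 k2] h1.
  rewrite expRN -/(chi g) => h2; have g0 : 0 < chi g by exact: expR_gt0.
  rewrite -(ler_pM2r g0) mulVf ?gt_eqF // in h2.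
  have h3 : chi g * (1 - e / 2) <= 1.
    by apply: le_trans h2; rewrite mulrC ler_pM2r //; lra.
  have h4 : chi g <= 1 + e.
    have a1 : 0 < 1 - e / 2 by lra.
    rewrite -(ler_pM2r a1); apply: (le_trans h3); have := mulr_ge0 (ltW e0) (ltW e0); have := e14.
    by nra.
  by rewrite ler_norml; apply/andP; split; lra.
have As : has_sup A.
  split; first by exists `|chi 1%g - 1|, 1%g.
  by exists e => _ [g Sg <-]; exact: chiS.
have A0 : 0 <= sup A.
  by apply: (@le_trans _ _ `|chi 1%g - 1|) => //; apply: sup_upper_bound => //; exists 1%g.
have [|v1 v2] := f_contracts Fpi A0 (x := y).
  by move=> g Sg; rewrite piB y1 mulr1; apply: sup_upper_bound => //; exists g.
have Ae : sup A <= e by apply: sup_le_ub; [case: As | move=> _ [g Sg <-]; exact: chiS].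
set v := rint mu pi f y in v1 v2.
have vn : 3 / 4 <= nrm v.
  have h1 : c0 * sup A <= 1 / 4 by apply: le_trans ec; rewrite ler_wpM2l.
  have := nrm_triangle y v 0; rewrite !subr0 y1 nrmBC; lra.
(* On a line every vector [z] is displaced by |chi(g) - 1| |z|. The average has norm at least 3 / 4
   and displacement at most sup A / 2, so sup A is 0 and the character is trivial on [S]. *)
have A2 : sup A <= 2 / 3 * sup A.
  apply: sup_le_ub; first by case: As.
  move=> _ [g Sg <-]; have := v2 g Sg; rewrite piB => h.
  have : `|chi g - 1| * (3 / 4) <= `|chi g - 1| * nrm v by rewrite ler_wpM2l.
  lra.
have chi1 g : S g -> la g = 0.
  move=> Sg; have : `|chi g - 1| <= sup A by apply: sup_upper_bound => //; exists g.
  move=> h; have /eqP : `|chi g - 1| = 0 by apply/eqP; rewrite eq_le normr_ge0 andbT; lra.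
  rewrite normr_eq0 subr_eq0 /chi => /eqP h'; have := congr1 (@ln R) h'.
  by rewrite expRK ln1 => /eqP; rewrite mulf_eq0 gt_eqF //= => /eqP.
have la0 x : la x = 0.
  have [n] := S_generates x; elim: n x => [|n IH] x; first by move=> /= ->.
  by move=> [a [b [Sa Sb ->]]]; rewrite laM IH // chi1 // addr0.
by move=> x; rewrite -[W x]lnK ?posrE // -/(la x) la0 expR0.
Qed.

Lemma kint_inv (phi : G -> K) : is_Cc phi -> kint setT (fun x => phi x^-1%g) = kint setT phi.
Proof.
move=> pC; have [W [Wc W0 WM Wi]] := modular_function; rewrite Wi //.
by apply: kint_ext => x _; rewrite (character_trivial Wc W0 WM) sc1 mulr1.
Qed.

Lemma invgE (A : set G) : [set x^-1%g | x in A] = [set x | A x^-1%g].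
Proof.
apply/seteqP; split=> [_ [x Ax <-]|x Ax]; first by rewrite /= invgK.
by exists x^-1%g; rewrite ?invgK.
Qed.

Lemma measurable_invg (A : set G) : measurable (A : set (borelType G)) ->
  measurable ([set x | A x^-1%g] : set (borelType G)).
Proof.
move=> mA; have := borel_continuous_map (@invg_continuous G) measurableT mA.
by rewrite setTI.
Qed.

(** Inner regularity reduces [U] to a compact subset, and a bump between the two lets [kint_inv] act
    on sets. *)
Lemma haar_inv_open (U : set G) : open U -> (mu U <= mu [set x | U x^-1%g])%E.
Proof.
move=> Uo; rewrite (haar_inner mu_haar Uo); apply: ge_ereal_sup => _ [A [Ac AU] <-].
have [h [B [hc h01 hA Bc [BU hB]]]] := compact_bump G_hausdorff G_lc R Ac Uo AU.
pose A' := [set x | A x^-1%g].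
have h0 x : 0 <= h x by have /andP[] := h01 x.
have iBc : compact [set x | B x^-1%g].
  rewrite -invgE; apply: continuous_compact => //; apply: continuous_subspaceT; exact: invg_continuous.
have AB : A `<=` B.
  by move=> x Ax; apply: contrapT => /hB; rewrite hA // => /eqP; rewrite oner_eq0.
have mA := borel_compact G_hausdorff Ac; have mB := borel_compact G_hausdorff iBc.
have hC : is_Cc (fun x => sc (h x) : K).
  by apply: (Cc_of_support G_hausdorff (sc_continuous hc) Bc) => x /hB ->; rewrite sc0.
have h1 : fine (mu A) <= \int[mu]_x h x.
  have := @mass_le_integral h B A 1 hc Bc hB h0 mA AB; rewrite mul1r; apply.
  by move=> x Ax; rewrite hA.
have h2 : \int[mu]_x h x <= fine (mu [set x | B x^-1%g]).
  have := kint_bound_compact G_hausdorff (haar_compact mu_haar)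
    (Cc_kok G_hausdorff mu_haar measurableT (Cc_inv hC)) iBc.
  move=> /(_ 1); have e1 := kint_inv hC; rewrite /= in e1; rewrite e1 kint_sc kabs_sc mul1r => h2.
  apply: le_trans (ler_norm _) (h2 _ _); first by move=> x /hB ->; rewrite sc0.
  by move=> x _; rewrite kabs_sc ger0_norm //; have /andP[] := h01 x^-1%g.
have fA : (mu A \is a fin_num)%E by rewrite ge0_fin_numE // (haar_compact mu_haar Ac).
have fB : (mu [set x | B x^-1%g] \is a fin_num)%E by rewrite ge0_fin_numE // (haar_compact mu_haar iBc).
apply: (@le_trans _ _ (mu [set x | B x^-1%g])).
  by rewrite -(fineK fA) -(fineK fB) lee_fin (le_trans h1).
apply: le_measure; rewrite ?inE //; first by apply: measurable_invg; exact: borel_open.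
by move=> x /BU.
Qed.

(** Outer regularity passes from open to Borel sets; the inequality applied to the inverse set is
    the converse one. *)
Lemma haar_inv (A : set G) : measurable (A : set (borelType G)) -> mu [set x | A x^-1%g] = mu A.
Proof.
suff h (D : set G) : measurable (D : set (borelType G)) -> (mu [set x | D x^-1%g] <= mu D)%E.
  move=> mA; apply/eqP; rewrite eq_le h //=; have := h _ (measurable_invg mA).
  by under eq_set do rewrite /= invgK.
move=> mD; rewrite (haar_outer mu_haar mD); apply: le_ereal_inf_tmp => _ [U [Uo DU] <-].
have iUo : open [set x | U x^-1%g] by apply: (open_comp _ Uo) => x _; exact: invg_continuous.
have := haar_inv_open iUo; under [X in (_ <= mu X)%E]eq_set do rewrite /= invgK.
apply: le_trans; apply: le_measure; rewrite ?inE //; first exact: measurable_invg.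
  exact: borel_open.
by move=> x /DU.
Qed.

Lemma Rintegral_inv (g : G -> R) (A B : set G) : continuous g -> compact B ->
  (forall x, ~ B x -> g x = 0) -> measurable (A : set (borelType G)) ->
  \int[mu]_(x in A) g x^-1%g = \int[mu]_(x in [set x | A x^-1%g]) g x.
Proof.
move=> gc Bc gB mA; have minv := borel_continuous_map (@invg_continuous G).
have mA' := measurable_invg mA.
have iBc : compact [set x | B x^-1%g].
  rewrite -invgE; apply: continuous_compact => //; apply: continuous_subspaceT; exact: invg_continuous.
have e1 : (fun x : borelType G => x^-1%g : borelType G) @^-1` [set x | A x^-1%g] = A.
  by apply/funext => x /=; rewrite invgK.
have gi : mu.-integrable A (fun x => (g x^-1%g)%:E).
  apply: (rintegrable_Cc (g := fun x => g x^-1%g) G_hausdorff (haar_compact mu_haar) mA iBc) => [|x].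
    exact: continuous_fun_comp (@invg_continuous G) gc.
  exact: gB.
rewrite /Rintegral; congr fine; transitivity
  (\int[pushforward mu (fun x : borelType G => (x^-1%g : borelType G))]_(x in [set x | A x^-1%g]) (g x)%:E)%E.
  by rewrite (integral_pushforward minv) ?e1 //; apply/measurable_EFinP; exact: borel_continuous.
apply: eq_measure_integral => D mD _; exact: haar_inv.
Qed.

Lemma kint_inv_set (u : G -> K) (A : set G) : is_Cc u -> measurable (A : set (borelType G)) ->
  kint A (fun x => u x^-1%g) = kint [set x | A x^-1%g] u.
Proof.
move=> uC mA; have [B Bc uB] := Cc_support uC; have uc := uC.1.
rewrite !kintE; congr (sc _ + sc_i * sc _).
  by apply: (Rintegral_inv (continuous_sc_re uc) Bc) => // x /uB ->; rewrite sc_re0.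
by apply: (Rintegral_inv (continuous_sc_im uc) Bc) => // x /uB ->; rewrite -sc0 sc_imK.
Qed.

Lemma set_integrals_le0 (g : G -> R) (B : set G) : continuous g -> compact B ->
  (forall x, ~ B x -> g x = 0) ->
  (forall A, measurable (A : set (borelType G)) -> \int[mu]_(x in A) g x = 0) -> forall x, g x <= 0.
Proof.
move=> gc Bc gB gA x; rewrite leNgt; apply/negP => gx.
pose O : set G := [set y | g x / 2 < g y].
have Oo : open O by apply: open_comp (@open_gt R (g x / 2)) => y _; exact: gc.
have Ox : O x by rewrite /O /=; lra.
have OB : O `<=` B by move=> y Oy; apply: contrapT => /gB gy; move: Oy; rewrite /O /= gy; lra.
have mO := borel_open Oo.
have muO : (mu O < +oo)%E.
  apply: le_lt_trans (haar_compact mu_haar Bc); apply: le_measure; rewrite ?inE //.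
  exact: borel_compact.
have : 0 < fine (mu O) by rewrite fine_gt0 // muO (haar_nonempty_open_gt0 Oo Ox).
have : g x / 2 * fine (mu O) <= 0.
  rewrite -Rintegral_cst // -(gA O mO); apply: le_Rintegral => //.
  - apply: (@measurable_bounded_integrable _ (borelType G) _ mu (fun=> g x / 2)) => //.
    exists `|g x / 2|; split; first exact: num_real.
    by move=> M MN y _; exact: ltW.
  - exact: (rintegrable_Cc G_hausdorff (haar_compact mu_haar) mO Bc gc gB).
  by move=> y /ltW.
by move=> h1 h2; have := mulr_gt0 gx h2; lra.
Qed.

(** [is_tilde] compares integrals over Borel sets, hence the passage through [haar_inv]. A
    continuous function all of whose integrals over sets vanish is 0, as seen on the signs of its
    real and imaginary parts. *)
Lemma is_tildeE (u v : G -> K) : is_Cc u -> is_tilde mu u v <-> v = fun x => u x^-1%g.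
Proof.
move=> uC; have iC := Cc_inv uC; split=> [[vC uv]|->]; last first.
  by split=> // A mA; rewrite kint_inv_set // invgE.
pose d := v \- (fun x => u x^-1%g); have dC : is_Cc d by exact: Cc_sub.
have d0 A : measurable (A : set (borelType G)) -> kint A d = 0.
  by move=> mA; rewrite kintB ?uv ?kint_inv_set ?invgE ?subrr //; exact: Cc_kok.
have [B Bc dB] := Cc_support dC; have dc := dC.1.
have re_le : forall x, sc_re (d x) <= 0.
  apply: (set_integrals_le0 (continuous_sc_re dc) Bc) => [x /dB ->|A mA]; first by rewrite sc_re0.
  by rewrite -sc_re_kint d0 // sc_re0.
have im_le : forall x, sc_im (d x) <= 0.
  apply: (set_integrals_le0 (continuous_sc_im dc) Bc) => [x /dB ->|A mA]; first by rewrite -sc0 sc_imK.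
  by rewrite -sc_im_kint d0 // -sc0 sc_imK.
have NC : is_Cc (fun x => -1 * d x) by exact: Cc_scale.
have nc := NC.1.
have re_ge : forall x, sc_re (-1 * d x) <= 0.
  apply: (set_integrals_le0 (continuous_sc_re nc) Bc) => [x /dB ->|A mA]; first by rewrite mulr0 sc_re0.
  by rewrite -sc_re_kint kintZ ?d0 ?mulr0 ?sc_re0 //; exact: Cc_kok.
have im_ge : forall x, sc_im (-1 * d x) <= 0.
  apply: (set_integrals_le0 (continuous_sc_im nc) Bc) => [x /dB ->|A mA]; first by rewrite mulr0 -sc0 sc_imK.
  by rewrite -sc_im_kint kintZ ?d0 ?mulr0 -?sc0 ?sc_imK //; exact: Cc_kok.
apply/funext => x; apply/eqP; rewrite -subr_eq0; apply/eqP; rewrite -[LHS]/(d x) (sc_decomp (d x)).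
have := re_ge x; have := im_ge x; rewrite !mulN1r sc_reN sc_imN => h1 h2.
have -> : sc_re (d x) = 0 by have := re_le x; lra.
have -> : sc_im (d x) = 0 by have := im_le x; lra.
by rewrite sc0 mulr0 addr0.
Qed.

End Inversion.

End Unimodular.

(** * Dual spaces and contragredient representations *)

Section DualSpace.
Context (R : realType) (k : scalar_kind).
Local Notation K := (scal R k).
Local Notation banach := (completeNormedModType K).
Variable E : banach.
Local Notation V := (E -> K^o).
Variable Q : V -> Prop.

Definition bounded_functional (f : V) :=
  linear f /\ exists M : R, forall x, kabs (f x) <= M * nrm x.

(** With [Q] always true this is the full dual; with [Q] a continuity condition for a group action,
    the part of the dual on which the action is continuous. Both are needed: duality stability
    speaks of the first, representations live on the second. *)
Definition dual_sub : set V := [set f | bounded_functional f /\ Q f].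

Definition dual_norm (f : V) : R := sup [set kabs (f x) | x in [set x | nrm x <= 1]].

Hypothesis Q0 : Q 0.
Hypothesis QP : forall (a : K) f g, dual_sub f -> dual_sub g -> Q (a *: f + g).
Hypothesis QC : forall f, bounded_functional f ->
  (forall e : R, 0 < e -> exists2 g, dual_sub g & forall x, kabs (f x - g x) <= e * nrm x) -> Q f.

Lemma fct_linE (a : K) (f g : V) x : (a *: f + g) x = a * f x + g x. Proof. by []. Qed.
Lemma fct_subE (f g : V) x : (f - g) x = f x - g x. Proof. by []. Qed.

Lemma functional0 (f : V) : linear f -> f 0 = 0.
Proof. by move=> fl; exact: linear0 (lin_of fl). Qed.

Lemma functionalZ (f : V) (a : K) x : linear f -> f (a *: x) = a * f x.
Proof. by move=> fl; have := linearZ_LR (lin_of fl) a x. Qed.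

Lemma dual_has_sup f : bounded_functional f -> has_sup [set kabs (f x) | x in [set x | nrm x <= 1]].
Proof.
move=> [fl [M fM]]; split; first by exists (kabs (f 0)), 0 => //=; rewrite nrm0.
exists `|M| => _ [x /= x1 <-]; apply: le_trans (fM x) _.
apply: (@le_trans _ _ (`|M| * nrm x)); first by rewrite ler_wpM2r ?nrm_ge0 ?ler_norm.
by rewrite ler_piMr.
Qed.

Lemma dual_normP f x : bounded_functional f -> kabs (f x) <= dual_norm f * nrm x.
Proof.
move=> fb; have [x0|/eqP x0] := eqVneq (nrm x) 0.
  by rewrite (nrm_eq0 x0) functional0 ?kabs0 ?nrm0 ?mulr0 //; case: fb.
have xp : 0 < nrm x by rewrite lt_neqAle eq_sym nrm_ge0 andbT; apply/eqP.
have : kabs (f (sc (nrm x)^-1 *: x)) <= dual_norm f.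
  apply: sup_upper_bound; first exact: dual_has_sup.
  by exists (sc (nrm x)^-1 *: x) => //=; rewrite nrmZ kabs_sc gtr0_norm ?invr_gt0 // mulVf // gt_eqF.
rewrite functionalZ; last by case: fb.
by rewrite kabsM kabs_sc gtr0_norm ?invr_gt0 // ler_pdivrMl // mulrC.
Qed.

Lemma dual_norm_le f M : bounded_functional f -> 0 <= M ->
  (forall x, kabs (f x) <= M * nrm x) -> dual_norm f <= M.
Proof.
move=> fb M0 fM; apply: sup_le_ub; first by case: (dual_has_sup fb).
by move=> _ [x /= x1 <-]; rewrite (le_trans (fM x)) // ler_piMr.
Qed.

Lemma dual_norm_ge0 f : bounded_functional f -> 0 <= dual_norm f.
Proof.
move=> fb; apply: (@le_trans _ _ (kabs (f 0))); first exact: kabs_ge0.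
by apply: sup_upper_bound; [exact: dual_has_sup | exists 0 => //=; rewrite nrm0].
Qed.

Lemma bounded_functionalP (a : K) f g : bounded_functional f -> bounded_functional g ->
  bounded_functional (a *: f + g).
Proof.
move=> fb gb; have [fl _] := fb; have [gl _] := gb; split.
  by move=> b x y; rewrite !fct_linE fl gl -![_ *: _]/(_ * _); ring.
exists (kabs a * dual_norm f + dual_norm g) => x; rewrite fct_linE (le_trans (kabsD _ _)) //.
rewrite kabsM mulrDl lerD ?dual_normP // -mulrA ler_wpM2l ?kabs_ge0 // dual_normP //.
Qed.

Lemma dual_sub0 : dual_sub 0.
Proof.
split; last exact: Q0.
split; first by move=> a x y; rewrite -[RHS]/(a * 0 + 0) mulr0 addr0.
by exists 0 => x; rewrite kabs0 mul0r.
Qed.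

Lemma dual_subP (a : K) f g : dual_sub f -> dual_sub g -> dual_sub (a *: f + g).
Proof.
by move=> fW gW; split; [apply: bounded_functionalP; [case: fW | case: gW] | exact: QP].
Qed.

Lemma dual_normZ (a : K) f : dual_sub f -> dual_norm (a *: f) = kabs a * dual_norm f.
Proof.
have le b g : bounded_functional g -> dual_norm (b *: g) <= kabs b * dual_norm g.
  move=> gb; have bb : bounded_functional (b *: g).
    by have := bounded_functionalP b gb dual_sub0.1; rewrite addr0.
  apply: dual_norm_le => //; first by rewrite mulr_ge0 ?kabs_ge0 // dual_norm_ge0.
  move=> x; rewrite -[(b *: g) x]/(b * g x) kabsM -mulrA ler_wpM2l ?kabs_ge0 //.
  exact: dual_normP.
move=> [fb _]; apply/eqP; rewrite eq_le le //=.
have [->|a0] := eqVneq a 0.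
  by rewrite kabs0 mul0r dual_norm_ge0 //; have := bounded_functionalP 0 fb dual_sub0.1; rewrite addr0.
have afb : bounded_functional (a *: f).
  by have := bounded_functionalP a fb dual_sub0.1; rewrite addr0.
have := le a^-1 _ afb; rewrite scalerA mulVf // scale1r kabsV.
by rewrite ler_pdivlMl // kabs_gt0.
Qed.

Lemma dual_normD f g : dual_sub f -> dual_sub g -> dual_norm (f + g) <= dual_norm f + dual_norm g.
Proof.
move=> [fb _] [gb _]; have fgb : bounded_functional (f + g).
  by have := bounded_functionalP 1 fb gb; rewrite scale1r.
apply: dual_norm_le => //; first by rewrite addr_ge0 ?dual_norm_ge0.
move=> x; rewrite -[(f + g) x]/(f x + g x) (le_trans (kabsD _ _)) // mulrDl.
by rewrite lerD // dual_normP.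
Qed.

Lemma dual_subB f g : dual_sub f -> dual_sub g -> dual_sub (f - g).
Proof. by move=> fW gW; rewrite addrC -scaleN1r; exact: dual_subP. Qed.

Lemma dual_complete (u : nat -> V) : (forall n, dual_sub (u n)) ->
  (forall e : R, 0 < e -> exists n0, forall m n, (n0 <= m)%N -> (n0 <= n)%N ->
     dual_norm (u m - u n) <= e) ->
  exists2 l, dual_sub l & forall e : R, 0 < e -> exists n0, forall n, (n0 <= n)%N ->
     dual_norm (u n - l) <= e.
Proof.
move=> uW uc.
have uB m n x : kabs (u m x - u n x) <= dual_norm (u m - u n) * nrm x.
  by rewrite -fct_subE dual_normP //; have [] := dual_subB (uW m) (uW n).
have /choice [l lP] x : exists l, forall e : R, 0 < e -> exists n0, forall n, (n0 <= n)%N ->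
    kabs (u n x - l) <= e.
  apply: scal_complete => e e0; have x1 : 0 < nrm x + 1 by rewrite ltr_wpDl ?nrm_ge0.
  have [|n0 hn0] := uc (e / (nrm x + 1)); first by rewrite divr_gt0.
  exists n0 => m n hm hn; apply: le_trans (uB m n x) _.
  apply: le_trans (ler_wpM2r (nrm_ge0 x) (hn0 _ _ hm hn)) _.
  by rewrite mulrAC ler_pdivrMr // ler_wpM2l ?(ltW e0) // lerDl.
have ul e n0 : (forall m n, (n0 <= m)%N -> (n0 <= n)%N -> dual_norm (u m - u n) <= e) ->
    forall n x, (n0 <= n)%N -> kabs (u n x - l x) <= e * nrm x.
  move=> h n x hn; apply/ler_addgt0Pl => r r0; have [n1 h1] := lP x r r0.
  pose m := maxn n0 n1.
  rewrite -[u n x](subrK (u m x)) -addrA (le_trans (kabsD _ _)) // [leRHS]addrC lerD //.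
    apply: le_trans (uB n m x) _; rewrite ler_wpM2r ?nrm_ge0 //.
    by apply: h => //; exact: leq_maxl.
  by apply: h1; exact: leq_maxr.
have lb : bounded_functional l.
  split.
    move=> a x y; apply/eqP; rewrite -subr_eq0 -kabs_eq0 eq_le kabs_ge0 andbT.
    apply/ler_addgt0Pl => e e0; rewrite addr0.
    pose A := nrm (a *: x + y) + kabs a * nrm x + nrm y + 1.
    have A0 : 0 < A by rewrite /A ltr_wpDl // !addr_ge0 ?nrm_ge0 // mulr_ge0 ?kabs_ge0 ?nrm_ge0.
    have [|n0 hn0] := uc (e / A); first by rewrite divr_gt0.
    have h := ul _ _ hn0 n0 _ (leqnn n0); have [[unl _] _] := uW n0.
    have -> : l (a *: x + y) - (a *: l x + l y) =
        - (u n0 (a *: x + y) - l (a *: x + y)) + (a * (u n0 x - l x) + (u n0 y - l y)).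
      rewrite unl -[_ *: u n0 x]/(a * u n0 x) -?[_ *: l x]/(a * l x).
      by move: (u n0 x) (u n0 y) (l x) (l y) (l _) => a1 a2 a3 a4 a5; ring.
    apply: le_trans (kabsD _ _) _; rewrite kabsN.
    apply: le_trans (lerD (h (a *: x + y)) (kabsD _ _)) _; rewrite kabsM.
    have := ler_wpM2l (kabs_ge0 a) (h x); have := h y => h1 h2.
    apply: (@le_trans _ _ (e / A * A)); last by rewrite divfK // gt_eqF.
    have eA : 0 <= e / A by rewrite divr_ge0 ?ltW.
    by move: (e / A) eA h1 h2 => r r0 h1 h2; rewrite /A; lra.
  have [n0 hn0] := uc 1 ltr01; have [ub _] := uW n0.
  exists (1 + dual_norm (u n0)) => x; have := ul _ _ hn0 n0 x (leqnn n0).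
  have := dual_normP x ub => h1; rewrite mulrDl -kabsN opprB => h2.
  by have := kabsD (l x - u n0 x) (u n0 x); rewrite subrK => h3; apply: le_trans h3 _; rewrite lerD.
have lW : dual_sub l.
  split=> //; apply: QC => // e e0; have [n0 hn0] := uc e e0.
  by exists (u n0) => // x; rewrite -kabsN opprB; exact: (ul _ _ hn0).
exists l => // e e0; have [n0 hn0] := uc e e0; exists n0 => n hn.
apply: dual_norm_le; [by case: (dual_subB (uW n) lW) | exact: ltW |].
by move=> x; exact: (ul _ _ hn0).
Qed.

Definition dual_seminormed := @SeminormedSpace R k V dual_sub dual_norm dual_sub0 dual_subP
  dual_normZ dual_normD dual_complete.
Definition dual_space : banach := sn_quot dual_seminormed.
Definition dual_proj (f : V) : dual_space := @sn_proj R k dual_seminormed f.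
Definition dual_ev (xi : dual_space) : V := @sn_rep R k dual_seminormed xi.

Lemma dual_evP xi : dual_sub (dual_ev xi).
Proof. exact: (@sn_repP R k dual_seminormed). Qed.

Lemma dual_evK xi : dual_proj (dual_ev xi) = xi.
Proof. exact: (@sn_repK R k dual_seminormed). Qed.

Lemma dual_projK f : dual_sub f -> dual_ev (dual_proj f) = f.
Proof.
move=> fW; have h : dual_norm (dual_ev (dual_proj f) - f) = 0.
  exact: (@sn_projK R k dual_seminormed).
apply/funext => x; apply/eqP; rewrite -subr_eq0 -kabs_eq0 eq_le kabs_ge0 andbT -fct_subE.
have [db _] := dual_subB (dual_evP (dual_proj f)) fW.
by have := dual_normP x db; rewrite h mul0r.
Qed.

Lemma nrm_dual xi : nrm xi = dual_norm (dual_ev xi).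
Proof. by rewrite -{1}(dual_evK xi); apply: (@nrm_sn_proj R k dual_seminormed); exact: dual_evP. Qed.

Lemma dual_proj_lin (a : K) f g : dual_sub f -> dual_sub g ->
  dual_proj (a *: f + g) = a *: dual_proj f + dual_proj g.
Proof. exact: (@sn_proj_linear R k dual_seminormed). Qed.

Lemma dual_ev_lin (a : K) xi eta x : dual_ev (a *: xi + eta) x = a * dual_ev xi x + dual_ev eta x.
Proof.
have xiW := dual_evP xi; have etaW := dual_evP eta.
rewrite -{1}(dual_evK xi) -{1}(dual_evK eta) -dual_proj_lin // dual_projK //.
exact: dual_subP.
Qed.

Lemma dual_ev0 x : dual_ev 0 x = 0.
Proof.
have := dual_ev_lin (-1) 0 0 x; rewrite scaler0 addr0 mulN1r addNr; exact.
Qed.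

Lemma dual_ev_sum (I : Type) (l : seq I) (c : I -> K) (v : I -> dual_space) x :
  dual_ev (\sum_(i <- l) c i *: v i) x = \sum_(i <- l) c i * dual_ev (v i) x.
Proof.
elim: l => [|i l IH]; first by rewrite !big_nil dual_ev0.
by rewrite !big_cons dual_ev_lin IH.
Qed.

Lemma dual_ev_inj xi eta : (forall x, dual_ev xi x = dual_ev eta x) -> xi = eta.
Proof. by move=> h; rewrite -(dual_evK xi) -(dual_evK eta); congr dual_proj; apply/funext. Qed.

Lemma dual_ev_linear xi : linear (dual_ev xi).
Proof. by have [[]] := dual_evP xi. Qed.

Lemma dual_ev_le xi x : kabs (dual_ev xi x) <= nrm xi * nrm x.
Proof. by rewrite nrm_dual; apply: dual_normP; have [] := dual_evP xi. Qed.

Lemma nrm_dual_le xi M : 0 <= M -> (forall x, kabs (dual_ev xi x) <= M * nrm x) -> nrm xi <= M.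
Proof. by move=> M0 h; rewrite nrm_dual; apply: dual_norm_le => //; have [] := dual_evP xi. Qed.

End DualSpace.

Section Contragredient.
Context (R : realType) (k : scalar_kind) (G : topGroupType).
Local Notation K := (scal R k).
Local Notation banach := (completeNormedModType K).
Hypothesis G_hausdorff : hausdorff_space G.
Hypothesis G_lc : locally_compact [set: G].
Variable mu : {measure set (borelType G) -> \bar R}.
Hypothesis mu_haar : left_haar mu.
Local Notation kint := (@scal_integral R k G mu).
Variables (EE : banach -> Prop) (m : G -> R).
Hypothesis EEs : stable_by_finite_representability EE.
Hypothesis EEd : stable_by_duality EE.
Hypothesis m_bounded : forall B : set G, compact B -> exists M, forall g, B g -> m g <= M.
Hypothesis mV : forall g, m g^-1%g = m g.
Hypothesis kint_inv : forall phi : G -> K, is_Cc phi ->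
  kint setT (fun x => phi x^-1%g) = kint setT phi.
Local Notation F := (family_of EE m).
Local Notation fnorm := (fnorm mu F).

Let Frep (E : banach) (r : G -> {linear E -> E}) : F r -> is_representation r.
Proof. by case. Qed.
Let Fgr (E : banach) (r : G -> {linear E -> E}) : F r ->
  forall g x, nrm (r g x) <= expR (m g) * nrm x.
Proof. by case. Qed.

Lemma kint_right (u : G -> K) a : is_Cc u -> kint setT (fun x => u (x * a)%g) = kint setT u.
Proof.
move=> uC; have rC := Cc_rtranslate G_hausdorff a uC; have iC := Cc_inv G_hausdorff uC.
rewrite -(kint_inv rC) -(kint_inv uC) -(kint_translate_Cc G_hausdorff mu_haar a^-1%g iC).
by apply: kint_ext => x _; rewrite invgM invgK.
Qed.

Lemma rint_right (E : banach) (pi : G -> {linear E -> E}) (psi : G -> K) a x :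
  is_representation pi -> is_Cc psi ->
  rint mu pi psi (pi a x) = rint mu pi (fun h => psi (h * a^-1)%g) x.
Proof.
move=> pr pC; have rC := Cc_rtranslate G_hausdorff a^-1%g pC.
apply/esym/(rint_eq G_hausdorff mu_haar pr rC) => phi phic.
rewrite (rintP G_hausdorff mu_haar pr _ pC phic).
rewrite -(kint_right a (integrand_Cc G_hausdorff pr x rC phic)).
by apply: kint_ext => h _; rewrite mulgK (repM pr).
Qed.

Lemma rint_bound_compact (E : banach) (pi : G -> {linear E -> E}) (f : G -> K) x (B : set G) (c L : R) :
  is_representation pi -> is_Cc f -> compact B -> (forall g, ~ B g -> f g = 0) ->
  (forall g, kabs (f g) <= c) -> (forall g, B g -> nrm (pi g x) <= L) ->
  nrm (rint mu pi f x) <= c * L * fine (mu B).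
Proof.
move=> pr fC Bc fB fc piL; apply: hahn_banach_le => phi phic phi1.
rewrite (rintP G_hausdorff mu_haar pr x fC phic).
apply: (kint_bound_compact G_hausdorff (haar_compact mu_haar)) => //.
- exact/Cc_kok/integrand_Cc.
- by move=> g /fB ->; rewrite mul0r.
move=> g Bg; rewrite kabsM; apply: ler_pM; rewrite ?kabs_ge0 //.
exact: le_trans (phi1 _) (piL g Bg).
Qed.

Section Dual.
Variables (E : banach) (pi : G -> {linear E -> E}).
Hypothesis Fpi : F pi.
Let pr := Frep Fpi.
Local Notation V := (E -> K^o).

(** The dual action need not be strongly continuous on the whole dual; this condition selects the
    functionals whose orbit map is continuous in norm. *)
Definition contra_equi (f : V) := forall e : R, 0 < e ->
  \forall g \near (1%g : G), forall x, kabs (f (pi g^-1%g x) - f x) <= e * nrm x.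

Local Notation sub := (dual_sub contra_equi).

Lemma near_growth : exists2 M : R, 0 < M & \forall g \near (1%g : G),
  forall x, nrm (pi g^-1%g x) <= M * nrm x.
Proof.
have [B [Bc B1 _]] := compact_nbhs G_hausdorff G_lc (@filterT _ (nbhs (1%g : G)) _).
have [M BM] := m_bounded Bc; exists (expR M); first exact: expR_gt0.
apply: filterS B1 => g Bg x; apply: le_trans (Fgr Fpi _ _) _.
by rewrite ler_wpM2r ?nrm_ge0 // ler_expR mV BM.
Qed.

Lemma contra_equi0 : contra_equi 0.
Proof.
by move=> e e0; apply: nearW => g x; rewrite -[X in kabs X]/(0 - 0) subrr kabs0 mulr_ge0 ?nrm_ge0 ?ltW.
Qed.

Lemma contra_equiP (a : K) f g : sub f -> sub g -> contra_equi (a *: f + g).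
Proof.
move=> [_ fe] [_ ge] e e0; pose d := e / (kabs a + 1).
have a0 : 0 < kabs a + 1 by rewrite ltr_wpDl ?kabs_ge0.
have d0 : 0 < d by rewrite divr_gt0.
apply: filterS (filterI (fe d d0) (ge d d0)) => h [/= h1 h2] x.
rewrite !fct_linE opprD addrACA -mulrBr (le_trans (kabsD _ _)) // kabsM.
apply: (@le_trans _ _ (kabs a * (d * nrm x) + d * nrm x)).
  by apply: lerD => //; rewrite ler_wpM2l ?kabs_ge0.
rewrite -{2}[d * nrm x]mul1r -mulrDl mulrA ler_wpM2r ?nrm_ge0 //.
by rewrite /d mulrCA divff ?mulr1 // gt_eqF.
Qed.

Lemma contra_equiC f : bounded_functional f ->
  (forall e : R, 0 < e -> exists2 g, sub g & forall x, kabs (f x - g x) <= e * nrm x) ->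
  contra_equi f.
Proof.
move=> fb h e e0; have [M M0 Mn] := near_growth; pose d := e / (M + 2).
have M2 : 0 < M + 2 by rewrite addr_gt0.
have d0 : 0 < d by rewrite divr_gt0.
have [u [_ ue] fu] := h d d0.
apply: filterS (filterI Mn (ue d d0)) => g [/= h1 h2] x.
have -> : f (pi g^-1%g x) - f x = (f (pi g^-1%g x) - u (pi g^-1%g x)) +
    (u (pi g^-1%g x) - u x) + (u x - f x) by rewrite !subrKA.
apply: le_trans (kabsD _ _) _; apply: le_trans (lerD (kabsD _ _) (lexx _)) _.
have k1 : kabs (u x - f x) <= d * nrm x by rewrite -kabsN opprB.
have k2 := h2 x.
have k3 : kabs (f (pi g^-1%g x) - u (pi g^-1%g x)) <= d * (M * nrm x).
  by apply: le_trans (fu _) _; rewrite ler_pM2l.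
have -> : e * nrm x = d * (M * nrm x) + d * nrm x + d * nrm x by rewrite /d; field; rewrite gt_eqF.
by rewrite lerD // lerD.
Qed.

Definition contra_space : banach := dual_space contra_equi0 contra_equiP contra_equiC.
Local Notation ev := (@dual_ev R k E contra_equi contra_equi0 contra_equiP contra_equiC).
Local Notation proj := (@dual_proj R k E contra_equi contra_equi0 contra_equiP contra_equiC).

(** The full dual [T] is in the class by duality, and the continuous part embeds in it
    isometrically. *)
Lemma contra_in_class : EE contra_space.
Proof.
have EEE : EE E by have [_ [X EX XE] _] := Fpi; exact: EE_isometric EEs EX XE.
pose T := @dual_space R k E (fun=> True) Logic.I (fun _ _ _ _ _ => Logic.I) (fun _ _ _ => Logic.I).
have ET : EE T.
  apply: (EEd EEE); exists (fun xi : T => lin_of (dual_ev_linear xi)); split.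
  - by move=> xi; apply: (@bounded_lin _ _ _ _ _ (nrm xi)) => x; exact: dual_ev_le.
  - by move=> a xi eta x; exact: dual_ev_lin.
  - move=> phi /lin_bounded [M M0 phiM].
    have phib : dual_sub (fun=> True) (phi : V).
      by split=> //; split; [move=> a x y; exact: linearP | exists M].
    by exists (dual_proj _ _ _ (phi : V)) => x; rewrite lin_ofE dual_projK.
  - by move=> xi; rewrite nrm_dual.
apply: (@fr_limit R k unit (principal_filter tt) (principal_filter_proper tt) (fun=> T)) => // n v.
have evb i : dual_sub (fun=> True) (ev (v i)).
  by split=> //; have [] := dual_evP (v i).
exists (fun _ i => dual_proj _ _ _ (ev (v i)) : T) => c.
rewrite (_ : (fun _ => _) = fun=> nrm (\sum_(i < n) c i *: v i)); first exact: ucvg_cst.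
apply/funext => _.
rewrite !nrm_dual; congr (dual_norm _); apply/funext => x.
by rewrite !dual_ev_sum; apply: eq_bigr => i _; rewrite dual_projK.
Qed.

Lemma contra_sub g f : sub f -> sub (fun x => f (pi g^-1%g x)).
Proof.
move=> [[fl fb] fe]; have fn := dual_normP _ (conj fl fb); split.
  split; first by move=> a x y; rewrite linearP fl.
  exists (dual_norm f * expR (m g)) => x; apply: le_trans (fn _) _.
  rewrite -mulrA ler_wpM2l ?dual_norm_ge0 // -(mV g); exact: Fgr Fpi _ _.
move=> e e0; pose d := e / expR (m g); have d0 : 0 < d by rewrite divr_gt0 ?expR_gt0.
apply: filterS (conj_near g (fe d d0)) => h hP x.
have -> : pi g^-1%g (pi h^-1%g x) = pi (g^-1 * h * g)^-1%g (pi g^-1%g x).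
  by rewrite -!(repM pr); congr (pi _ x); rewrite !invgM invgK !mulgA mulgK.
apply: le_trans (hP _) _; apply: (@le_trans _ _ (d * (expR (m g) * nrm x))).
  by rewrite ler_pM2l // -(mV g); exact: Fgr Fpi _ _.
by rewrite mulrA divfK // gt_eqF // expR_gt0.
Qed.

Definition contra_act g (xi : contra_space) : contra_space := proj (fun x => ev xi (pi g^-1%g x)).

Lemma contra_actE g xi x : ev (contra_act g xi) x = ev xi (pi g^-1%g x).
Proof. by rewrite dual_projK //; apply: contra_sub; exact: dual_evP. Qed.

Lemma contra_act_linear g : linear (contra_act g).
Proof.
by move=> a xi eta; apply: dual_ev_inj => x; rewrite contra_actE !dual_ev_lin !contra_actE.
Qed.

Definition contra g := lin_of (contra_act_linear g).

Lemma contra_growth g xi : nrm (contra g xi) <= expR (m g) * nrm xi.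
Proof.
apply: nrm_dual_le => [|x]; first by rewrite mulr_ge0 ?expR_ge0 ?nrm_ge0.
rewrite contra_actE; apply: le_trans (dual_ev_le _ _) _.
have -> : expR (m g) * nrm xi * nrm x = nrm xi * (expR (m g) * nrm x) by ring.
by rewrite ler_wpM2l ?nrm_ge0 // -(mV g); exact: Fgr Fpi _ _.
Qed.

Lemma contraM g h xi : contra (g * h)%g xi = contra g (contra h xi).
Proof.
apply: dual_ev_inj => x; rewrite !lin_ofE !contra_actE.
by rewrite -(repM pr) -invgM.
Qed.

Lemma contra_near xi e : 0 < e -> \forall g \near (1%g : G), nrm (contra g xi - xi) <= e.
Proof.
move=> e0; have [_ xie] := dual_evP xi; apply: filterS (xie e e0) => g gP.
apply: nrm_dual_le => [|x]; first exact: ltW.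
have -> : contra g xi - xi = (-1) *: xi + contra g xi by rewrite scaleN1r addrC.
by rewrite dual_ev_lin mulN1r addrC lin_ofE contra_actE.
Qed.

Lemma contra_F : F contra.
Proof.
split; last exact: contra_growth.
  split.
  - by move=> xi; apply: dual_ev_inj => x; rewrite lin_ofE contra_actE invg1 (rep1 pr).
  - by move=> g h xi; exact: contraM.
  - by move=> g; apply: bounded_lin => xi; exact: contra_growth.
  - move=> xi; apply/nrm_continuousP => g e e0; pose d := e / (2 * expR (m g)).
    have d0 : 0 < d by rewrite divr_gt0 // mulr_gt0 // expR_gt0.
    have := translate_near g (contra_near xi d0); apply: filterS => h hP.
    rewrite -[_ < _]/(nrm (contra h xi - contra g xi) < e).
    have -> : contra h xi - contra g xi = contra g (contra (g^-1 * h)%g xi - xi).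
      by rewrite linearB -contraM mulVKg.
    apply: le_lt_trans (contra_growth _ _) _.
    apply: (@le_lt_trans _ _ (expR (m g) * d)); first by rewrite ler_pM2l ?expR_gt0.
    have -> : expR (m g) * d = e / 2 by rewrite /d; field; rewrite gt_eqF ?expR_gt0.
    lra.
exists contra_space; first exact: contra_in_class.
by exists idfun; split=> //; exists idfun.
Qed.

(** Translating the functional xi o pi(psi) amounts to translating [psi] on the right, by
    unimodularity ([rint_right]); uniform continuity of [psi] then makes the orbit of this
    functional continuous in norm. *)
Lemma smear_sub (xi : {linear E -> K^o}) (psi : G -> R) (B : set G) :
  (forall x, kabs (xi x) <= nrm x) -> continuous psi -> compact B -> (forall x, ~ B x -> psi x = 0) ->
  sub (fun x => xi (rint mu pi (fun h => sc (psi h)) x)).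
Proof.
move=> xi1 psic Bc psiB; pose p h : K := sc (psi h).
have pC : is_Cc p.
  by apply: (Cc_of_support G_hausdorff (sc_continuous psic) Bc) => x /psiB; rewrite /p => ->; rewrite sc0.
have xil : linear (fun x => xi (rint mu pi p x)).
  by move=> a x y; rewrite (rint_linear G_hausdorff mu_haar pr) // linearP.
have grow (A : set G) : compact A -> exists2 M : R, 0 < M & forall g x, A g -> nrm (pi g x) <= M * nrm x.
  move=> /m_bounded [M AM]; exists (expR M); first exact: expR_gt0.
  move=> g x /AM gM; apply: le_trans (Fgr Fpi _ _) _.
  by rewrite ler_wpM2r ?nrm_ge0 // ler_expR.
split.
  split=> //; have [M M0 BM] := grow B Bc; have [D [D0 psiD]] := compact_bound Bc psic.
  exists (D * M * fine (mu B)) => x; apply: le_trans (xi1 _) _.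
  have -> : D * M * fine (mu B) * nrm x = D * (M * nrm x) * fine (mu B) by ring.
  apply: rint_bound_compact => //.
  - by move=> g /psiB; rewrite /p => ->; rewrite sc0.
  - move=> g; rewrite kabs_sc; have [/psiD //|/psiB ->] := pselect (B g).
    by rewrite normr0.
  - by move=> g; exact: BM.
move=> e e0; have [A [Ac A1 _]] := compact_nbhs G_hausdorff G_lc (@filterT _ (nbhs (1%g : G)) _).
pose B' := [set z | exists x y, [/\ B x, A y & z = (x * y^-1)%g]].
have B'c : compact (B `|` B') by apply: compactU => //; exact: compact_mulV.
have [M M0 BM] := grow _ B'c.
pose c := e / (M * (fine (mu (B `|` B')) + 1)).
have mB1 : 0 < fine (mu (B `|` B')) + 1 by rewrite ltr_wpDl // fine_ge0.
have c0 : 0 < c by rewrite divr_gt0 // mulr_gt0.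
have ic : continuous (fun x => psi x^-1%g) by exact: continuous_fun_comp (@invg_continuous G) psic.
have iBc : compact [set x | B x^-1%g].
  rewrite -invgE; apply: continuous_compact => //; apply: continuous_subspaceT; exact: invg_continuous.
have psiu := uniform_modulus G_hausdorff G_lc ic iBc (fun x => psiB x^-1%g) c0.
apply: filterS (filterI psiu A1) => g [/= gP Ag] x.
have rC := Cc_rtranslate G_hausdorff g pC.
have rE : rint mu pi p (pi g^-1%g x) = rint mu pi (fun h => p (h * g)%g) x.
  by rewrite (rint_right _ x pr pC) invgK.
rewrite -linearB -/p rE -(rintB G_hausdorff mu_haar pr x rC pC).
apply: le_trans (xi1 _) _.
apply: (@le_trans _ _ (c * (M * nrm x) * fine (mu (B `|` B')))).
  apply: rint_bound_compact => //.
  - exact: Cc_sub.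
  - move=> h /not_orP[hB hB']; rewrite /p /= !psiB ?sc0 ?subrr // => Bhg.
    by apply: hB'; exists (h * g)%g, g; split=> //; rewrite mulgK.
  - move=> h; rewrite /p /= -scB kabs_sc; have := gP h^-1%g.
    by rewrite invgK invgM invgK invgK.
  - by move=> h; exact: BM.
have -> : c * (M * nrm x) * fine (mu (B `|` B')) =
    e * nrm x * (fine (mu (B `|` B')) / (fine (mu (B `|` B')) + 1)).
  by rewrite /c; field; rewrite !gt_eqF.
rewrite ler_piMr ?mulr_ge0 ?nrm_ge0 ?(ltW e0) // ler_pdivrMr // mul1r lerDl //.
Qed.

End Dual.

(* The functionals [xi o pi(psi)] are continuous for the contragredient action, and norming
   up to a constant as [psi] concentrates at 1. *)
Lemma tilde_bound : exists2 M : R, 0 <= M & forall f, is_Cc f ->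
  fnorm (fun x => f x^-1%g) <= M * fnorm f.
Proof.
have [B [Bc B1 _]] := compact_nbhs G_hausdorff G_lc (@filterT _ (nbhs (1%g : G)) _).
(* [B] is fixed before the vector: the bump will concentrate on a smaller set [D] inside [B], so
   that [M] bounds pi(psi) for all of them. *)
have [M0 BM] := m_bounded Bc; pose M := expR M0; have Mp : 0 < M by exact: expR_gt0.
exists M; first exact: ltW.
move=> f fC; have iC := Cc_inv G_hausdorff fC.
have fn0 : 0 <= fnorm f by exact: fnorm_ge0.
apply: (fnorm_le G_hausdorff mu_haar Frep Fgr m_bounded iC); first by rewrite mulr_ge0 // ltW.
move=> E pi x Fpi; have pr := Frep Fpi.
set y := rint mu pi (fun z => f z^-1%g) x.
apply/ler_addgt0Pl => r r0.
have [xi [xi1 xiy]] := hahn_banach y.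
have xic : continuous xi by apply: (@bounded_lin _ _ _ _ _ 1) => z; rewrite mul1r nrm_kabs.
pose D : set G := B `&` [set h | nrm (pi h y - y) < r].
have D1 : nbhs (1%g : G) D.
  apply: filterI B1 _.
  have := proj1 (nrm_continuousP _) (@rep_strongly_continuous _ _ _ _ _ pr y) 1%g r r0.
  by rewrite (rep1 pr).
have [b [bc b01 b1 bD]] := bump_exists G_hausdorff G_lc R D1.
have bB x' : ~ B x' -> b x' = 0 by move=> nB; apply: bD => -[].
have b0 z : 0 <= b z by have /andP[] := b01 z.
pose I := \int[mu]_z b z.
have I0 : 0 < I.
  rewrite lt_neqAle Rintegral_ge0 ?andbT //; apply/eqP => /esym I0.
  have := nonneg_integral_zero G_hausdorff mu_haar bc Bc bB b0 I0 1%g.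
  by rewrite b1 => /eqP; rewrite oner_eq0.
pose psi z := b z / I.
have psic : continuous psi by move=> z; apply: cvgM; [exact: bc | exact: cvg_cst].
have psiB z : ~ B z -> psi z = 0 by move=> /bB; rewrite /psi => ->; rewrite mul0r.
pose p z : K := sc (psi z).
have pC : is_Cc p.
  by apply: (Cc_of_support G_hausdorff (sc_continuous psic) Bc) => z /psiB; rewrite /p => ->; rewrite sc0.
have bi := rintegrable_Cc G_hausdorff (haar_compact mu_haar) (@measurableT _ (borelType G)) Bc bc bB.
have intpsi : \int[mu]_z psi z = 1 by rewrite /psi RintegralZr // divff // gt_eqF.
have p1 : kint setT p = 1 by rewrite kint_sc intpsi sc1.
have kp : \int[mu]_z kabs (p z) = 1.
  by rewrite -intpsi; apply: eq_Rintegral => z _; rewrite kabs_sc ger0_norm // divr_ge0 // ltW.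
have pD z : p z != 0 -> D z.
  by move=> pz; apply: contrapT => /bD bz; move: pz; rewrite /p /psi bz mul0r sc0 eqxx.
have pM z : nrm (rint mu pi p z) <= M * nrm z.
  have := rint_bounded G_hausdorff mu_haar pr (x := z) (L := M * nrm z) pC.
  rewrite kp mulr1; apply=> h /pD [Bh _]; apply: le_trans (Fgr Fpi _ _) _.
  by rewrite ler_wpM2r ?nrm_ge0 // ler_expR BM.
have sS := smear_sub Fpi xi1 psic Bc psiB.
pose eta : contra_space Fpi := dual_proj _ _ _ (fun x => xi (rint mu pi p x)).
have etaE z : dual_ev eta z = xi (rint mu pi p z) by rewrite dual_projK.
have etan : nrm eta <= M.
  apply: nrm_dual_le => [|z]; first exact: ltW.
  by rewrite etaE; apply: le_trans (xi1 _) _.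
pose phi := lin_of (dual_ev_linear eta).
have phic : continuous phi by apply: (@bounded_lin _ _ _ _ _ (nrm eta)) => z; exact: dual_ev_le.
have evl : linear (fun zeta : contra_space Fpi => dual_ev zeta x : K^o).
  by move=> a z1 z2; exact: dual_ev_lin.
have evc : continuous (lin_of evl).
  by apply: (@bounded_lin _ _ _ _ _ (nrm x)) => z; rewrite lin_ofE nrm_kabs mulrC; exact: dual_ev_le.
have CF := contra_F Fpi.
(* The operator of [f] on the contragredient is the transpose of that of f~; the substitution is an
   inversion, hence [kint_inv]. *)
have key : phi y = dual_ev (rint mu (contra Fpi) f eta) x.
  rewrite (rintP G_hausdorff mu_haar pr x iC phic).
  have := rintP G_hausdorff mu_haar (Frep CF) eta fC evc; rewrite lin_ofE => ->.
  have jC := integrand_Cc G_hausdorff pr x iC phic.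
  rewrite -(kint_inv jC); apply: kint_ext => g _.
  by rewrite invgK !lin_ofE contra_actE.
have k1 : kabs (phi y) <= M * fnorm f * nrm x.
  rewrite key; apply: le_trans (dual_ev_le _ _) _; rewrite ler_wpM2r ?nrm_ge0 //.
  have := le_fnorm G_hausdorff mu_haar Frep Fgr m_bounded eta fC CF => h.
  by apply: (le_trans h); rewrite mulrC ler_wpM2r.
have k2 : nrm (rint mu pi p y - y) <= r.
  have := rint_near G_hausdorff mu_haar pr (x := y) (v := y) (L := r) pC p1.
  by rewrite kp mulr1; apply=> h /pD [_ /ltW].
have -> : nrm y = kabs (xi y) by rewrite xiy kabs_sc ger0_norm ?nrm_ge0.
have -> : xi y = phi y - xi (rint mu pi p y - y).
  by rewrite lin_ofE etaE linearB opprB addrC subrK.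
apply: le_trans (kabsD _ _) _; rewrite kabsN addrC lerD //.
exact: le_trans (xi1 _) k2.
Qed.

End Contragredient.

(** * Self-adjointness *)

Section SelfAdjoint.
Context (R : realType) (k : scalar_kind) (G : topGroupType).
Local Notation K := (scal R k).
Local Notation banach := (completeNormedModType K).
Hypothesis G_hausdorff : hausdorff_space G.
Variable mu : {measure set (borelType G) -> \bar R}.
Hypothesis mu_haar : left_haar mu.
Local Notation kint := (@scal_integral R k G mu).
Local Notation Cc := (@is_Cc R k G).
Variables (F : rep_family R k G) (m : G -> R).
Hypothesis F_rep : forall (E : banach) (pi : G -> {linear E -> E}), F pi ->
  is_representation pi.
Hypothesis F_growth : forall (E : banach) (pi : G -> {linear E -> E}), F pi ->
  forall g x, nrm (pi g x) <= expR (m g) * nrm x.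
Hypothesis m_bounded : forall B : set G, compact B -> exists M, forall g, B g -> m g <= M.
Local Notation Fn := (F_norm mu F).
Local Notation fnorm := (fnorm mu F).
Local Notation rint := (rint mu).

(** Inversion reverses products; the substitution behind it is a left translation by [x], so left
    invariance suffices. *)
Lemma convolution_inv (a b : G -> K) x : Cc a -> Cc b ->
  convolution mu a b x^-1%g =
  convolution mu (fun y => b y^-1%g) (fun y => a y^-1%g) x.
Proof.
move=> aC bC; pose h y := a y * b (y^-1 * x^-1)%g.
have hC : Cc h.
  apply: (Cc_mul G_hausdorff) => //.
  apply: (@continuous_fun_comp _ _ _ (fun y => y^-1 * x^-1)%g b); last exact: bC.1.
  move=> y; apply: (@continuous_comp _ _ _ (fun y => (y^-1, x^-1)%g) (fun p => p.1 * p.2)%g).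
    by apply: cvg_pair => /=; [exact: invg_continuous | exact: cvg_cst].
  exact: mulg_continuous.
rewrite /convolution -[LHS](kint_translate_Cc G_hausdorff mu_haar x^-1%g hC).
apply: kint_ext => y _; rewrite /h mulrC; congr (b _ * a _).
  by rewrite invgM invgK -mulgA mulgV mulg1.
by rewrite invgM invgK.
Qed.

Variables (S : set G) (f : G -> K) (c0 a0 M : R).
Hypothesis S_generates : forall g, exists n, spow S n g.
Hypotheses (fC : Cc f) (f1 : kint setT f = 1) (c00 : 0 <= c0) (a00 : 0 <= a0).
Hypothesis f_contracts : forall (E : banach) (pi : G -> {linear E -> E}) x d, F pi ->
  0 <= d -> (forall g, S g -> nrm (pi g x - x) <= d) ->
  nrm (rint pi f x - x) <= c0 * d /\
  forall g, S g -> nrm (pi g (rint pi f x) - rint pi f x) <= d / 2.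
Hypothesis S_bounded : forall (E : banach) (pi : G -> {linear E -> E}) x g, F pi ->
  S g -> nrm (pi g x - x) <= a0 * nrm x.
Hypothesis M0 : 0 <= M.
Hypothesis tilde_le : forall u, Cc u -> fnorm (fun x => u x^-1%g) <= M * fnorm u.
Hypothesis kint_inv : forall u : G -> K, Cc u -> kint setT (fun x => u x^-1%g) = kint setT u.
Hypothesis tildeE : forall u v : G -> K, Cc u -> is_tilde mu u v <-> v = fun x => u x^-1%g.

Local Notation cp := (conv_pow mu f).
Local Notation inv u := (fun x => u x^-1%g).

Let uC n : Cc (cp n) := Cc_conv_pow G_hausdorff mu_haar fC n.
Let uc : fcauchy mu F cp :=
  conv_pow_cauchy G_hausdorff mu_haar F_rep F_growth m_bounded fC c00 a00 f_contracts S_bounded.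

Lemma conv_pow_limit (E : banach) (pi : G -> {linear E -> E}) x n : F pi ->
  exists2 y, (forall g, pi g y = y) & nrm (rint pi (cp n) x - y) <= 2 * c0 * a0 * 2^-1 ^+ n * nrm x.
Proof.
move=> Fpi.
have [P [PP Pinv]] := contraction_limit F_rep S_generates c00 a00 f_contracts S_bounded Fpi.
exists (P x); first by move=> g; exact: Pinv.
rewrite (rint_conv_pow G_hausdorff mu_haar F_rep fC) //.
apply/ler_addgt0Pl => e e0; have /nrm_cvgP := PP x => /(_ _ e0) [n1 _ n1P].
have := n1P (maxn n1 n.+1) (leq_maxl _ _) => /= /ltW h.
have := contraction_cauchy c00 a00 f_contracts S_bounded x Fpi (leq_maxr n1 n.+1) => h2.
apply: le_trans (nrm_triangle _ (iter (maxn n1 n.+1) (rint pi f) x) _) _.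
rewrite addrC lerD //; rewrite nrmBC; apply: le_trans h2 _.
rewrite mulrAC ler_wpM2r ?nrm_ge0 // ler_wpM2l ?mulr_ge0 //.
by rewrite exprS ler_piMl ?exprn_ge0 ?invr_ge0 // invf_le1 // ler1n.
Qed.

(* With u = conv_pow n and v = u~, the function (v * u)~ is v * u again, so that
   |v - u| <= |(v * u - u)~| + |v * u - u|; and v * u - u is small since the range of u is
   almost invariant while v has integral 1. *)
Lemma tilde_conv_pow : fequiv mu F (fun n => inv (cp n)) cp.
Proof.
have [L L0 uL] := fcauchy_bounded G_hausdorff mu_haar F_rep F_growth m_bounded uc.
(* The range of [cp n] is within [2 * c0 * a0 * 2^-1 ^+ n] of invariant vectors, [M * L + 1] bounds
   pi(v) - 1 on the remainder, and [M + 1] adds this estimate to its image under inversion. *)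
pose D := (M + 1) * ((M * L + 1) * (2 * c0 * a0)).
move=> e e0; have [n0 h] := half_pow_small D e0; exists n0 => n /h; apply: le_trans.
pose v := inv (cp n); have vC : Cc v by exact: Cc_inv (uC n).
have wC : Cc (convolution mu v (cp n)) by exact: (Cc_convolution G_hausdorff mu_haar).
have vL : fnorm v <= M * L by apply: le_trans (tilde_le (uC n)) _; rewrite ler_wpM2l.
have E1 : fnorm (convolution mu v (cp n) \- cp n) <= (M * L + 1) * (2 * c0 * a0) * 2^-1 ^+ n.
  apply: (fnorm_le G_hausdorff mu_haar F_rep F_growth m_bounded); first exact: (Cc_sub G_hausdorff).
    by rewrite !mulr_ge0 ?exprn_ge0 ?invr_ge0 // addr_ge0 // mulr_ge0.
  move=> E pi x Fpi; have pr := F_rep Fpi.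
  rewrite (rintB G_hausdorff mu_haar pr) // (rint_convolution G_hausdorff mu_haar pr) //.
  have [y yi yn] := conv_pow_limit x n Fpi; set z := rint pi (cp n) x.
  have -> : rint pi v z - z = rint pi v (z - y) - (z - y).
    have yE : rint pi v y = y by apply: (rint_invariant G_hausdorff mu_haar pr) => //; rewrite kint_inv ?kint_conv_pow.
    by rewrite (rintBr G_hausdorff mu_haar pr) // yE opprB addrA subrK.
  have zM : nrm (rint pi v (z - y)) <= M * L * nrm (z - y).
    apply: le_trans (le_fnorm G_hausdorff mu_haar F_rep F_growth m_bounded _ vC Fpi) _.
    by rewrite ler_wpM2r ?nrm_ge0.
  have ML : 0 <= M * L by rewrite mulr_ge0.
  have := ler_wpM2l (addr_ge0 ML ler01) yn; rewrite -/z.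
  have := nrm_triangle (rint pi v (z - y)) 0 (z - y); rewrite subr0 sub0r nrmN.
  by rewrite !mulrA; lra.
have E2 : fnorm (v \- convolution mu v (cp n)) <= M * fnorm (convolution mu v (cp n) \- cp n).
  rewrite (fnormC G_hausdorff mu_haar F_rep F_growth m_bounded vC wC).
  have <- : (fun x => (convolution mu v (cp n) \- cp n) x^-1%g) = convolution mu v (cp n) \- v.
    apply/funext => x /=; rewrite convolution_inv //; congr (convolution _ _ _ _ - _).
    by apply/funext => y; rewrite /v invgK.
  by apply: tilde_le; exact: (Cc_sub G_hausdorff).
have := fnorm_triangle G_hausdorff mu_haar F_rep F_growth m_bounded vC wC (uC n).
have M1 : 0 <= M + 1 by rewrite addr_ge0.
have := ler_wpM2l M1 E1.
by rewrite /D -/v !mulrA; lra.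
Qed.

Lemma contraction_self_adjoint : self_adjoint mu F (class_of mu F cp).
Proof.
have invB (u w : G -> K) : inv u \- inv w = inv (u \- w) by [].
have iC u : (forall n, Cc (u n)) -> forall n, Cc (inv (u n)) by move=> h n; exact: Cc_inv (h n).
have tilde_equiv u w : (forall n, Cc (u n)) -> (forall n, Cc (w n)) -> fequiv mu F u w ->
    fequiv mu F (fun n => inv (u n)) (fun n => inv (w n)).
  move=> uC' wC uw e e0; have e1 : 0 < e / (M + 1) by rewrite divr_gt0 // ltr_wpDl.
  have [n0 h] := uw _ e1; exists n0 => n /h h1; rewrite invB.
  apply: le_trans (tilde_le (Cc_sub G_hausdorff (uC' n) (wC n))) _.
  have := ler_wpM2l M0 h1 => h2; apply: (le_trans h2).
  by rewrite mulrA ler_pdivrMr ?ltr_wpDl // mulrC ler_pM2l //; lra.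
have cE := @class_ofE _ _ _ G_hausdorff _ mu_haar _ _ F_rep F_growth m_bounded.
have kE := @is_cauchyE _ _ _ G_hausdorff _ mu_haar _ _ F_rep F_growth m_bounded.
have eE := @seq_equivE _ _ _ G_hausdorff _ mu_haar _ _ F_rep F_growth m_bounded.
have sy := @fequiv_sym _ _ _ G_hausdorff _ mu_haar _ _ F_rep F_growth m_bounded.
have re := @fequiv_refl _ _ _ G_hausdorff _ mu_haar _ _ F_rep F_growth m_bounded.
have tr := @fequiv_trans _ _ _ G_hausdorff _ mu_haar _ _ F_rep F_growth m_bounded.
split.
  exists M => u v uC' /(tildeE _ uC') ->.
  rewrite !(fnormE G_hausdorff mu_haar F_rep F_growth m_bounded) //; last exact: Cc_inv.
  by rewrite -EFinM lee_fin tilde_le.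
have tE := tilde_conv_pow.
have ivC := iC _ _ uC.
apply/seteqP; split=> w.
  move=> [/kE wc [u [v [/(cE _ _ uc) [u'c uu'] uv]]]].
  have {uv} -> : v = fun n => inv (u n) by apply/funext => n; apply/tildeE => //; exact: u'c.1.
  have iuC := iC _ _ u'c.1.
  move=> /(eE _ _ iuC wc.1) vw.
  apply/cE => //; split=> //.
  apply: (tr _ _ _ uC iuC wc.1) => //.
  apply: (tr _ _ _ uC ivC iuC); first exact: sy.
  by apply: (tilde_equiv cp u) => //; exact: u'c.1.
move=> /(cE _ _ uc) [wc uw]; split; first exact/kE.
exists cp, (fun n => inv (cp n)); split.
- by apply/cE => //; split=> //; exact: re.
- by move=> n; apply/tildeE.
- by apply/eE => //; [exact: wc.1 | exact: (tr _ _ _ ivC uC wc.1)].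
Qed.

End SelfAdjoint.

Lemma contraction_projection (R : realType) (k : scalar_kind) (G : topGroupType)
  (S : set G) (EE : completeNormedModType (scal R k) -> Prop) (s C c0 : R)
  (mu : {measure set (borelType G) -> \bar R}) (f : G -> scal R k) :
  hausdorff_space G -> locally_compact [set: G] ->
  compact S -> (forall x, S x -> S x^-1%g) -> S 1%g ->
  (forall g, exists n, spow S n g) ->
  stable_by_finite_representability EE ->
  (exists2 X : completeNormedModType (scal R k), EE X & ~ finite_dim [set: X]) ->
  left_haar mu -> 0 < s -> 0 < C ->
  let F := family_of EE (fun g => s * (word_length S g)%:R + C) in
  0 <= c0 -> is_Cc f -> scal_integral mu setT f = 1 ->
  (forall (E : completeNormedModType (scal R k)) (pi : G -> {linear E -> E}) x d, F E pi ->
     0 <= d -> (forall g, S g -> nrm (pi g x - x) <= d) ->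
     nrm (rint mu pi f x - x) <= c0 * d /\
     forall g, S g -> nrm (pi g (rint mu pi f x) - rint mu pi f x) <= d / 2) ->
  exists p, is_kazhdan_projection mu F p /\ (stable_by_duality EE -> self_adjoint mu F p).
Proof.
move=> G_hausdorff G_lc S_compact S_sym S_one S_gen EEs EEinf mu_haar s0 C0 F c00 fC f1 fct.
have Frep (E : completeNormedModType (scal R k)) (r : G -> {linear E -> E}) : F E r -> is_representation r by case.
have Fgr (E : completeNormedModType (scal R k)) (r : G -> {linear E -> E}) : F E r ->
    forall g x, nrm (r g x) <= expR (s * (word_length S g)%:R + C) * nrm x by case.
have mb (B : set G) : compact B -> exists M : R, forall g, B g -> s * (word_length S g)%:R + C <= M.
  exact: (growth_bounded G_hausdorff G_lc S_compact S_one S_gen C (ltW s0)).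
(* Bounds the norm of pi(g) - 1 for [g] in [S], hence the initial displacement to which the
   contraction is applied. *)
pose a0 : R := expR (s + C) + 1.
have a00 : 0 <= a0 by rewrite addr_ge0 ?expR_ge0.
have Sb (E : completeNormedModType (scal R k)) (pi : G -> {linear E -> E}) x g : F E pi -> S g -> nrm (pi g x - x) <= a0 * nrm x.
  move=> Fpi Sg; have := growth_spow s0 x Fpi (spow1 Sg); rewrite mulr1 => h.
  have := nrm_triangle (pi g x) 0 x; rewrite subr0 sub0r nrmN => h2.
  by rewrite /a0 mulrDl mul1r; apply: (le_trans h2); rewrite lerD2r.
exists (class_of mu F (conv_pow mu f)); split.
  exact: (contraction_kazhdan G_hausdorff mu_haar Frep Fgr mb S_gen fC f1 c00 a00 fct Sb).
move=> EEd.
have ki := kint_inv G_hausdorff G_lc mu_haar S_compact S_one S_gen EEs EEinf s0 C0 c00 fct.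
have tE := is_tildeE G_hausdorff G_lc mu_haar S_compact S_one S_gen EEs EEinf s0 C0 c00 fct.
have mV g : s * (word_length S g^-1%g)%:R + C = s * (word_length S g)%:R + C.
  congr (s * _%:R + C); apply/eqP; rewrite eqn_leq.
  have le h : (word_length S h^-1%g <= word_length S h)%N.
    by apply: word_length_le; apply: spow_inv => //; exact: word_lengthP.
  by rewrite le /= -{1}[g]invgK le.
have [M M0 tb] := tilde_bound G_hausdorff G_lc mu_haar EEs EEd mb mV ki.
exact: (contraction_self_adjoint G_hausdorff mu_haar Frep Fgr mb S_gen fC f1 c00 a00 fct Sb M0 tb ki tE).
Qed.

Theorem corollary5p15 (R : realType) (k : scalar_kind)
  (EE : completeNormedModType (scal R k) -> Prop)
  (EE_stable : stable_by_finite_representability EE)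
  (EE_infinite_dim : exists2 E : completeNormedModType (scal R k),
     EE E & ~ finite_dim [set: E])
  (G : topGroupType)
  (G_hausdorff : hausdorff_space G)
  (G_locally_compact : locally_compact [set: G])
  (G_separable : separable_space G)
  (G_infinite : infinite_set [set: G])
  (S : set G)
  (S_compact : compact S)
  (S_sym : forall x, S x -> S x^-1%g)
  (S_one : S 1%g)
  (S_generates : forall g, exists n, spow S n g)
  (G_presented : compactly_presented S)
  (N : set G)
  (N_normal : normal_subgroup N)
  (N_discrete : discrete_subset N)
  (H : topGroupType) (q : G -> H)
  (H_quotient : is_quotient N q)
  (muH : {measure set (borelType H) -> \bar R})
  (muH_haar : left_haar muH)
  (H_strongT : strong_property_T (q @` S) muH EE) :
  forall C : R, 0 < C ->
  exists s : R, 0 < s /\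
  exists (N' : set G) (H' : topGroupType) (q' : G -> H'),
    [/\ normal_subgroup N', N' `<=` N, is_quotient N' q',
        compactly_presented (q' @` S) &
        forall mu : {measure set (borelType H') -> \bar R}, left_haar mu ->
        let F := family_of EE
          (fun g => s * (word_length (q' @` S) g)%:R + C) in
        exists p, is_kazhdan_projection mu F p /\
          (stable_by_duality EE -> self_adjoint mu F p)].
Proof.
move=> C C0; have [s0 s00 kaz] := H_strongT.
(* Twisting by a cocycle doubles the rate, so half the rate of [H] is what remains for the
   quotients. It does not depend on [C]; only the index [j] does. *)
pose s := s0 / 2; have sp : 0 < s by rewrite divr_gt0.
have s2 : 2 * s = s0 by rewrite mulrC divfK.
pose Nj j := normal_closure [set x | N x /\ spow S j x].
have Nj_normal j : normal_subgroup (Nj j) by exact: normal_closure_normal.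
have Nj_sub j : Nj j `<=` N by apply: normal_closure_sub => // x [].
have Nj_discrete j : discrete_subset (Nj j).
  move=> x Nx; have [_ [V xV VN]] := N_discrete x (Nj_sub j x Nx).
  split; first exact/mem_set.
  exists V => //; apply/seteqP; split=> [y [Vy Ny]|_ ->].
    by rewrite -VN; split=> //; exact: Nj_sub Ny.
  by split=> //; exact: nbhs_singleton.
have Nj_closed j : closed (Nj j) by exact: discrete_subgroup_closed.
have N_closed : closed N by exact: discrete_subgroup_closed.
pose Hj j : topGroupType := quot_group (Nj_normal j).
pose qj j : G -> Hj j := quot_proj (Nj_normal j).
have Hqj j : is_quotient (Nj j) (qj j) by exact: quot_groupP.
have Nj_N x : N x -> \forall j \near \oo, Nj j x.
  move=> Nx; have [i xi] := S_generates x; exists i => // j /= ij.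
  by apply: normal_closure_gen; split=> //; exact: spow_mono ij _ xi.
have kaz2 D : 0 < D -> exists p, is_kazhdan_projection muH
    (family_of EE (fun h => 2 * s * (word_length (q @` S) h)%:R + D)) p.
  by rewrite s2; exact: kaz.
have [j jP] := contraction_transfer G_hausdorff G_locally_compact S_compact S_one S_generates
  N_closed H_quotient Nj_closed Hqj Nj_N EE_stable EE_infinite_dim muH_haar sp C0 kaz2.
exists s; split=> //; exists (Nj j), (Hj j), (qj j); split=> //.
  exact: quotient_presented G_presented (Hqj j).
move=> mu mu_haar; have [f [c0 [c00 fC f1 fct]]] := jP mu mu_haar.
apply: (contraction_projection _ _ _ _ _ _ _ _ mu_haar _ _ c00 fC f1 fct) => //.
- exact: (quotient_hausdorff (Hqj j) (@Nj_closed j)).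
- exact: (quotient_locally_compact (Hqj j) G_locally_compact (@Nj_closed j)).
- exact: (quotient_compact (Hqj j)).
- by move=> _ [x Sx <-]; exists x^-1%g; [exact: S_sym | exact: (quotientV (Hqj j))].
- by exists 1%g => //; exact: (quotient1 (Hqj j)).
- exact: (quotient_generates (Hqj j)).
Qed.
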